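(* For any given $K>1$ there exist two constants $\varepsilon_0=\varepsilon_0(K)\in(0,1)$ and $L=L(K)>1$ with the following property: let $\zeta_0$ and $\zeta_1$ be two infinitely renormalizable normalized $C^3$ critical commuting pairs which are $K$-controlled, both having negative Schwarzian, with $\rho(\zeta_0)=\rho(\zeta_1)\in[0,1]\setminus\mathbb{Q}$ and $d_2(\zeta_0,\zeta_1)<\varepsilon_0$. Then $$d_2\big(\mathcal{R}(\zeta_0),\mathcal{R}(\zeta_1)\big)\le L\,d_2(\zeta_0,\zeta_1),$$ where $d_2$ denotes the $C^2$ distance in the space of $C^2$ critical commuting pairs.
   Context: Critical commuting pairs: a $C^r$ critical commuting pair $\zeta=(\eta,\xi)$ consists of two $C^r$ orientation preserving homeomorphisms $\eta:I_\eta\to\eta(I_\eta)$, $\xi:I_\xi\to\xi(I_\xi)$ with: (1) $I_\eta=[0,\xi(0)]$ and $I_\xi=[\eta(0),0]$ compact intervals in $\mathbb{R}$; (2) $(\eta\circ\xi)(0)=(\xi\circ\eta)(0)\ne0$; (3) $D\eta>0$ on $I_\eta\setminus\{0\}$ and $D\xi>0$ on $I_\xi\setminus\{0\}$; (4) there exist a positive integer $d$, an open interval $C\ni0$ and orientation preserving $C^r$ diffeomorphisms $\phi:C\to\phi(C)$, $\psi:C\to\psi(C)$ fixing $0$ with $\eta(x)=\phi(x)^{2d+1}+\eta(0)$ on $C\cap I_\eta$ and $\xi(x)=\psi(x)^{2d+1}+\xi(0)$ on $C\cap I_\xi$; (5) $D_-^j(\eta\circ\xi)(0)=D_+^j(\xi\circ\eta)(0)$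 for $1\le j\le r$. It is normalized if $|I_\xi|=1$, i.e. $\eta(0)=-1$. It has negative Schwarzian if $S\eta<0$ on $I_\eta\setminus\{0\}$ and $S\xi<0$ on $I_\xi\setminus\{0\}$, where $Sf=\frac{D^3f}{Df}-\frac32\big(\frac{D^2f}{Df}\big)^2$. Renormalization: if $(\xi\circ\eta)(0)\in I_\eta$, the period $\chi(\zeta)$ is the $a\in\mathbb{N}$ with $\eta^{a+1}(\xi(0))<0\le\eta^a(\xi(0))$ ($\chi(\zeta)=\infty$ if none exists); $\zeta$ is renormalizable if $a=\chi(\zeta)<\infty$, and its pre-renormalization is $p\mathcal{R}(\zeta)=(\eta|_{[0,\eta^a(\xi(0))]},\ \eta^a\circ\xi|_{I_\xi})$. If $(\xi\circ\eta)(0)\in I_\xi$ the definition is analogous: $\xi^a(\eta(0))\le0<\xi^{a+1}(\eta(0))$ and $p\mathcal{R}(\zeta)=(\xi^a\circ\eta|_{I_\eta},\ \xi|_{[\xi^a(\eta(0)),0]})$. The renormalization $\mathcal{R}(\zeta)$ is $p\mathcal{R}(\zeta)$ conjugated by a linear rescaling so as to be normalized. $\zeta$ is infinitely renormalizable if $\chi(\mathcal{R}^j(\zeta))<\infty$ for all $j\ge0$; then its rotation number is $\rho(\zeta)=[\chi(\zeta),\chi(\mathcal{R}(\zeta)),\chi(\mathcal{R}^2(\zeta)),\dots]$, where $[a_0,a_1,\dots]=1/(a_0+1/(a_1+\cdots))$. Control: for $K>1$, a normalized $C^3$ critical commuting pair $\zeta=(\eta,\xi)$ which is renormalizable with period $a$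 is $K$-controlled if: $1/K\le\xi(0)\le K$; $\xi(0)-\eta(\xi(0))\ge1/K$; $\eta^{a-1}(\xi(0))-\eta^a(\xi(0))\ge1/K$; $\eta^a(\xi(0))\ge1/K$; $\eta^{a+1}(\xi(0))\le-1/K$; $\|\xi\|_{C^3([-1,0])}\le K$ and $\|\eta\|_{C^3([0,\xi(0)])}\le K$; $D\eta(x)\ge1/K$ for all $x\in[\eta^a(\xi(0)),\xi(0)]$. Metric: for critical commuting pairs $\zeta_i=(\eta_i,\xi_i)$ let $A_i$ be the M\''obius transformation with $A_i(\eta_i(0))=-1$, $A_i(0)=0$, $A_i(\xi_i(0))=1$, and view $\zeta_i$ as the piecewise map equal to $\xi_i$ on $I_{\xi_i}$ and $\eta_i$ on $I_{\eta_i}$. Then $d_r(\zeta_1,\zeta_2)=\max\big\{\big|\frac{\xi_1(0)}{\eta_1(0)}-\frac{\xi_2(0)}{\eta_2(0)}\big|,\ \|A_1\circ\zeta_1\circ A_1^{-1}-A_2\circ\zeta_2\circ A_2^{-1}\|_r\big\}$, where $\|\cdot\|_r$ is the $C^r$ norm for maps on $[-1,1]$ with one discontinuity at $0$ (maximum of the $C^r$ norms of the two branches). *)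

(* Defs.v *)
From HB Require Import structures.
From mathcomp Require Import all_boot all_order all_algebra.
From mathcomp Require Import all_classical all_reals all_analysis.
From mathcomp Require Import ring lra.

Set Implicit Arguments.
Unset Strict Implicit.
Unset Printing Implicit Defensive.

Import Order.TTheory GRing.Theory Num.Theory.
Import numFieldNormedType.Exports.

Local Open Scope classical_set_scope.
Local Open Scope ring_scope.

Section calculus_on_a_set.
Variable R : realType.
Implicit Types (A : set R) (f : R -> R) (x : R).

(* Partial maps of the line are total functions of which only the values on a
   given set matter.  Derivatives are therefore taken relative to that set:
   on an interval this is the usual derivative at interior points and the
   one-sided derivative at endpoints belonging to the interval. *)
Definition dquot f x : R -> R := fun y => (f y - f x) / (y - x).

Definition derivable_in A f x : Prop := cvg (dquot f x @ within A x^').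

Definition deriv_in A f : R -> R := fun x => lim (dquot f x @ within A x^').

Definition nderiv_in A (k : nat) f : R -> R := iter k (deriv_in A) f.

Definition Cr_on (r : nat) A f : Prop :=
  (forall k x, (k < r)%N -> A x -> derivable_in A (nderiv_in A k f) x) /\
  (forall k, (k <= r)%N -> {within A, continuous (nderiv_in A k f)}).

(* Extended-real valued, so that an unbounded derivative gives +oo. *)
Definition Cr_norm (r : nat) A f : \bar R :=
  \big[maxe/0%E]_(k < r.+1)
     ereal_sup [set (`|nderiv_in A k f x|)%:E | x in A].

Definition increasing_on A f : Prop :=
  forall x y, A x -> A y -> x < y -> f x < f y.

Definition op_homeo_on A f : Prop :=
  [/\ increasing_on A f, {within A, continuous f} &
      exists g : R -> R, (forall x, A x -> g (f x) = x) /\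
                         {within f @` A, continuous g}].

Definition op_diffeo_on (r : nat) A f : Prop :=
  [/\ increasing_on A f, Cr_on r A f &
      exists g : R -> R, (forall x, A x -> g (f x) = x) /\
                         Cr_on r (f @` A) g].

Definition schwarzian_in A f x : R :=
  nderiv_in A 3 f x / nderiv_in A 1 f x
  - 3 / 2 * (nderiv_in A 2 f x / nderiv_in A 1 f x) ^+ 2.

End calculus_on_a_set.

(* The underlying data of a pair (eta, xi); only the restrictions of the two
   maps to [dom_eta] and [dom_xi] are meaningful. *)
Record cpair (R : Type) := CPair { eta_ : R -> R ; xi_ : R -> R }.

Section commuting_pairs.
Variable R : realType.
Implicit Type z : cpair R.

Definition dom_eta z : set R := `[0, xi_ z 0].
Definition dom_xi z : set R := `[eta_ z 0, 0].

(* In the last clause the compositions are only meaningful near 0 on the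
   relevant side; the iterated one-sided derivatives at 0 depend only on the
   corresponding one-sided germ. *)
Definition critical_commuting_pair (r : nat) z : Prop :=
  [/\ [/\ eta_ z 0 < 0, 0 < xi_ z 0,
          Cr_on r (dom_eta z) (eta_ z) /\ op_homeo_on (dom_eta z) (eta_ z) &
          Cr_on r (dom_xi z) (xi_ z) /\ op_homeo_on (dom_xi z) (xi_ z)],
      eta_ z (xi_ z 0) = xi_ z (eta_ z 0) /\ xi_ z (eta_ z 0) != 0,
      (forall x, dom_eta z x -> x != 0 ->
         0 < deriv_in (dom_eta z) (eta_ z) x) /\
      (forall x, dom_xi z x -> x != 0 ->
         0 < deriv_in (dom_xi z) (xi_ z) x),
      (exists (d : nat) (C : set R) (phi psi : R -> R),
        [/\ (0 < d)%N,
            [/\ open C, is_interval C & C 0],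
            op_diffeo_on r C phi /\ op_diffeo_on r C psi,
            phi 0 = 0 /\ psi 0 = 0 &
            (forall x, C x -> dom_eta z x ->
               eta_ z x = phi x ^+ (2 * d + 1) + eta_ z 0) /\
            (forall x, C x -> dom_xi z x ->
               xi_ z x = psi x ^+ (2 * d + 1) + xi_ z 0)]) &
      forall j, (1 <= j <= r)%N ->
        nderiv_in `]-oo, 0] j (eta_ z \o xi_ z) 0 =
        nderiv_in `[0, +oo[ j (xi_ z \o eta_ z) 0].

Definition normalized z : Prop := eta_ z 0 = -1.

Definition negative_schwarzian z : Prop :=
  (forall x, dom_eta z x -> x != 0 ->
     schwarzian_in (dom_eta z) (eta_ z) x < 0) /\
  (forall x, dom_xi z x -> x != 0 ->
     schwarzian_in (dom_xi z) (xi_ z) x < 0).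

(* Whether (xi o eta)(0) lies in I_eta; otherwise it lies in I_xi. *)
Definition eta_side z : bool := 0 <= xi_ z (eta_ z 0) <= xi_ z 0.

(* The clause on i <= a says that the iterates involved are defined, i.e. that
   the orbit has not left the domain of the map being iterated. *)
Definition is_period z (a : nat) : Prop :=
  if eta_side z then
    (forall i, (i <= a)%N -> dom_eta z (iter i (eta_ z) (xi_ z 0))) /\
    iter a.+1 (eta_ z) (xi_ z 0) < 0
  else
    (forall i, (i <= a)%N -> dom_xi z (iter i (xi_ z) (eta_ z 0))) /\
    0 < iter a.+1 (xi_ z) (eta_ z 0).

(* [None] stands for an infinite period. *)
Definition period z : option nat :=
  xget None [set Some a | a in [set a | is_period z a]].

Definition renormalizable z : Prop := period z <> None.

(* Only meaningful for renormalizable pairs. *)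
Definition prerenorm z : cpair R :=
  if period z is Some a then
    if eta_side z then CPair (eta_ z) (iter a (eta_ z) \o xi_ z)
    else CPair (iter a (xi_ z) \o eta_ z) (xi_ z)
  else z.

Definition rescale (lam : R) z : cpair R :=
  CPair (fun x => eta_ z (lam * x) / lam) (fun x => xi_ z (lam * x) / lam).

Definition renorm z : cpair R :=
  rescale (- eta_ (prerenorm z) 0) (prerenorm z).

Definition infinitely_renormalizable z : Prop :=
  forall j, renormalizable (iter j renorm z).

(* [:: a_0; ...; a_n] |-> 1 / (a_0 + 1 / (... + 1 / a_n)) *)
Definition cfrac (s : seq nat) : R :=
  foldr (fun a t => (a%:R + t)^-1) 0 s.

(* Only meaningful for infinitely renormalizable pairs. *)
Definition rotation_number z : R :=
  lim ((fun n => cfrac (mkseq (fun j => odflt 0 (period (iter j renorm z))) n))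
         @ \oo).

(* The inequalities refer to eta^a (xi 0), hence to the case where
   (xi o eta)(0) lies in I_eta; there a >= 1. *)
Definition controlled (K : R) z : Prop :=
  eta_side z /\
  exists2 a : nat, period z = Some a &
    let x_ j := iter j (eta_ z) (xi_ z 0) in
    [/\ K^-1 <= xi_ z 0 <= K,
        xi_ z 0 - eta_ z (xi_ z 0) >= K^-1,
        [/\ x_ a.-1 - x_ a >= K^-1, x_ a >= K^-1 & x_ a.+1 <= - K^-1],
        (Cr_norm 3 `[(-1)%R, 0%R] (xi_ z) <= K%:E)%E /\
        (Cr_norm 3 `[0%R, xi_ z 0%R] (eta_ z) <= K%:E)%E &
        forall x, x_ a <= x <= xi_ z 0 ->
          deriv_in (dom_eta z) (eta_ z) x >= K^-1].

(* The Moebius transformation sending e, 0, s to -1, 0, 1, and its inverse;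
   see [is_mobius_mob], [mobE], [mob_unique] and [mobK] below. *)
Definition mob (e s x : R) : R := ((e - s) * x) / (2 * e * s - (e + s) * x).
Definition mobV (e s y : R) : R := (2 * e * s * y) / ((e - s) + (e + s) * y).

Definition mob_conj z (f : R -> R) : R -> R :=
  mob (eta_ z 0) (xi_ z 0) \o f \o mobV (eta_ z 0) (xi_ z 0).

Definition dist_Cr (r : nat) z0 z1 : \bar R :=
  maxe (`|xi_ z0 0 / eta_ z0 0 - xi_ z1 0 / eta_ z1 0|)%:E
    (maxe
      (Cr_norm r `[-1, 0]
         (fun x => mob_conj z0 (xi_ z0) x - mob_conj z1 (xi_ z1) x))
      (Cr_norm r `[0, 1]
         (fun x => mob_conj z0 (eta_ z0) x - mob_conj z1 (eta_ z1) x))).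

End commuting_pairs.

Section mobius_facts.
Variable R : realType.
Implicit Types e s x y : R.

Definition is_mobius (a b c d : R) (f : R -> R) : Prop :=
  a * d - b * c != 0 /\
  forall x, c * x + d != 0 -> f x = (a * x + b) / (c * x + d).

Lemma is_mobius_mob e s : e < 0 -> 0 < s ->
  is_mobius (e - s) 0 (- (e + s)) (2 * e * s) (mob e s).
Proof.
move=> e0 s0; split; last by move=> x _; rewrite /mob addr0 mulNr [- _ + _]addrC.
have es : e - s != 0 by rewrite subr_eq0 lt_eqF // (lt_trans e0 s0).
have e1 : e != 0 by rewrite lt_eqF.
have s1 : s != 0 by rewrite gt_eqF.
by rewrite mul0r subr0 !mulf_neq0 // pnatr_eq0.
Qed.

Lemma mobE e s : e < 0 -> 0 < s ->
  [/\ mob e s e = -1, mob e s 0 = 0 & mob e s s = 1].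
Proof.
move=> e0 s0; have es : e - s != 0 by rewrite subr_eq0 lt_eqF // (lt_trans e0 s0).
have e1 : e != 0 by rewrite lt_eqF.
have s1 : s != 0 by rewrite gt_eqF.
rewrite /mob; split.
- have -> : 2 * e * s - (e + s) * e = - ((e - s) * e) by ring.
  by rewrite invrN mulrN divff // mulf_neq0.
- by rewrite mulr0 mul0r.
- have -> : 2 * e * s - (e + s) * s = (e - s) * s by ring.
  by rewrite divff // mulf_neq0.
Qed.

Lemma mob_den e s x : e < 0 -> 0 < s -> e <= x <= s ->
  2 * e * s - (e + s) * x < 0.
Proof. by move=> e0 s0 /andP[ex xs]; nra. Qed.

Lemma mob_unique (a b c d : R) (f : R -> R) e s :
    e < 0 -> 0 < s -> is_mobius a b c d f ->
    c * e + d != 0 -> d != 0 -> c * s + d != 0 ->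
    f e = -1 -> f 0 = 0 -> f s = 1 ->
  forall x, e <= x <= s -> c * x + d != 0 /\ f x = mob e s x.
Proof.
move=> e0 s0 [_ fE] ced d0 csd fe f0 fs x xes.
have e1 : e != 0 by rewrite lt_eqF.
have s1 : s != 0 by rewrite gt_eqF.
have b0 : b = 0.
  move: f0; rewrite fE mulr0 ?add0r // mulr0 add0r => /eqP.
  by rewrite mulf_eq0 invr_eq0 (negPf d0) orbF => /eqP.
have ae : a * e = - (c * e + d).
  by move: fe; rewrite fE // b0 addr0 => /(canRL (divfK ced)); rewrite mulN1r.
have as_ : a * s = c * s + d.
  by move: fs; rewrite fE // b0 addr0 => /(canRL (divfK csd)); rewrite mul1r.
have c2 : 2 * e * s * c = - (d * (e + s)).
  have h : a * e * s = a * s * e by ring.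
  rewrite ae as_ in h; lra.
have a2 : 2 * e * s * a = d * (e - s).
  have -> : 2 * e * s * a = 2 * e * (a * s) by ring.
  rewrite as_ mulrDr.
  have -> : 2 * e * (c * s) = 2 * e * s * c by ring.
  rewrite c2; ring.
have es0 : 2 * e * s != 0 by rewrite !mulf_neq0 // pnatr_eq0.
have D0 : 2 * e * s - (e + s) * x != 0 by rewrite lt_eqF // mob_den.
have cxE : 2 * e * s * (c * x + d) = d * (2 * e * s - (e + s) * x).
  by rewrite mulrDr mulrA c2; ring.
have cx0 : c * x + d != 0.
  apply: contra_neq (mulf_neq0 d0 D0) => h.
  by rewrite -cxE h mulr0.
split=> //; rewrite fE // b0 addr0 /mob.
apply/eqP; rewrite eqr_div //; apply/eqP; apply: (mulfI es0).
have -> : 2 * e * s * ((e - s) * x * (c * x + d)) =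
          (e - s) * x * (2 * e * s * (c * x + d)) by ring.
by rewrite !(mulrA (2 * e * s)) a2 cxE; ring.
Qed.

Lemma mobK e s x : e < 0 -> 0 < s -> e <= x <= s -> mobV e s (mob e s x) = x.
Proof.
move=> e0 s0 xes; have D0 := mob_den e0 s0 xes.
have e1 : e != 0 by rewrite lt_eqF.
have s1 : s != 0 by rewrite gt_eqF.
have es : e - s != 0 by rewrite subr_eq0 lt_eqF // (lt_trans e0 s0).
set D := 2 * e * s - (e + s) * x in D0.
have D1 : D != 0 by rewrite lt_eqF.
have E : (e - s) + (e + s) * mob e s x = (e - s) * (2 * e * s) / D.
  apply: (mulIf D1); rewrite divfK // mulrDl /mob -/D mulrA divfK //.
  by rewrite /D; ring.
rewrite /mobV E /mob -/D.
by field; rewrite D1 es e1 s1.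
Qed.

Lemma mobVE e s : e < 0 -> 0 < s ->
  [/\ mobV e s (-1) = e, mobV e s 0 = 0 & mobV e s 1 = s].
Proof.
move=> e0 s0; have [h1 h2 h3] := mobE e0 s0.
by split; [rewrite -h1|rewrite -[X in mobV _ _ X]h2|rewrite -h3];
  rewrite mobK //; apply/andP; split; lra.
Qed.

End mobius_facts.

(* Main.v *)
Require Import Defs.
From mathcomp Require Import all_boot all_order all_algebra.
From mathcomp Require Import all_classical all_reals all_analysis.
From mathcomp Require Import ring lra zify.


(** In the coordinate in which a controlled pair has its end points at -1 and 1,
    the renormalization is (F, F^a \o X) up to a final change of coordinate, with
    F and X the two branches.  Composition and Moebius changes of coordinate are
    Lipschitz operations on C^2 maps with bounded, Lipschitz second derivative.
    The difficulty is that the period a is not bounded: the control excludes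
    fixed points of F in the corridor [F^a 1, 1], but the gap x - F x may be
    arbitrarily small there, and then a passage takes many steps.  Three ideas
    make the constants independent of a.

    Negative Schwarzian derivative says that (DF)^(-1/2) is convex.  Together
    with the control this bounds the second derivative of the gap from below
    where the gap is small: F is close to a saddle-node bifurcation, never to a
    more degenerate one (schwarzian_gap, controlled_model).

    For two maps at distance d, compare two orbits with the same number of steps
    whose initial points are close and whose end points are close.  The minimal
    gaps then agree up to a factor 1 + O(d), since otherwise one of the orbits
    would leave too early (gap_compare).  Hence the distance of the orbits stays
    below a barrier of order d (barrier_entry, barrier_exit, passage_orbits).
    The quotient of the derivative of F^j by the gap is a product of factors
    1 + O(gap), and the gaps along an orbit add up to at most the length of the
    corridor.  So the first two derivatives of F^a along the two orbits differ by
    O(d), uniformly in a (passage_jets).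

    It remains to see that the end points are close, that is, that the return
    maps F^a \o X of the two pairs differ by O(d).  This is where the rotation
    number enters.  The sign of the displacement of a word in the two generators
    is determined by the rotation number (sign_tracks).  If one of the return
    maps exceeded the other by a large multiple of d everywhere, some word would
    have displacements of opposite signs for the two pairs (no_domination).
    Therefore the return maps are O(d)-close at one point at least.  Where they
    are close, their derivatives are close by the previous paragraph, so that
    closeness propagates to the whole interval (propagate, model_close). *)

Set Implicit Arguments.
Unset Strict Implicit.
Unset Printing Implicit Defensive.

Import Order.TTheory GRing.Theory Num.Theory.
Import numFieldNormedType.Exports.

Local Open Scope classical_set_scope.
Local Open Scope ring_scope.

(** * One-sided differential calculus *)

Section one_sided_calculus.
Variable R : realType.
Implicit Types (a b c d e x y M : R) (f g h : R -> R).

(** Differentiability along [a, b], one-sided at the end points, in a form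
    without limits: it makes sense on degenerate intervals and passes to
    subintervals, so that the derivative f1 can be carried along as a datum. *)
Definition diff_on a b f f1 := forall x, a <= x <= b -> forall e, 0 < e ->
  exists2 d, 0 < d & forall y, a <= y <= b -> `|y - x| < d ->
    `|f y - f x - f1 x * (y - x)| <= e * `|y - x|.

Lemma diff_on_cont a b f f1 x e : diff_on a b f f1 -> a <= x <= b -> 0 < e ->
  exists2 d, 0 < d & forall y, a <= y <= b -> `|y - x| < d -> `|f y - f x| <= e.
Proof.
move=> H xab e0; have [d d0 Hd] := H x xab 1 ltr01.
have k0 : 0 < 1 + `|f1 x| by rewrite ltr_pwDl.
exists (Num.min d (e / (1 + `|f1 x|))); first by rewrite lt_min d0 divr_gt0.
move=> y yab; rewrite lt_min => /andP[yd ye].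
have := Hd y yab yd; rewrite mul1r => Hy.
have -> : f y - f x = (f y - f x - f1 x * (y - x)) + f1 x * (y - x) by ring.
rewrite (le_trans (ler_normD _ _))// normrM (le_trans (lerD Hy (lexx _)))//.
by rewrite -{1}[`|y - x|]mul1r -mulrDl mulrC -ler_pdivlMr// ltW.
Qed.

Lemma diff_on_within a b f f1 : diff_on a b f f1 ->
  {within `[a, b], continuous f}.
Proof.
move=> H; apply/subspace_continuousP => x /=; rewrite in_itv/= => xab.
apply/cvgrPdist_le => e e0; have [d d0 Hd] := diff_on_cont H xab e0.
rewrite /within /=; apply/nbhs_ballP; exists d => //= y; rewrite /ball/= => yx.
rewrite in_itv/= => yab; rewrite distrC; apply: Hd => //; by rewrite distrC.
Qed.

Lemma diff_on_is_derive a b f f1 x : diff_on a b f f1 -> a < x < b ->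
  is_derive x 1 f (f1 x).
Proof.
move=> H /andP[ax xb].
have xab : a <= x <= b by rewrite !ltW.
suff L : h^-1 *: (f (h *: (1 : R) + x) - f x) @[h --> 0^'] --> f1 x.
  by apply: DeriveDef; [apply/cvg_ex; exists (f1 x)|apply/cvg_lim].
apply/cvgrPdist_le => e e0; have [d d0 Hd] := H x xab e e0.
have r0 : 0 < Num.min d (Num.min (x - a) (b - x)) by rewrite !lt_min d0 !subr_gt0 ax xb.
suff : \forall t \near nbhs (0 : R), t != 0 ->
    `|f1 x - t^-1 *: (f (t *: (1 : R) + x) - f x)| <= e by [].
apply/nbhs_ballP; eexists; first exact: r0.
move=> t; rewrite /ball/= sub0r normrN !lt_min => /andP[td /andP[ta tb]] t0.
have tn : t \is a GRing.unit by rewrite unitfE.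
have txab : a <= t + x <= b.
  by move: ta tb; rewrite !ltr_norml => ta tb; apply/andP; split; lra.
have := Hd (t + x) txab; rewrite addrK => /(_ td) Q.
rewrite scaler1 -[X in X - _](mulrK tn (f1 x)) mulrC -mulrBr normrM normfV.
by rewrite ler_pdivrMl ?normr_gt0// distrC (le_trans Q)// mulrC.
Qed.

Lemma diff_on_sub a b c d f f1 : a <= c -> d <= b -> diff_on a b f f1 ->
  diff_on c d f f1.
Proof.
move=> ac db H x /andP[cx xd] e e0.
have [|r r0 Hr] := H x _ e e0; first by rewrite (le_trans ac cx) (le_trans xd db).
exists r => // y /andP[cy yd] yr; apply: Hr => //.
by rewrite (le_trans ac cy) (le_trans yd db).
Qed.

Lemma diff_on_MVT a b f f1 x y : diff_on a b f f1 -> a <= x -> x < y -> y <= b ->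
  exists2 c, x < c < y & f y - f x = f1 c * (y - x).
Proof.
move=> H ax xy yb; have Hs := diff_on_sub ax yb H.
have [] := @MVT R f f1 x y xy.
- by move=> z; rewrite in_itv/=; exact: diff_on_is_derive.
- exact: diff_on_within Hs.
- by move=> c; rewrite in_itv/= => cxy E; exists c.
Qed.

Lemma diff_on_lip a b f f1 M x y : diff_on a b f f1 ->
  (forall x, a <= x <= b -> `|f1 x| <= M) ->
  a <= x <= b -> a <= y <= b -> `|f x - f y| <= M * `|x - y|.
Proof.
move=> H HM.
wlog xy : x y / x < y.
  move=> W xab yab; have [xy|yx|->] := ltgtP x y; first exact: W.
  - by rewrite distrC (distrC x); exact: W.
  - by rewrite !subrr normr0 mulr0.
move=> /andP[ax xb] /andP[ay yb].
have [c /andP[xc cy] E] := diff_on_MVT H ax xy yb.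
rewrite distrC E normrM (distrC x) ler_wpM2r// HM//.
by rewrite (le_trans ax (ltW xc)) (le_trans (ltW cy) yb).
Qed.

Lemma diff_on_incr a b f f1 x y : diff_on a b f f1 ->
  (forall x, a < x < b -> 0 <= f1 x) ->
  a <= x -> x <= y -> y <= b -> f x <= f y.
Proof.
move=> H H0 ax; rewrite le_eqVlt => /predU1P[->//|xy] yb.
have [c /andP[xc cy] E] := diff_on_MVT H ax xy yb.
rewrite -subr_ge0 E mulr_ge0 ?subr_ge0 ?(ltW xy)// H0//.
by rewrite (le_lt_trans ax xc) (lt_le_trans cy yb).
Qed.

Lemma diff_on_cst a b c : diff_on a b (fun=> c) (fun=> 0).
Proof.
move=> x _ e e0; exists 1 => // y _ _.
by rewrite mul0r subrr subr0 normr0 mulr_ge0// ltW.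
Qed.

Lemma diff_on_id a b : diff_on a b id (fun=> 1).
Proof.
move=> x _ e e0; exists 1 => // y _ _.
by rewrite mul1r subrr normr0 mulr_ge0// ltW.
Qed.

Lemma diff_on_add a b f f1 g g1 : diff_on a b f f1 -> diff_on a b g g1 ->
  diff_on a b (fun x => f x + g x) (fun x => f1 x + g1 x).
Proof.
move=> Hf Hg x xab e e0; have e2 : 0 < e / 2 by rewrite divr_gt0.
have [d d0 Hd] := Hf x xab _ e2; have [r r0 Hr] := Hg x xab _ e2.
exists (Num.min d r); first by rewrite lt_min d0.
move=> y yab; rewrite lt_min => /andP[yd yr].
have -> : f y + g y - (f x + g x) - (f1 x + g1 x) * (y - x) =
  (f y - f x - f1 x * (y - x)) + (g y - g x - g1 x * (y - x)) by ring.
rewrite (le_trans (ler_normD _ _))//.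
by rewrite (le_trans (lerD (Hd _ yab yd) (Hr _ yab yr)))// -mulrDl -splitr.
Qed.

Lemma diff_on_scale a b c f f1 : diff_on a b f f1 ->
  diff_on a b (fun x => c * f x) (fun x => c * f1 x).
Proof.
move=> Hf x xab e e0; have k0 : 0 < 1 + `|c| by rewrite ltr_pwDl.
have [d d0 Hd] := Hf x xab (e / (1 + `|c|)) ltac:(by rewrite divr_gt0).
exists d => // y yab yd.
have -> : c * f y - c * f x - c * f1 x * (y - x) =
  c * (f y - f x - f1 x * (y - x)) by ring.
rewrite normrM (le_trans (ler_wpM2l (normr_ge0 _) (Hd _ yab yd)))//.
rewrite mulrA ler_wpM2r// mulrCA ler_piMr ?(ltW e0)//.
by rewrite ler_pdivrMr// mul1r lerDr.
Qed.

Lemma diff_on_opp a b f f1 : diff_on a b f f1 ->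
  diff_on a b (fun x => - f x) (fun x => - f1 x).
Proof.
move=> Hf x xab e e0; have [d d0 Hd] := Hf x xab e e0.
exists d => // y yab yd; rewrite (_ : _ - _ = - (f y - f x - f1 x * (y - x))).
  by rewrite normrN; exact: Hd.
by ring.
Qed.

Lemma diff_on_subr a b f f1 g g1 : diff_on a b f f1 -> diff_on a b g g1 ->
  diff_on a b (fun x => f x - g x) (fun x => f1 x - g1 x).
Proof. by move=> Hf Hg; exact: diff_on_add Hf (diff_on_opp Hg). Qed.

Lemma diff_on_comp a b c d f f1 h h1 :
  diff_on a b h h1 -> diff_on c d f f1 ->
  (forall x, a <= x <= b -> c <= h x <= d) ->
  diff_on a b (fun x => f (h x)) (fun x => f1 (h x) * h1 x).
Proof.
move=> Hh Hf hab x xab e e0.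
set k := `|h1 x| + 1; have k0 : 0 < k by rewrite ltr_wpDl.
set m := `|f1 (h x)| + 1; have m0 : 0 < m by rewrite ltr_wpDl.
have [r r0 Hr] := Hf _ (hab _ xab) (e / 2 / k) ltac:(by rewrite !divr_gt0).
have [s s0 Hs] := Hh _ xab (Num.min 1 (e / 2 / m))
  ltac:(by rewrite lt_min ltr01 !divr_gt0).
exists (Num.min s (r / k)); first by rewrite lt_min s0 divr_gt0.
move=> y yab; rewrite lt_min => /andP[ys yr].
have H1 := Hs y yab ys.
have H2 : `|h y - h x| <= k * `|y - x|.
  have -> : h y - h x = (h y - h x - h1 x * (y - x)) + h1 x * (y - x) by ring.
  rewrite (le_trans (ler_normD _ _))// /k normrM mulrDl [leRHS]addrC lerD2r.
  by rewrite (le_trans H1)// ler_wpM2r// ge_min lexx.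
have H3 : `|h y - h x| < r.
  by rewrite (le_lt_trans H2)// mulrC -ltr_pdivlMr.
have H4 := Hr _ (hab _ yab) H3.
have -> : f (h y) - f (h x) - f1 (h x) * h1 x * (y - x) =
  (f (h y) - f (h x) - f1 (h x) * (h y - h x)) +
  f1 (h x) * (h y - h x - h1 x * (y - x)) by ring.
rewrite (le_trans (ler_normD _ _))// [e]splitr mulrDl lerD//.
  rewrite (le_trans H4)// (le_trans (ler_wpM2l _ H2))//.
    by rewrite ltW// !divr_gt0.
  by rewrite mulrA divfK// gt_eqF.
rewrite normrM (le_trans (ler_wpM2l (normr_ge0 _) H1))//.
rewrite (@le_trans _ _ (m * (e / 2 / m * `|y - x|)))//.
  apply: ler_pM; rewrite ?normr_ge0 ?lerDl//.
    by rewrite mulr_ge0// le_min ler01/= ltW// !divr_gt0.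
  by rewrite ler_wpM2r// ge_min lexx orbT.
by rewrite mulrA [m * _]mulrC divfK// gt_eqF.
Qed.

Lemma diff_on_sqr c d : diff_on c d (fun x => x ^+ 2) (fun x => 2 * x).
Proof.
move=> x _ e e0; exists e => // y _ yx.
have -> : y ^+ 2 - x ^+ 2 - 2 * x * (y - x) = (y - x) * (y - x) by ring.
by rewrite normrM ler_wpM2r// ltW.
Qed.

Lemma diff_on_ext a b f f1 g g1 : diff_on a b f f1 ->
  (forall x, a <= x <= b -> f x = g x) ->
  (forall x, a <= x <= b -> f1 x = g1 x) -> diff_on a b g g1.
Proof.
move=> H E E1 x xab e e0; have [d d0 Hd] := H x xab e e0.
by exists d => // y yab yd; rewrite -!E// -E1//; exact: Hd.
Qed.

Lemma diff_on_mul a b f f1 g g1 : diff_on a b f f1 -> diff_on a b g g1 ->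
  diff_on a b (fun x => f x * g x) (fun x => f1 x * g x + f x * g1 x).
Proof.
move=> Hf Hg.
pose N u := (u : R) - 1. pose B f x := `|f x| + 1 : R.
move=> x xab e e0.
set k := `|g x| + 1; have k0 : 0 < k by rewrite ltr_wpDl.
set m := `|f x| + 1; have m0 : 0 < m by rewrite ltr_wpDl.
set n := `|f1 x| + 1; have n0 : 0 < n by rewrite ltr_wpDl.
have e3 : 0 < e / 3 by rewrite divr_gt0.
have [d1 d10 H1] := Hf x xab (Num.min 1 (e / 3 / k))
  ltac:(by rewrite lt_min ltr01 divr_gt0).
have [d2 d20 H2] := Hg x xab (e / 3 / m) ltac:(by rewrite divr_gt0).
have [d3 d30 H3] := diff_on_cont Hg xab (e := e / 3 / (n + 1))
  ltac:(by rewrite divr_gt0// ltr_wpDl// ltW).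
exists (Num.min d1 (Num.min d2 d3)); first by rewrite !lt_min d10 d20.
move=> y yab; rewrite !lt_min => /and3P[y1 y2 y3].
have := H1 _ yab y1; have := H2 _ yab y2; have := H3 _ yab y3.
set D := `|y - x|; have D0 : 0 <= D by exact: normr_ge0.
move=> E3 E2 E1.
have -> : f y * g y - f x * g x - (f1 x * g x + f x * g1 x) * (y - x) =
  (f y - f x - f1 x * (y - x)) * g x + f x * (g y - g x - g1 x * (y - x))
  + (f y - f x) * (g y - g x) by ring.
have E4 : `|f y - f x| <= (n + 1) * D.
  have -> : f y - f x = (f y - f x - f1 x * (y - x)) + f1 x * (y - x) by ring.
  rewrite (le_trans (ler_normD _ _))// normrM -/D.
  have : `|f y - f x - f1 x * (y - x)| <= 1 * D.
    by rewrite (le_trans E1)// ler_wpM2r// ge_min lexx.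
  by rewrite /n => ?; nra.
have -> : e * D = e / 3 * D + e / 3 * D + e / 3 * D by field.
rewrite (le_trans (ler_normD _ _))// lerD//; last first.
  rewrite normrM (le_trans (ler_pM _ _ E4 E3))// mulrAC mulrCA.
  by rewrite divff ?mulr1 ?mul1r ?gt_eqF// ?ltr_wpDl ?ltW// mulrC.
rewrite (le_trans (ler_normD _ _))// lerD// normrM.
  rewrite (@le_trans _ _ ((e / 3 / k * D) * k))//.
    rewrite ler_pM ?lerDl// (le_trans E1)// ler_wpM2r// ge_min lexx orbT//.
  by rewrite mulrAC divfK// gt_eqF.
rewrite (@le_trans _ _ (m * (e / 3 / m * D)))//.
  by rewrite ler_pM ?lerDl//.
by rewrite mulrA [m * _]mulrC divfK// gt_eqF.
Qed.

Lemma diff_on_inv a b f f1 : diff_on a b f f1 ->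
  (forall x, a <= x <= b -> f x != 0) ->
  diff_on a b (fun x => (f x)^-1) (fun x => - f1 x / f x ^+ 2).
Proof.
move=> Hf f0 x xab e e0; have fx0 := f0 _ xab.
have p0 : 0 < `|f x| by rewrite normr_gt0.
set p := `|f x| in p0 *.
set n := `|f1 x| + 1; have n0 : 0 < n by rewrite ltr_wpDl.
have [d1 d10 H1] := Hf x xab (Num.min 1 (e / 4 * p ^+ 2))
  ltac:(by rewrite lt_min ltr01 !mulr_gt0// exprn_gt0).
have [d2 d20 H2] := diff_on_cont Hf xab (e := Num.min (p / 2) (e * p ^+ 3 / 4 / n))
  ltac:(by rewrite lt_min !mulr_gt0// ?exprn_gt0// invr_gt0).
exists (Num.min d1 d2); first by rewrite !lt_min d10 d20.
move=> y yab; rewrite !lt_min => /andP[y1 y2].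
have := H1 _ yab y1; have := H2 _ yab y2; have fy0 := f0 _ yab.
set D := `|y - x|; have D0 : 0 <= D by exact: normr_ge0.
rewrite le_min => /andP[E2 E3] E1.
have fyp : p / 2 <= `|f y|.
  have := ler_normD (f y) (f x - f y); rewrite addrC subrK -/p distrC => ?; lra.
have q0 : 0 < p / 2 by rewrite divr_gt0.
have -> : (f y)^-1 - (f x)^-1 - - f1 x / f x ^+ 2 * (y - x) =
  - (f y - f x - f1 x * (y - x)) / (f x * f y)
  + f1 x * (y - x) * (f y - f x) / (f x ^+ 2 * f y).
  by field; rewrite fx0 fy0.
rewrite (le_trans (ler_normD _ _))//.
have -> : e * D = e / 2 * D + e / 2 * D by field.
rewrite lerD// normrM normfV ler_pdivrMr ?normr_gt0 ?mulf_neq0 ?expf_neq0//.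
  rewrite normrN normrM -/p (@le_trans _ _ (e / 4 * p ^+ 2 * D))//.
    by rewrite (le_trans E1)// ler_wpM2r// ge_min lexx orbT.
  have -> : e / 4 * p ^+ 2 * D = e / 2 * D * (p * (p / 2)) by field.
  rewrite ler_wpM2l//; first by rewrite mulr_ge0// ltW// divr_gt0.
  by rewrite ler_wpM2l// ltW.
rewrite [leLHS]normrM [`|f1 x * _|]normrM [`|f x ^+ 2 * _|]normrM normrX -/p -/D.
rewrite (@le_trans _ _ (n * D * (e * p ^+ 3 / 4 / n)))//.
  by rewrite ler_pM ?mulr_ge0// ler_wpM2r// lerDl.
have -> : n * D * (e * p ^+ 3 / 4 / n) = e / 2 * D * (p ^+ 2 * (p / 2)).
  by field; rewrite gt_eqF.
rewrite ler_wpM2l//; first by rewrite mulr_ge0// ltW// divr_gt0.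
by rewrite ler_wpM2l// exprn_ge0// ltW.
Qed.

End one_sided_calculus.

(** * Barriers around an almost parabolic point *)

Section barrier.
Variable R : realType.
Implicit Types (X Y : R).

(** A nondegenerate minimum at 0, seen through the quadratic Taylor bounds at
    all points. Below, g X is the gap X - f X of an increasing map f, in a
    coordinate centred where the gap is least; the orbits of f are then those of
    X - g X. *)
Record well (k M r : R) (g g1 : R -> R) : Prop := Well {
  well_lo : forall X Y, `|X| <= r -> `|Y| <= r ->
    k * (Y - X) ^+ 2 <= g Y - g X - g1 X * (Y - X);
  well_up : forall X Y, `|X| <= r -> `|Y| <= r ->
    g Y - g X - g1 X * (Y - X) <= M * (Y - X) ^+ 2;
  well_slope : forall X, `|X| <= r -> `|g1 X| <= M * `|X| }.

Variables (k M r b d C p q : R) (g g1 h : R -> R).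
Hypothesis (k0 : 0 < k) (k1 : k <= 1) (M1 : 1 <= M).
Hypothesis (r0 : 0 < r) (rM : 8 * M * r <= 1).
Hypothesis W : well k M (2 * r) g g1.
Hypothesis (e0 : 0 < g 0) (er : g 0 <= r ^+ 2).
Hypothesis (b0 : 0 <= b) (bM : 16 * M ^+ 2 * b <= k) (d0 : 0 <= d) (C0 : 0 <= C).

Let M0 : 0 <= M. Proof. exact: le_trans ler01 M1. Qed.

Ltac hyps := move: (k0) (k1) (M1) (r0) (rM) (e0) (er) (b0) (bM) (d0) (C0) (M0) =>
  ? ? ? ? ? ? ? ? ? ? ? ?.
Ltac slra := hyps; lra.
Ltac snra := hyps; nra.

Let zero_in : `|0 : R| <= 2 * r.
Proof. by rewrite normr0 mulr_ge0// ltW. Qed.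

Lemma well_slope0 : g1 0 = 0.
Proof. by have := well_slope W zero_in; rewrite normr0 mulr0 normr_le0 => /eqP. Qed.

Lemma well_ge X : `|X| <= 2 * r -> g 0 + k * X ^+ 2 <= g X.
Proof.
move=> Xr; have := well_lo W zero_in Xr; rewrite well_slope0 !subr0 mul0r subr0.
by rewrite lerBrDl.
Qed.

Lemma well_le X : `|X| <= 2 * r -> g X <= g 0 + M * X ^+ 2.
Proof.
move=> Xr; have := well_up W zero_in Xr; rewrite well_slope0 !subr0 mul0r subr0.
by rewrite lerBlDl.
Qed.

Lemma well_gt0 X : `|X| <= 2 * r -> 0 < g X.
Proof.
move=> Xr; apply: lt_le_trans (well_ge Xr).
by rewrite ltr_wpDr// mulr_ge0 ?sqr_ge0// ltW.
Qed.

Lemma well_slope_sgn X : `|X| <= 2 * r -> 0 <= g1 X * X.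
Proof.
move=> Xr; have := well_lo W Xr zero_in; have := well_ge Xr.
have : 0 <= k * X ^+ 2 by rewrite mulr_ge0 ?sqr_ge0// ltW.
by rewrite sub0r sqrrN mulrN; slra.
Qed.

(** The tolerated distance between two orbits near X, up to a factor b.  It is
    comparable to sqrt (g 0) + |X|, the distance by which X moves under a
    relative change of scale of the well. *)
Let s : R := Num.sqrt (g 0).
Definition width X := g X / (s + `|X|).
Let s0 : 0 < s. Proof. by rewrite sqrtr_gt0. Qed.
Let ss : s ^+ 2 = g 0. Proof. by rewrite sqr_sqrtr// ltW. Qed.
Let sr : s <= r.
Proof. by rewrite -(gtr0_norm r0) -sqrtr_sqr ler_wsqrtr. Qed.

Ltac hyps ::= move: (k0) (k1) (M1) (r0) (rM) (e0) (er) (b0) (bM) (d0) (C0) (M0)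
  (s0) (sr) => ? ? ? ? ? ? ? ? ? ? ? ? ? ?.

Lemma width_scale X : `|X| <= 2 * r ->
  k / 2 * (s + `|X|) ^+ 2 <= g X <= M * (s + `|X|) ^+ 2.
Proof.
move=> Xr; have := well_ge Xr; have := well_le Xr.
rewrite -ss -(real_normK (num_real X)); have x0 : 0 <= `|X| by [].
set x : R := `|X| in x0 * => H1 H2.
have A1 : k * s ^+ 2 <= 1 * s ^+ 2 by rewrite ler_wpM2r ?sqr_ge0.
have A2 : 1 * s ^+ 2 <= M * s ^+ 2 by rewrite ler_wpM2r ?sqr_ge0.
have A3 : 0 <= k * (s - x) ^+ 2 by rewrite mulr_ge0 ?sqr_ge0 ?ltW.
have A4 : 0 <= M * (s * x) by apply: mulr_ge0; [|rewrite mulr_ge0// ltW].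
by apply/andP; split; slra.
Qed.

Lemma width_le X : `|X| <= 2 * r -> 0 < width X <= M * (s + `|X|).
Proof.
move=> Xr; have sX : 0 < s + `|X| by rewrite ltr_wpDr.
rewrite /width divr_gt0 ?well_gt0//= ler_pdivrMr// -mulrA -expr2.
by have /andP[] := width_scale Xr.
Qed.

Lemma width_ge X : `|X| <= 2 * r -> k / 2 * `|X| <= width X.
Proof.
move=> Xr; have sX : 0 < s + `|X| by rewrite ltr_wpDr.
have /andP[A _] := width_scale Xr.
rewrite /width ler_pdivlMr//; apply: le_trans A.
rewrite expr2 mulrA ler_wpM2r ?(ltW sX)//.
have : 0 <= k / 2 * s by rewrite mulr_ge0 ?(ltW s0)// divr_ge0// ltW.
by move=> ?; lra.
Qed.

Lemma width_le1 X : `|X| <= r -> width X <= 1.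
Proof.
move=> Xr; have Xr2 : `|X| <= 2 * r by move: r0 => ?; lra.
have /andP[_ A] := width_le Xr2; apply: le_trans A _.
have : M * (s + `|X|) <= M * (2 * r) by apply: ler_wpM2l => //; move: (sr) => ?; lra.
by move: rM => ? ?; lra.
Qed.

Lemma width_sqr X : `|X| <= 2 * r -> width X ^+ 2 <= M * g X.
Proof.
move=> Xr; have sX : 0 < s + `|X| by rewrite ltr_wpDr.
have /andP[w0 wM] := width_le Xr.
have -> : width X ^+ 2 = width X / (s + `|X|) * g X.
  by rewrite expr2 {2}/width; field; rewrite gt_eqF.
by rewrite ler_wpM2r ?(ltW (well_gt0 Xr))// ler_pdivrMr.
Qed.

Lemma width_slope X : `|X| <= 2 * r -> `|g1 X| * width X <= M * g X.
Proof.
move=> Xr; have sX : 0 < s + `|X| by rewrite ltr_wpDr.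
have g0 := well_gt0 Xr; have := well_slope W Xr.
rewrite /width mulrA ler_pdivrMr// => H.
rewrite -mulrA [g X * _]mulrC mulrA ler_wpM2r ?(ltW g0)//.
by rewrite (le_trans H)// ler_wpM2l// lerDr ltW.
Qed.

(** The defining property of the width: along the orbit it decays on the way in
   (respectively grows on the way out) faster than the linearised error. *)
Lemma width_entry X : 0 <= X -> 0 <= X - g X -> X <= r ->
  width X - width (X - g X) <= g1 X * width X - k / 8 * g X.
Proof.
move=> g0X X'0 Xr.
have Xr2 : `|X| <= 2 * r by rewrite ger0_norm//; slra.
have G0 := well_gt0 Xr2; set G := g X in G0 X'0 *; set X' := X - G in X'0 *.
have X'r : `|X'| <= 2 * r by rewrite ger0_norm// /X'; slra.
have /andP[H1 _] := width_scale Xr2; move: H1; rewrite -/G.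
have := well_lo W Xr2 X'r; rewrite -/G /X'.
have -> : X - G - X = - G by ring.
have := well_slope W Xr2; rewrite [in X in X -> _](ger0_norm g0X) => /ler_normlP[_ H3].
rewrite /width -/G -/X' !ger0_norm//; set Z := (s + X); set Z' := s + X'.
have Z0 : 0 < Z by rewrite ltr_wpDr. have Z'0 : 0 < Z' by rewrite ltr_wpDr.
have ZZ : Z' = Z - G by rewrite /Z' /Z /X'; ring.
move=> H2 H1.
have g1X : g1 X <= 1 / 2.
  have MX : M * X <= M * r by rewrite ler_wpM2l.
  by move: (rM) (H3) => ? ?; slra.
have H4 : G * (1 - g1 X) <= g X'.
  have : 0 <= k * (- G) ^+ 2 by rewrite mulr_ge0 ?sqr_ge0// ltW.
  by move: H2; rewrite -/X' => H2 ?; slra.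
have H5 : G * (1 - g1 X) / Z' <= g X' / Z' by rewrite ler_wpM2r// invr_ge0 ltW.
suff : G / Z - G * (1 - g1 X) / Z' <= g1 X * (G / Z) - k / 8 * G by slra.
rewrite -subr_ge0.
have -> : g1 X * (G / Z) - k / 8 * G - (G / Z - G * (1 - g1 X) / Z') =
   G * ((1 - g1 X) * (Z - Z') / (Z * Z') - k / 8).
  by field; rewrite !gt_eqF.
have -> : Z - Z' = G by rewrite ZZ; ring.
rewrite mulr_ge0 ?(ltW G0)// subr_ge0 ler_pdivlMr ?mulr_gt0//.
have Z'Z : Z' <= Z by rewrite ZZ; slra.
have H6 : Z * Z' <= Z ^+ 2 by rewrite expr2 ler_wpM2l// ltW.
have H7 : 1 / 2 * G <= (1 - g1 X) * G by apply: ler_wpM2r; [exact: ltW|slra].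
have k8 : 0 <= k / 8 by slra.
have := ler_wpM2l k8 H6.
by move=> ?; slra.
Qed.

Lemma width_exit X : X <= 0 -> - r <= X ->
  g1 X * width X + k / 8 * g X <= width X - width (X - g X).
Proof.
move=> X0 Xr.
have Xr2 : `|X| <= 2 * r by rewrite ler0_norm//; slra.
have G0 := well_gt0 Xr2; have /andP[H1 H7] := width_scale Xr2.
move: H1 H7; set G := g X in G0 *; set X' := X - G => H1 H7.
have Ex : s + `|X| <= 2 * r by rewrite ler0_norm//; slra.
have sX0 : 0 < s + `|X| by rewrite ltr_wpDr.
have GZ : 4 * G <= s + `|X|.
  have : M * (s + `|X|) ^+ 2 <= M * (2 * r) * (s + `|X|).
    by rewrite expr2 -mulrA ler_wpM2l // ler_wpM2r// ltW.
  have : (8 * M * r) * (s + `|X|) <= 1 * (s + `|X|) by rewrite ler_wpM2r// ltW.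
  by move=> ? ?; slra.
have X'0 : X' <= 0 by rewrite /X'; slra.
have X'r : `|X'| <= 2 * r.
  by rewrite ler0_norm// /X'; move: GZ Ex; rewrite ler0_norm// => *; slra.
have H2 := well_up W Xr2 X'r; move: H2; rewrite -/G /X'.
have -> : X - G - X = - G by ring.
rewrite sqrrN /width -/G -/X' => H2.
have S : g1 X <= 0.
  move: X0; rewrite le_eqVlt => /predU1P[->|X0]; first by rewrite well_slope0.
  by have := well_slope_sgn Xr2; rewrite nmulr_lge0.
move: H1 H7 GZ Ex sX0; rewrite !ler0_norm//; set Z := s - X; set Z' := s - X'.
move=> H1 H7 GZ Ex Z0.
have ZZ : Z' = Z + G by rewrite /Z' /Z /X'; ring.
have Z'0 : 0 < Z' by rewrite ZZ; slra.
have H4 : g X' <= G - g1 X * G + M * G ^+ 2 by move: H2; rewrite -/X'; slra.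
have H5 : g X' / Z' <= (G - g1 X * G + M * G ^+ 2) / Z'.
  by rewrite ler_wpM2r// invr_ge0 ltW.
suff : g1 X * (G / Z) + k / 8 * G <= G / Z - (G - g1 X * G + M * G ^+ 2) / Z' by slra.
rewrite -subr_ge0.
have -> : G / Z - (G - g1 X * G + M * G ^+ 2) / Z' - (g1 X * (G / Z) + k / 8 * G) =
  G * (((1 - g1 X) * G - M * G * Z) / (Z * Z') - k / 8).
  have E : (1 - g1 X) * G = (1 - g1 X) * (Z' - Z) by rewrite ZZ; ring.
  rewrite E; rewrite ZZ; field.
  by rewrite -ZZ !gt_eqF.
rewrite mulr_ge0 ?(ltW G0)// subr_ge0 ler_pdivlMr ?mulr_gt0//.
have MZ : M * Z <= 1 / 4.
  by have : M * Z <= M * (2 * r) by [exact: ler_wpM2l]; slra.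
have : M * Z * G <= 1 / 4 * G by rewrite ler_wpM2r ?(ltW G0).
have : 0 <= - g1 X * G by rewrite mulr_ge0 ?(ltW G0) ?oppr_ge0.
have : Z * Z' <= 5 / 4 * Z ^+ 2.
  by rewrite [5 / 4 * _]mulrC expr2 -mulrA ler_wpM2l ?(ltW Z0)// ZZ; slra.
move=> A1 A2 A3.
have k8 : 0 <= k / 8 by slra.
by have := ler_wpM2l k8 A1; move=> ?; slra.
Qed.

Hypothesis near : forall X, `|X| <= 2 * r -> `|h X - g X| <= C * d * g X.
Hypothesis bC : 64 * C * d <= k * b.

Lemma width_perturb X (t : R) : `|X| <= r -> `|t| <= b ->
  `|X + t * width X| <= 2 * r /\
  `|h (X + t * width X) - g X - t * (g1 X * width X)| <= b * (k / 8 * g X).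
Proof.
move=> Xr tb; have Xr2 : `|X| <= 2 * r by rewrite (le_trans Xr)//; slra.
have /andP[w0 wM] := width_le Xr2; have wS := width_sqr Xr2.
have wG := width_slope Xr2; have G0 := well_gt0 Xr2.
set w := width X in w0 wM wS wG *.
have MM : M <= M ^+ 2 by rewrite expr2 ler_peMr.
have bM1 : b * M <= 1 / 16.
  have : b * M <= b * M ^+ 2 by rewrite ler_wpM2l.
  by move=> ?; slra.
have bM2 : b * M ^+ 2 <= 1 / 16 by slra.
have tw : `|t * w| <= r.
  rewrite normrM (gtr0_norm w0) (@le_trans _ _ (b * (M * (s + `|X|))))//.
    by rewrite ler_pM// ltW.
  rewrite mulrA (@le_trans _ _ (1 / 16 * (s + `|X|)))//.
    by rewrite ler_wpM2r// addr_ge0// ltW.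
  by move: (sr) (Xr) => *; slra.
have Yr : `|X + t * w| <= 2 * r.
  by rewrite (le_trans (ler_normD _ _))//; slra.
split=> //; set Y := X + t * w in Yr *.
have YX : Y - X = t * w by rewrite /Y; ring.
have t2 : t ^+ 2 <= b * b by rewrite -(real_normK (num_real t)) expr2; apply: ler_pM.
have H1 := well_lo W Xr2 Yr; have H2 := well_up W Xr2 Yr.
rewrite YX exprMn in H1 H2.
have Q0 : 0 <= k * (t ^+ 2 * w ^+ 2).
  by apply: mulr_ge0; [exact: ltW|apply: mulr_ge0; exact: sqr_ge0].
have Q1 : M * (t ^+ 2 * w ^+ 2) <= b * M ^+ 2 * b * g X.
  have -> : b * M ^+ 2 * b * g X = M * (b * b * (M * g X)) by ring.
  by apply: ler_wpM2l => //; apply: ler_pM => //; exact: sqr_ge0.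
have bg : 0 <= b * g X by rewrite mulr_ge0// ltW.
have Q2 : b * M ^+ 2 * b * g X <= b * (k / 16 * g X).
  have : M ^+ 2 * b <= k / 16 by slra.
  by move=> /(ler_wpM2r bg) ?; lra.
have b16 : b <= 1 / 16.
  by have : b * 1 <= b * M by [exact: ler_wpM2l]; lra.
have bk : b * (k / 16 * g X) <= g X.
  have : k * (b * g X) <= 1 * (b * g X) by exact: ler_wpM2r.
  have : b * g X <= 1 / 16 * g X by apply: ler_wpM2r => //; exact: ltW.
  by move=> *; lra.
have gY : g Y <= 4 * g X.
  have : `|t * (g1 X * w)| <= b * (M * g X).
    by rewrite normrM; apply: ler_pM => //; rewrite normrM (gtr0_norm w0).
  move=> /ler_normlP[_ A1]; have A2 : b * M * g X <= 1 / 16 * g X.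
    by apply: ler_wpM2r => //; exact: ltW.
  have E : t * (g1 X * w) = g1 X * (t * w) by ring.
  by rewrite E in A1; lra.
have H3 := near Yr.
have H4 : C * d * g Y <= b * (k / 16 * g X).
  apply: (@le_trans _ _ (C * d * (4 * g X))).
    by apply: ler_wpM2l => //; exact: mulr_ge0.
  by have := ler_wpM2r (ltW G0) bC => ?; lra.
have -> : h Y - g X - t * (g1 X * w) = (h Y - g Y) + (g Y - g X - g1 X * (t * w)) by ring.
rewrite (le_trans (ler_normD _ _))//.
have : `|g Y - g X - g1 X * (t * w)| <= b * (k / 16 * g X).
  by rewrite ger0_norm; slra.
by move=> *; slra.
Qed.

Hypothesis (pr : p <= - (2 * r)) (qr : 2 * r <= q).
Hypothesis incr : forall Y Z, p <= Y -> Y < Z -> Z <= q -> Y - h Y < Z - h Z.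

Let incrW Y Z : p <= Y -> Y <= Z -> Z <= q -> Y - h Y <= Z - h Z.
Proof.
move=> pY; rewrite le_eqVlt => /predU1P[-> //|YZ Zq]; exact/ltW/incr.
Qed.

(** A tube of half-width b * width around an orbit is mapped into itself on the
    way in: errors are multiplied by about 1 - g1 X, the width shrinks by
    strictly less (width_entry), and the margin k / 8 * g X absorbs the
    perturbation h of g. *)
Lemma barrier_entry X Y : p <= Y <= q -> 0 <= X -> 0 <= X - g X -> X <= r ->
  `|Y - X| <= b * width X ->
  `|(Y - h Y) - (X - g X)| <= b * width (X - g X).
Proof.
move=> /andP[pY Yq] X0 X'0 Xr; have E := width_entry X0 X'0 Xr.
have Xr1 : `|X| <= r by rewrite ger0_norm.
have bb : `|b| <= b by rewrite ger0_norm.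
have bb' : `|- b| <= b by rewrite normrN ger0_norm.
have [/ler_normlP[U1 U2] /ler_normlP[P1 _]] := width_perturb Xr1 bb.
have [/ler_normlP[L1 L2]] := width_perturb Xr1 bb'.
move=> /ler_normlP[_ P2].
move/ler_normlP => [Y1 Y2].
have B := ler_wpM2l b0 E.
apply/ler_normlP; split.
- have := @incrW (X + - b * width X) Y ltac:(move: pr; lra) ltac:(lra) Yq.
  by move=> ?; lra.
- have := @incrW Y (X + b * width X) pY ltac:(lra) ltac:(move: qr; lra).
  by move=> ?; lra.
Qed.

(** On the way out errors are expanded faster than the width grows, so that
    closeness is inherited backwards in time. *)
Lemma barrier_exit X Y : p <= Y <= q -> X <= 0 -> - r <= X ->
  `|(Y - h Y) - (X - g X)| <= b * width (X - g X) ->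
  `|Y - X| <= b * width X.
Proof.
move=> /andP[pY Yq] X0 Xr; have E := width_exit X0 Xr.
have Xr1 : `|X| <= r by rewrite ler0_norm//; slra.
have bb : `|b| <= b by rewrite ger0_norm.
have bb' : `|- b| <= b by rewrite normrN ger0_norm.
have [/ler_normlP[U1 U2] /ler_normlP[_ P1]] := width_perturb Xr1 bb.
have [/ler_normlP[L1 L2]] := width_perturb Xr1 bb'.
move=> /ler_normlP[P2 _].
move/ler_normlP => [Y1 Y2].
have B := ler_wpM2l b0 E.
apply/ler_normlP; split; rewrite leNgt; apply/negP => A.
- have := @incr Y (X + - b * width X) pY ltac:(lra) ltac:(move: qr; lra).
  by move=> ?; lra.
- have := @incr (X + b * width X) Y ltac:(move: pr; lra) ltac:(lra) Yq.
  by move=> ?; lra.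
Qed.

Lemma width_gap X Y : `|X| <= r -> `|Y - X| <= b * width X ->
  `|h Y - g X| <= (M + k / 8) * b * g X.
Proof.
move=> Xr YX; have Xr2 : `|X| <= 2 * r by rewrite (le_trans Xr)//; slra.
have /andP[w0 _] := width_le Xr2; have wG := width_slope Xr2.
have [tb tY] : `|(Y - X) / width X| <= b /\ Y = X + (Y - X) / width X * width X.
  split; last by rewrite divfK ?gt_eqF//; ring.
  by rewrite normrM normfV (gtr0_norm w0) ler_pdivrMr.
move: tb tY; set t := _ / _ => tb ->.
have [_ H] := width_perturb Xr tb.
have -> : h (X + t * width X) - g X =
  (h (X + t * width X) - g X - t * (g1 X * width X)) + t * (g1 X * width X) by ring.
rewrite (le_trans (ler_normD _ _))//.
have : `|t * (g1 X * width X)| <= b * (M * g X).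
  by rewrite normrM; apply: ler_pM => //; rewrite normrM (gtr0_norm w0).
by move=> *; lra.
Qed.

End barrier.

Section scaling.
Variable R : realType.

(** Once the minimal gaps of h and g differ by the factor 1 + b, scaling by 1 +
    b makes the well of h dominate that of g: orbits of h that start below a
    scaled orbit of g stay below it. *)
Lemma scaling_step (k M r b C d p q : R) (g g1 h : R -> R) :
  0 < k -> 0 < r -> well k M (2 * r) g g1 -> 0 <= b <= 1 -> 0 <= C * d ->
  4 * (C * d) <= k * b ->
  (forall X, `|X| <= 2 * r -> `|(h X - h 0) - (g X - g 0)| <= C * d * X ^+ 2) ->
  (1 + b) * g 0 <= h 0 -> p <= - (2 * r) -> 2 * r <= q ->
  (forall Y Z, p <= Y -> Y < Z -> Z <= q -> Y - h Y < Z - h Z) ->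
  forall X Y, p <= Y -> `|X| <= r -> Y <= (1 + b) * X ->
  Y - h Y <= (1 + b) * (X - g X).
Proof.
move=> k0 r0 W /andP[b0 b1] Cd0 bC near hg pr qr incr X Y pY Xr YX.
have Xr2 : `|X| <= 2 * r by lra.
have bXr : `|(1 + b) * X| <= 2 * r.
  by rewrite normrM ger0_norm; [apply: ler_pM => //; lra|lra].
have S := well_slope0 r0 W.
have z : `|0 : R| <= 2 * r by rewrite normr0; lra.
suff H : (1 + b) * g X <= h ((1 + b) * X).
  have : Y - h Y <= (1 + b) * X - h ((1 + b) * X).
    move: YX; rewrite le_eqVlt => /predU1P[-> //|YX]; apply/ltW/incr => //.
    by move/ler_normlP: bXr => [_ ?]; lra.
  by move=> ?; lra.
have H1 := near _ bXr; have H2 := well_lo W Xr2 z; have H3 := well_lo W Xr2 bXr.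
have A : ((1 + b) * X) ^+ 2 <= 4 * X ^+ 2.
  have : (1 + b) * (1 + b) <= 2 * 2 by apply: ler_pM; lra.
  by move=> /(ler_wpM2r (sqr_ge0 X)) ?; lra.
have B : C * d * ((1 + b) * X) ^+ 2 <= k * b * X ^+ 2.
  rewrite (le_trans (ler_wpM2l Cd0 A))// mulrA ler_wpM2r ?sqr_ge0//.
  by rewrite mulrC.
move/ler_normlP: H1 => [H1 _].
have E : (1 + b) * X - X = b * X by ring.
rewrite E exprMn in H3; rewrite sub0r sqrrN in H2.
have D : 0 <= k * (b ^+ 2 * X ^+ 2).
  by apply: mulr_ge0; [exact: ltW|apply: mulr_ge0; exact: sqr_ge0].
have F := ler_wpM2l b0 H2.
by lra.
Qed.

End scaling.

(** * Passages through a corridor *)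

Section taylor.
Variable R : realType.
Implicit Types (a b x y k : R) (f : R -> R).

Lemma taylor_ge a b k f f1 f2 x y : diff_on a b f f1 -> diff_on a b f1 f2 ->
  (forall z, a <= z <= b -> k <= f2 z) -> a <= x <= b -> a <= y <= b ->
  k / 2 * (y - x) ^+ 2 <= f y - f x - f1 x * (y - x).
Proof.
move=> H1 H2 Hk xab yab.
pose q t := f t - f1 x * t - k / 2 * (t - x) ^+ 2.
pose q1 t := f1 t - f1 x * 1 - k / 2 * (2 * (t - x) * (1 - 0)).
have Hq : diff_on a b q q1.
  apply: diff_on_subr; first apply: diff_on_subr => //.
    by apply: diff_on_scale; exact: diff_on_id.
  apply: diff_on_scale.
  apply: (diff_on_comp (c := a - x) (d := b - x) (f := fun x => x ^+ 2)
    (f1 := fun x => 2 * x) (h := fun t => t - x) (h1 := fun=> 1 - 0)).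
  - apply: diff_on_subr; [exact: diff_on_id|exact: diff_on_cst].
  - exact: diff_on_sqr.
  - by move=> z zab; lra.
suff : q x <= q y.
  rewrite /q subrr expr0n/= mulr0 subr0 => ?; lra.
case: (ltgtP x y) => [xy|yx|->//].
- have [c /andP[xc cy] E] := diff_on_MVT Hq (proj1 (andP xab)) xy (proj2 (andP yab)).
  have [e /andP[xe ec] E2] := diff_on_MVT H2 (proj1 (andP xab)) xc ltac:(lra).
  rewrite -subr_ge0 E mulr_ge0//; last by rewrite subr_ge0 ltW.
  have -> : q1 c = (f2 e - k) * (c - x) by rewrite mulrBl -E2 /q1; field.
  by rewrite mulr_ge0// subr_ge0; [apply: Hk; lra|exact: ltW].
- have [c /andP[xc cy] E] := diff_on_MVT Hq (proj1 (andP yab)) yx (proj2 (andP xab)).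
  have [e /andP[xe ec] E2] := diff_on_MVT H2 (x := c) ltac:(lra) cy (proj2 (andP xab)).
  have {}E : q y - q x = (- q1 c) * (x - y) by rewrite mulNr -E; ring.
  rewrite -subr_ge0 E mulr_ge0//; last by rewrite subr_ge0 ltW.
  have -> : - q1 c = (f2 e - k) * (x - c) by rewrite mulrBl -E2 /q1; field.
  by rewrite mulr_ge0// subr_ge0; [apply: Hk; lra|exact: ltW].
Qed.

Lemma taylor_le a b k f f1 f2 x y : diff_on a b f f1 -> diff_on a b f1 f2 ->
  (forall z, a <= z <= b -> f2 z <= k) -> a <= x <= b -> a <= y <= b ->
  f y - f x - f1 x * (y - x) <= k / 2 * (y - x) ^+ 2.
Proof.
move=> H1 H2 Hk xab yab.
have := taylor_ge (k := - k) (diff_on_opp H1) (diff_on_opp H2) _ xab yab.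
move=> /(_ ltac:(by move=> z zab; rewrite lerN2; exact: Hk)) ?; lra.
Qed.

Lemma taylor_abs a b k f f1 f2 x y : diff_on a b f f1 -> diff_on a b f1 f2 ->
  (forall z, a <= z <= b -> `|f2 z| <= k) -> a <= x <= b -> a <= y <= b ->
  `|f y - f x - f1 x * (y - x)| <= k / 2 * (y - x) ^+ 2.
Proof.
move=> H1 H2 Hk xab yab; apply/ler_normlP; split.
- have := taylor_ge (k := - k) H1 H2 _ xab yab.
  move=> /(_ ltac:(by move=> z zab; have /ler_normlP[] := Hk _ zab; lra)) ?; lra.
- apply: taylor_le H1 H2 _ xab yab => z zab.
  by have /ler_normlP[] := Hk _ zab.
Qed.

Lemma diff_on_shift a b m f f1 : diff_on a b f f1 ->
  diff_on (a - m) (b - m) (fun X => f (m + X)) (fun X => f1 (m + X)).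
Proof.
move=> H x xab e e0; have [d d0 Hd] := H (m + x) ltac:(lra) e e0.
exists d => // y yab yx; have E : m + y - (m + x) = y - x by ring.
by have := Hd (m + y) ltac:(lra); rewrite E; exact.
Qed.

Lemma ler_or_gt (x y : R) : x <= y \/ y < x.
Proof. by case: leP => _; [left|right]. Qed.

Lemma diff_on_argmin (l u m : R) (g g1 : R -> R) : diff_on l u g g1 -> l < m < u ->
  (forall x, l <= x <= u -> g m <= g x) -> g1 m = 0.
Proof.
move=> H /andP[lm mu] mmin; apply/eqP; apply: contraT => n0.
have e0 : 0 < `|g1 m| / 2 by rewrite divr_gt0// normr_gt0.
have [d d0 Hd] := H m ltac:(lra) _ e0.
pose s := Num.min (d / 2) (Num.min (m - l) (u - m)).
have s0 : 0 < s by rewrite !lt_min; apply/and3P; split; lra.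
have sd : s < d by rewrite (@le_lt_trans _ _ (d / 2)) ?ge_min ?lexx//; lra.
have sl : s <= m - l by rewrite !ge_min lexx orbT.
have su : s <= u - m by rewrite !ge_min lexx !orbT.
have := Hd (m + s) ltac:(lra); have := Hd (m - s) ltac:(lra).
have -> : m - s - m = - s by ring. have -> : m + s - m = s by ring.
rewrite normrN (gtr0_norm s0) => /(_ sd)/ler_normlP[A1 A2] /(_ sd)/ler_normlP[B1 B2].
have := mmin (m + s) ltac:(lra); have := mmin (m - s) ltac:(lra).
move=> C1 C2; have [n|n] := leP 0 (g1 m).
- have n' : 0 < g1 m by rewrite lt_neqAle n andbT eq_sym.
  rewrite (ger0_norm n) in A1 A2.
  by have : 0 < g1 m * s by [exact: mulr_gt0]; lra.
- rewrite (ltr0_norm n) in B1 B2.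
  by have : 0 < - g1 m * s by [apply: mulr_gt0 => //; lra]; lra.
Qed.

End taylor.

Section passage.
Variable R : realType.

(** A corridor [l, u] through which f moves all points to the left. The gap x -
    f x may be arbitrarily small, so that the number of steps of a passage is
    not bounded, but it grows at least quadratically away from some point x0.
    All estimates depend on c and M only. *)
Record passage (c M l u : R) (f f1 f2 : R -> R) : Prop := Passage {
  ps_lu : l <= u;
  ps_len : u - l <= M;
  ps_gap : forall x, l <= x <= u -> x - f x <= M;
  ps_d1 : diff_on l u f f1;
  ps_d2 : diff_on l u f1 f2;
  ps_f1 : forall x, l <= x <= u -> c <= f1 x <= M;
  ps_f2 : forall x, l <= x <= u -> `|f2 x| <= M;
  ps_lip : forall x y, l <= x <= u -> l <= y <= u ->
    `|f2 x - f2 y| <= M * `|x - y|;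
  ps_quad : exists x0, forall x, l <= x <= u -> c * (x - x0) ^+ 2 <= x - f x;
  ps_pos : forall x, l <= x <= u -> 0 < x - f x;
  ps_l : c <= l - f l;
  ps_u : c <= u - f u }.

Section one_map.
Variables (c M l u : R) (f f1 f2 : R -> R).
Hypothesis P : passage c M l u f f1 f2.
Hypothesis (c0 : 0 < c) (c1 : c <= 1) (M1 : 1 <= M).
Ltac hyps := move: (c0) (c1) (M1) => ? ? ?.

Lemma passage_incr x y : l <= x -> x <= y -> y <= u ->
  c * (y - x) <= f y - f x <= M * (y - x).
Proof.
move=> lx; rewrite le_eqVlt => /predU1P[->|xy] yu; first by rewrite !subrr !mulr0 lexx.
have [z /andP[xz zy] ->] := diff_on_MVT (ps_d1 P) lx xy yu.
have /andP[? ?] := ps_f1 P (x := z) ltac:(lra).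
by apply/andP; split; apply: ler_wpM2r => //; lra.
Qed.

Lemma passage_gap_lip x y : l <= x <= u -> l <= y <= u ->
  `|(x - f x) - (y - f y)| <= 2 * M * `|x - y|.
Proof.
move=> xlu ylu.
have := diff_on_lip (f := f) (M := M) (ps_d1 P) _ xlu ylu.
have H z : l <= z <= u -> `|f1 z| <= M.
  by move=> /(ps_f1 P)/andP[? ?]; hyps; rewrite ger0_norm; lra.
move=> /(_ H) L.
have -> : (x - f x) - (y - f y) = (x - y) - (f x - f y) by ring.
rewrite (le_trans (ler_normB _ _))//.
have : 1 * `|x - y| <= M * `|x - y| by apply: ler_wpM2r.
by move=> ?; lra.
Qed.

(** A lower bound for the gap on the first fundamental domain [f u, u] and near
    l. *)
Definition pass_gap := c ^+ 2 / (16 * M).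
Let D0 : 0 < 16 * M. Proof. by hyps; lra. Qed.
Lemma pass_gap_gt0 : 0 < pass_gap.
Proof. by rewrite divr_gt0// exprn_gt0. Qed.
Lemma pass_gap_le : M * pass_gap <= c / 16.
Proof.
have -> : M * pass_gap = c * c / 16 by rewrite /pass_gap; field; move: M1 => ?; lra.
by have : c * c <= c * 1 by [apply: ler_wpM2l => //; exact: ltW]; lra.
Qed.
Lemma pass_gap_le1 : pass_gap <= c / 16.
Proof.
apply: le_trans pass_gap_le.
by apply: ler_peMl => //; exact/ltW/pass_gap_gt0.
Qed.

Lemma passage_bottom x : l <= x <= u -> x <= l + 2 * pass_gap -> c / 2 <= x - f x.
Proof.
move=> xlu xl; have ll : l <= l <= u by rewrite lexx (ps_lu P).
have := passage_gap_lip xlu ll; have := ps_l P.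
have B := pass_gap_le; hyps.
rewrite [`|x - l|]ger0_norm; last by lra.
have : M * (x - l) <= M * (2 * pass_gap) by apply: ler_wpM2l; lra.
by move=> ? ? /ler_normlP[? ?]; lra.
Qed.

Lemma passage_entry x : f u <= x <= u -> l <= x -> pass_gap <= x - f x.
Proof.
move=> /andP[fx xu] lx; have := pass_gap_le1; have := ps_u P => U B.
have [H|H] := leP (u - x) (c / 2).
  have := passage_incr lx xu (lexx u) => /andP[? _]; hyps.
  have : 0 <= c * (u - x) by apply: mulr_ge0; lra.
  by move=> ?; lra.
have := passage_incr lx xu (lexx u) => /andP[? _]; hyps.
have : c * (c / 2) <= c * (u - x) by apply: ler_wpM2l; lra.
have : pass_gap <= c * (c / 2).
  rewrite /pass_gap ler_pdivrMr// expr2.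
  have : 0 <= c * c * (M - 1) by apply: mulr_ge0; [apply: mulr_ge0; lra|lra].
  by have : 0 <= c * c by [apply: mulr_ge0; lra]; lra.
by move=> ? ?; lra.
Qed.

Lemma passage_argmin : exists2 m, l <= m <= u &
  forall x, l <= x <= u -> m - f m <= x - f x.
Proof.
have Hg : diff_on l u (fun x => x - f x) (fun x => 1 - f1 x).
  by apply: diff_on_subr; [exact: diff_on_id|exact: ps_d1 P].
have [m mlu Hm] := EVT_min (ps_lu P) (diff_on_within Hg).
by exists m => [|x xlu]; [move: mlu|apply: Hm]; rewrite in_itv.
Qed.

Lemma passage_quad_min m x : l <= m <= u ->
  (forall x, l <= x <= u -> m - f m <= x - f x) -> l <= x <= u ->
  c / 4 * (x - m) ^+ 2 <= x - f x.
Proof.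
move=> mlu mmin xlu; have [x0 H0] := ps_quad P.
have := H0 _ mlu; have := H0 _ xlu; have := mmin _ xlu; hyps => A1 A2 A3.
have : 0 <= c * ((x - x0) + (m - x0)) ^+ 2 by apply: mulr_ge0; [lra|exact: sqr_ge0].
by move=> ?; lra.
Qed.

Lemma passage_crit m : l < m < u ->
  (forall x, l <= x <= u -> m - f m <= x - f x) -> f1 m = 1.
Proof.
move=> lmu mmin; have H : diff_on l u (fun x => x - f x) (fun x => 1 - f1 x).
  by apply: diff_on_subr; [exact: diff_on_id|exact: ps_d1 P].
by apply/eqP; rewrite eq_sym -subr_eq0; apply/eqP; exact: diff_on_argmin H lmu mmin.
Qed.

(** Points where the gap is small are far from both ends of the corridor, so a
    deep minimum has room for a whole well around it. *)
Lemma passage_deep m r : l <= m <= u ->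
  (forall x, l <= x <= u -> m - f m <= x - f x) ->
  0 <= r -> 4 * M * r <= pass_gap -> 2 * (m - f m) < pass_gap ->
  l + 2 * pass_gap <= m - r /\ m + r <= f u.
Proof.
move=> mlu mmin r0 Mr e; have pg := pass_gap_gt0; have pg1 := pass_gap_le1.
have lip x : l <= x <= u -> `|x - m| <= r -> x - f x < pass_gap.
  move=> xlu xm; have /ler_normlP[_] := passage_gap_lip xlu mlu.
  have : M * `|x - m| <= M * r by hyps; apply: ler_wpM2l => //; lra.
  by move=> *; lra.
have mb : l + 2 * pass_gap < m.
  rewrite ltNge; apply/negP => H; have := passage_bottom mlu H; hyps; lra.
have mu : m < f u.
  rewrite ltNge; apply/negP => H.
  by have := passage_entry (x := m); rewrite H; move: mlu => /andP[-> ->] /(_ isT isT); lra.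
have fu : f u <= u by have := ps_pos P (x := u) ltac:(move: (ps_lu P); lra); lra.
split; rewrite leNgt; apply/negP => H.
- have := lip (l + 2 * pass_gap) ltac:(lra).
  have := passage_bottom (x := l + 2 * pass_gap) ltac:(lra) (lexx _).
  rewrite ler0_norm; last by lra.
  by hyps; move=> ? /(_ ltac:(lra)); lra.
- have := lip (f u) ltac:(lra).
  have := passage_entry (x := f u) ltac:(lra) ltac:(lra).
  rewrite ger0_norm; last by lra.
  by hyps; move=> ? /(_ ltac:(lra)); lra.
Qed.

(** Radius and depth below which the gap is a uniformly convex well. *)
Definition well_rad := Num.min (pass_gap / (4 * M)) (c / (32 * M)).
Definition well_eps := Num.min (pass_gap / 4) (c * well_rad ^+ 2 / 64).
Lemma well_rad_gt0 : 0 < well_rad.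
Proof.
have A : 0 < 4 * M by hyps; lra. have B : 0 < 32 * M by hyps; lra.
by rewrite lt_min (divr_gt0 pass_gap_gt0 A) (divr_gt0 c0 B).
Qed.
Lemma well_eps_gt0 : 0 < well_eps.
Proof.
rewrite lt_min divr_gt0 ?pass_gap_gt0//= divr_gt0// mulr_gt0// exprn_gt0//.
exact: well_rad_gt0.
Qed.

Lemma well_radP : 4 * M * well_rad <= pass_gap /\ 32 * M * well_rad <= c.
Proof.
have A : 0 < 4 * M by hyps; lra. have B : 0 < 32 * M by hyps; lra.
split; rewrite mulrC -ler_pdivlMr// /well_rad ge_min lexx ?orbT//.
Qed.

Lemma well_epsP : 4 * well_eps <= pass_gap /\ 64 * well_eps <= c * well_rad ^+ 2.
Proof.
split; rewrite mulrC -ler_pdivlMr// /well_eps ge_min lexx ?orbT//.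
Qed.

(** At a deep minimum the quadratic lower bound for the gap forces a lower bound
    for its second derivative, which persists nearby by the Lipschitz bound on
    f2. *)
Lemma passage_well m : l <= m <= u ->
  (forall x, l <= x <= u -> m - f m <= x - f x) -> m - f m <= well_eps ->
  [/\ well (c / 64) M well_rad (fun X => (m + X) - f (m + X))
       (fun X => 1 - f1 (m + X)),
    l + 2 * pass_gap <= m - well_rad & m + well_rad <= f u].
Proof.
move=> mlu mmin me; have [R1 R2] := well_radP; have [E1 E2] := well_epsP.
have r0 := well_rad_gt0; have pg := pass_gap_gt0.
set r := well_rad in R1 R2 E2 r0 *.
have [ml mu] := passage_deep mlu mmin (ltW r0) R1 ltac:(lra).
split=> //.
have fu : f u <= u by have := ps_pos P (x := u) ltac:(move: (ps_lu P); lra); lra.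
have crit := passage_crit (m := m) ltac:(lra) mmin.
have Hg : diff_on (l - m) (u - m) (fun X => (m + X) - f (m + X))
     (fun X => 1 - f1 (m + X)).
  apply: (diff_on_shift (f := fun x => x - f x) (f1 := fun x => 1 - f1 x)).
  by apply: diff_on_subr; [exact: diff_on_id|exact: ps_d1 P].
have Hg1 : diff_on (l - m) (u - m) (fun X => 1 - f1 (m + X)) (fun X => - f2 (m + X)).
  apply: (diff_on_shift (f := fun x => 1 - f1 x) (f1 := fun x => - f2 x)).
  apply: (diff_on_ext (f := fun x => 1 - f1 x) (f1 := fun x => 0 - f2 x)) => //.
    by apply: diff_on_subr; [exact: diff_on_cst|exact: ps_d2 P].
  by move=> x _; rewrite sub0r.
have inr X : `|X| <= r -> - r <= X <= r by rewrite ler_norml.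
have rl : l - m <= - r by lra. have ru : r <= u - m by lra.
have {}Hg := diff_on_sub rl ru Hg.
have {}Hg1 := diff_on_sub rl ru Hg1.
have M0 : 0 <= M by hyps; lra.
have lip X : - r <= X <= r -> `|f2 (m + X) - f2 m| <= M * r.
  move=> Xr; apply: le_trans (ps_lip P _ mlu) _; first by lra.
  apply: ler_wpM2l => //; rewrite addrC addKr ler_norml//.
have sec : c / 16 <= - f2 m.
  have T := taylor_le (k := - f2 m + M * r) Hg Hg1 (x := 0) (y := r).
  have := T _ ltac:(lra) ltac:(lra); rewrite addr0 crit subrr mul0r !subr0.
  have Q := passage_quad_min mlu mmin (x := m + r) ltac:(lra).
  rewrite [m + r - m]addrC addKr in Q.
  have H z : - r <= z <= r -> - f2 (m + z) <= - f2 m + M * r.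
    by move=> /lip/ler_normlP[? ?]; lra.
  move=> /(_ H) {}T.
  rewrite leNgt; apply/negP => A.
  have r2 : 0 < r ^+ 2 by rewrite exprn_gt0.
  have : (- f2 m + M * r) * r ^+ 2 <= (c / 16 + c / 32) * r ^+ 2.
    by apply: ler_wpM2r; [exact: ltW|lra].
  have : 0 < c * r ^+ 2 by exact: mulr_gt0.
  by move=> *; lra.
have lo z : - r <= z <= r -> c / 32 <= - f2 (m + z).
  by move=> /lip/ler_normlP[? ?]; lra.
have up z : - r <= z <= r -> - f2 (m + z) <= 2 * M.
  move=> zr; have /ler_normlP[? ?] := ps_f2 P (x := m + z) ltac:(lra); lra.
constructor.
- move=> X Y /inr Xr /inr Yr.
  by have := taylor_ge Hg Hg1 lo Xr Yr; move=> ?; lra.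
- move=> X Y /inr Xr /inr Yr.
  by have := taylor_le Hg Hg1 up Xr Yr; move=> ?; lra.
- move=> X /inr Xr.
  have := diff_on_lip (M := M) Hg1 _ Xr (y := 0).
  rewrite addr0 crit subrr !subr0; apply; last by lra.
  by move=> x xr; rewrite normrN; apply: (ps_f2 P); lra.
Qed.

(** Few iterates are spent where the gap is bounded below. *)
Lemma passage_count e x n : 0 < e ->
  (forall k, (k < n)%N -> l <= iter k f x <= u /\ e <= iter k f x - f (iter k f x)) ->
  n%:R <= M / e + 1.
Proof.
move=> e0; case: n => [|n] H; first by rewrite addr_ge0// divr_ge0 ?ltW//; hyps; lra.
rewrite -natr1 lerD2r ler_pdivlMr// (le_trans _ (ps_len P))//.
have [/andP[_ xu] _] := H 0 isT; have [/andP[xl _] _] := H n (ltnSn n).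
suff : n%:R * e <= x - iter n f x by move: xu; rewrite /=; lra.
have {xl} : forall k, (k < n)%N -> e <= iter k f x - f (iter k f x).
  by move=> k kn; have [|//] := H k; rewrite ltnS ltnW.
elim: n {H} => [|n IH] H; first by rewrite mul0r subrr.
have := IH (fun k kn => H k (ltnW kn)); have := H n (ltnSn n).
by rewrite -[in n.+1%:R]natr1 /=; lra.
Qed.

End one_map.
End passage.

(** * Two orbits in transit *)

Section two_orbits.
Variable R : realType.

Definition close_on (l u d : R) (f f1 f2 h h1 h2 : R -> R) := forall x,
  l <= x <= u -> [/\ `|h x - f x| <= d, `|h1 x - f1 x| <= d & `|h2 x - f2 x| <= d].

(** Two orbits with the same number of steps that enter the corridor close to
    one another and leave it close to one another. Without the condition on the
    exit the orbits could drift apart during a long passage. *)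
Record transit (l u p d : R) (f h : R -> R) (a : nat) (x y : R) : Prop := Transit {
  tr_x : forall j, (j < a)%N -> l <= iter j f x <= u;
  tr_y : forall j, (j < a)%N -> l <= iter j h y <= u;
  tr_x0 : f u <= x;
  tr_y0 : h u <= y;
  tr_xa : iter a f x <= l + p;
  tr_ya : iter a h y <= l + p;
  tr_d0 : `|y - x| <= d;
  tr_da : `|iter a h y - iter a f x| <= d }.

Lemma close_on_sym l u d f f1 f2 h h1 h2 :
  close_on l u d f f1 f2 h h1 h2 -> close_on l u d h h1 h2 f f1 f2.
Proof. by move=> H x /H[]; rewrite distrC (distrC (h1 x)) (distrC (h2 x)). Qed.

Lemma transit_sym l u p d f h a x y :
  transit l u p d f h a x y -> transit l u p d h f a y x.
Proof. by case=> *; constructor; rewrite // distrC. Qed.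

Section few_steps.
Variables (c M l u p d e : R) (f f1 f2 h : R -> R) (a N : nat) (x y : R).
Hypothesis P : passage c M l u f f1 f2.
Hypothesis (c0 : 0 < c) (c1 : c <= 1) (M1 : 1 <= M) (d0 : 0 <= d) (e0 : 0 < e).
Hypothesis cl : forall z, l <= z <= u -> `|h z - f z| <= d.
Hypothesis T : transit l u p d f h a x y.
Hypothesis eN : M / e + 1 <= N%:R.
Ltac hyps := move: (c0) (c1) (M1) (d0) (e0) => ? ? ? ? ?.

(** The crude exponential bound, good enough for the boundedly many steps that
    are made while the gap is at least e: forwards from the entrance (few_fwd)
    or backwards from the exit (few_bwd). *)
Definition few_const := (2 * M / c) ^+ N.

Let base1 : 1 <= 2 * M / c.
Proof. by rewrite ler_pdivlMr// mul1r; move: (c0) (c1) (M1) => ? ? ?; lra. Qed.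

Lemma few_const_ge1 : 1 <= few_const.
Proof. exact: exprn_ege1. Qed.

Let few_pow n A : (n <= N)%N -> 1 <= A <= 2 * M / c -> A ^+ n <= few_const.
Proof.
move=> nN /andP[A1 A2]; apply: (@le_trans _ _ (A ^+ N)).
  by rewrite ler_weXn2l.
by apply: lerXn2r => //; rewrite nnegrE (le_trans ler01)// (le_trans A1).
Qed.

Let step n : (n < a)%N ->
  c * `|iter n h y - iter n f x| - d <= `|iter n.+1 h y - iter n.+1 f x|
  <= M * `|iter n h y - iter n f x| + d.
Proof.
move=> na; have xlu := tr_x T na; have ylu := tr_y T na.
rewrite !iterS; set X := iter n f x in xlu *; set Y := iter n h y in ylu *.
have := cl ylu; have fXY : c * `|Y - X| <= `|f Y - f X| <= M * `|Y - X|.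
  have [XY|YX] := leP X Y.
    have := passage_incr P (proj1 (andP xlu)) XY (proj2 (andP ylu)).
    have : 0 <= c * (Y - X) by rewrite mulr_ge0 ?subr_ge0// ltW.
    by move=> A /andP[B C]; rewrite !ger0_norm ?subr_ge0//; lra.
  have := passage_incr P (proj1 (andP ylu)) (ltW YX) (proj2 (andP xlu)).
  have : 0 <= c * (X - Y) by rewrite mulr_ge0 ?subr_ge0// ltW.
  by move=> A /andP[B C]; rewrite distrC (distrC _ (f X)) !ger0_norm ?subr_ge0//; lra.
have := ler_normD (h Y - f Y) (f Y - f X); rewrite addrA subrK.
have := ler_normD (h Y - f X) (f Y - h Y).
have -> : h Y - f X + (f Y - h Y) = f Y - f X by ring.
rewrite (distrC (f Y) (h Y)); move: fXY => /andP[? ?] *; apply/andP; split; lra.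
Qed.

Lemma few_fwd n : (n <= a)%N ->
  (forall k, (k < n)%N -> e <= iter k f x - f (iter k f x)) ->
  `|iter n h y - iter n f x| <= few_const * d.
Proof.
move=> na H; have nN : (n <= N)%N.
  rewrite -(ler_nat R) (le_trans _ eN)//; apply: (passage_count P c0 c1 M1) => // k kn.
  by split; [apply: (tr_x T); exact: leq_trans na|exact: H].
apply: (@le_trans _ _ ((M + 1) ^+ n * d)).
  elim: n na {H nN} => [|n IH] na.
    by rewrite expr0 mul1r; exact: tr_d0 T.
  have /andP[_ S] := step na; apply: le_trans S _.
  have := IH (ltnW na); set A := _ ^+ n.
  have A1 : 1 <= A by rewrite exprn_ege1// lerDr (le_trans ler01).
  move=> /(ler_wpM2l (le_trans ler01 M1)).
  have : 0 <= (A - 1) * d by rewrite mulr_ge0// subr_ge0.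
  by rewrite exprS -/A => *; lra.
apply: ler_wpM2r => //; apply: few_pow => //; hyps; apply/andP; split; first lra.
by rewrite ler_pdivlMr//; have : c * M <= 1 * M by [apply: ler_wpM2r; lra]; lra.
Qed.

Lemma few_bwd n : (n <= a)%N ->
  (forall k, (n <= k < a)%N -> e <= iter k f x - f (iter k f x)) ->
  `|iter n h y - iter n f x| <= few_const * d.
Proof.
move=> na H; have nN : (a - n <= N)%N.
  rewrite -(ler_nat R) (le_trans _ eN)//.
  apply: (passage_count P c0 c1 M1 (x := iter n f x)) => // k kn.
  rewrite -iterD; have ka : (k + n < a)%N by lia.
  by split; [exact: (tr_x T)|apply: H; rewrite leq_addl].
apply: (@le_trans _ _ ((2 / c) ^+ (a - n) * d)).
  have [k ak] : exists k, (a - n = k)%N by exists (a - n)%N.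
  rewrite ak; elim: k n na ak {H nN} => [|k IH] n na ak.
    have -> : n = a by lia.
    by rewrite expr0 mul1r; exact: tr_da T.
  have na' : (n < a)%N by lia.
  have /andP[S _] := step na'; have := IH n.+1 na' ltac:(lia).
  set A := _ ^+ k.
  have A1 : 1 <= A by rewrite exprn_ege1// ler_pdivlMr//; hyps; lra.
  have : 0 <= (A - 1) * d by rewrite mulr_ge0// subr_ge0.
  rewrite exprS -/A => ? ?; rewrite -mulrA mulrAC ler_pdivlMr//.
  by rewrite mulrC; lra.
apply: ler_wpM2r => //; apply: few_pow => //.
apply/andP; split; first by rewrite ler_pdivlMr//; hyps; lra.
by rewrite ler_pM2r ?invr_gt0//; hyps; lra.
Qed.

End few_steps.
End two_orbits.

Section saddle_node.
Variable R : realType.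

Lemma normr_le_of_sqr (t B : R) : 0 <= B -> t ^+ 2 <= B ^+ 2 -> `|t| <= B.
Proof.
by move=> B0; rewrite -(real_normK (num_real t)) ler_pXn2r.
Qed.

Definition node_rad (c M : R) := well_rad c M / 2.
(** Threshold on the minimal gap below which the two wells can be aligned. *)
Definition node_eps (c M : R) :=
  Num.min (well_eps c M) (Num.min (node_rad c M ^+ 2) (c * node_rad c M / 4)).
(** A lower bound for the gap at distance node_rad / (2 * M) from the minimum. *)
Definition node_gap (c M : R) := c / 16 * (node_rad c M / M) ^+ 2.

Section numbers.
Variables c M : R.
Hypothesis (c0 : 0 < c) (c1 : c <= 1) (M1 : 1 <= M).
Let M0 : 0 < M. Proof. exact: lt_le_trans ltr01 M1. Qed.

Lemma node_rad_gt0 : 0 < node_rad c M.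
Proof. by rewrite divr_gt0// well_rad_gt0. Qed.

Lemma node_eps_gt0 : 0 < node_eps c M.
Proof.
have r0 := node_rad_gt0.
by rewrite lt_min (well_eps_gt0 c0 c1 M1) lt_min exprn_gt0//= divr_gt0// mulr_gt0.
Qed.

Lemma node_gap_gt0 : 0 < node_gap c M.
Proof. by rewrite mulr_gt0 ?divr_gt0// exprn_gt0// divr_gt0// node_rad_gt0. Qed.

Lemma node_epsP : [/\ node_eps c M <= well_eps c M,
  node_eps c M <= node_rad c M ^+ 2 & 4 * node_eps c M <= c * node_rad c M].
Proof.
split; [by rewrite ge_min lexx| |rewrite mulrC -ler_pdivlMr//];
by rewrite ge_min; apply/orP; right; rewrite ge_min lexx ?orbT.
Qed.
End numbers.

Section aligned.
Variables (c M l u d : R) (f f1 f2 h h1 h2 : R -> R) (a N : nat) (x y m n : R).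
Hypothesis (c0 : 0 < c) (c1 : c <= 1) (M1 : 1 <= M) (d0 : 0 <= d).
Hypothesis P : passage c M l u f f1 f2.
Hypothesis Q : passage c M l u h h1 h2.
Hypothesis cl : close_on l u d f f1 f2 h h1 h2.
Hypothesis T : transit l u (pass_gap c M) d f h a x y.
Hypothesis (mlu : l <= m <= u) (nlu : l <= n <= u).
Hypothesis mmin : forall x, l <= x <= u -> m - f m <= x - f x.
Hypothesis nmin : forall x, l <= x <= u -> n - h n <= x - h x.
Hypothesis (me : m - f m <= node_eps c M) (ne : n - h n <= node_eps c M).
Hypothesis de : d <= node_eps c M.
Hypothesis eN : M / node_gap c M + 1 <= N%:R.

Let r := node_rad c M.
Let k := c / 64.
Let Cs := few_const c M N.
Let Cm := 32 / c.
Let C2 := 1 + M * Cm.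
Let e0 := m - f m.
Let e1 := n - h n.
Let g X : R := (m + X) - f (m + X).
Let g1 X : R := 1 - f1 (m + X).
Let hh X : R := (n + X) - h (n + X).
Let hh1 X : R := 1 - h1 (n + X).

Let M0 : 0 < M. Proof. exact: lt_le_trans ltr01 M1. Qed.
Let r0 : 0 < r. Proof. exact: node_rad_gt0. Qed.
Let k0 : 0 < k. Proof. by rewrite divr_gt0. Qed.
Let k1 : k <= 1. Proof. by rewrite ler_pdivrMr// mul1r; move: c1 => ?; lra. Qed.
Let r2 : 2 * r = well_rad c M. Proof. by rewrite /r /node_rad; field. Qed.
Let rM : 8 * M * r <= 1.
Proof.
have [_] := well_radP c0 c1 M1; rewrite -r2; move: c1 => ? ?; lra.
Qed.
Let gap0 : 0 < node_gap c M. Proof. exact: node_gap_gt0. Qed.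

Let Wf : [/\ well k M (2 * r) g g1, l + 2 * pass_gap c M <= m - 2 * r & m + 2 * r <= f u].
Proof.
have [A _ _] := node_epsP c M; rewrite r2.
exact (passage_well P c0 c1 M1 mlu mmin (le_trans me A)).
Qed.

Let Wh : [/\ well k M (2 * r) hh hh1, l + 2 * pass_gap c M <= n - 2 * r & n + 2 * r <= h u].
Proof.
have [A _ _] := node_epsP c M; rewrite r2.
exact (passage_well Q c0 c1 M1 nlu nmin (le_trans ne A)).
Qed.

Let fu : f u <= u.
Proof. by have := ps_pos P (x := u); rewrite lexx (ps_lu P) => /(_ isT); lra. Qed.
Let hu : h u <= u.
Proof. by have := ps_pos Q (x := u); rewrite lexx (ps_lu Q) => /(_ isT); lra. Qed.
Let pg : 0 < pass_gap c M. Proof. exact: pass_gap_gt0. Qed.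
Let e00 : 0 < e0. Proof. exact (ps_pos P mlu). Qed.
Let e10 : 0 < e1. Proof. exact (ps_pos Q nlu). Qed.
Let eps4 : 4 * e0 <= c * r.
Proof. have [_ _] := node_epsP c M; move: me; rewrite -/e0 -/r; lra. Qed.
Let ge0 : g 0 = e0. Proof. by rewrite /g addr0. Qed.
Let he1 : hh 0 = e1. Proof. by rewrite /hh addr0. Qed.

(** Both minima are nondegenerate critical points of gaps that are close in C^1. *)
Lemma argmin_shift : `|n - m| <= Cm * d.
Proof.
have [_ lm um] := Wf; have [W ln un] := Wh.
have mlu' : l <= m <= u by move: pg r0 fu lm um => *; lra.
have Qm := passage_quad_min Q c0 c1 M1 nlu nmin mlu'.
have [A _ _] := node_epsP c M; have [_ E2] := well_epsP c M.
have Em : m - h m <= 2 * node_eps c M.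
  by have [/ler_normlP[? ?] _ _] := cl mlu; move: me de => ? ?; lra.
have X2 : `|m - n| <= 2 * r.
  apply: normr_le_of_sqr; first by rewrite mulr_ge0// ltW.
  rewrite -(ler_pM2l c0) r2; have : 0 <= c * well_rad c M ^+ 2.
    by rewrite mulr_ge0 ?sqr_ge0// ltW.
  by move=> ?; lra.
have z2 : `|0 : R| <= 2 * r by rewrite normr0 mulr_ge0// ltW.
have := well_lo W X2 z2; have := well_lo W z2 X2.
have crit : g1 0 = 0 by have [Wf' _ _] := Wf; exact: well_slope0 r0 Wf'.
rewrite (well_slope0 r0 W) mul0r !subr0 sub0r sqrrN.
have [_ + _] := cl mlu; have -> : h1 m - f1 m = - hh1 (m - n).
  have E : n + (m - n) = m by ring.
  by move: crit; rewrite /g1 /hh1 addr0 E => ?; lra.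
rewrite normrN => H A1 A2.
have A3 : 2 * k * (m - n) ^+ 2 <= hh1 (m - n) * (m - n) by lra.
have A4 : 2 * k * `|m - n| ^+ 2 <= d * `|m - n|.
  rewrite real_normK ?num_real//; apply: le_trans A3 _.
  by apply: le_trans (ler_norm _) _; rewrite normrM; apply: ler_wpM2r.
rewrite distrC; have [->|n0] := eqVneq `|m - n| 0.
  by rewrite mulr_ge0// divr_ge0// ltW.
have p0 : 0 < `|m - n| by rewrite lt_neqAle eq_sym n0 normr_ge0.
move: A4; rewrite expr2 mulrA ler_pM2r// => A4.
rewrite /Cm mulrAC ler_pdivlMr// mulrC.
by move: A4; rewrite /k => ?; lra.
Qed.

Let Cm0 : 0 <= Cm. Proof. by rewrite divr_ge0// ltW. Qed.
Let C20 : 0 <= C2. Proof. by rewrite addr_ge0// mulr_ge0// ltW. Qed.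
Let Cs1 : 1 <= Cs. Proof. exact (few_const_ge1 N c0 c1 M1). Qed.

Lemma well_near X : `|X| <= 2 * r ->
  `|(hh X - hh 0) - (g X - g 0)| <= C2 * d * X ^+ 2.
Proof.
have [Wf' lm um] := Wf; have [Wh' ln un] := Wh.
rewrite ler_norml => Xr.
pose D Z := hh Z - g Z; pose D1 Z := hh1 Z - g1 Z.
pose D2 Z := f2 (m + Z) - h2 (n + Z).
have sh (z : R) (F F1 F2 : R -> R) : passage c M l u F F1 F2 ->
    l <= z - 2 * r -> z + 2 * r <= u ->
    diff_on (- (2 * r)) (2 * r) (fun Z => (z + Z) - F (z + Z)) (fun Z => 1 - F1 (z + Z)) /\
    diff_on (- (2 * r)) (2 * r) (fun Z => 1 - F1 (z + Z)) (fun Z => 0 - F2 (z + Z)).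
  move=> PF lz uz.
  have A1 : l - z <= - (2 * r) by lra. have A2 : 2 * r <= u - z by lra.
  split; apply: (diff_on_sub A1 A2).
    apply: (diff_on_shift (f := fun x => x - F x) (f1 := fun x => 1 - F1 x)).
    by apply: diff_on_subr; [exact: diff_on_id|exact: ps_d1 PF].
  apply: (diff_on_shift (f := fun x => 1 - F1 x) (f1 := fun x => 0 - F2 x)).
  by apply: diff_on_subr; [exact: diff_on_cst|exact: ps_d2 PF].
have [Df Df1] := sh m _ _ _ P ltac:(move: pg; lra) ltac:(move: fu; lra).
have [Dh Dh1] := sh n _ _ _ Q ltac:(move: pg; lra) ltac:(move: hu; lra).
have HD : diff_on (- (2 * r)) (2 * r) D D1 by exact: diff_on_subr.
have HD1 : diff_on (- (2 * r)) (2 * r) D1 D2.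
  apply: diff_on_ext (diff_on_subr Dh1 Df1) _ _ => // Z _.
  by rewrite /D2; ring.
have r0' : - (2 * r) <= 0 <= 2 * r by move: r0 => ?; lra.
have H2 Z : - (2 * r) <= Z <= 2 * r -> `|D2 Z| <= C2 * d.
  move=> Zr; have nZ : l <= n + Z <= u by move: pg hu => ? ?; lra.
  have mZ : l <= m + Z <= u by move: pg fu => ? ?; lra.
  have [_ _ A1] := cl nZ; have A2 := ps_lip P nZ mZ.
  have -> : D2 Z = - ((h2 (n + Z) - f2 (n + Z)) + (f2 (n + Z) - f2 (m + Z))).
    by rewrite /D2; ring.
  rewrite normrN (le_trans (ler_normD _ _))//.
  have E : n + Z - (m + Z) = n - m by ring.
  rewrite E in A2; have := ler_wpM2l (ltW M0) argmin_shift.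
  by rewrite /C2 => ?; lra.
have := taylor_abs HD HD1 H2 r0' Xr; rewrite subr0.
have -> : D1 0 = 0 by rewrite /D1 (well_slope0 r0 Wf') (well_slope0 r0 Wh') subrr.
rewrite mul0r subr0 => H; have -> : hh X - hh 0 - (g X - g 0) = D X - D 0.
  by rewrite /D; ring.
apply: le_trans H _; rewrite -subr_ge0.
have : 0 <= C2 * d * X ^+ 2 by rewrite mulr_ge0 ?sqr_ge0// mulr_ge0.
by move=> ?; lra.
Qed.

Lemma hh_incr Y Z : l - n <= Y -> Y < Z -> Z <= u - n -> Y - hh Y < Z - hh Z.
Proof.
move=> lY YZ Zu; rewrite /hh.
have /andP[A _] := passage_incr Q (x := n + Y) (y := n + Z)
  ltac:(lra) ltac:(lra) ltac:(lra).
have : 0 < c * (n + Z - (n + Y)) by rewrite mulr_gt0//; lra.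
by move=> ?; lra.
Qed.

Let xs j := iter j f x.
Let ys j := iter j h y.

Lemma xs_decr j i : (j <= i <= a)%N -> xs i <= xs j.
Proof.
move=> /andP[]; elim: i => [|i IH]; first by rewrite leqn0 => /eqP ->.
rewrite leq_eqVlt => /predU1P[-> //|ji] ia; apply: le_trans (IH ji (ltnW ia)).
by have := ps_pos P (tr_x T ia); rewrite /xs /= => ?; lra.
Qed.

Lemma gap_far z : l <= z <= u -> r / (2 * M) <= `|z - m| -> node_gap c M <= z - f z.
Proof.
move=> zlu zm; apply: le_trans (passage_quad_min P c0 c1 M1 mlu mmin zlu).
have -> : node_gap c M = c / 4 * (r / (2 * M)) ^+ 2.
  by rewrite /node_gap -/r; field; rewrite gt_eqF.
apply: ler_wpM2l; first by rewrite divr_ge0// ltW.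
rewrite -(real_normK (num_real (z - m))) ler_pXn2r// nnegrE divr_ge0 ?ltW//.
by rewrite mulr_gt0.
Qed.

Let rM2 : r / (2 * M) <= r.
Proof. by rewrite ler_pdivrMr ?mulr_gt0// ler_peMr ?(ltW r0)//; move: M1 => ?; lra. Qed.

Lemma entry_bound j : (j <= a)%N -> (forall i, (i < j)%N -> m + r <= xs i) ->
  `|ys j - xs j| <= Cs * d.
Proof.
move=> ja H; apply: (few_fwd P c0 c1 M1 d0 gap0 _ T eN ja).
  by move=> z /cl[].
move=> i ij; apply: gap_far; first exact: (tr_x T (leq_trans ij ja)).
have := H _ ij; rewrite /xs => A; rewrite ger0_norm; move: rM2 r0 => ? ?; lra.
Qed.

Lemma exit_bound j : (j <= a)%N -> (forall i, (j <= i < a)%N -> xs i <= m - r / (2 * M)) ->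
  `|ys j - xs j| <= Cs * d.
Proof.
move=> ja H; apply: (few_bwd P c0 c1 M1 d0 gap0 _ T eN ja).
  by move=> z /cl[].
move=> i ij; apply: gap_far; first by apply: (tr_x T); move/andP: ij => [].
have : 0 <= r / (2 * M) by rewrite divr_ge0 ?ltW// mulr_gt0.
have := H _ ij; rewrite /xs => A B; rewrite ler0_norm; lra.
Qed.

Lemma landing j : (j < a)%N -> m + r <= xs j -> m + c * r / 2 <= xs j.+1.
Proof.
move=> ja; rewrite /xs iterS -/(xs j) => mj.
have /andP[_ xu] := tr_x T ja; have /andP[lm _] := mlu.
have := passage_incr P lm (y := xs j) ltac:(move: r0; lra) xu => /andP[A _].
have : c * r <= c * (xs j - m) by rewrite ler_pM2l//; lra.
by move: eps4 e00; rewrite /e0 => *; lra.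
Qed.

Lemma leaving j : (j < a)%N -> xs j.+1 <= m - r -> xs j <= m - r / (2 * M).
Proof.
move=> ja; rewrite /xs iterS -/(xs j) => mj.
have /andP[lx xu] := tr_x T ja; have /andP[lm um] := mlu.
rewrite -/(xs j) in lx xu.
have er : e0 <= r / 2.
  by have : c * r <= 1 * r by [apply: ler_wpM2r => //; exact: ltW]; move: eps4 r0; lra.
have [mx|xm] := leP m (xs j).
  have /andP[A _] := passage_incr P lm mx xu.
  have : 0 <= c * (xs j - m) by rewrite mulr_ge0 ?subr_ge0// ltW.
  by move: er r0; rewrite /e0; lra.
have /andP[_ A] := passage_incr P lx (ltW xm) um.
suff : r / 2 <= M * (m - xs j).
  have -> : r / (2 * M) = (r / 2) / M by field; rewrite gt_eqF.
  move=> H; have : r / 2 / M <= m - xs j by rewrite ler_pdivrMr// [leRHS]mulrC.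
  by move=> ?; lra.
by move: er r0; rewrite /e0; lra.
Qed.

Let x0_top : m + 2 * r <= x.
Proof. by have [_ _ A] := Wf; exact: le_trans A (tr_x0 T). Qed.

Let xa_bot : xs a <= m - 2 * r.
Proof. by have [_ A _] := Wf; have := tr_xa T; rewrite /xs; move: pg => ? ?; lra. Qed.

Lemma before j i : (i <= j < a)%N -> m + r <= xs j -> m + r <= xs i.
Proof. by move=> /andP[ij ja] H; apply: le_trans H _; apply: xs_decr; rewrite ij ltnW. Qed.

Lemma entry_bound_landing j : (j < a)%N -> m + r <= xs j ->
  `|ys j.+1 - xs j.+1| <= Cs * d.
Proof.
move=> ja mj; apply: entry_bound => // i ij; apply: before mj; rewrite ja andbT.
by rewrite -ltnS.
Qed.

Lemma exit_bound_leaving j : (j < a)%N -> xs j.+1 <= m - r ->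
  `|ys j - xs j| <= Cs * d.
Proof.
move=> ja mj; apply: exit_bound; first exact: ltnW.
move=> i /andP[ji ia]; apply: le_trans (leaving ja mj).
by apply: xs_decr; rewrite ji ltnW.
Qed.

Let gX j : (xs j - m) - g (xs j - m) = xs j.+1 - m.
Proof. by rewrite /g /xs /= [m + _]addrC subrK; ring. Qed.

Let hY j : (ys j - n) - hh (ys j - n) = ys j.+1 - n.
Proof. by rewrite /hh /ys /= [n + _]addrC subrK; ring. Qed.

Let offset j : `|ys j - xs j| <= Cs * d ->
  `|(ys j - n) - (xs j - m)| <= (Cs + Cm) * d.
Proof.
move=> H; have -> : ys j - n - (xs j - m) = (ys j - xs j) - (n - m) by ring.
rewrite (le_trans (ler_normB _ _))// mulrDl lerD//; exact: argmin_shift.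
Qed.

(** If the gap of the second map exceeded that of the first by a definite
   proportion, its orbit would be forced out too early. *)
Lemma gap_compare B : 0 < d -> 4 * M * (Cs + Cm) <= B * (c * r) ->
  4 * C2 <= k * B -> B * d <= 1 -> e1 <= (1 + B * d) * e0.
Proof.
move=> dp B1 B2 B3; rewrite leNgt; apply/negP => H.
have B0 : 0 < B.
  have : 0 < 4 * M * (Cs + Cm) by rewrite !mulr_gt0// ltr_pwDl// (lt_le_trans ltr01).
  by move=> /lt_le_trans/(_ B1); rewrite pmulr_lgt0// mulr_gt0.
have b01 : 0 <= B * d <= 1 by rewrite B3 mulr_ge0// ltW.
have [W lm um] := Wf; have [_ ln un] := Wh.
have CC : 0 <= (Cs + Cm) * d by rewrite mulr_ge0// addr_ge0// (le_trans ler01).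
have step := scaling_step k0 r0 W b01 (C := C2) (d := d) (h := hh) (mulr_ge0 C20 d0)
  ltac:(by rewrite !mulrA ler_pM2r) well_near
  ltac:(by rewrite he1 ge0; exact: ltW) (p := l - n) (q := u - n)
  ltac:(move: pg; lra) ltac:(move: hu; lra) hh_incr.
have key j : (j < a)%N -> m - r < xs j ->
    m + r <= xs j \/ ys j - n <= (1 + B * d) * (xs j - m).
  elim: j => [|j IH] ja mj; first by left; move: x0_top r0; rewrite /xs /=; lra.
  have ja' := ltnW ja; have mj' : m - r < xs j.
    by apply: lt_le_trans mj _; apply: xs_decr; rewrite leqnSn ltnW.
  have [?|xr] := leP (m + r) (xs j.+1); [by left|right].
  have [E|E] := IH ja' mj'.
  - have /ler_normlP[_ A] := offset (entry_bound_landing ja' E).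
    have L := landing ja' E.
    have A2 : B * d * (c * r / 2) <= B * d * (xs j.+1 - m).
      by apply: ler_wpM2l; [case/andP: b01|lra].
    have A3 : 1 * ((Cs + Cm) * d) <= M * ((Cs + Cm) * d) by apply: ler_wpM2r.
    have A4 := ler_wpM2r d0 B1.
    by lra.
  - have [xr'|xr'] := leP (m + r) (xs j).
      have /ler_normlP[_ A] := offset (entry_bound_landing ja' xr').
      have L := landing ja' xr'.
      have A2 : B * d * (c * r / 2) <= B * d * (xs j.+1 - m).
        by apply: ler_wpM2l; [case/andP: b01|lra].
      have A3 : 1 * ((Cs + Cm) * d) <= M * ((Cs + Cm) * d) by apply: ler_wpM2r.
      have A4 := ler_wpM2r d0 B1.
      by lra.
    rewrite -gX -hY; apply: step => //.
    + by have /andP[? ?] := tr_y T ja'; rewrite lerD2r.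
    + by rewrite ler_norml; lra.
have [j ja [mj mj1]] : exists2 j, (j < a)%N & m - r < xs j /\ xs j.+1 <= m - r.
  have : xs a <= m - r by move: xa_bot r0; lra.
  suff S i : (i <= a)%N -> xs i <= m - r ->
    exists2 j, (j < a)%N & m - r < xs j /\ xs j.+1 <= m - r by exact: S.
  elim: i => [|i IH] ia H1; first by move: x0_top r0 H1; rewrite /xs /=; lra.
  have [H2|H2] := leP (xs i) (m - r); first by apply: IH => //; exact: ltnW.
  by exists i.
have L := leaving ja mj1.
have rM0 : 0 < r / (2 * M) by rewrite divr_gt0// mulr_gt0.
case: (key j ja mj) => [E|E].
  have := landing ja E; have : 0 < c * r / 2 by rewrite divr_gt0// mulr_gt0.
  by move: r0; lra.
have /ler_normlP[A _] := offset (exit_bound_leaving ja mj1).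
have A2 : B * d * (r / (2 * M)) <= B * d * (m - xs j).
  by apply: ler_wpM2l; [case/andP: b01|lra].
have A4 : 2 * (Cs + Cm) <= B * (r / (2 * M)).
  rewrite mulrA ler_pdivlMr ?mulr_gt0//.
  have : c * (B * r) <= 1 * (B * r) by apply: ler_wpM2r => //; rewrite mulr_ge0// ltW.
  by move: B1 => ? ?; lra.
have A5 := ler_wpM2r d0 A4.
have : 0 < (Cs + Cm) * d by rewrite mulr_gt0// ltr_pwDl// (lt_le_trans ltr01).
by move=> ?; lra.
Qed.

Section barrier_constant.
Variables B D : R.
Hypothesis (B0 : 0 <= B) (Bd : B * d <= 1).
Hypothesis (e10B : e1 <= (1 + B * d) * e0) (e01B : e0 <= (1 + B * d) * e1).
Let C4 := 2 * B + C2 / k.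
Hypothesis (D1 : 64 * C4 <= k * D) (D2 : 16 * M ^+ 2 * (D * d) <= k).
Hypothesis D3 : 4 * M * (Cs + Cm) <= D * (k * (c * r)).

Let C40 : 0 <= C4.
Proof. by apply: addr_ge0; [exact: mulr_ge0|rewrite divr_ge0// ltW]. Qed.

Let D0 : 0 <= D.
Proof.
have : 0 <= k * D by apply: le_trans D1; rewrite mulr_ge0.
by rewrite pmulr_rge0.
Qed.

Lemma well_close X : `|X| <= 2 * r -> `|hh X - g X| <= C4 * d * g X.
Proof.
move=> Xr; have [W _ _] := Wf; have := well_near Xr; rewrite ge0 he1 => A.
have G := well_ge r0 W Xr; rewrite ge0 in G.
have X2 := sqr_ge0 X; have kX : 0 <= k * X ^+ 2 by rewrite mulr_ge0// ltW.
have Bd0 : 0 <= B * d by exact: mulr_ge0.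
have E1 : `|e1 - e0| <= 2 * (B * d) * e0.
  have : B * d * e1 <= B * d * ((1 + B * d) * e0) by exact: ler_wpM2l.
  have : B * d * (B * d * e0) <= 1 * (B * d * e0).
    by apply: ler_wpM2r => //; rewrite mulr_ge0// ltW.
  have : 0 <= B * d * e0 by rewrite mulr_ge0// ltW.
  by move: e10B e01B => *; apply/ler_normlP; split; lra.
have E2 : 2 * (B * d) * e0 <= 2 * (B * d) * g X by apply: ler_wpM2l; [lra|lra].
have E3 : C2 * d * X ^+ 2 <= C2 / k * d * g X.
  have -> : C2 * d * X ^+ 2 = C2 / k * d * (k * X ^+ 2) by field; rewrite gt_eqF.
  apply: ler_wpM2l; first by rewrite mulr_ge0// divr_ge0// ltW.
  by move: e00 => ?; lra.
have -> : hh X - g X = (hh X - e1 - (g X - e0)) + (e1 - e0) by ring.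
by rewrite (le_trans (ler_normD _ _))// /C4; lra.
Qed.

Let er : g 0 <= r ^+ 2.
Proof. by have [_ A _] := node_epsP c M; rewrite ge0; exact: le_trans me A. Qed.
Let g00 : 0 < g 0. Proof. by rewrite ge0. Qed.
Let b0 : 0 <= D * d. Proof. exact: mulr_ge0. Qed.
Let bC : 64 * C4 * d <= k * (D * d).
Proof. by rewrite mulrA; apply: ler_wpM2r. Qed.
Let W : well k M (2 * r) g g1. Proof. by have [] := Wf. Qed.
Let pr : l - n <= - (2 * r). Proof. by have [_ A _] := Wh; move: pg; lra. Qed.
Let qr : 2 * r <= u - n. Proof. by have [_ _ A] := Wh; move: hu; lra. Qed.

Let crM : 0 <= c * r / (2 * M).
Proof. by apply: divr_ge0; apply: mulr_ge0 => //; exact: ltW. Qed.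

Let wide X : c * r / (2 * M) <= `|X| -> `|X| <= 2 * r ->
  (Cs + Cm) * d <= D * d * width g X.
Proof.
move=> X1 X2; have A := width_ge k0 k1 M1 r0 rM W g00 er b0 D2 d0 C40 X2.
have A1 : D * d * (k / 2 * (c * r / (2 * M))) <= D * d * width g X.
  apply: ler_wpM2l => //; apply: le_trans A; apply: ler_wpM2l => //.
  by rewrite divr_ge0// ltW.
apply: le_trans A1; have -> : D * d * (k / 2 * (c * r / (2 * M))) =
  D * (k * (c * r)) / (4 * M) * d by field; rewrite gt_eqF.
by apply: ler_wpM2r => //; rewrite ler_pdivlMr ?mulr_gt0// mulrC.
Qed.

Let tr_Y j : (j < a)%N -> l - n <= ys j - n <= u - n.
Proof. by move=> /(tr_y T) /andP[A1 A2]; rewrite !lerD2r A1. Qed.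

Lemma barrier_in j : (j < a)%N -> m <= xs j -> xs j < m + r ->
  `|(ys j - n) - (xs j - m)| <= D * d * width g (xs j - m).
Proof.
have L i : (i < a)%N -> m + r <= xs i -> xs i.+1 < m + r ->
    `|(ys i.+1 - n) - (xs i.+1 - m)| <= D * d * width g (xs i.+1 - m).
  move=> ia mi mi1; apply: le_trans (offset (entry_bound_landing ia mi)) _.
  have A := landing ia mi.
  have B1 : c * r / (2 * M) <= c * r / 2.
    rewrite ler_pdivrMr ?mulr_gt0//.
    have : c * r / 2 * 2 <= c * r / 2 * (2 * M).
      by apply: ler_wpM2l; [rewrite divr_ge0// mulr_ge0// ltW|move: M1; lra].
    by move=> ?; lra.
  have B2 := crM.
  by apply: wide; rewrite ger0_norm; move: r0; lra.
elim: j => [|j IH] ja mj mj1.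
  by move: x0_top r0 mj1; rewrite /xs /=; lra.
have [?|H] := leP (m + r) (xs j); first by apply: L => //; exact: ltnW.
have ja' := ltnW ja; have mj' : m <= xs j.
  by apply: le_trans mj _; apply: xs_decr; rewrite leqnSn.
rewrite -gX -hY; apply: (barrier_entry k0 k1 M1 r0 rM W g00 er b0 D2 d0 C40
  well_close bC pr qr hh_incr); rewrite ?gX ?subr_ge0//; [exact: tr_Y|lra|exact: IH].
Qed.

Lemma barrier_out j : (j < a)%N -> xs j <= m -> m - r < xs j ->
  `|(ys j - n) - (xs j - m)| <= D * d * width g (xs j - m).
Proof.
have [i] : exists i, (a - j = i)%N by eexists.
elim: i j => [|i IH] j ai ja' mj mj1.
  by move: ja'; rewrite -subn_gt0 ai.
have [H|H] := leP (xs j.+1) (m - r).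
  apply: le_trans (offset (exit_bound_leaving ja' H)) _.
  have A := leaving ja' H.
  have B1 : c * r / (2 * M) <= r / (2 * M).
    by rewrite ler_pM2r ?invr_gt0 ?mulr_gt0// ler_piMl// ltW.
  have B2 := crM.
  by apply: wide; rewrite ler0_norm; move: r0; lra.
have ja1 : (j.+1 < a)%N.
  rewrite ltn_neqAle ja' andbT; apply/eqP => E.
  by move: H; rewrite E; move: xa_bot r0; lra.
apply: (barrier_exit k0 k1 M1 r0 rM W g00 er b0 D2 d0 C40
  well_close bC pr qr hh_incr); [exact: tr_Y|lra|lra|].
rewrite gX hY; apply: IH => //; first by rewrite subnS ai.
by apply: le_trans mj; apply: xs_decr; rewrite leqnSn.
Qed.

Definition node_const :=
  (Cs + Cm + D) + ((1 + 2 * M * Cs) / node_gap c M + (M + 1) * D).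

(** Far from the minimum only boundedly many steps are made, and near it the
    barriers apply, forwards on the way in and backwards on the way out. *)
Lemma aligned_orbits j : (j < a)%N ->
  `|ys j - xs j| <= node_const * d /\
  `|(ys j - h (ys j)) - (xs j - f (xs j))| <= node_const * d * (xs j - f (xs j)).
Proof.
move=> ja; have xlu := tr_x T ja; have ylu := tr_y T ja.
rewrite -/(xs j) in xlu; rewrite -/(ys j) in ylu.
have gp := ps_pos P xlu.
have Cs0 : 0 <= Cs by apply: le_trans Cs1.
have N1 : 0 <= (1 + 2 * M * Cs) / node_gap c M.
  by rewrite divr_ge0 ?(ltW gap0)// addr_ge0// !mulr_ge0// ltW.
have N2 : 0 <= (M + 1) * D by rewrite mulr_ge0// addr_ge0// ltW.
have nle A : A <= Cs + Cm + D -> A * d <= node_const * d.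
  by move=> H; apply: ler_wpM2r => //; rewrite /node_const; lra.
have nle2 A : A <= (1 + 2 * M * Cs) / node_gap c M + (M + 1) * D ->
    A * d * (xs j - f (xs j)) <= node_const * d * (xs j - f (xs j)).
  move=> H; apply: ler_wpM2r; first exact: ltW.
  by apply: ler_wpM2r => //; rewrite /node_const; move: Cm0 D0; lra.
have far : `|ys j - xs j| <= Cs * d -> node_gap c M <= xs j - f (xs j) ->
  `|ys j - xs j| <= node_const * d /\
  `|(ys j - h (ys j)) - (xs j - f (xs j))| <= node_const * d * (xs j - f (xs j)).
  move=> H1 H2; split; first by apply: le_trans H1 _; apply: nle; move: Cm0 D0; lra.
  have [A1 _ _] := cl ylu; have A2 := passage_gap_lip P c0 c1 M1 ylu xlu.
  apply: le_trans (nle2 ((1 + 2 * M * Cs) / node_gap c M) ltac:(lra)).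
  apply: (@le_trans _ _ ((1 + 2 * M * Cs) * d)); last first.
    have -> : (1 + 2 * M * Cs) / node_gap c M * d * (xs j - f (xs j)) =
      (1 + 2 * M * Cs) * d * ((xs j - f (xs j)) / node_gap c M) by ring.
    rewrite ler_peMr//; last by rewrite ler_pdivlMr// mul1r.
    by rewrite mulr_ge0// addr_ge0// !mulr_ge0// ltW.
  have -> : ys j - h (ys j) - (xs j - f (xs j)) =
    - (h (ys j) - f (ys j)) + (ys j - f (ys j) - (xs j - f (xs j))) by ring.
  rewrite (le_trans (ler_normD _ _))// normrN.
  have : 2 * M * `|ys j - xs j| <= 2 * M * (Cs * d).
    by apply: ler_wpM2l => //; rewrite mulr_ge0// ltW.
  by move=> ?; lra.
have [E|H1] := leP (m + r) (xs j).
  apply: far.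
    by apply: entry_bound; [exact: ltnW|move=> i ij; apply: before E; rewrite ja ltnW].
  by apply: gap_far => //; rewrite ger0_norm; move: rM2 r0; lra.
have [E|H2] := leP (xs j) (m - r).
  apply: far.
    apply: exit_bound; first exact: ltnW.
    move=> i /andP[ji ia]; apply: (@le_trans _ _ (xs j)); last by move: rM2; lra.
    by apply: xs_decr; rewrite ji ltnW.
  by apply: gap_far => //; rewrite ler0_norm; move: rM2 r0; lra.
have Xr : `|xs j - m| <= r by rewrite ler_norml; apply/andP; split; lra.
have bar : `|(ys j - n) - (xs j - m)| <= D * d * width g (xs j - m).
  by have [E|E] := leP m (xs j); [exact: barrier_in|apply: barrier_out => //; exact: ltW].
split.
  apply: le_trans (nle (Cm + D) ltac:(move: Cs1; lra)).
  have -> : ys j - xs j = (ys j - n - (xs j - m)) + (n - m) by ring.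
  rewrite (le_trans (ler_normD _ _))//.
  have := width_le1 k0 k1 M1 r0 rM W g00 er b0 D2 d0 C40 Xr.
  by move=> /(ler_wpM2l b0) ?; have := argmin_shift; lra.
have := width_gap k0 k1 M1 r0 rM W g00 er b0 D2 d0 C40 well_close bC Xr bar.
have -> : hh (ys j - n) = ys j - h (ys j).
  by rewrite /hh; have -> : n + (ys j - n) = ys j by ring.
have -> : g (xs j - m) = xs j - f (xs j).
  by rewrite /g; have -> : m + (xs j - m) = xs j by ring.
move/le_trans; apply; rewrite mulrA; apply: nle2.
have : (M + k / 8) * D <= (M + 1) * D by apply: ler_wpM2r => //; move: k1; lra.
by move=> ?; lra.
Qed.

End barrier_constant.
End aligned.
End saddle_node.

Section passage_comparison.
Variable R : realType.

Lemma ex_nat_ge (x : R) : exists N : nat, x <= N%:R.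
Proof.
have [x0|x0] := leP 0 x; last by exists 0; exact: ltW.
by exists (Num.bound x); exact/ltW/archi_boundP.
Qed.

(** If the gap of one of the maps is not small, the whole passage takes
    boundedly many steps. Otherwise both gaps are wells; the minimal gaps agree
    up to a factor 1 + O(d) by gap_compare, and the barriers apply after
    aligning the minima. *)
Lemma passage_orbits (c M : R) : 0 < c -> c <= 1 -> 1 <= M ->
  exists C d0 : R, [/\ 1 <= C, 0 < d0, d0 <= 1 &
  forall l u d (f f1 f2 h h1 h2 : R -> R) (a : nat) (x y : R),
  0 < d -> d <= d0 ->
  passage c M l u f f1 f2 -> passage c M l u h h1 h2 ->
  close_on l u d f f1 f2 h h1 h2 ->
  transit l u (pass_gap c M) d f h a x y ->
  forall j, (j < a)%N -> `|iter j h y - iter j f x| <= C * d /\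
    `|(iter j h y - h (iter j h y)) - (iter j f x - f (iter j f x))| <=
     C * d * (iter j f x - f (iter j f x))].
Proof.
move=> c0 c1 M1; have M0 : 0 < M by exact: lt_le_trans ltr01 M1.
have g0 := node_gap_gt0 c0 c1 M1; have eps0 := node_eps_gt0 c0 c1 M1.
have r0 := node_rad_gt0 c0 c1 M1.
set e := node_eps c M / 2; have e0 : 0 < e by rewrite divr_gt0.
have [N HN] := ex_nat_ge (M / node_gap c M + 1).
have [N2 HN2] := ex_nat_ge (M / e + 1).
set Cs := few_const c M N; have Cs1 : 1 <= Cs := few_const_ge1 N c0 c1 M1.
set Cs2 := few_const c M N2; have Cs21 : 1 <= Cs2 := few_const_ge1 N2 c0 c1 M1.
have pos A : 1 <= A -> 0 <= 1 + 2 * M * A.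
  move=> A1; apply: addr_ge0 => //; apply: mulr_ge0; last exact: le_trans A1.
  by apply: mulr_ge0 => //; exact: ltW.
set k := c / 64; have k0 : 0 < k by rewrite divr_gt0.
set r := node_rad c M in r0.
have Cm0 : 0 < Cs + 32 / c by rewrite addr_gt0 ?divr_gt0// (lt_le_trans ltr01).
have C20 : 0 < 1 + M * (32 / c) by rewrite addr_gt0// mulr_gt0// divr_gt0.
set B := 4 * M * (Cs + 32 / c) / (c * r) + 4 * (1 + M * (32 / c)) / k.
have cr0 : 0 < c * r by exact: mulr_gt0.
have B11 : 0 < 4 * M * (Cs + 32 / c) / (c * r) by rewrite divr_gt0// mulr_gt0// mulr_gt0.
have B12 : 0 < 4 * (1 + M * (32 / c)) / k by rewrite divr_gt0// mulr_gt0.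
have B0 : 0 < B by exact: addr_gt0.
have B1 : 4 * M * (Cs + 32 / c) <= B * (c * r) by rewrite -ler_pdivrMr// /B lerDl ltW.
have B2 : 4 * (1 + M * (32 / c)) <= k * B by rewrite [leRHS]mulrC -ler_pdivrMr// /B lerDr ltW.
set D := 64 * (2 * B + (1 + M * (32 / c)) / k) / k + 4 * M * (Cs + 32 / c) / (k * (c * r)).
have kcr0 : 0 < k * (c * r) by exact: mulr_gt0.
have D11 : 0 < 64 * (2 * B + (1 + M * (32 / c)) / k) / k.
  by rewrite divr_gt0// mulr_gt0// addr_gt0// ?divr_gt0// mulr_gt0.
have D12 : 0 < 4 * M * (Cs + 32 / c) / (k * (c * r)).
  by rewrite divr_gt0// mulr_gt0// mulr_gt0.
have D0 : 0 < D by exact: addr_gt0.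
have D1 : 64 * (2 * B + (1 + M * (32 / c)) / k) <= k * D.
  by rewrite [leRHS]mulrC -ler_pdivrMr// /D lerDl ltW.
have D3 : 4 * M * (Cs + 32 / c) <= D * (k * (c * r)).
  by rewrite -ler_pdivrMr// /D lerDr ltW.
set C := node_const c M N D + (Cs2 + (1 + 2 * M * Cs2) / e).
have nc0 : 1 <= node_const c M N D.
  rewrite /node_const -/Cs.
  have : 0 <= 32 / c by rewrite divr_ge0// ltW.
  have : 0 <= (1 + 2 * M * Cs) / node_gap c M.
    by apply: divr_ge0; [exact: pos|exact: ltW].
  have : 0 <= (M + 1) * D by apply: mulr_ge0; [rewrite addr_ge0// ltW|exact: ltW].
  by move: D0 Cs1; lra.
have E2 : 0 <= (1 + 2 * M * Cs2) / e.
  by apply: divr_ge0; [exact: pos|exact: ltW].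
pose d0 := Num.min e (Num.min B^-1 (Num.min (k / (16 * M ^+ 2 * D)) 1)).
have mm : 0 < 16 * M ^+ 2 * D by rewrite mulr_gt0// mulr_gt0// exprn_gt0.
exists C, d0; split.
- by rewrite /C; move: nc0 E2 Cs21; lra.
- by rewrite !lt_min e0 invr_gt0 B0 ltr01 divr_gt0.
- by rewrite !ge_min lexx !orbT.
move=> l u d f f1 f2 h h1 h2 a x y dp; rewrite !le_min => /and4P[de dB dD _] P Q cl T.
have d00 := ltW dp.
have cl' z : l <= z <= u -> `|h z - f z| <= d by move=> /cl[].
have dB' : B * d <= 1 by rewrite mulrC -ler_pdivlMr// div1r.
have dD' : 16 * M ^+ 2 * (D * d) <= k by rewrite mulrA mulrC -ler_pdivlMr.
have [m mlu mmin] := passage_argmin P; have [n nlu nmin] := passage_argmin Q.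
have [me|me] := leP (m - f m) e.
  have me' : m - f m <= node_eps c M by move: me e0; rewrite /e; lra.
  have ne' : n - h n <= node_eps c M.
    have := nmin _ mlu; have /ler_normlP[+ _] := cl' _ mlu.
    by move: me de; rewrite /e; lra.
  have de' : d <= node_eps c M by move: de e0; rewrite /e; lra.
  have G1 := gap_compare c0 c1 M1 d00 P Q cl T mlu nlu mmin nmin me' ne' de' HN dp B1 B2 dB'.
  have G2 := gap_compare c0 c1 M1 d00 Q P (close_on_sym cl) (transit_sym T)
    nlu mlu nmin mmin ne' me' de' HN dp B1 B2 dB'.
  move=> j ja; have [A1 A2] := aligned_orbits c0 c1 M1 d00 P Q cl T mlu nlu mmin nmin
    me' ne' de' HN (ltW B0) dB' G1 G2 D1 dD' D3 ja.
  have nC : node_const c M N D <= C by rewrite /C; move: E2 Cs21; lra.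
  split; first by apply: le_trans A1 _; exact: ler_wpM2r.
  apply: le_trans A2 _; apply: ler_wpM2r; last exact: ler_wpM2r.
  exact/ltW/(ps_pos P)/(tr_x T).
move=> j ja; have xlu := tr_x T ja; have ylu := tr_y T ja.
have far z : l <= z <= u -> e <= z - f z by move=> /mmin; move: me; lra.
have H1 : `|iter j h y - iter j f x| <= Cs2 * d.
  apply: (few_fwd P c0 c1 M1 d00 e0 cl' T HN2 (ltnW ja)) => i ij.
  by apply/far/(tr_x T)/(ltn_trans ij).
split.
  apply: le_trans H1 _; apply: ler_wpM2r => //.
  by rewrite /C; move: E2 nc0; lra.
have A2 := passage_gap_lip P c0 c1 M1 ylu xlu; have A1 := cl' _ ylu.
set X := iter j f x in xlu H1 A2 *; set Y := iter j h y in ylu H1 A1 A2 *.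
have A3 : `|(Y - h Y) - (X - f X)| <= (1 + 2 * M * Cs2) * d.
  have -> : Y - h Y - (X - f X) = - (h Y - f Y) + (Y - f Y - (X - f X)) by ring.
  rewrite (le_trans (ler_normD _ _))// normrN.
  have : 2 * M * `|Y - X| <= 2 * M * (Cs2 * d).
    by apply: ler_wpM2l => //; rewrite mulr_ge0// ltW.
  by move=> ?; lra.
apply: le_trans A3 _; apply: (@le_trans _ _ ((1 + 2 * M * Cs2) / e * d * (X - f X))).
  have -> : (1 + 2 * M * Cs2) / e * d * (X - f X) =
      (1 + 2 * M * Cs2) * d * ((X - f X) / e) by ring.
  rewrite ler_peMr//; last by rewrite ler_pdivlMr// mul1r; exact: far.
  by apply: mulr_ge0 => //; exact: pos.
apply: ler_wpM2r; first exact/ltW/(ps_pos P).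
by apply: ler_wpM2r => //; rewrite /C; move: nc0 Cs21; lra.
Qed.

End passage_comparison.

(** * Derivatives of long iterates *)

Section iterate_jets.
Variable R : realType.
Implicit Types f : R -> R.

Fixpoint it1 f f1 (j : nat) (x : R) : R :=
  if j is i.+1 then f1 (iter i f x) * it1 f f1 i x else 1.
Fixpoint it2 f f1 f2 (j : nat) (x : R) : R :=
  if j is i.+1 then f2 (iter i f x) * it1 f f1 i x ^+ 2 +
    f1 (iter i f x) * it2 f f1 f2 i x else 0.
(** The nonlinearity D (log D f^j): unlike the derivatives it is a sum. *)
Fixpoint itn f f1 f2 (j : nat) (x : R) : R :=
  if j is i.+1 then itn f f1 f2 i x +
    f2 (iter i f x) / f1 (iter i f x) * it1 f f1 i x else 0.

Lemma it2E f f1 f2 j x : (forall i, (i < j)%N -> f1 (iter i f x) != 0) ->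
  it2 f f1 f2 j x = it1 f f1 j x * itn f f1 f2 j x.
Proof.
elim: j => [|j IH] H /=; first by rewrite mulr0.
rewrite IH; last by move=> i ij; apply: H; rewrite ltnW.
by field; exact: H.
Qed.

Section one_map.
Variables (c M l u : R) (f f1 f2 : R -> R).
Hypothesis P : passage c M l u f f1 f2.
Hypothesis (c0 : 0 < c) (c1 : c <= 1) (M1 : 1 <= M).

Let M0 : 0 < M. Proof. exact: lt_le_trans ltr01 M1. Qed.

(** The mean slope of f between f z and z, equivalently the ratio of two
    consecutive gaps. The derivative of f^j divided by the gap is therefore a
    product of factors slope_ratio = 1 + O(gap), and the gaps along an orbit add
    up to at most the length of the corridor: this is why derivatives of f^j are
    bounded uniformly in j. *)
Definition slope_avg (z : R) := (f z - f (f z)) / (z - f z).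
Definition slope_ratio z := f1 z / slope_avg z.

Lemma slope_avg_bd z : l <= z <= u -> l <= f z -> c <= slope_avg z <= M.
Proof.
move=> zlu lf; have zp := ps_pos P zlu; move/andP: (zlu) => [lz zu].
have /andP[A B] := passage_incr P lf (y := z) ltac:(lra) zu.
by rewrite /slope_avg ler_pdivlMr// ler_pdivrMr// A.
Qed.

Lemma slope_avg_close z : l <= z <= u -> l <= f z ->
  `|slope_avg z - f1 z| <= M * (z - f z).
Proof.
move=> zlu lf; have zp := ps_pos P zlu.
have flu : l <= f z <= u by rewrite lf; move/andP: zlu => [? ?]; lra.
have := taylor_abs (ps_d1 P) (ps_d2 P) (ps_f2 P) zlu flu.
have -> : slope_avg z - f1 z = - (f (f z) - f z - f1 z * (f z - z)) / (z - f z).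
  by rewrite /slope_avg; field; rewrite gt_eqF.
move=> H; rewrite normrM normrN normfV (gtr0_norm zp) ler_pdivrMr//.
apply: le_trans H _; have := sqr_ge0 (f z - z).
move=> /(mulr_ge0 (ltW M0)) ?; lra.
Qed.

Lemma slope_ratio_le z : l <= z <= u -> l <= f z ->
  0 < slope_ratio z <= expR (M / c * (z - f z)).
Proof.
move=> zlu lf; have /andP[A1 A2] := slope_avg_bd zlu lf.
have a0 : 0 < slope_avg z by exact: lt_le_trans A1.
have /andP[B1 _] := ps_f1 P zlu.
rewrite divr_gt0 ?(lt_le_trans c0)//=; apply: le_trans (expR_ge1Dx _).
rewrite ler_pdivrMr// mulrDl mul1r.
have /ler_normlP[C1 _] := slope_avg_close zlu lf.
have zp := ps_pos P zlu.
have H1 : M / c * (z - f z) * c <= M / c * (z - f z) * slope_avg z.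
  apply: ler_wpM2l => //; apply: mulr_ge0; last exact: ltW.
  by rewrite divr_ge0// ltW.
have H2 : M / c * (z - f z) * c = M * (z - f z) by field; rewrite gt_eqF.
by lra.
Qed.

Definition it1_const := expR (M / c * (M + M)) / pass_gap c M.

Section orbit.
Variables (a : nat) (x : R).
Hypothesis xlu : forall j, (j < a)%N -> l <= iter j f x <= u.
Hypothesis x0 : f u <= x.

Lemma orbit_gap0 : (0 < a)%N -> pass_gap c M <= x - f x.
Proof.
move=> /xlu /= /andP[lx xu].
by apply: (passage_entry P c0 c1 M1); rewrite // x0.
Qed.

Lemma orbit_len j : (j <= a)%N -> x - iter j f x <= M + M.
Proof.
case: j => [|j] ja; first by rewrite /= subrr addr_ge0// ltW.
have := ps_gap P (xlu ja); have /andP[? ?] := xlu ja; have := ps_len P.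
by have /= /andP[? ?] := xlu (leq_ltn_trans (leq0n j) ja); lra.
Qed.

Lemma it1_gt0 j : (j <= a)%N -> 0 < it1 f f1 j x.
Proof.
elim: j => [//|j IH] ja /=; rewrite mulr_gt0 ?IH 1?ltnW//.
by have /andP[A _] := ps_f1 P (xlu ja); exact: lt_le_trans A.
Qed.

Let gap j := iter j f x - f (iter j f x).
Definition it1_rel j := it1 f f1 j x / gap j.

Let gap0 j : (j < a)%N -> 0 < gap j. Proof. by move=> /xlu /(ps_pos P). Qed.

Lemma it1_relS j : (j.+1 < a)%N -> it1_rel j.+1 = slope_ratio (iter j f x) * it1_rel j.
Proof.
move=> ja; have g1 := gap0 ja; have g0 := gap0 (ltnW ja).
rewrite /it1_rel /slope_ratio /slope_avg /gap /= in g0 g1 *.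
by field; rewrite !gt_eqF.
Qed.

Lemma it1_rel_le j : (j < a)%N -> 0 < it1_rel j <= it1_const.
Proof.
move=> ja; rewrite divr_gt0 ?(gap0 ja) ?(it1_gt0 (ltnW ja))//=.
have pg := pass_gap_gt0 c0 c1 M1.
apply: (@le_trans _ _ ((pass_gap c M)^-1 * expR (M / c * (x - iter j f x)))); last first.
  rewrite /it1_const mulrC ler_pM2r ?invr_gt0// ler_expR.
  by apply: ler_wpM2l; [rewrite divr_ge0// ltW|exact/orbit_len/ltnW].
elim: j ja => [|j IH] ja.
  rewrite /it1_rel /gap /= subrr mulr0 expR0 mulr1 div1r.
  by rewrite lef_pV2 ?posrE ?orbit_gap0//; exact: (gap0 ja).
rewrite it1_relS//; have ja' := ltnW ja.
have lf : l <= f (iter j f x) by have /andP[] := xlu ja.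
have /andP[A1 A2] := slope_ratio_le (xlu ja') lf.
apply: le_trans (ler_pM _ _ A2 (IH ja')) _; first exact: ltW.
  by rewrite divr_ge0 ?(ltW (gap0 ja'))// ltW// it1_gt0// ltnW.
rewrite mulrCA -expRD -mulrDr /=; apply: ler_wpM2l; first by rewrite invr_ge0 ltW.
by rewrite ler_expR; apply: ler_wpM2l; [rewrite divr_ge0// ltW|lra].
Qed.

Lemma it1_gap j : (j < a)%N -> it1 f f1 j x <= it1_const * gap j.
Proof. by move=> ja; have /andP[_] := it1_rel_le ja; rewrite ler_pdivrMr ?gap0. Qed.

Lemma it1_const_ge0 : 0 <= it1_const.
Proof. by rewrite divr_ge0 ?expR_ge0// ltW// pass_gap_gt0. Qed.

Lemma it1_le : (0 < a)%N -> it1 f f1 a x <= M * (it1_const * M).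
Proof.
move=> a0; have [j ja] : exists j, a = j.+1 by exists a.-1; rewrite prednK.
have ja' : (j < a)%N by rewrite ja.
rewrite ja /=; have /andP[A1 A2] := ps_f1 P (xlu ja').
apply: ler_pM => //; [by apply: le_trans A1; exact: ltW|exact/ltW/it1_gt0/ltnW|].
apply: le_trans (it1_gap ja') _; apply: ler_wpM2l; first exact: it1_const_ge0.
exact: (ps_gap P (xlu ja')).
Qed.

Lemma itn_le j : (j <= a)%N ->
  `|itn f f1 f2 j x| <= M / c * it1_const * (x - iter j f x).
Proof.
elim: j => [|j IH] ja; first by rewrite /= normr0 subrr mulr0.
have /= := IH (ltnW ja); have B := it1_gap ja; have D := it1_gt0 (ltnW ja).
have /andP[A1 A2] := ps_f1 P (xlu ja); have A3 := ps_f2 P (xlu ja).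
move=> H; apply: le_trans (ler_normD _ _) _.
have f0 : 0 < f1 (iter j f x) by exact: lt_le_trans A1.
have : `|f2 (iter j f x) / f1 (iter j f x) * it1 f f1 j x| <= M / c * (it1_const * gap j).
  rewrite normrM (gtr0_norm D); apply: ler_pM => //; first exact: ltW.
  rewrite normrM normfV (gtr0_norm f0); apply: ler_pM => //; first by rewrite invr_ge0 ltW.
  by rewrite lef_pV2 ?posrE.
by rewrite /gap => ?; lra.
Qed.

End orbit.
End one_map.
End iterate_jets.

Section two_jets.
Variable R : realType.
Variables (c M E l u d : R) (f f1 f2 h h1 h2 : R -> R).
Hypothesis P : passage c M l u f f1 f2.
Hypothesis Q : passage c M l u h h1 h2.
Hypothesis cl : close_on l u d f f1 f2 h h1 h2.
Hypothesis (c0 : 0 < c) (c1 : c <= 1) (M1 : 1 <= M) (E1 : 1 <= E).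
Hypothesis (d0 : 0 <= d) (d1 : d <= 1).

Let M0 : 0 < M. Proof. exact: lt_le_trans ltr01 M1. Qed.
Let E0 : 0 < E. Proof. exact: lt_le_trans ltr01 E1. Qed.

(** What passage_orbits provides at corresponding points of the two orbits. *)
Definition matched z w :=
  `|w - z| <= E * d /\ `|(w - h w) - (z - f z)| <= E * d * (z - f z).

Let S := 1 + M * E + M * E * M + M * E.
Let S' := 1 + M * E + S * M.
Definition ratio_const := M * S' / c ^+ 2 + S / c.
Let S0 : 0 <= S. Proof. by rewrite !addr_ge0 ?mulr_ge0// ltW. Qed.
Let S'0 : 0 <= S'. Proof. by rewrite !addr_ge0 ?mulr_ge0// ltW. Qed.

Lemma matched_f1 z w : l <= z <= u -> l <= w <= u -> matched z w ->
  `|h1 w - f1 z| <= (1 + M * E) * d.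
Proof.
move=> zlu wlu [A1 _]; have [_ B1 _] := cl wlu.
have B2 := diff_on_lip (ps_d2 P) (ps_f2 P) wlu zlu.
have -> : h1 w - f1 z = (h1 w - f1 w) + (f1 w - f1 z) by ring.
rewrite (le_trans (ler_normD _ _))//.
by have := ler_wpM2l (ltW M0) A1; lra.
Qed.

Lemma matched_f2 z w : l <= z <= u -> l <= w <= u -> `|w - z| <= (E + E * M) * d ->
  `|h2 w - f2 z| <= (1 + M * E + M * E * M) * d.
Proof.
move=> zlu wlu A1; have [_ _ B1] := cl wlu; have B2 := ps_lip P wlu zlu.
have -> : h2 w - f2 z = (h2 w - f2 w) + (f2 w - f2 z) by ring.
rewrite (le_trans (ler_normD _ _))//.
by have := ler_wpM2l (ltW M0) A1; lra.
Qed.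

Lemma slope_avg_matched z w : l <= z <= u -> l <= w <= u -> l <= f z -> l <= h w ->
  matched z w ->
  `|(slope_avg h w - h1 w) - (slope_avg f z - f1 z)| <= S * d * (z - f z).
Proof.
move=> zlu wlu lf lh [A1 A2].
have gz := ps_pos P zlu; have gw := ps_pos Q wlu.
set Gz := z - f z in A2 gz *; set Gw := w - h w in A2 gw *.
have GM : Gz <= M by exact (ps_gap P zlu).
pose p t := h (w - Gw * t) / Gw - f (z - Gz * t) / Gz.
pose p1 t := f1 (z - Gz * t) - h1 (w - Gw * t).
pose p2 t := h2 (w - Gw * t) * Gw - f2 (z - Gz * t) * Gz.
have aff (z' G : R) (F F1 : R -> R) : 0 < G -> l <= z' - G -> z' <= u -> diff_on l u F F1 ->
    diff_on 0 1 (fun t => F (z' - G * t)) (fun t => F1 (z' - G * t) * (0 - G * 1)).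
  move=> G0 lz zu H.
  apply: (diff_on_comp (h := fun t => z' - G * t) _ H).
    by apply: diff_on_subr; [exact: diff_on_cst|apply: diff_on_scale; exact: diff_on_id].
  move=> t /andP[t0 t1].
  have : G * t <= G * 1 by apply: ler_wpM2l => //; exact: ltW.
  by have : 0 <= G * t by [rewrite mulr_ge0// ltW]; lra.
have zl : l <= z - Gz by rewrite /Gz; lra.
have wl : l <= w - Gw by rewrite /Gw; lra.
have zu : z <= u by case/andP: zlu. have wu : w <= u by case/andP: wlu.
have D1 : diff_on 0 1 p p1.
  apply: diff_on_ext (diff_on_subr (diff_on_scale Gw^-1 (aff _ _ _ _ gw wl wu (ps_d1 Q)))
    (diff_on_scale Gz^-1 (aff _ _ _ _ gz zl zu (ps_d1 P)))) _ _ => t _.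
    by rewrite /p; ring.
  by rewrite /p1; field; rewrite !gt_eqF.
have D2 : diff_on 0 1 p1 p2.
  apply: diff_on_ext (diff_on_subr (aff _ _ _ _ gz zl zu (ps_d2 P))
    (aff _ _ _ _ gw wl wu (ps_d2 Q))) _ _ => t _ //.
  by rewrite /p2; ring.
have B t : 0 <= t <= 1 -> `|p2 t| <= S * d * Gz.
  move=> /andP[t0 t1]; rewrite /p2.
  have tz : 0 <= Gz * t <= Gz by rewrite mulr_ge0 ?(ltW gz)//= ler_piMr// ltW.
  have tw : 0 <= Gw * t <= Gw by rewrite mulr_ge0 ?(ltW gw)//= ler_piMr// ltW.
  have zt : l <= z - Gz * t <= u by move/andP: tz => [? ?]; lra.
  have wt : l <= w - Gw * t <= u by move/andP: tw => [? ?]; lra.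
  have H1 : `|h2 (w - Gw * t) - f2 (z - Gz * t)| <= (1 + M * E + M * E * M) * d.
    apply: matched_f2 => //.
    have -> : w - Gw * t - (z - Gz * t) = (w - z) - (Gw - Gz) * t by ring.
    rewrite (le_trans (ler_normB _ _))// [(E + _) * d]mulrDl lerD//.
    rewrite normrM (ger0_norm t0); apply: (@le_trans _ _ (E * d * Gz)).
      by apply: le_trans A2; rewrite ler_piMr.
    have -> : E * M * d = E * d * M by ring.
    by apply: ler_wpM2l => //; rewrite mulr_ge0// ltW.
  have -> : h2 (w - Gw * t) * Gw - f2 (z - Gz * t) * Gz =
    (h2 (w - Gw * t) - f2 (z - Gz * t)) * Gz + h2 (w - Gw * t) * (Gw - Gz) by ring.
  rewrite (le_trans (ler_normD _ _))// !normrM (gtr0_norm gz).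
  have H2 : `|h2 (w - Gw * t)| * `|Gw - Gz| <= M * (E * d * Gz).
    by apply: ler_pM => //; exact (ps_f2 Q wt).
  have H3 : `|h2 (w - Gw * t) - f2 (z - Gz * t)| * Gz <= (1 + M * E + M * E * M) * d * Gz.
    by apply: ler_wpM2r => //; exact: ltW.
  by rewrite /S; lra.
have z01 : (0 : R) <= (0 : R) <= (1 : R) by rewrite lexx ler01.
have o01 : (0 : R) <= (1 : R) <= (1 : R) by rewrite ler01 lexx.
have := taylor_abs D1 D2 B z01 o01; rewrite subr0 mulr1.
have -> : p 1 - p 0 - p1 0 = - ((slope_avg h w - h1 w) - (slope_avg f z - f1 z)).
  have e1 : w - Gw * 1 = h w by rewrite /Gw; ring.
  have e2 : z - Gz * 1 = f z by rewrite /Gz; ring.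
  rewrite /p /p1 /slope_avg !mulr0 !subr0 e1 e2 -/Gz -/Gw; ring.
rewrite normrN; move/le_trans; apply.
have : 0 <= S * d * Gz by rewrite !mulr_ge0// ltW.
by move=> ?; lra.
Qed.

(** The error is small relative to the gap, so it can be summed along a passage
    of any length. *)
Lemma slope_ratio_matched z w : l <= z <= u -> l <= w <= u -> l <= f z -> l <= h w ->
  matched z w ->
  `|slope_ratio h h1 w - slope_ratio f f1 z| <= ratio_const * d * (z - f z).
Proof.
move=> zlu wlu lf lh H; have A := slope_avg_matched zlu wlu lf lh H.
have B := matched_f1 zlu wlu H.
have C := slope_avg_close P M1 zlu lf.
have /andP[D1 _] := slope_avg_bd P zlu lf.
have /andP[D2 _] := slope_avg_bd Q wlu lh.
have gz := ps_pos P zlu; have GM : z - f z <= M by exact (ps_gap P zlu).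
rewrite /slope_ratio; move: A C D1 D2.
set af := slope_avg f z; set ah := slope_avg h w; set G := z - f z in gz GM *.
move=> A C D1 D2.
have af0 : 0 < af by exact: lt_le_trans D1.
have ah0 : 0 < ah by exact: lt_le_trans D2.
have F : `|ah - af| <= S' * d.
  have -> : ah - af = ((ah - h1 w) - (af - f1 z)) + (h1 w - f1 z) by ring.
  rewrite (le_trans (ler_normD _ _))//.
  have : S * d * G <= S * d * M by apply: ler_wpM2l => //; exact: mulr_ge0.
  by rewrite /S'; lra.
have -> : h1 w / ah - f1 z / af = (af - f1 z) * (ah - af) / (af * ah)
    - ((ah - h1 w) - (af - f1 z)) / ah.
  by field; rewrite !gt_eqF.
rewrite (le_trans (ler_normB _ _))// /ratio_const.
have -> : (M * S' / c ^+ 2 + S / c) * d * G = M * S' / c ^+ 2 * d * G + S / c * d * G.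
  by ring.
apply: lerD.
  rewrite !normrM normfV normrM !(gtr0_norm af0) !(gtr0_norm ah0).
  have -> : M * S' / c ^+ 2 * d * G = (M * G) * (S' * d) / (c * c).
    by field; rewrite gt_eqF.
  apply: ler_pM; [by rewrite mulr_ge0|by rewrite invr_ge0 mulr_ge0// ltW| |].
    by apply: ler_pM.
  by rewrite lef_pV2 ?posrE ?(mulr_gt0 af0 ah0) ?(mulr_gt0 c0 c0)//; apply: ler_pM => //; exact: ltW.
rewrite normrM normfV (gtr0_norm ah0).
have -> : S / c * d * G = S * d * G / c by ring.
apply: ler_pM => //; first by rewrite invr_ge0 ltW.
by rewrite lef_pV2 ?posrE.
Qed.

Section orbits.
Variables (a : nat) (x y : R).
Hypothesis xlu : forall j, (j < a)%N -> l <= iter j f x <= u.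
Hypothesis ylu : forall j, (j < a)%N -> l <= iter j h y <= u.
Hypothesis (x0 : f u <= x) (y0 : h u <= y).
Hypothesis mat : forall j, (j < a)%N -> matched (iter j f x) (iter j h y).

Let pg := pass_gap c M.
Let pg0 : 0 < pg. Proof. exact (pass_gap_gt0 c0 c1 M1). Qed.
Let K1 := E / pg.
Let T := it1_const c M.
Let T0 : 0 <= T. Proof. exact (it1_const_ge0 c0 c1 M1). Qed.
Let K2 := ratio_const * T.
Let X2 := expR (M / c * (M + M)).
Let K4 := (K1 + K2 * (M + M)) * X2.
Let rc0 : 0 <= ratio_const.
Proof.
by rewrite addr_ge0// ?divr_ge0 ?mulr_ge0 ?(ltW M0) ?exprn_ge0 ?(ltW c0).
Qed.
Let K10 : 0 <= K1. Proof. by rewrite divr_ge0// ltW. Qed.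
Let K20 : 0 <= K2. Proof. exact: mulr_ge0. Qed.
Let K40 : 0 <= K4.
Proof. by apply: mulr_ge0; [rewrite addr_ge0// mulr_ge0// addr_ge0// ltW|exact: expR_ge0]. Qed.

Let pf j := it1 f f1 j x.
Let ph j := it1 h h1 j y.
Let gf j := iter j f x - f (iter j f x).
Let gh j := iter j h y - h (iter j h y).
Let gf0 j : (j < a)%N -> 0 < gf j. Proof. by move=> /xlu /(ps_pos P). Qed.
Let gh0 j : (j < a)%N -> 0 < gh j. Proof. by move=> /ylu /(ps_pos Q). Qed.

Let rf j := it1_rel f f1 x j.
Let rh j := it1_rel h h1 y j.

Lemma it1_rel_matched j : (j < a)%N -> `|rh j - rf j| <= K4 * d.
Proof.
move=> ja.
suff : `|rh j - rf j| <= (K1 + K2 * (x - iter j f x)) * d * expR (M / c * (y - iter j h y)).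
  move/le_trans; apply.
  have Lx := orbit_len P M1 xlu (ltnW ja).
  have Ly := orbit_len Q M1 ylu (ltnW ja).
  have xj0 : 0 <= x - iter j f x.
    by elim: (j) (ja) => [|i IH] ia /=; [rewrite subrr|
      have := IH (ltnW ia); have := gf0 (ltnW ia); rewrite /gf; lra].
  have -> : K4 * d = (K1 + K2 * (M + M)) * d * X2 by rewrite /K4; ring.
  apply: ler_pM; rewrite ?expR_ge0//.
  - by apply: mulr_ge0 => //; apply: addr_ge0 => //; exact: mulr_ge0.
  - by apply: ler_wpM2r => //; rewrite lerD2l; exact: ler_wpM2l.
  - by rewrite ler_expR; apply: ler_wpM2l => //; rewrite divr_ge0// ltW.
elim: j ja => [|j IH] ja.
  rewrite /= !subrr !mulr0 expR0 addr0 mulr1 /rh /rf /it1_rel /=.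
  have G0 := gf0 ja; have H0 := gh0 ja; have [_ +] := mat ja.
  rewrite /gf /gh /= in G0 H0 *; set G := x - f x in G0 *; set H := y - h y in H0 *.
  have HH : pg <= H := orbit_gap0 Q c0 c1 M1 ylu y0 ja.
  move=> A; have -> : 1 / H - 1 / G = - (H - G) / (H * G) by field; rewrite !gt_eqF.
  rewrite normrM normrN normfV normrM (gtr0_norm G0) (gtr0_norm H0).
  rewrite ler_pdivrMr ?mulr_gt0//; apply: le_trans A _.
  have -> : K1 * d * (H * G) = E * d * G * (H / pg) by rewrite /K1; ring.
  rewrite ler_peMr//; first by rewrite !mulr_ge0// ltW.
  by rewrite ler_pdivlMr// mul1r.
have ja' := ltnW ja; have {IH} := IH ja'; rewrite /rh /rf.
rewrite (it1_relS P xlu ja) (it1_relS Q ylu ja).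
have lf : l <= f (iter j f x) by have /andP[] := xlu ja.
have lh : l <= h (iter j h y) by have /andP[] := ylu ja.
have A := slope_ratio_matched (xlu ja') (ylu ja') lf lh (mat ja').
have /andP[B1 B2] := slope_ratio_le Q c0 M1 (ylu ja') lh.
have /andP[C1 C2] := it1_rel_le P c0 c1 M1 xlu x0 ja'.
rewrite /= ; move: A B1 B2 C1 C2.
set th := slope_ratio h h1 _; set tf := slope_ratio f f1 _.
set qf := it1_rel f f1 x j; set qh := it1_rel h h1 y j.
set X := iter j f x; set Y := iter j h y => A B1 B2 C1 C2 IH.
clearbody th tf qf qh.
have -> : th * qh - tf * qf = th * (qh - qf) + (th - tf) * qf by ring.
rewrite (le_trans (ler_normD _ _))// !normrM (gtr0_norm B1) (gtr0_norm C1).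
have GX : 0 < X - f X := gf0 ja'. have GY : 0 < Y - h Y := gh0 ja'.
have YY : 0 <= y - Y.
  rewrite /Y; elim: (j) (ja') => [|i IHi] ia /=; first by rewrite subrr.
  by have := IHi (ltnW ia); have := gh0 (ltnW ia); rewrite /gh; lra.
have F1 : th * `|qh - qf| <= (K1 + K2 * (x - X)) * d * expR (M / c * (y - h Y)).
  have -> : (K1 + K2 * (x - X)) * d * expR (M / c * (y - h Y)) =
    expR (M / c * (Y - h Y)) * ((K1 + K2 * (x - X)) * d * expR (M / c * (y - Y))).
    rewrite mulrCA -expRD -mulrDr; congr (_ * expR (_ * _)); ring.
  by apply: ler_pM => //; exact: ltW.
have F2 : `|th - tf| * qf <= K2 * (X - f X) * d * expR (M / c * (y - h Y)).
  apply: (@le_trans _ _ (ratio_const * d * (X - f X) * T)).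
    by apply: ler_pM => //; exact: ltW.
  have -> : ratio_const * d * (X - f X) * T = K2 * (X - f X) * d by rewrite /K2; ring.
  have X0 : 0 <= K2 * (X - f X) * d.
    by apply: mulr_ge0 => //; apply: mulr_ge0 => //; exact: ltW.
  rewrite ler_peMr//.
  rewrite -expR0 ler_expR mulr_ge0//; first by rewrite divr_ge0// ltW.
  by lra.
apply: le_trans (lerD F1 F2) _.
by rewrite -!mulrDl le_eqVlt; apply/orP; left; apply/eqP; ring.
Qed.

Let K5 := K4 * (1 + E) + T * E.
Let K50 : 0 <= K5. Proof. by rewrite addr_ge0// mulr_ge0// ?addr_ge0// ltW. Qed.

Lemma it1_matched j : (j < a)%N -> `|ph j - pf j| <= K5 * d * gf j.
Proof.
move=> ja; have A := it1_rel_matched ja; have [_ B] := mat ja.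
rewrite -/(gf j) -/(gh j) in B; have G0 := gf0 ja; have H0 := gh0 ja.
have /andP[C1 C2] := it1_rel_le P c0 c1 M1 xlu x0 ja.
rewrite -/(rf j) in C1 C2; have -> : ph j = rh j * gh j by rewrite /rh /it1_rel divfK// gt_eqF.
have -> : pf j = rf j * gf j by rewrite /rf /it1_rel divfK// gt_eqF.
have -> : rh j * gh j - rf j * gf j = (rh j - rf j) * gh j + rf j * (gh j - gf j) by ring.
rewrite (le_trans (ler_normD _ _))// [X in X + _]normrM [X in _ + X]normrM (gtr0_norm H0) (gtr0_norm C1).
have GH : gh j <= (1 + E) * gf j.
  have /ler_normlP[_ B'] := B.
  have : E * d * gf j <= E * 1 * gf j.
    by apply: ler_wpM2r; [exact: ltW|apply: ler_wpM2l => //; exact: ltW].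
  by lra.
have F1 : `|rh j - rf j| * gh j <= K4 * d * ((1 + E) * gf j).
  by apply: ler_pM => //; exact: ltW.
have F2 : rf j * `|gh j - gf j| <= T * (E * d * gf j).
  by apply: ler_pM => //; exact: ltW.
by rewrite /K5; lra.
Qed.

Let nf j := itn f f1 f2 j x.
Let nh j := itn h h1 h2 j y.
Let N1 := (1 + M * E + M * E * M) / c + M * (1 + M * E) / c ^+ 2.
Let K6 := N1 * (K5 + T) + M / c * K5.
Let N10 : 0 <= N1.
Proof.
by apply: addr_ge0; apply: divr_ge0; rewrite ?exprn_ge0 ?(ltW c0)//;
  rewrite ?mulr_ge0 ?addr_ge0 ?mulr_ge0 ?ltW.
Qed.

Lemma itn_matched j : (j <= a)%N -> `|nh j - nf j| <= K6 * d * (x - iter j f x).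
Proof.
elim: j => [|j IH] ja; first by rewrite /nh /nf /= !subrr normr0 mulr0.
have {IH} := IH (ltnW ja); rewrite /nh /nf /= => IH.
have A := it1_matched ja; have B1 := it1_gap P c0 c1 M1 xlu x0 ja.
have pf0 := it1_gt0 P c0 xlu (ltnW ja).
have ph0 := it1_gt0 Q c0 ylu (ltnW ja).
have C1 := matched_f1 (xlu ja) (ylu ja) (mat ja).
have C2 : `|h2 (iter j h y) - f2 (iter j f x)| <= (1 + M * E + M * E * M) * d.
  apply: matched_f2 (xlu ja) (ylu ja) _; have [+ _] := mat ja.
  have : 0 <= E * M * d by rewrite mulr_ge0// mulr_ge0// ltW.
  by lra.
have /andP[F1 _] := ps_f1 P (xlu ja); have /andP[H1 _] := ps_f1 Q (ylu ja).
have F2 := ps_f2 P (xlu ja); have H2 := ps_f2 Q (ylu ja).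
rewrite -/(pf j) -/(ph j) -/(gf j) in A B1 pf0 ph0 *; have G0 := gf0 ja.
move: C1 C2 F1 H1 F2 H2; set X := iter j f x; set Y := iter j h y.
move=> C1 C2 F1 H1 F2 H2.
have f10 : 0 < f1 X by exact: lt_le_trans F1.
have h10 : 0 < h1 Y by exact: lt_le_trans H1.
have D1 : `|h2 Y / h1 Y - f2 X / f1 X| <= N1 * d.
  have -> : h2 Y / h1 Y - f2 X / f1 X =
    (h2 Y - f2 X) / h1 Y - f2 X * (h1 Y - f1 X) / (f1 X * h1 Y).
    by field; rewrite !gt_eqF.
  rewrite (le_trans (ler_normB _ _))// /N1 [leRHS]mulrDl; apply: lerD.
    rewrite [leRHS]mulrAC normrM normfV (gtr0_norm h10); apply: ler_pM => //.
      by rewrite invr_ge0 ltW.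
    by rewrite lef_pV2 ?posrE.
  rewrite !normrM normfV normrM (gtr0_norm f10) (gtr0_norm h10).
  have -> : M * (1 + M * E) / c ^+ 2 * d = M * ((1 + M * E) * d) / (c * c).
    by field; rewrite gt_eqF.
  apply: ler_pM; [by rewrite mulr_ge0|by rewrite invr_ge0 mulr_ge0// ltW| |].
    by apply: ler_pM.
  by rewrite lef_pV2 ?posrE ?(mulr_gt0 f10 h10) ?(mulr_gt0 c0 c0)//; apply: ler_pM => //; exact: ltW.
have D2 : `|f2 X / f1 X| <= M / c.
  rewrite normrM normfV (gtr0_norm f10); apply: ler_pM => //; first by rewrite invr_ge0 ltW.
  by rewrite lef_pV2 ?posrE.
have D3 : ph j <= (K5 + T) * gf j.
  have /ler_normlP[_ A'] := A.
  have B1' : pf j <= T * gf j := B1.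
  have : K5 * d * gf j <= K5 * 1 * gf j.
    by apply: ler_wpM2r; [exact: ltW|exact: ler_wpM2l].
  by lra.
have -> : itn h h1 h2 j y + h2 Y / h1 Y * ph j - (itn f f1 f2 j x + f2 X / f1 X * pf j) =
  (itn h h1 h2 j y - itn f f1 f2 j x) + ((h2 Y / h1 Y - f2 X / f1 X) * ph j
   + f2 X / f1 X * (ph j - pf j)) by ring.
rewrite (le_trans (ler_normD _ _))//.
have L1 : `|(h2 Y / h1 Y - f2 X / f1 X) * ph j| <= N1 * d * ((K5 + T) * gf j).
  by rewrite normrM (gtr0_norm ph0); apply: ler_pM => //; exact: ltW.
have L2 : `|f2 X / f1 X * (ph j - pf j)| <= M / c * (K5 * d * gf j).
  by rewrite normrM; apply: ler_pM.
have L3 := ler_normD ((h2 Y / h1 Y - f2 X / f1 X) * ph j) (f2 X / f1 X * (ph j - pf j)).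
have -> : K6 * d * (x - f X) = K6 * d * (x - X) + (N1 * (K5 + T) + M / c * K5) * d * gf j.
  by rewrite /K6 /gf -/X; ring.
rewrite -/X in IH.
by lra.
Qed.

Hypothesis a0 : (0 < a)%N.
Let M2 := M + M.
Let J1 := (1 + M * E) * (T * M) + M * (K5 * M).
Let B1 := M * (T * M).
Let Bn := M / c * T * M2.
Definition jet1_const := J1.
Definition jet2_const := J1 * Bn + B1 * (K6 * M2).

Lemma it1_end : `|it1 h h1 a y - it1 f f1 a x| <= jet1_const * d.
Proof.
rewrite -/(ph a) -/(pf a) /jet1_const.
have [j ja] : exists j, a = j.+1 by exists a.-1; rewrite prednK.
have ja' : (j < a)%N by rewrite ja.
have A := it1_matched ja'; have B2 := it1_gap P c0 c1 M1 xlu x0 ja'.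
have pf0 := it1_gt0 P c0 xlu (ltnW ja').
have C1 := matched_f1 (xlu ja') (ylu ja') (mat ja').
have /andP[H1 H2] := ps_f1 Q (ylu ja').
have G : gf j <= M := ps_gap P (xlu ja').
rewrite /ph /pf ja /= -/(pf j) -/(ph j) -/(gf j) in A B2 pf0 *.
move: C1 H1 H2; set X := iter j f x; set Y := iter j h y => C1 H1 H2.
have -> : h1 Y * ph j - f1 X * pf j = (h1 Y - f1 X) * pf j + h1 Y * (ph j - pf j) by ring.
rewrite (le_trans (ler_normD _ _))// [X in X + _]normrM [X in _ + X]normrM (gtr0_norm pf0).
have L1 : `|h1 Y - f1 X| * pf j <= (1 + M * E) * d * (T * M).
  apply: ler_pM => //; first exact: ltW.
  by apply: le_trans B2 _; exact: ler_wpM2l.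
have L2 : `|h1 Y| * `|ph j - pf j| <= M * (K5 * d * M).
  apply: ler_pM => //; first by rewrite ger0_norm// (le_trans _ H1)// ltW.
  by apply: le_trans A _; apply: ler_wpM2l => //; exact: mulr_ge0.
by rewrite /J1; lra.
Qed.

Lemma it2_end : `|it2 h h1 h2 a y - it2 f f1 f2 a x| <= jet2_const * d.
Proof.
rewrite /jet2_const.
have nzf i : (i < a)%N -> f1 (iter i f x) != 0.
  by move=> /xlu /(ps_f1 P) /andP[? _]; rewrite gt_eqF// (lt_le_trans c0).
have nzh i : (i < a)%N -> h1 (iter i h y) != 0.
  by move=> /ylu /(ps_f1 Q) /andP[? _]; rewrite gt_eqF// (lt_le_trans c0).
rewrite !it2E// -/(pf a) -/(ph a) -/(nf a) -/(nh a).
have A : `|ph a - pf a| <= J1 * d := it1_end; have B := itn_matched (leqnn a).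
have pf0 : 0 < pf a := it1_gt0 P c0 xlu (leqnn a).
have pf1 : pf a <= B1 := it1_le P c0 c1 M1 xlu x0 a0.
have nn : `|nh a| <= Bn.
  apply: le_trans (itn_le Q c0 c1 M1 ylu y0 (leqnn a)) _.
  apply: ler_wpM2l; last exact (orbit_len Q M1 ylu (leqnn a)).
  by rewrite mulr_ge0// divr_ge0// ltW.
have K60 : 0 <= K6.
  apply: addr_ge0; apply: mulr_ge0 => //; first exact: addr_ge0.
  by rewrite divr_ge0// ltW.
have -> : ph a * nh a - pf a * nf a = (ph a - pf a) * nh a + pf a * (nh a - nf a) by ring.
rewrite (le_trans (ler_normD _ _))// [X in X + _]normrM [X in _ + X]normrM (gtr0_norm pf0).
have L1 : `|ph a - pf a| * `|nh a| <= J1 * d * Bn by apply: ler_pM.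
have L2 : pf a * `|nh a - nf a| <= B1 * (K6 * d * M2).
  apply: ler_pM => //; first exact: ltW.
  apply: le_trans B _; apply: ler_wpM2l; first exact: mulr_ge0.
  exact (orbit_len P M1 xlu (leqnn a)).
by lra.
Qed.

End orbits.
End two_jets.

Section passage_jets.
Variable R : realType.

(** Closeness of orbits and of relative gaps is inherited by the 2-jets of the
    iterates, uniformly in the number of steps, since these are expressed by
    sums of terms of the order of the gap. *)
Lemma passage_jets (c M : R) : 0 < c -> c <= 1 -> 1 <= M ->
  exists C d0 : R, [/\ 1 <= C, 0 < d0 &
  forall l u d (f f1 f2 h h1 h2 : R -> R) (a : nat) (x y : R),
  0 < d -> d <= d0 -> (0 < a)%N ->
  passage c M l u f f1 f2 -> passage c M l u h h1 h2 ->
  close_on l u d f f1 f2 h h1 h2 ->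
  transit l u (pass_gap c M) d f h a x y ->
  `|it1 h h1 a y - it1 f f1 a x| <= C * d /\
  `|it2 h h1 h2 a y - it2 f f1 f2 a x| <= C * d].
Proof.
move=> c0 c1 M1; have [E [e0 [E1 e00 e01 H]]] := passage_orbits c0 c1 M1.
exists (1 + (`|jet1_const c M E| + `|jet2_const c M E|)), e0; split=> //.
  by rewrite lerDl addr_ge0.
move=> l u d f f1 f2 h h1 h2 a x y dp de a0 P Q cl T.
have mat j : (j < a)%N -> matched E d f h (iter j f x) (iter j h y).
  by move=> ja; apply: H de P Q cl T j ja.
have d1 : d <= 1 by exact: le_trans de e01.
have xlu := tr_x T; have ylu := tr_y T.
have A := it1_end P Q cl c0 c1 M1 E1 (ltW dp) d1 xlu ylu (tr_x0 T) (tr_y0 T) mat a0.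
have B := it2_end P Q cl c0 c1 M1 E1 (ltW dp) d1 xlu ylu (tr_x0 T) (tr_y0 T) mat a0.
split; [apply: le_trans A _|apply: le_trans B _]; apply: ler_wpM2r (ltW dp) _ _ _.
  by apply: le_trans (ler_norm _) _; rewrite addrCA lerDl addr_ge0.
by apply: le_trans (ler_norm _) _; rewrite addrA lerDr addr_ge0.
Qed.
End passage_jets.

(** * Rotation numbers *)

Section continued_fractions.
Variable R : realType.
Implicit Type al : nat -> nat.

Definition cf al (n : nat) : R := cfrac R (mkseq al n).

Lemma cf0 al : cf al 0 = 0. Proof. by []. Qed.

Lemma cfS al n : cf al n.+1 = ((al 0)%:R + cf (fun j => al j.+1) n)^-1.
Proof.
rewrite /cf /mkseq /=; congr (_ + cfrac R _)^-1.
by rewrite -[1%N]addn0 iotaDl -map_comp; apply: eq_map => i.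
Qed.

Lemma cf_bd al n : (forall j, 0 < al j)%N -> 0 <= cf al n <= 1.
Proof.
elim: n al => [|n IH] al H; first by rewrite cf0 lexx ler01.
rewrite cfS; have /andP[A _] := IH (fun j => al j.+1) (fun j => H j.+1).
have a1 : 1 <= (al 0)%:R :> R by rewrite ler1n.
rewrite invr_ge0 addr_ge0//=; rewrite invf_le1; last by lra.
by lra.
Qed.

(** Two steps of the Gauss map contract uniformly; this gives convergence of
    continued fractions. *)
Lemma cf_contract (p q s t : R) : 1 <= p -> 1 <= q -> 0 <= s -> 0 <= t ->
  `|(p + (q + s)^-1)^-1 - (p + (q + t)^-1)^-1| <= 4^-1 * `|s - t|.
Proof.
move=> p1 q1 s0 t0.
have A : (p * (q + s) + 1) * (p * (q + t) + 1) >= 2 * 2.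
  have H r : 0 <= r -> 2 <= p * (q + r) + 1.
    by move=> r0; have : 1 * 1 <= p * (q + r) by [apply: ler_pM; lra]; lra.
  by apply: ler_pM (H _ s0) (H _ t0).
have B r : 0 <= r -> p * (q + r) + 1 != 0.
  move=> r0; apply: lt0r_neq0.
  by have : 0 < p * (q + r) by [apply: mulr_gt0; lra]; lra.
have qs : q + s != 0 by apply: lt0r_neq0; lra.
have qt : q + t != 0 by apply: lt0r_neq0; lra.
have -> : (p + (q + s)^-1)^-1 - (p + (q + t)^-1)^-1 =
  (s - t) / ((p * (q + s) + 1) * (p * (q + t) + 1)).
  by field; rewrite ?B// qs qt.
rewrite normrM mulrC; apply: ler_pM => //.
rewrite normfV ger0_norm; last by lra.
by rewrite lef_pV2 ?posrE; lra.
Qed.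

Lemma cf_cauchy k n m al : (forall j, 0 < al j)%N ->
  (2 * k <= n)%N -> (2 * k <= m)%N -> `|cf al n - cf al m| <= 4^-1 ^+ k.
Proof.
elim: k n m al => [|k IH] n m al H kn km.
  have /andP[? ?] := cf_bd n H; have /andP[? ?] := cf_bd m H.
  by rewrite expr0 ler_norml; apply/andP; split; lra.
case: n kn => [|[|n]] kn; [by rewrite mulnS in kn|by rewrite mulnS in kn|].
case: m km => [|[|m]] km; [by rewrite mulnS in km|by rewrite mulnS in km|].
rewrite !cfS; pose al2 j := al j.+2.
have H2 j : (0 < al2 j)%N by exact: H.
have /andP[? _] := cf_bd n H2; have /andP[? _] := cf_bd m H2.
have -> : cf (fun j => al j.+2) n = cf al2 n by [].
apply: le_trans (cf_contract _ _ _ _) _ => //; rewrite ?ler1n//.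
rewrite exprS ler_pM2l ?invr_gt0//; apply: IH => //.
  by move: kn; rewrite mulnS !ltnS.
by move: km; rewrite mulnS !ltnS.
Qed.

Lemma cf_cvg al : (forall j, 0 < al j)%N -> cvg (cf al @ \oo).
Proof.
move=> H; apply/cauchy_cvgP; apply: cauchy_exP => e e0.
have [k ke] : exists k, (4^-1 : R) ^+ k < e.
  have c4 : `|4^-1 : R| < 1 by rewrite ger0_norm ?invr_ge0// invf_lt1// ltr1n.
  have /cvgrPdist_lt/(_ e e0) [k _ Hk] := cvg_expr c4.
  exists k; have := Hk k (leqnn k); rewrite /= sub0r normrN; exact: le_lt_trans (ler_norm _).
exists (cf al (2 * k)%N); exists (2 * k)%N => // n /= kn.
by rewrite /ball/=; apply: le_lt_trans ke; exact: cf_cauchy.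
Qed.

Definition cf_lim al : R := lim (cf al @ \oo).

Lemma cf_lim_ge0 al : (forall j, 0 < al j)%N -> 0 <= cf_lim al.
Proof.
move=> H; apply: limr_ge; first exact: cf_cvg.
by apply: nearW => n; have /andP[] := cf_bd n H.
Qed.

Lemma cf_limS al : (forall j, 0 < al j)%N ->
  cf_lim al = ((al 0)%:R + cf_lim (fun j => al j.+1))^-1.
Proof.
move=> H; pose be j := al j.+1.
have Hb j : (0 < be j)%N by exact: H.
have L0 := cf_lim_ge0 Hb.
have a1 : 1 <= (al 0)%:R :> R by rewrite ler1n.
have S : (fun n => ((al 0)%:R + cf be n)^-1) @ \oo --> ((al 0)%:R + cf_lim be)^-1.
  apply: cvgV; first by apply: lt0r_neq0; lra.
  apply: cvgD; first exact: cvg_cst.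
  exact: cf_cvg Hb.
apply/cvg_lim => //; rewrite -cvg_shiftS; apply: cvg_trans S.
by apply: near_eq_cvg; apply: nearW => n; rewrite /= cfS.
Qed.

End continued_fractions.

Section tracking.
Variable R : realType.
Implicit Types (z : cpair R) (A phi psi : R -> R) (a m n : nat).

(** In the coordinate A the pair is the restriction of a pair of commuting
   increasing maps of the line. *)
Record tracks A z phi psi : Prop := Tracks {
  tk_e : eta_ z 0 < 0;
  tk_s : 0 < xi_ z 0;
  tk_A0 : A 0 = 0;
  tk_incr : forall x y, eta_ z 0 <= x -> x < y -> y <= xi_ z 0 -> A x < A y;
  tk_eta : forall x, 0 <= x <= xi_ z 0 ->
    eta_ z 0 <= eta_ z x <= xi_ z 0 /\ A (eta_ z x) = phi (A x);
  tk_xi : forall x, eta_ z 0 <= x <= 0 ->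
    eta_ z 0 <= xi_ z x <= xi_ z 0 /\ A (xi_ z x) = psi (A x);
  tk_phi : {homo phi : x y / x < y};
  tk_psi : {homo psi : x y / x < y};
  tk_comm : forall x, phi (psi x) = psi (phi x) }.

Section one_pair.
Variables (A : R -> R) (z : cpair R) (phi psi : R -> R).
Hypothesis T : tracks A z phi psi.
Let e := eta_ z 0.
Let s := xi_ z 0.

Lemma tk_le x y : e <= x <= s -> e <= y <= s -> (A x <= A y) = (x <= y).
Proof.
move=> /andP[ex xs] /andP[ey ys]; apply/idP/idP.
  by rewrite leNgt => H; rewrite leNgt; apply: contra H => yx; exact: (tk_incr T).
rewrite le_eqVlt => /predU1P[-> //|xy]; exact/ltW/(tk_incr T).
Qed.

Let e0 : e < 0. Proof. exact (tk_e T). Qed.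
Let s0 : 0 < s. Proof. exact (tk_s T). Qed.
Let in0 : e <= 0 <= s. Proof. by rewrite (ltW e0) (ltW s0). Qed.

Lemma tk_eta_homo x y : 0 <= x -> x <= y -> y <= s -> eta_ z x <= eta_ z y.
Proof.
move=> x0; rewrite le_eqVlt => /predU1P[-> //|xy] ys.
have ys' : 0 <= y <= s by rewrite ys (le_trans x0 (ltW xy)).
have xs' : 0 <= x <= s by rewrite x0 (le_trans (ltW xy) ys).
have [A1 A2] := tk_eta T ys'; have [B1 B2] := tk_eta T xs'.
rewrite -tk_le// A2 B2; apply/ltW/(tk_phi T)/(tk_incr T) => //.
exact: le_trans (ltW e0) x0.
Qed.

Lemma tk_xi_homo x y : e <= x -> x <= y -> y <= 0 -> xi_ z x <= xi_ z y.
Proof.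
move=> x0; rewrite le_eqVlt => /predU1P[-> //|xy] ys.
have ys' : e <= y <= 0 by rewrite ys (le_trans x0 (ltW xy)).
have xs' : e <= x <= 0 by rewrite x0 (le_trans (ltW xy) ys).
have [A1 A2] := tk_xi T ys'; have [B1 B2] := tk_xi T xs'.
rewrite -tk_le// A2 B2; apply/ltW/(tk_psi T)/(tk_incr T) => //.
exact: le_trans ys (ltW s0).
Qed.

Lemma tk_commute0 : eta_ z s = xi_ z e.
Proof.
have s1 : 0 <= s <= s by rewrite lexx (ltW s0).
have e1 : e <= e <= 0 by rewrite lexx (ltW e0).
have z1 : (0 : R) <= (0 : R) <= s by rewrite lexx (ltW s0).
have z2 : e <= (0 : R) <= (0 : R) by rewrite lexx (ltW e0).
have [A1 A2] := tk_eta T s1; have [B1 B2] := tk_xi T e1.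
have [_ C2] := tk_eta T z1; have [_ D2] := tk_xi T z2.
have E : A (eta_ z s) = A (xi_ z e) by rewrite A2 B2 C2 D2 (tk_comm T).
by apply/eqP; rewrite eq_le -(tk_le A1 B1) -(tk_le B1 A1) E lexx.
Qed.

End one_pair.

Lemma iter_comm (f g : R -> R) : (forall x, f (g x) = g (f x)) ->
  forall n x, f (iter n g x) = iter n g (f x).
Proof. by move=> H; elim=> [//|n IH] x; rewrite !iterS H IH. Qed.

Lemma iter_homo (f : R -> R) n : {homo f : x y / x < y} ->
  {homo iter n f : x y / x < y}.
Proof. by move=> H x y xy; elim: n => [//|n IH]; rewrite !iterS; exact: H. Qed.

Lemma iter_homoW (f : R -> R) n : {homo f : x y / x < y} ->
  {homo iter n f : x y / x <= y}.
Proof.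
by move=> H x y; rewrite le_eqVlt => /predU1P[-> //|xy]; exact/ltW/iter_homo.
Qed.

Lemma period_is_period z a : period z = Some a -> is_period z a.
Proof.
rewrite /period; case: xgetP => // _ -> [b Hb <-] [<-]; exact: Hb.
Qed.

Lemma renormalizableP z : renormalizable z -> exists2 a, period z = Some a & is_period z a.
Proof.
rewrite /renormalizable; case E : (period z) => [a|]// _.
by exists a => //; exact: period_is_period.
Qed.

Lemma inf_renormS z : infinitely_renormalizable z -> infinitely_renormalizable (renorm z).
Proof. by move=> H j; rewrite -iterSr; exact: H. Qed.

(** One renormalization step when (xi o eta)(0) lies in the domain of eta. *)
Lemma tracks_renorm_eta A z phi psi : tracks A z phi psi ->
  infinitely_renormalizable z -> eta_side z ->
  exists a, [/\ period z = Some a, (0 < a)%N,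
    tracks (fun x => A (- eta_ z 0 * x)) (renorm z) phi (iter a phi \o psi) &
    eta_side (renorm z) = false].
Proof.
move=> T inf side; have [a pa] := renormalizableP (inf 0).
rewrite /is_period side => -[dom ex].
set e := eta_ z 0 in T *; set s := xi_ z 0 in dom ex *.
have e0 : e < 0 := tk_e T; have s0 : 0 < s := tk_s T.
have la0 : 0 < - e by rewrite oppr_gt0.
pose x_ i := iter i (eta_ z) s.
have xi0 i : (i <= a)%N -> 0 <= x_ i <= s.
  by move=> /dom; rewrite /dom_eta /= in_itv.
have x1 : x_ 1 = xi_ z e := tk_commute0 T.
have a0 : (0 < a)%N.
  case: (posnP a) => // a0; move: ex side.
  by rewrite a0 /eta_side -/e -x1 /= => ex'; rewrite leNgt ex'.
have orb i v : (i <= a)%N -> x_ 1 <= v <= s -> x_ i.+1 <= iter i (eta_ z) v <= x_ i.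
  elim: i => [//|i IH] ia vx; have /andP[B1 B2] := IH (ltnW ia) vx.
  have /andP[C1 C2] := xi0 _ (ltnW ia); have /andP[D1 D2] := xi0 _ ia.
  rewrite /x_ 3!iterS -/(x_ i) -/(x_ i.+1); apply/andP; split; apply: (tk_eta_homo T) => //.
    exact: le_trans B2 C2.
  exact: le_trans D1 B1.
have orbA i v : (i <= a)%N -> x_ 1 <= v <= s -> A (iter i (eta_ z) v) = iter i phi (A v).
  elim: i => [//|i IH] ia vx; rewrite !iterS -IH 1?ltnW//.
  have /andP[B1 B2] := orb i v (ltnW ia) vx.
  have /andP[C1 C2] := xi0 _ (ltnW ia); have /andP[D1 D2] := xi0 _ ia.
  apply: (tk_eta T _).2; rewrite -/s (le_trans D1 B1)/=; exact: le_trans B2 C2.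
have vx y : e <= y <= 0 -> x_ 1 <= xi_ z y <= s.
  move=> /andP[ey y0]; rewrite x1; apply/andP; split; apply: (tk_xi_homo T) => //.
have xa1 : x_ a.+1 < 0 := ex.
have rE : renorm z = CPair (fun x => eta_ z (- e * x) / - e)
                           (fun x => iter a (eta_ z) (xi_ z (- e * x)) / - e).
  by rewrite /renorm /prerenorm pa side.
have mxl y : -1 <= y -> e <= - e * y.
  move=> y1; rewrite -subr_ge0 (_ : _ - _ = - e * (y + 1)); last by ring.
  by rewrite mulr_ge0 ?(ltW la0)// -lerBlDr sub0r.
have mx y : -1 <= y <= 0 -> e <= - e * y <= 0.
  by move=> /andP[y1 y0]; rewrite mxl//= pmulr_rle0.
have Rxi y : -1 <= y <= 0 -> x_ a.+1 / - e <= xi_ (renorm z) y <= x_ a / - e.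
  move=> /mx yy; rewrite rE /= !ler_pM2r ?invr_gt0//; apply: orb => //; exact: vx.
have e'E : eta_ (renorm z) 0 = -1.
  by rewrite rE /= mulr0 -/e; field; rewrite lt_eqF.
have s'E : xi_ (renorm z) 0 = x_ a / - e by rewrite rE /= mulr0.
have r1E : xi_ (renorm z) (-1) = x_ a.+1 / - e.
  by rewrite rE /= mulrN1 opprK -x1 -iterSr.
have xa0 : 0 < x_ a.
  have /andP[xa _] := xi0 _ (leqnn a); rewrite lt_neqAle xa andbT; apply/eqP => xaz.
  have [b _] : exists2 b, period (renorm z) = Some b & is_period (renorm z) b.
    exact: renormalizableP (inf 1%N).
  rewrite /is_period /eta_side e'E r1E.
  rewrite [X in X && _]leNgt pmulr_llt0 ?invr_gt0// xa1 andFb => -[+ H].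
  move=> /(_ b (leqnn b)); rewrite /dom_xi e'E set_itvE => wb.
  move: H; rewrite ltNge => /negP; apply.
  by have /andP[_] := Rxi _ wb; rewrite -xaz mul0r.
exists a; split=> //; last first.
  by rewrite /eta_side e'E r1E [X in X && _]leNgt pmulr_llt0 ?invr_gt0// xa1.
have xas : x_ a <= s by have /andP[] := xi0 _ (leqnn a).
have mx' y : 0 <= y <= x_ a / - e -> 0 <= - e * y <= x_ a.
  move=> /andP[y0]; rewrite ler_pdivlMr// => ya.
  by rewrite mulr_ge0 ?(ltW la0)//= mulrC.
split.
- by rewrite e'E ltrN10.
- by rewrite s'E divr_gt0.
- by rewrite mulr0 (tk_A0 T).
- move=> x y; rewrite e'E s'E => x1' xy ys; apply: (tk_incr T).
  + exact: mxl.
  + by rewrite ltr_pM2l.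
  + by apply: le_trans xas; move: ys; rewrite ler_pdivlMr// mulrC.
- move=> x; rewrite s'E e'E => /mx' /andP[y0 ya].
  have ys : 0 <= - e * x <= s by rewrite y0 (le_trans ya).
  have [/andP[B1 B2] B3] := tk_eta T ys; rewrite rE /=.
  rewrite mulrCA divff ?mulr1 ?gt_eqF//; split=> //.
  rewrite ler_pdivlMr// mulN1r opprK B1 ler_pM2r ?invr_gt0//=.
  apply: le_trans (ltW xa0); apply: le_trans (ltW xa1); rewrite /x_ iterS.
  exact: (tk_eta_homo T).
- move=> x; rewrite s'E e'E => xx; have /andP[B1 B2] := Rxi _ xx; split.
    rewrite B2 andbT; apply: le_trans B1; rewrite ler_pdivlMr// mulN1r opprK.
    by have [/andP[]] := tk_eta T (xi0 _ (leqnn a)).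
  rewrite rE /= mulrCA divff ?mulr1 ?gt_eqF//.
  by rewrite orbA ?vx ?mx//; congr iter; apply: (tk_xi T _).2; exact: mx.
- exact: tk_phi T.
- by move=> x y xy; apply: (iter_homo _ (tk_phi T)); exact: (tk_psi T).
- by move=> x /=; rewrite (iter_comm (f := phi) (g := phi))// (tk_comm T).
Qed.

(** One renormalization step when (xi o eta)(0) lies in the domain of xi. *)
Lemma tracks_renorm_xi A z phi psi : tracks A z phi psi ->
  infinitely_renormalizable z -> eta_side z = false ->
  exists a, [/\ period z = Some a, (0 < a)%N,
    tracks (fun x => A (- iter a (xi_ z) (eta_ z 0) * x)) (renorm z)
      (iter a psi \o phi) psi &
    eta_side (renorm z)].
Proof.
move=> T inf side; have [a pa] := renormalizableP (inf 0).
rewrite /is_period side => -[dom ex].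
set e := eta_ z 0 in T dom ex *; set s := xi_ z 0 in T *.
have e0 : e < 0 := tk_e T; have s0 : 0 < s := tk_s T.
pose y_ i := iter i (xi_ z) e.
have yi0 i : (i <= a)%N -> e <= y_ i <= 0.
  by move=> /dom; rewrite /dom_xi /= in_itv.
have y1 : y_ 1 = eta_ z s by rewrite (tk_commute0 T).
have y1s : y_ 1 <= s.
  have ee : e <= e <= 0 by rewrite lexx (ltW e0).
  by have [/andP[]] := tk_xi T ee.
have y10 : y_ 1 < 0.
  move: side; rewrite /eta_side -/e -/s; rewrite -/(y_ 1) y1s andbT => /negbT.
  by rewrite -ltNge.
have a0 : (0 < a)%N.
  case: (posnP a) => // a0; move: ex; rewrite a0 -/(y_ 1) => ex'.
  by move: y10; rewrite ltNge (ltW ex').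
have orb i v : (i <= a)%N -> e <= v <= y_ 1 -> y_ i <= iter i (xi_ z) v <= y_ i.+1.
  elim: i => [//|i IH] ia vx; have /andP[B1 B2] := IH (ltnW ia) vx.
  have /andP[C1 C2] := yi0 _ (ltnW ia); have /andP[D1 D2] := yi0 _ ia.
  rewrite /y_ 3!iterS -/(y_ i) -/(y_ i.+1); apply/andP; split; apply: (tk_xi_homo T) => //.
    exact: le_trans B2 D2.
  exact: le_trans C1 B1.
have orbA i v : (i <= a)%N -> e <= v <= y_ 1 -> A (iter i (xi_ z) v) = iter i psi (A v).
  elim: i => [//|i IH] ia vx; rewrite !iterS -IH 1?ltnW//.
  have /andP[B1 B2] := orb i v (ltnW ia) vx.
  have /andP[C1 C2] := yi0 _ (ltnW ia); have /andP[D1 D2] := yi0 _ ia.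
  apply: (tk_xi T _).2; rewrite (le_trans C1 B1)/=; exact: le_trans B2 D2.
have vx y : 0 <= y <= s -> e <= eta_ z y <= y_ 1.
  move=> /andP[y0' ys]; rewrite y1; apply/andP; split; apply: (tk_eta_homo T) => //.
have ya1 : 0 < y_ a.+1 := ex.
pose la := - y_ a.
have rE : renorm z = CPair (fun x => iter a (xi_ z) (eta_ z (la * x)) / la)
                           (fun x => xi_ z (la * x) / la).
  by rewrite /renorm /prerenorm pa side.
have ya0 : y_ a < 0.
  have /andP[_ ya] := yi0 _ (leqnn a); rewrite lt_neqAle ya andbT; apply/eqP => yaz.
  have [b _] : exists2 b, period (renorm z) = Some b & is_period (renorm z) b.
    exact: renormalizableP (inf 1%N).
  have rz : renorm z = CPair (fun=> 0) (fun=> 0).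
    by rewrite rE /la yaz oppr0 invr0; congr CPair; apply/funext => t; rewrite mulr0.
  rewrite /is_period rz /eta_side /= lexx /= => -[_].
  by rewrite ltxx.
have la0 : 0 < la by rewrite oppr_gt0.
have e'E : eta_ (renorm z) 0 = -1.
  by rewrite rE /= mulr0 -/e -/(y_ a) /la; field; rewrite lt_eqF.
have s'E : xi_ (renorm z) 0 = s / la by rewrite rE /= mulr0.
have mx y : 0 <= y <= s / la -> 0 <= la * y <= s.
  move=> /andP[y0']; rewrite ler_pdivlMr// => ya.
  by rewrite mulr_ge0 ?(ltW la0)//= mulrC.
have Reta y : 0 <= y <= s / la -> -1 <= eta_ (renorm z) y <= y_ a.+1 / la.
  move=> /mx yy; rewrite rE /= ler_pdivlMr// mulN1r opprK ler_pM2r ?invr_gt0//.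
  by apply: orb => //; exact: vx.
have r1E : xi_ (renorm z) (-1) = y_ a.+1 / la.
  by rewrite rE /= mulrN1 opprK.
have yas : y_ a.+1 <= s.
  have [/andP[_ H] _] := tk_xi T (yi0 _ (leqnn a)); exact: H.
have ea : e <= y_ a by have /andP[] := yi0 _ (leqnn a).
have mx' y : -1 <= y <= 0 -> y_ a <= la * y <= 0.
  move=> /andP[ya yb]; rewrite pmulr_rle0// yb andbT -subr_ge0.
  rewrite (_ : _ - _ = la * (y + 1)); last by rewrite /la; ring.
  by rewrite mulr_ge0 ?(ltW la0)// -lerBlDr sub0r.
exists a; split=> //; last first.
  by rewrite /eta_side e'E r1E s'E divr_ge0 ?(ltW ya1) ?(ltW la0)//= ler_pM2r ?invr_gt0.
split.
- by rewrite e'E ltrN10.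
- by rewrite s'E divr_gt0.
- by rewrite mulr0 (tk_A0 T).
- move=> x y; rewrite e'E s'E => x1' xy ys; apply: (tk_incr T).
  + have [x0|x0] := leP x 0.
      by have /andP[+ _] := mx' x ltac:(by rewrite x1'); exact: le_trans ea.
    by apply: le_trans (ltW e0) _; rewrite mulr_ge0// ltW.
  + by rewrite ltr_pM2l.
  + by move: ys; rewrite ler_pdivlMr// mulrC.
- move=> x; rewrite s'E e'E => xx; have /andP[B1 B2] := Reta _ xx; split.
    rewrite B1 /=; apply: le_trans B2 _; by rewrite ler_pM2r ?invr_gt0.
  rewrite rE /= mulrCA divff ?mulr1 ?gt_eqF//.
  by rewrite orbA ?vx ?mx//; congr iter; apply: (tk_eta T _).2; exact: mx.
- move=> x; rewrite s'E e'E => /mx' /andP[ya yb].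
  have ys : e <= la * x <= 0 by rewrite yb (le_trans ea).
  have [/andP[B1 B2] B3] := tk_xi T ys; rewrite rE /=.
  rewrite mulrCA divff ?mulr1 ?gt_eqF//; split=> //.
  rewrite ler_pdivlMr// mulN1r opprK ler_pM2r ?invr_gt0// B2 andbT.
  apply: le_trans (ltW ya0) _; apply: le_trans (ltW ya1) _; rewrite /y_ iterS.
  exact: (tk_xi_homo T).
- by move=> x y xy; apply: (iter_homo _ (tk_psi T)); exact: (tk_phi T).
- exact: tk_psi T.
- by move=> x /=; rewrite (tk_comm T) (iter_comm (f := psi) (g := psi)).
Qed.

Lemma tk_phi_lt0 A z phi psi k : tracks A z phi psi -> (0 < k)%N -> iter k phi 0 < 0.
Proof.
move=> T; have phi0 : phi 0 < 0.
  have z1 : 0 <= (0 : R) <= xi_ z 0 by apply/andP; split=> //; exact/ltW/(tk_s T).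
  have [_] := tk_eta T z1; rewrite (tk_A0 T) => <-.
  by have := tk_incr T (lexx _) (tk_e T) (ltW (tk_s T)); rewrite (tk_A0 T).
elim: k => [//|[|k] IHk] _ //; rewrite iterS; apply: lt_trans phi0.
by apply: (tk_phi T); exact: IHk.
Qed.

Lemma tk_psi_gt0 A z phi psi k : tracks A z phi psi -> (0 < k)%N -> 0 < iter k psi 0.
Proof.
move=> T; have psi0 : 0 < psi 0.
  have z2 : eta_ z 0 <= (0 : R) <= 0 by apply/andP; split=> //; exact/ltW/(tk_e T).
  have [_] := tk_xi T z2; rewrite (tk_A0 T) => <-.
  by have := tk_incr T (ltW (tk_e T)) (tk_s T) (lexx _); rewrite (tk_A0 T).
elim: k => [//|[|k] IHk] _ //; rewrite iterS; apply: lt_trans psi0 _.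
by apply: (tk_psi T); exact: IHk.
Qed.

Lemma iter_comm2 (f g : R -> R) j k x : (forall x, f (g x) = g (f x)) ->
  iter j f (iter k g x) = iter k g (iter j f x).
Proof.
by move=> H; apply: iter_comm => y; rewrite (iter_comm (f := g)).
Qed.

Lemma iter_mix (f g : R -> R) a k x : (forall x, f (g x) = g (f x)) ->
  iter k (iter a f \o g) x = iter (a * k) f (iter k g x).
Proof.
move=> H; elim: k => [|k IHk]; first by rewrite muln0.
rewrite iterS IHk /= mulnS iterD; congr (iter a f _).
by rewrite (iter_comm (f := g)).
Qed.

Lemma tracks_period_gt0 A z phi psi : tracks A z phi psi ->
  infinitely_renormalizable z ->
  forall j, (0 < odflt 0 (period (iter j (@renorm R) z)))%N.
Proof.
move=> T inf j; elim: j A z phi psi T inf => [|j IH] A z phi psi T inf.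
  have [side|/negbTE side] := boolP (eta_side z).
    by have [a [-> a0 _ _]] := tracks_renorm_eta T inf side.
  by have [a [-> a0 _ _]] := tracks_renorm_xi T inf side.
rewrite iterSr; have inf' := inf_renormS inf.
have [side|/negbTE side] := boolP (eta_side z).
  by have [a [_ _ T' _]] := tracks_renorm_eta T inf side; exact: IH T' inf'.
by have [a [_ _ T' _]] := tracks_renorm_xi T inf side; exact: IH T' inf'.
Qed.

Lemma rotation_numberE z :
  rotation_number z = cf_lim R (fun j => odflt 0 (period (iter j (@renorm R) z))).
Proof. by []. Qed.

Lemma rotation_number_renorm A z phi psi : tracks A z phi psi ->
  infinitely_renormalizable z -> 0 <= rotation_number (renorm z) /\
  rotation_number z = ((odflt 0 (period z))%:R + rotation_number (renorm z))^-1.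
Proof.
move=> T inf; have H := tracks_period_gt0 T inf.
have E : rotation_number (renorm z) =
    cf_lim R (fun j => odflt 0 (period (iter j.+1 (@renorm R) z))).
  by rewrite rotation_numberE; congr cf_lim; apply/funext => j; rewrite iterSr.
rewrite E; split; first by apply: cf_lim_ge0 => j; exact: H.
by rewrite rotation_numberE (cf_limS R H).
Qed.

(** Euclid's algorithm: a renormalization step is a change of basis of the
   action of Z^2 generated by phi and psi, and a continued fraction step for
   the slope. *)
Lemma sign_tracks N m n A z phi psi : (m + n <= N)%N -> (0 < m + n)%N ->
  tracks A z phi psi -> infinitely_renormalizable z ->
  let rho : R := rotation_number z in
  let q := if eta_side z then n%:R - m%:R * rho else n%:R * rho - m%:R in
  (0 < q -> 0 < iter m phi (iter n psi 0)) /\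
  (q < 0 -> iter m phi (iter n psi 0) < 0).
Proof.
elim: N m n A z phi psi => [|N IH] m n A z phi psi mnN mn0 T inf rho q.
  by move: mnN; rewrite leqn0 => /eqP E; rewrite E in mn0.
have [L rhoE] := rotation_number_renorm T inf; rewrite -/rho in rhoE.
have inf' := inf_renormS inf.
have [side|/negbTE side] := boolP (eta_side z).
- have [a [pa a0 T' side']] := tracks_renorm_eta T inf side.
  rewrite pa /= in rhoE; have a1 : 1 <= a%:R :> R by rewrite ler1n.
  have den0 : 0 < a%:R + rotation_number (renorm z) by lra.
  have rho0 : 0 < rho by rewrite rhoE invr_gt0.
  have rho1 : rho * (a%:R + rotation_number (renorm z)) = 1.
    by rewrite rhoE mulVf// gt_eqF.
  rewrite /q side; have [n0|n0] := posnP n.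
    move: mn0; rewrite n0 addn0 /= => m0; split => [|_]; last exact: tk_phi_lt0 T m0.
    by rewrite sub0r oppr_gt0 ltNge mulr_ge0// ltW.
  have key : rho * (n%:R * rotation_number (renorm z) - (m%:R - a%:R * n%:R)) =
      n%:R - m%:R * rho.
    transitivity (rho * (a%:R + rotation_number (renorm z)) * n%:R - m%:R * rho); first by ring.
    by rewrite rho1 mul1r.
  have [am|am] := leqP (a * n) m.
    have nan : (n <= a * n)%N by rewrite leq_pmull.
    have := IH (m - a * n)%N n _ _ _ _ _ _ T' inf'; rewrite side'.
    rewrite (iter_mix _ _ _ (tk_comm T)) -iterD subnK// natrB// natrM -key.
    by rewrite pmulr_rgt0// pmulr_rlt0//; apply; lia.
  have qp : 0 < n%:R * rotation_number (renorm z) - (m%:R - a%:R * n%:R).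
    rewrite -natrM; have : m%:R < (a * n)%:R :> R by rewrite ltr_nat.
    have : 0 <= n%:R * rotation_number (renorm z) by rewrite mulr_ge0.
    by lra.
  rewrite -key; split => [_|]; last by rewrite pmulr_rlt0// ltNge (ltW qp).
  rewrite ltNge; apply/negP => W.
  have := tk_psi_gt0 T' n0; rewrite (iter_mix _ _ _ (tk_comm T)) ltNge => /negP; apply.
  have -> : (a * n = (a * n - m) + m)%N by rewrite subnK// ltnW.
  rewrite iterD; apply: le_trans (iter_homoW _ (tk_phi T) W) _.
  by apply: ltW; apply: tk_phi_lt0 T _; rewrite subn_gt0.
- have [a [pa a0 T' side']] := tracks_renorm_xi T inf side.
  rewrite pa /= in rhoE; have a1 : 1 <= a%:R :> R by rewrite ler1n.
  have den0 : 0 < a%:R + rotation_number (renorm z) by lra.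
  have rho0 : 0 < rho by rewrite rhoE invr_gt0.
  have rho1 : rho * (a%:R + rotation_number (renorm z)) = 1.
    by rewrite rhoE mulVf// gt_eqF.
  have comm' x : psi (phi x) = phi (psi x) by rewrite (tk_comm T).
  rewrite /q side (iter_comm2 _ _ _ (tk_comm T)); have [m0|m0] := posnP m.
    move: mn0; rewrite m0 add0n subr0 /= => n0; split => [_|]; first exact: tk_psi_gt0 T n0.
    by rewrite ltNge mulr_ge0// ltW.
  have key : rho * (n%:R - a%:R * m%:R - m%:R * rotation_number (renorm z)) =
      n%:R * rho - m%:R.
    transitivity (n%:R * rho - rho * (a%:R + rotation_number (renorm z)) * m%:R); first by ring.
    by rewrite rho1 mul1r.
  have [an|an] := leqP (a * m) n.
    have nan : (m <= a * m)%N by rewrite leq_pmull.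
    have := IH m (n - a * m)%N _ _ _ _ _ _ T' inf'; rewrite side'.
    rewrite (iter_comm2 _ _ _ (tk_comm T')).
    rewrite (iter_mix _ _ _ comm') -iterD subnK// natrB// natrM -key.
    by rewrite pmulr_rgt0// pmulr_rlt0//; apply; lia.
  have qp : n%:R - a%:R * m%:R - m%:R * rotation_number (renorm z) < 0.
    rewrite -natrM; have : n%:R < (a * m)%:R :> R by rewrite ltr_nat.
    have : 0 <= m%:R * rotation_number (renorm z) by rewrite mulr_ge0.
    by lra.
  rewrite -key; split => [|_]; first by rewrite pmulr_rgt0// ltNge (ltW qp).
  rewrite ltNge; apply/negP => W.
  have := tk_phi_lt0 T' m0; rewrite (iter_mix _ _ _ comm') ltNge => /negP; apply.
  have -> : (a * m = (a * m - n) + n)%N by rewrite subnK// ltnW.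
  rewrite iterD; apply: le_trans (iter_homoW _ (tk_psi T) W).
  by apply: ltW; apply: tk_psi_gt0 T _; rewrite subn_gt0.
Qed.

End tracking.

(** * Lifts to the line *)

Section circle_lift.
Variable R : realType.
Variables (F X : R -> R).
Hypothesis Xincr : forall x y, -1 <= x -> x < y -> y <= 0 -> X x < X y.
Hypothesis Fincr : forall x y, 0 <= x -> x < y -> y <= 1 -> F x < F y.
Hypothesis (F0 : F 0 = -1) (X0 : X 0 = 1) (FX : F 1 = X (-1)).

Let base x := if x < 0 then X x else F x + 2.

(** Gluing x to x + 2 turns the two branches into one map of the circle. *)
Definition circle_lift (x : R) : R :=
  let k : R := 2 * (Num.floor ((x + 1) / 2))%:~R in base (x - k) + k.

Let floor_ex (x : R) : exists k : int, -1 <= x - 2 * k%:~R < 1.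
Proof.
exists (Num.floor ((x + 1) / 2)); have := floor_itv ((x + 1) / 2).
by rewrite intrD => /andP[? ?]; apply/andP; split; lra.
Qed.

Lemma liftE (k : int) x : -1 <= x - 2 * k%:~R < 1 -> circle_lift x = base (x - 2 * k%:~R) + 2 * k%:~R.
Proof.
move=> /andP[? ?]; rewrite /circle_lift; have -> // : Num.floor ((x + 1) / 2) = k.
by apply: floor_def; rewrite intrD; apply/andP; split; lra.
Qed.

Lemma lift_period x : circle_lift (x + 2) = circle_lift x + 2.
Proof.
have [k Hk] := floor_ex x; rewrite (liftE Hk).
have E : x + 2 - 2 * (k + 1)%:~R = x - 2 * k%:~R by rewrite intrD; ring.
by rewrite (@liftE (k + 1)) E// intrD; ring.
Qed.

Let base_homo x y : -1 <= x -> x < y -> y < 1 -> base x < base y.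
Proof.
move=> x1 xy y1; rewrite /base; case: ifPn => x0; case: ifPn => y0.
- by apply: Xincr => //; exact: ltW.
- move: x0 y0; rewrite -leNgt => x0 y0; apply: (@lt_le_trans _ _ 1).
    by rewrite -X0; exact: Xincr.
  move: y0; rewrite le_eqVlt => /predU1P[<-|y0]; first by rewrite F0; lra.
  by have := Fincr (lexx _) y0 (ltW y1); rewrite F0; lra.
- by move: x0 y0; rewrite -leNgt; lra.
- by rewrite ltrD2r; apply: Fincr; rewrite ?leNgt// -leNgt ltW.
Qed.

Let base_bd x : -1 <= x -> x < 1 -> F 1 <= base x < F 1 + 2.
Proof.
move=> x1 x1'; rewrite /base; case: ifPn => x0.
  have A : X x < X 0 by exact: Xincr.
  have B : F 0 < F 1 by exact: Fincr.
  move: x1; rewrite le_eqVlt => /predU1P[x1|x1].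
    by rewrite -x1 -FX lexx /=; lra.
  have := Xincr (lexx _) x1 (ltW x0); rewrite -FX; rewrite F0 in B; rewrite X0 in A; lra.
move: x0; rewrite -leNgt => x0.
have A : F x < F 1 by exact: Fincr.
have C : F 1 < 1.
  by have := @Xincr (-1) 0 (lexx _) (ltrN10 R) (lexx _); rewrite X0 -FX.
move: x0; rewrite le_eqVlt => /predU1P[x0|x0].
  by move: A; rewrite -x0 F0 => ?; apply/andP; split; lra.
have := Fincr (lexx _) x0 (ltW x1'); rewrite F0; lra.
Qed.

Lemma lift_homo : {homo circle_lift : x y / x < y}.
Proof.
move=> x y xy; have [k Hk] := floor_ex x; have [l Hl] := floor_ex y.
rewrite (liftE Hk) (liftE Hl); move/andP: Hk Hl => [k1 k2] /andP[l1 l2].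
have [kl|lk|E] := ltgtP k l.
- have : k%:~R + 1 <= l%:~R :> R by rewrite -[1]/(1%:~R) -intrD ler_int lezD1.
  have /andP[_ A] := base_bd k1 k2; have /andP[B _] := base_bd l1 l2.
  by lra.
- have : l%:~R + 1 <= k%:~R :> R by rewrite -[1]/(1%:~R) -intrD ler_int lezD1.
  by lra.
- by subst l; rewrite ltrD2r; apply: base_homo => //; lra.
Qed.

Lemma lift_X x : -1 <= x <= 0 -> circle_lift x = X x.
Proof.
move=> /andP[x1 x0]; have E : x - 2 * 0%:~R = x by rewrite mulr0 subr0.
rewrite (@liftE 0) E; last by apply/andP; split; lra.
rewrite /base; case: ifPn => [_|]; first by rewrite mulr0 addr0.
rewrite -leNgt => x0'; have -> : x = 0 by apply: le_anti; rewrite x0 x0'.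
by rewrite F0 X0; ring.
Qed.

Lemma lift_F x : 0 <= x <= 1 -> circle_lift x = F x + 2.
Proof.
move=> /andP[x0]; rewrite le_eqVlt => /predU1P[->|x1].
  have E : 1 - 2 * 1%:~R = -1 :> R by ring.
  rewrite (@liftE 1) E; last by apply/andP; split; lra.
  by rewrite /base ltrN10 FX; ring.
have E : x - 2 * 0%:~R = x by rewrite mulr0 subr0.
rewrite (@liftE 0) E; last by apply/andP; split; lra.
by rewrite /base ltNge x0 /= mulr0 addr0.
Qed.

End circle_lift.

Section word_signs.
Variable R : realType.
Variables (psi : R -> R) (rho : R).
Let phi x := psi x - 2.
Hypothesis per : forall x, psi (x + 2) = psi x + 2.
Hypothesis homo : {homo psi : x y / x < y}.

(** psi and psi - 2 are the two generators of the pair; the word with m letters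
    phi and n letters psi has the sign of the translation n - m * rho. *)
Definition word_signs := forall m n : nat, (0 < m + n)%N ->
  (0 < n%:R - m%:R * rho -> 0 < iter m phi (iter n psi 0)) /\
  (n%:R - m%:R * rho < 0 -> iter m phi (iter n psi 0) < 0).

Lemma lift_comm x : phi (psi x) = psi (phi x).
Proof. by rewrite /phi -[in LHS](subrK 2 (psi x)) per addrK. Qed.

Lemma phi_homo : {homo phi : x y / x < y}.
Proof. by move=> x y xy; rewrite /phi ltrD2r; exact: homo. Qed.

Let word m n x := iter m phi (iter n psi x).

Let word_homo m n : {homo word m n : x y / x <= y}.
Proof. by move=> x y xy; apply: (iter_homoW _ phi_homo); exact: (iter_homoW _ homo). Qed.

Let word_add m n k l x : word m n (word k l x) = word (m + k) (n + l) x.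
Proof. by rewrite /word (iter_comm2 _ _ _ (fun x => esym (lift_comm x))) -!iterD. Qed.

Let word_per m n x : word m n (x + 2) = word m n x + 2.
Proof.
have H k y : iter k psi (y + 2) = iter k psi y + 2.
  by elim: k => [//|k IH]; rewrite !iterS IH per.
have H2 k y : iter k phi (y + 2) = iter k phi y + 2.
  by elim: k => [//|k IH]; rewrite !iterS IH /phi per; ring.
by rewrite /word H H2.
Qed.

Let word_pow M m n x : iter M (word m n) x = word (m * M) (n * M) x.
Proof.
elim: M => [|M IH]; first by rewrite !muln0.
by rewrite iterS IH word_add !mulnS.
Qed.

Let shift_ex (x b : R) : exists y : R, [/\ b <= y, y < b + 2 & forall m n : nat,
   word m n x - x = word m n y - y].
Proof.
have P (k : nat) m n y : word m n (y + 2 * k%:R) = word m n y + 2 * k%:R.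
  elim: k => [|k IH]; first by rewrite mulr0 !addr0.
  have -> : y + 2 * k.+1%:R = (y + 2 * k%:R) + 2 by rewrite -natr1; ring.
  by rewrite word_per IH -natr1; ring.
have P' (k : int) m n y : word m n (y + 2 * k%:~R) = word m n y + 2 * k%:~R.
  case: k => k; first exact: P.
  rewrite NegzE intrN; have := P k.+1 m n (y + 2 * - k.+1%:~R).
  have -> : y + 2 * - k.+1%:~R + 2 * k.+1%:R = y by ring.
  by move=> ->; ring.
have := floor_itv ((x - b) / 2); set k := Num.floor _ => /andP[k1 k2].
exists (x + 2 * (- k)%:~R); split.
- by rewrite intrN; lra.
- by move: k2; rewrite intrD intrN; lra.
- by move=> m n; rewrite P'; ring.
Qed.

Hypothesis S : word_signs.
Hypothesis rho0 : 0 <= rho.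

Let big (v w : R) : 0 < v -> exists2 M : nat, (0 < M)%N & w < M%:R * v.
Proof.
move=> v0; exists (Num.bound (`|w| / v)).+1 => //.
rewrite -ltr_pdivrMr//; have H : w / v <= `|w| / v.
  by rewrite ler_pM2r ?invr_gt0// ler_norm.
apply: le_lt_trans H _; apply: lt_le_trans (archi_boundP _) _.
  by rewrite divr_ge0// ltW.
by rewrite ler_nat.
Qed.

Lemma word_gt m n x : 0 < n%:R - m%:R * rho -> x < iter m phi (iter n psi x).
Proof.
move=> v0; rewrite -/(word m n x) ltNge; apply/negP => W.
have [y [y0 y2 E]] := shift_ex x 0; rewrite add0r in y2.
have {}W : word m n y <= y by rewrite -subr_le0 -E subr_le0.
have n0 : (0 < n)%N.
  rewrite lt0n; apply: contraTneq v0 => ->.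
  by rewrite sub0r oppr_gt0 -leNgt mulr_ge0.
have [M M0 HM] := big (1 + rho) v0.
have WM : word (m * M) (n * M) y <= y.
  rewrite -word_pow; elim: (M) => [//|k IH]; rewrite iterS.
  exact: le_trans (word_homo _ _ IH) W.
have [k nM] : exists k, (n * M = k.+1)%N by exists (n * M).-1; rewrite prednK// muln_gt0 n0.
have W0 : word (m * M) (n * M) 0 < 2 by apply: le_lt_trans (word_homo _ _ y0) (le_lt_trans WM y2).
have : word (m * M).+1 k 0 < 0.
  have E1 : word (m * M) k (word 1 0 0) = word (m * M).+1 k 0.
    by rewrite word_add addn1 addn0.
  have E2 : word (m * M) k (word 1 0 0 + 2) = word (m * M) (n * M) 0.
    have <- : word 0 1 0 = word 1 0 0 + 2 by rewrite /word /= /phi subrK.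
    by rewrite word_add addn1 addn0 nM.
  by rewrite word_per E1 in E2; lra.
apply/negP; rewrite -leNgt; apply: ltW; have [H _] := @S (m * M).+1 k isT; apply: H.
have E1 : (n * M)%:R = k%:R + 1 :> R by rewrite nM natr1.
rewrite natrM in E1; rewrite -natr1 natrM.
by lra.
Qed.

Lemma word_lt m n x : n%:R - m%:R * rho < 0 -> iter m phi (iter n psi x) < x.
Proof.
move=> v0; rewrite -/(word m n x) ltNge; apply/negP => W.
have [y [y0 y2 E]] := shift_ex x (-2).
have {}W : y <= word m n y by rewrite -subr_ge0 -E subr_ge0.
have m0 : (0 < m)%N.
  rewrite lt0n; apply: contraTneq v0 => ->.
  by rewrite mul0r subr0 -leNgt.
have v0' : 0 < m%:R * rho - n%:R by lra.
have [M M0 HM] := big (1 + rho) v0'.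
have WM : y <= word (m * M) (n * M) y.
  rewrite -word_pow; elim: (M) => [//|k IH]; rewrite iterS.
  exact: le_trans W (word_homo _ _ IH).
have [k mM] : exists k, (m * M = k.+1)%N by exists (m * M).-1; rewrite prednK// muln_gt0 m0.
have W0 : - 2 <= word (m * M) (n * M) 0.
  by apply: le_trans y0 (le_trans WM (word_homo _ _ _)); lra.
have : 0 <= word k (n * M).+1 0.
  have <- : word k (n * M) (word 0 1 0) = word k (n * M).+1 0.
    by rewrite word_add addn1 addn0.
  have -> : word 0 1 0 = word 1 0 0 + 2 by rewrite /word /= /phi subrK.
  have -> : word k (n * M) (word 1 0 0 + 2) = word (m * M) (n * M) 0 + 2.
    by rewrite word_per word_add addn1 addn0 mM.
  by lra.
apply/negP; rewrite -ltNge; have [_ H] := @S k (n * M).+1 ltac:(by rewrite addnS); apply: H.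
have E1 : (m * M)%:R = k%:R + 1 :> R by rewrite mM natr1.
rewrite natrM in E1; rewrite -natr1 natrM.
by have := E1; have : (k%:R + 1) * rho = m%:R * M%:R * rho; [rewrite E1|lra].
Qed.
End word_signs.

(** * Domination and rotation numbers *)

Section recurrence.
Variable R : realType.
Variables (psi : R -> R) (rho : R) (a : nat).
Let phi x := psi x - 2.
Hypothesis per : forall x, psi (x + 2) = psi x + 2.
Hypothesis homo : {homo psi : x y / x < y}.
Hypothesis S : word_signs psi rho.
Hypothesis (rho0 : 0 <= rho) (irr : irrational rho) (a0 : (0 < a)%N).
(** With a the period, chi is the second branch of the renormalization; phi on
    [0, top[ and chi on [-1, 0[ form an exchange of two intervals. *)
Let chi x := iter a phi (psi x).
Let top := chi 0.
Hypothesis (phi0 : phi 0 = -1) (top0 : 0 < top).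

Let word k l x := iter k phi (iter l chi x).
Let value k l : R := l%:R - (k + a * l)%:R * rho.

Let comm x : phi (psi x) = psi (phi x). Proof. exact: lift_comm. Qed.
Let phiH : {homo phi : x y / x < y}. Proof. by move=> x y xy; rewrite /phi ltrD2r; exact: homo. Qed.
Let chiH : {homo chi : x y / x < y}.
Proof. by move=> x y xy; apply: (iter_homo _ phiH); exact: homo. Qed.
Let phiHW : {homo phi : x y / x <= y}.
Proof. by move=> x y; rewrite /phi lerD2r le_eqVlt => /predU1P[->//|/homo/ltW]. Qed.

Let wordE k l x : word k l x = iter (k + a * l) phi (iter l psi x).
Proof. by rewrite /word (iter_mix _ _ _ comm) -iterD. Qed.

Lemma value_neq0 k l : (0 < k + l)%N -> value k l != 0.
Proof.
move=> kl; apply/eqP => /eqP; rewrite subr_eq0 => /eqP E; apply: irr.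
exists (l%:R / (k + a * l)%:R) => //.
have n0 : (0 < k + a * l)%N.
  by case: (k) kl => [|k'] kl; [rewrite add0n muln_gt0 a0|rewrite addSn].
have n0' : (k + a * l)%:R != 0 :> R by rewrite pnatr_eq0 -lt0n.
rewrite rmorphM fmorphV !rmorph_nat E mulrAC divff// mul1r//.
Qed.

Lemma value_gt k l x : 0 < value k l -> x < word k l x.
Proof. by move=> v; rewrite wordE; exact: (word_gt per homo S rho0). Qed.

Lemma value_lt k l x : value k l < 0 -> word k l x < x.
Proof. by move=> v; rewrite wordE; exact: (word_lt per homo S). Qed.

Lemma word_gt_value k l x : (0 < k + l)%N -> x <= word k l x -> 0 < value k l.
Proof.
move=> kl H; have [//|v|v] := ltgtP 0 (value k l).
  by have := value_lt x v; rewrite ltNge H.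
by have := value_neq0 kl; rewrite -v eqxx.
Qed.

Lemma word_lt_value k l x : (0 < k + l)%N -> word k l x <= x -> value k l < 0.
Proof.
move=> kl H; have [v|//|v] := ltgtP 0 (value k l).
  by have := value_gt x v; rewrite ltNge H.
by have := value_neq0 kl; rewrite -v eqxx.
Qed.

Lemma phi_lt x : phi x < x.
Proof.
have : value 1 0 < 0; last by move=> /(value_lt x).
by apply: (@word_lt_value 1 0 0) => //; rewrite /word /= phi0; lra.
Qed.

Let vchi : 0 < value 0 1.
Proof. by apply: (@word_gt_value 0 1 0) => //; exact: ltW. Qed.

Lemma chi_gt x : x < chi x.
Proof. exact: (value_gt x vchi). Qed.

Let chi_comm x : phi (chi x) = chi (phi x).
Proof. by rewrite /chi (iter_comm (f := phi) (g := phi))// comm. Qed.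

Let word_add m n k l x : word m n (word k l x) = word (m + k) (n + l) x.
Proof. by rewrite /word (iter_comm2 _ _ _ (fun x => esym (chi_comm x))) -!iterD. Qed.

Let word_homo m n : {homo word m n : x y / x < y}.
Proof. by move=> x y xy; apply: (iter_homo _ phiH); exact: (iter_homo _ chiH). Qed.

Let word_pow M m n x : iter M (word m n) x = word (m * M) (n * M) x.
Proof.
elim: M => [|M IH]; first by rewrite !muln0.
by rewrite iterS IH word_add !mulnS.
Qed.

Definition inside x := -1 <= x < top.
Definition next x := if x < 0 then chi x else phi x.

Lemma chi_N1 : chi (-1) = phi top.
Proof. by rewrite -phi0 -chi_comm. Qed.

Lemma inside_next x : inside x -> inside (next x).
Proof.
move=> /andP[x1 xt]; rewrite /next; case: ifPn => x0.
  apply/andP; split; last exact: chiH.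
  apply: (@le_trans _ _ (chi (-1))).
    by rewrite chi_N1 -phi0; apply/phiHW/ltW.
  by move: x1; rewrite le_eqVlt => /predU1P[-> //|/chiH/ltW].
rewrite -leNgt in x0; apply/andP; split; last by rewrite (lt_trans (phi_lt x)).
by rewrite -phi0; exact: phiHW.
Qed.

Lemma inside_iter n x : inside x -> inside (iter n next x).
Proof. by move=> xi; elim: n => [//|n IH]; rewrite iterS; exact: inside_next. Qed.

Lemma next_word n x : exists k l, (k + l = n)%N /\ iter n next x = word k l x.
Proof.
elim: n => [|n [k [l [E IH]]]]; first by exists 0, 0.
rewrite iterS IH /next; case: ifPn => _.
  exists k, l.+1; rewrite addnS E; split=> //.
  by have -> : chi (word k l x) = word 0 1 (word k l x) by []; rewrite word_add add1n.
exists k.+1, l; rewrite addSn E; split=> //.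
Qed.

(** The values of chi on the fundamental domain lie above those of phi, so two
    words of the same length cannot both stay inside without giving the same
    point. *)
Lemma word_inside k l k' l' x : inside (word k l x) -> inside (word k' l' x) ->
  (k + l = k' + l')%N -> word k l x = word k' l' x.
Proof.
wlog kk : k l k' l' / (k' <= k)%N.
  move=> W; have [kk|kk] := leqP k' k; first exact: W.
  by move=> A B E; rewrite (W k' l' k l)// ltnW.
move=> /andP[A1 A2] /andP[B1 B2] E.
have [s ks] : exists s, (k = k' + s)%N by exists (k - k')%N; rewrite subnKC.
have ls : (l' = l + s)%N by lia.
case: s ks ls => [|s] ks ls; first by rewrite ks ls !addn0.
exfalso; set y := word k l x in A1 A2; set y' := word k' l' x in B1 B2.
have F : word s.+1 0 y' = word 0 s.+1 y.
  by rewrite /y /y' !word_add ks ls; congr word; lia.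
have F1 : word s.+1 0 y' <= phi y'.
  rewrite /word /=; elim: (s) => [//|i IH] /=.
  by apply: le_trans IH; exact/ltW/phi_lt.
have F2 : chi y <= word 0 s.+1 y.
  rewrite /word /=; elim: (s) => [//|i IH] /=.
  by apply: le_trans IH _; exact/ltW/chi_gt.
have F3 : chi (-1) <= chi y.
  by move: A1; rewrite le_eqVlt => /predU1P[-> //|/chiH/ltW].
have := phiH B2; rewrite -chi_N1; rewrite F in F1.
by rewrite ltNge (le_trans F3 (le_trans F2 F1)).
Qed.

(** Pigeonhole principle. *)
Lemma near_return e : 0 < e -> exists i j, [/\ (i < j)%N &
  `|iter j next 0 - iter i next 0| < e].
Proof.
move=> e0; have in0 : inside 0 by rewrite /inside lerN10 top0.
pose p n := iter n next 0.
have bnd n : 0 <= p n + 1 < top + 1.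
  by have /andP[A B] := inside_iter n in0; rewrite /p; lra.
pose N := Num.bound ((top + 1) / e).
have HN : (top + 1) / e < N%:R.
  by apply: archi_boundP; rewrite divr_ge0 ?ltW// addr_gt0.
pose b n := Num.truncn ((p n + 1) / e).
have bN n : (b n < N)%N.
  have /andP[A B] := bnd n; have q0 : 0 <= (p n + 1) / e by rewrite divr_ge0// ltW.
  rewrite -(ltr_nat R); have /andP[t1 _] := truncn_itv q0; apply: le_lt_trans t1 _.
  by apply: lt_trans HN; rewrite ltr_pM2r// invr_gt0.
pose f (i : 'I_N.+1) : 'I_N := Ordinal (bN i).
have : ~~ injectiveb f.
  apply/negP => /injectiveP/leq_card; rewrite !card_ord ltnn//.
move=> /injectivePn[i [j ij fij]].
have H (i' j' : nat) : b i' = b j' -> `|p i' - p j'| < e.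
  move=> E; have /andP[A _] := bnd i'; have /andP[B _] := bnd j'.
  have qi : 0 <= (p i' + 1) / e by rewrite divr_ge0// ltW.
  have qj : 0 <= (p j' + 1) / e by rewrite divr_ge0// ltW.
  have /andP[i1 i2] := truncn_itv qi; have /andP[j1 j2] := truncn_itv qj.
  rewrite -/(b i') E in i1 i2; rewrite -/(b j') in j1 j2.
  move: i1 i2 j1 j2; rewrite !ler_pdivlMr// !ltr_pdivrMr// -!natr1 => *.
  by rewrite ltr_norml; apply/andP; split; lra.
have bij : b i = b j by have := congr1 val fij.
have [L|L|E] := ltngtP i j.
- by exists i, j; split=> //; exact: H.
- by exists j, i; split=> //; exact: H.
- by move: ij; rewrite -val_eqE /= E eqxx.
Qed.

(** If the close return y of x lands above x, the iterates of this return climb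
    until they have gone once around the circle; the first one past a full turn
    falls between x and y, and so it is a close return of y from below. *)
Lemma return_below e : 0 < e -> exists x n, [/\ inside x, (0 < n)%N &
  x - e <= iter n next x <= x].
Proof.
move=> e0; have in0 : inside 0 by rewrite /inside lerN10 top0.
have [i [j [ij]]] := near_return e0.
set x := iter i next 0; set y := iter j next 0 => /ltr_normlP[yx1 yx2].
have xi : inside x by exact: inside_iter. have yi : inside y by exact: inside_iter.
have yE : y = iter (j - i) next x by rewrite -iterD subnK// ltnW.
have ji0 : (0 < j - i)%N by rewrite subn_gt0.
have [yx|xy] := leP y x.
  exists x, (j - i)%N; split=> //; rewrite -yE yx andbT; lra.
have [k [l [kl yw]]] := next_word (j - i) x; rewrite -yE in yw.
have kl0 : (0 < k + l)%N by rewrite kl.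
have v0 : 0 < value k l by apply: (word_gt_value (x := x)) => //; rewrite -yw ltW.
have l0 : (0 < l)%N.
  rewrite lt0n; apply: contraTneq v0 => ->.
  by rewrite /value sub0r oppr_gt0 -leNgt mulr_ge0.
pose P m := chi x <= phi (iter m (word k l) x).
have exP : exists m, P m.
  have [M M0 HM] : exists2 M : nat, (0 < M)%N & 2 + rho < M%:R * value k l.
    exists (Num.bound ((2 + rho) / value k l)).+1 => //; rewrite -ltr_pdivrMr//; apply: lt_le_trans (archi_boundP _) _.
      by rewrite divr_ge0 ?ltW// ltr_wpDr.
    by rewrite ler_nat.
  exists M; rewrite /P word_pow.
  have [q lM] : exists q, (l * M = q.+1)%N by exists (l * M).-1; rewrite prednK// muln_gt0 l0 M0.
  have vv : 0 < value (k * M).+1 q.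
    have E1 : l%:R * M%:R = q%:R + 1 :> R by rewrite -natrM lM natr1.
    move: HM; rewrite /value !natrD !natrM -!natr1 !natrM.
    move=> HM.
    have E2 : a%:R * rho * (l%:R * M%:R) = a%:R * rho * (q%:R + 1) by rewrite E1.
    have := value_gt; have ar : 0 <= a%:R * rho by rewrite mulr_ge0.
    by move=> _; lra.
  have -> : phi (word (k * M) (l * M) x) = chi (word (k * M).+1 q x).
    have -> : chi (word (k * M).+1 q x) = word 0 1 (word (k * M).+1 q x) by [].
    by rewrite word_add add1n -lM.
  exact/ltW/chiH/value_gt.
have [m Pm min] := ex_minnP exP.
case: m Pm min => [|[|m]] Pm min.
- by move: Pm; rewrite /P /= leNgt (lt_trans (phi_lt x) (chi_gt x)).
- move: Pm; rewrite /P /= -yw => H; exfalso.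
  have : phi y < chi (-1) by rewrite chi_N1; apply: phiH; case/andP: yi.
  rewrite ltNge => /negP; apply; apply: le_trans H.
  by case/andP: xi; rewrite le_eqVlt => /predU1P[<- //|/chiH/ltW].
have nP : phi (iter m.+1 (word k l) x) < chi x.
  by rewrite ltNge; apply/negP => /min; rewrite ltnn.
have [q lM] : exists q, (l * m.+2 = q.+1)%N by exists (l * m.+2).-1; rewrite prednK// muln_gt0 l0.
have [q' lM'] : exists q, (l * m.+1 = q.+1)%N by exists (l * m.+1).-1; rewrite prednK// muln_gt0 l0.
pose w := word (k * m.+2).+1 q x.
have chiw : chi w = phi (iter m.+2 (word k l) x).
  have -> : chi w = word 0 1 w by [].
  by rewrite /w word_add add1n -lM word_pow.
have xw : x <= w.
  rewrite leNgt; apply/negP => /chiH; rewrite chiw ltNge.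
  by move/negP; apply; exact: Pm.
have wy : w < y.
  rewrite ltNge; apply/negP => yw'.
  have : chi y <= chi w by move: yw'; rewrite le_eqVlt => /predU1P[-> //|/chiH/ltW].
  rewrite chiw leNgt => /negP; apply.
  have -> : phi (iter m.+2 (word k l) x) = word k l (phi (iter m.+1 (word k l) x)).
    rewrite [iter m.+2 _ x]iterS; set t := iter m.+1 _ x.
    have : word 1 0 (word k l t) = word k l (word 1 0 t).
      by rewrite !word_add addn1 addn0.
    by [].
  have -> : chi y = word k l (chi x).
    have : word 0 1 (word k l x) = word k l (word 0 1 x).
      by rewrite !word_add addn1 addn0.
    by rewrite -yw.
  exact: word_homo.
have wi : inside w.
  by case/andP: xi => x1 _; case/andP: yi => _ yt; rewrite /inside (le_trans x1 xw) (lt_trans wy yt).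
have wyE : w = word (k * m.+1).+1 q' y.
  have e1 : ((k * m.+2).+1 = (k * m.+1).+1 + k)%N by rewrite mulnS addSn addnC.
  have e2 : (q = q' + l)%N by apply: succn_inj; rewrite -lM mulnS lM' addnS addnC.
  by rewrite yw word_add /w e1 e2.
have [k' [l' [kl' E']]] := next_word ((k * m.+1).+1 + q') y.
have wn : w = iter ((k * m.+1).+1 + q') next y.
  rewrite E' wyE; apply: word_inside => //; first by rewrite -wyE.
  by rewrite -E'; exact: inside_iter.
exists y, ((k * m.+1).+1 + q')%N; split=> //.
rewrite -wn (ltW wy) andbT; lra.
Qed.

End recurrence.

Section comparison.
Variable R : realType.
Variables (psi0 psi1 : R -> R) (rho d kappa : R) (a : nat).
Let phi0 x := psi0 x - 2.
Let phi1 x := psi1 x - 2.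
Let chi0 x := iter a phi0 (psi0 x).
Let chi1 x := iter a phi1 (psi1 x).

(** If the return map of the second pair exceeds that of the first by a definite
    amount everywhere, the rotation numbers differ.  Follow an orbit of the
    first pair that returns slightly below its starting point x, and apply the
    same word of the second pair to x, or to x - 2 * d if x < 0.  At a letter
    phi the second orbit falls behind by at most d, but the letter chi that
    follows brings it ahead by d.  So the second word does not move its starting
    point down, whereas the first one does; but both have the same sign. *)
Lemma no_domination :
  (forall x, psi0 (x + 2) = psi0 x + 2) -> {homo psi0 : x y / x < y} ->
  (forall x, psi1 (x + 2) = psi1 x + 2) -> {homo psi1 : x y / x < y} ->
  word_signs psi0 rho -> word_signs psi1 rho ->
  0 <= rho -> irrational rho -> (0 < a)%N ->
  phi0 0 = -1 -> 0 < chi0 0 -> 0 < d -> d < kappa ->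
  (forall x, 0 <= x < chi0 0 -> phi0 x <= - kappa /\ phi0 x - d <= phi1 x) ->
  (forall x, -1 <= x < 0 -> chi0 x + d <= chi1 (x - 2 * d)) ->
  False.
Proof.
move=> per0 homo0 per1 homo1 S0 S1 rho0 irr a0 p0 top0 dp dk Hphi Hchi.
have [x [n [xi n0 /andP[xn1 xn2]]]] :=
  return_below per0 homo0 S0 rho0 irr a0 p0 top0 dp.
have phi1H : {homo phi1 : x y / x <= y}.
  by move=> s t; rewrite /phi1 lerD2r le_eqVlt => /predU1P[->//|/homo1/ltW].
have chi1H : {homo chi1 : x y / x <= y}.
  move=> s t; rewrite le_eqVlt => /predU1P[->//|st].
  apply/ltW/(iter_homo _ _); last exact: homo1.
  by move=> u v uv; rewrite /phi1 ltrD2r; exact: homo1.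
have comm1 u : phi1 (chi1 u) = chi1 (phi1 u).
  rewrite /chi1 (iter_comm (f := phi1) (g := phi1))//.
  by congr iter; exact: (lift_comm per1).
pose z := if x < 0 then x - 2 * d else x.
have key m : exists k l, [/\ (k + l = m)%N,
    iter m (next psi0 a) x = iter k phi0 (iter l chi0 x) &
    let u := iter m (next psi0 a) x in let v := iter k phi1 (iter l chi1 z) in
    (if u < 0 then u - 2 * d else u) <= v /\
    ((0 < m)%N -> u + d <= v \/ (u <= - kappa /\ u - d <= v))].
  elim: m => [|m [k [l [E1 E2 [E3 _]]]]]; first by exists 0, 0; split=> //=; split.
  have ui := inside_iter per0 homo0 S0 rho0 irr a0 p0 top0 m xi.
  move: E2 E3 ui; rewrite iterS; set u := iter m _ x; set v := iter k phi1 _.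
  move=> E2 E3 /andP[u1 u2].
  case: ifPn E3 => un E3.
    have -> : next psi0 a u = chi0 u by rewrite /next un.
    have L : chi0 u + d <= chi1 v.
      by apply: le_trans (Hchi u _) (chi1H _ _ E3); rewrite u1.
    exists k, l.+1; rewrite addnS E1; split=> //.
      rewrite E2 (iter_comm (f := chi0))// => t.
      rewrite /chi0 (iter_comm (f := phi0) (g := phi0))//; congr iter.
      exact (esym (lift_comm per0 t)).
    have -> : iter k phi1 (iter l.+1 chi1 z) = chi1 v.
      by rewrite /v (iter_comm (f := chi1) (g := phi1))// => t; rewrite comm1.
    split; last by left.
    by apply: le_trans L; case: ifP => _; lra.
  rewrite -leNgt in un; have [K1 K2] := Hphi u ltac:(by rewrite un).
  have L : phi0 u - d <= phi1 v by apply: le_trans K2 (phi1H _ _ E3).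
  have -> : next psi0 a u = phi0 u by rewrite /next ltNge un.
  exists k.+1, l; rewrite addSn E1; split=> //.
    by rewrite E2.
  have -> : iter k.+1 phi1 (iter l chi1 z) = phi1 v by [].
  split; last by right.
  by apply: le_trans L; rewrite ifT; lra.
have [k [l [E1 E2 [_ E3]]]] := key n.
have kl0 : (0 < k + l)%N by rewrite E1.
have V0 := word_lt_value per0 homo0 S0 rho0 irr a0 (k := k) (l := l) (x := x) kl0.
have V1 := word_gt_value per1 homo1 S1 irr a0 (k := k) (l := l) (x := z) kl0.
have /lt_gtF : l%:R - (k + a * l)%:R * rho < 0 by apply: V0; rewrite -E2.
rewrite V1// /z; have := E3 n0; rewrite -/phi1 -/chi1.
move: xn1 xn2; set u := iter n _ x; set v := iter k phi1 _ => xn1 xn2 H.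
case: ifPn H => x0.
  by move=> [|[]]; lra.
by rewrite -leNgt in x0; move=> [|[]]; lra.
Qed.

End comparison.

(** * Derivatives along an interval and norms *)

Section link.
Variable R : realType.
Implicit Types (a b : R) (f : R -> R).

Lemma dquot_cvg a b f f1 x : diff_on a b f f1 -> a <= x <= b ->
  dquot f x @ within `[a, b] x^' --> f1 x.
Proof.
move=> H xab; apply/cvgrPdist_le => e e0; have [d d0 Hd] := H x xab e e0.
rewrite /within /= /dnbhs /within /=; apply/nbhs_ballP; exists d => //= y; rewrite /ball/= => yx yx0.
rewrite in_itv/= => yab.
have yx1 : y - x != 0 by rewrite subr_eq0.
have -> : f1 x - dquot f x y = - ((f y - f x - f1 x * (y - x)) / (y - x)).
  by rewrite /dquot; field.
by rewrite normrN normrM normfV ler_pdivrMr ?normr_gt0//; apply: Hd => //; rewrite distrC.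
Qed.

Lemma within_itv_proper a b x : a < b -> a <= x <= b ->
  ProperFilter (within `[a, b] x^').
Proof.
move=> ab xab; apply: Build_ProperFilter_ex => P.
rewrite /within /= /dnbhs /within /= => /nbhs_ballP[d /= d0 Hd].
have [y [yab yx yd]] : exists y, [/\ a <= y <= b, y != x & `|x - y| < d].
  case/andP: xab; rewrite [x <= b]le_eqVlt => ax /predU1P[xb|xb].
    exists (x - Num.min (x - a) d / 2).
    have m0 : 0 < Num.min (x - a) d by rewrite lt_min d0 subr_gt0 xb ab.
    have m1 : Num.min (x - a) d <= x - a by rewrite ge_min lexx.
    have m2 : Num.min (x - a) d <= d by rewrite ge_min lexx orbT.
    move: m0 m1 m2; set m := Num.min _ _; clearbody m => m0 m1 m2.
    split; [apply/andP; split; lra|by rewrite lt_eqF//; lra|].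
    by rewrite ltr_norml; apply/andP; split; lra.
  exists (x + Num.min (b - x) d / 2).
  have m0 : 0 < Num.min (b - x) d by rewrite lt_min d0 subr_gt0 xb.
  have m1 : Num.min (b - x) d <= b - x by rewrite ge_min lexx.
  have m2 : Num.min (b - x) d <= d by rewrite ge_min lexx orbT.
  move: m0 m1 m2; set m := Num.min _ _; clearbody m => m0 m1 m2.
  split; [apply/andP; split; lra|by rewrite gt_eqF//; lra|].
  by rewrite ltr_norml; apply/andP; split; lra.
by exists y; apply: (Hd y) => //; rewrite /= in_itv.
Qed.

Lemma deriv_in_diff a b f f1 x : a < b -> diff_on a b f f1 -> a <= x <= b ->
  deriv_in `[a, b] f x = f1 x.
Proof.
move=> ab H xab; have FF := within_itv_proper ab xab.
apply: cvg_lim; [exact: Rhausdorff|exact: dquot_cvg].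
Qed.

Lemma diff_derivable_in a b f : (forall x, a <= x <= b -> derivable_in `[a, b] f x) ->
  diff_on a b f (deriv_in `[a, b] f).
Proof.
move=> H x xab e e0.
have /cvg_ex[l Hl] := H x xab.
have [ab|] := boolP (a < b); last first.
  rewrite -leNgt => ba; exists 1 => // y yab _.
  have -> : y = x by lra.
  by rewrite !subrr mulr0 subr0 normr0 mulr0.
have FF := within_itv_proper ab xab.
have -> : deriv_in `[a, b] f x = l by apply: cvg_lim => //; exact: Rhausdorff.
move/cvgrPdist_le : Hl => /(_ e e0).
rewrite /within /= /dnbhs /within /= => /nbhs_ballP[d /= d0 Hd]; exists d => // y yab yd.
have [->|yx] := eqVneq y x; first by rewrite !subrr mulr0 subr0 normr0 mulr0.
have := Hd y; rewrite /ball /= distrC in_itv => /(_ yd yx yab).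
have yx1 : y - x != 0 by rewrite subr_eq0.
have -> : f y - f x - l * (y - x) = - ((l - dquot f x y) * (y - x)).
  by rewrite /dquot; field.
by rewrite normrN normrM => h; rewrite ler_wpM2r.
Qed.

Lemma Cr_on_diff r a b f k : Cr_on r `[a, b] f -> (k < r)%N ->
  diff_on a b (nderiv_in `[a, b] k f) (nderiv_in `[a, b] k.+1 f).
Proof.
by move=> [H _] kr; apply: diff_derivable_in => x xab; apply: H => //=; rewrite in_itv.
Qed.

Lemma Cr_normP r (A : set R) f (c : R) : 0 <= c ->
  (Cr_norm r A f <= c%:E)%E <->
  forall k x, (k <= r)%N -> A x -> `|nderiv_in A k f x| <= c.
Proof.
move=> c0; split.
  move=> /bigmax_leP[_ H] k x kr Ax.
  have /ereal_supP Hk := H (Ordinal (kr : (k < r.+1)%N)) isT.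
  by rewrite -lee_fin; apply: Hk; exists x.
move=> H; apply/bigmax_leP; split; first by rewrite lee_fin.
by move=> k _; apply: ge_ereal_sup => _ [x Ax <-]; rewrite lee_fin H// -ltnS.
Qed.

Lemma nderiv_diff a b f f1 f2 x : a < b -> diff_on a b f f1 -> diff_on a b f1 f2 ->
  a <= x <= b ->
  nderiv_in `[a, b] 1 f x = f1 x /\ nderiv_in `[a, b] 2 f x = f2 x.
Proof.
move=> ab H1 H2 xab; split; first exact: deriv_in_diff.
apply: deriv_in_diff => //; apply: diff_on_ext H2 _ _ => // y yab.
by rewrite /= (deriv_in_diff ab H1 yab).
Qed.

Lemma C2_normP a b f f1 f2 c : 0 <= c -> a < b ->
  diff_on a b f f1 -> diff_on a b f1 f2 ->
  (Cr_norm 2 `[a, b] f <= c%:E)%E <->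
  forall x, a <= x <= b -> [/\ `|f x| <= c, `|f1 x| <= c & `|f2 x| <= c].
Proof.
move=> c0 ab H1 H2; rewrite Cr_normP//; split=> H x.
  move=> xab; have [<- <-] := nderiv_diff ab H1 H2 xab.
  by split; [apply: (H 0)|apply: H|apply: H] => //=; rewrite in_itv.
move=> y; rewrite /= in_itv /= => kr yab; have [E1 E2] := nderiv_diff ab H1 H2 yab.
have [h0 h1 h2] := H y yab.
by case: x kr => [|[|[|]]]// _; rewrite ?E1 ?E2.
Qed.

End link.

(** * Lipschitz dependence *)

Section closeness.
Variable R : realType.
Implicit Types (M N d u v x y : R).

(** Two bounded quantities that depend in a Lipschitz way on data at distance d.
    The relation is stable under ring operations and inversion, with constants
    computed from those of the arguments. *)
Definition lclose M d u v := [/\ `|u| <= M, `|v| <= M & `|u - v| <= M * d].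

Lemma lclose_ge0 M d u v : lclose M d u v -> 0 <= M.
Proof. by case=> + _ _; apply: le_trans. Qed.

Lemma lclose_weak M N d u v : M <= N -> 0 <= d -> lclose M d u v -> lclose N d u v.
Proof.
move=> MN d0 [A B C]; split; [exact: le_trans MN|exact: le_trans MN|].
by apply: le_trans C _; exact: ler_wpM2r.
Qed.

Lemma lclose_cst d u : 0 <= d -> lclose `|u| d u u.
Proof. by move=> d0; split=> //; rewrite subrr normr0 mulr_ge0. Qed.

Lemma lclose_add M N d u v x y : lclose M d u v -> lclose N d x y -> lclose (M + N) d (u + x) (v + y).
Proof.
move=> [A B C] [A' B' C']; split.
- by apply: le_trans (ler_normD _ _) _; exact: lerD.
- by apply: le_trans (ler_normD _ _) _; exact: lerD.
- have -> : u + x - (v + y) = (u - v) + (x - y) by ring.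
  by rewrite mulrDl; apply: le_trans (ler_normD _ _) _; exact: lerD.
Qed.

Lemma lclose_opp M d u v : lclose M d u v -> lclose M d (- u) (- v).
Proof. by move=> [A B C]; split; rewrite ?normrN// -opprD normrN. Qed.

Lemma lclose_mul M N d u v x y : lclose M d u v -> lclose N d x y ->
  lclose (2 * (M * N)) d (u * x) (v * y).
Proof.
move=> H H'; have M0 := lclose_ge0 H; have N0 := lclose_ge0 H'.
case: H => A B C; case: H' => A' B' C'.
have MN : 0 <= M * N by rewrite mulr_ge0.
have d0 : 0 <= M * d by apply: le_trans C.
have d0' : 0 <= N * d by apply: le_trans C'.
split.
- rewrite normrM; apply: (@le_trans _ _ (M * N)); [exact: ler_pM|lra].
- rewrite normrM; apply: (@le_trans _ _ (M * N)); [exact: ler_pM|lra].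
- have -> : u * x - v * y = (u - v) * x + v * (x - y) by ring.
  apply: le_trans (ler_normD _ _) _; rewrite !normrM.
  have p1 : `|u - v| * `|x| <= M * d * N by exact: ler_pM.
  have p2 : `|v| * `|x - y| <= M * (N * d) by exact: ler_pM.
  lra.
Qed.

Lemma lclose_inv M m d u v : 0 <= d -> 0 < m -> m <= u -> m <= v -> lclose M d u v ->
  lclose (m^-1 + m^-1 * m^-1 * M) d u^-1 v^-1.
Proof.
move=> d0 m0 mu mv H; have M0 := lclose_ge0 H; case: H => _ _ C.
have u0 := lt_le_trans m0 mu; have v0 := lt_le_trans m0 mv.
have bu : `|u^-1| <= m^-1 by rewrite normfV gtr0_norm// lef_pV2.
have bv : `|v^-1| <= m^-1 by rewrite normfV gtr0_norm// lef_pV2.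
have i0 : 0 < m^-1 by rewrite invr_gt0.
have w0 : 0 <= m^-1 * m^-1 * M by rewrite !mulr_ge0// ltW.
split.
- by apply: le_trans bu _; rewrite lerDl.
- by apply: le_trans bv _; rewrite lerDl.
- have -> : u^-1 - v^-1 = - (u^-1 * v^-1 * (u - v)) by field; rewrite (gt_eqF u0) (gt_eqF v0).
  rewrite normrN normrM normrM.
  have p : `|u^-1| * `|v^-1| * `|u - v| <= m^-1 * m^-1 * (M * d).
    by apply: ler_pM => //; exact: ler_pM.
  apply: le_trans p _; rewrite mulrDl mulrA lerDr; apply: mulr_ge0 => //; exact: ltW.
Qed.

(** The chain rule for the first two derivatives, on numbers. *)
Definition ch1 f1 h1 : R := f1 * h1.
Definition ch2 f1 f2 h1 h2 : R := f2 * h1 * h1 + f1 * h2.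

Lemma lclose_ch1 M N d u v x y : lclose M d u v -> lclose N d x y ->
  lclose (2 * (M * N)) d (ch1 u x) (ch1 v y).
Proof. exact: lclose_mul. Qed.

Lemma lclose_ch2 M N d f1 f2 h1 h2 f1' f2' h1' h2' :
  lclose M d f1 f1' -> lclose M d f2 f2' -> lclose N d h1 h1' -> lclose N d h2 h2' ->
  lclose (2 * (2 * (M * N) * N) + 2 * (M * N)) d (ch2 f1 f2 h1 h2) (ch2 f1' f2' h1' h2').
Proof. by move=> *; apply: lclose_add; [apply: lclose_mul => //; exact: lclose_mul|exact: lclose_mul]. Qed.

Lemma diff_ch1 a b c d f f1 h h1 : diff_on a b h h1 -> diff_on c d f f1 ->
  (forall x, a <= x <= b -> c <= h x <= d) ->
  diff_on a b (f \o h) (fun x => ch1 (f1 (h x)) (h1 x)).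
Proof. exact: diff_on_comp. Qed.

Lemma diff_ch2 a b c d f f1 f2 h h1 h2 :
  diff_on a b h h1 -> diff_on a b h1 h2 -> diff_on c d f f1 -> diff_on c d f1 f2 ->
  (forall x, a <= x <= b -> c <= h x <= d) ->
  diff_on a b (fun x => ch1 (f1 (h x)) (h1 x))
    (fun x => ch2 (f1 (h x)) (f2 (h x)) (h1 x) (h2 x)).
Proof.
move=> H1 H2 F1 F2 D; exact: (diff_on_mul (diff_on_comp H1 F2 D) H2).
Qed.

(** The Moebius maps that fix 0, with their first two derivatives. *)
Definition moeb al be ga x : R := al * x / (be + ga * x).
Definition moeb1 al be ga x : R := al * be * (be + ga * x)^-1 * (be + ga * x)^-1.
Definition moeb2 al be ga x : R :=
  - (2 * al * be * ga * (be + ga * x)^-1 * (be + ga * x)^-1 * (be + ga * x)^-1).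

Lemma diff_moeb_den a b be ga : diff_on a b (fun x => be + ga * x) (fun=> ga).
Proof.
apply: (diff_on_ext (diff_on_add (@diff_on_cst R a b be) (diff_on_scale ga (@diff_on_id R a b)))) => // x _.
by rewrite add0r mulr1.
Qed.

Lemma diff_moeb a b al be ga : (forall x, a <= x <= b -> be + ga * x != 0) ->
  diff_on a b (moeb al be ga) (moeb1 al be ga).
Proof.
move=> H; have D := diff_on_inv (@diff_moeb_den a b be ga) H.
apply: (diff_on_ext (diff_on_mul (diff_on_scale al (@diff_on_id R a b)) D)) => // x xab.
by rewrite /moeb1; field; exact: H.
Qed.

Lemma diff_moeb1 a b al be ga : (forall x, a <= x <= b -> be + ga * x != 0) ->
  diff_on a b (moeb1 al be ga) (moeb2 al be ga).
Proof.
move=> H; have D := diff_on_inv (@diff_moeb_den a b be ga) H.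
apply: (diff_on_ext (diff_on_scale (al * be) (diff_on_mul D D))) => x xab.
  by rewrite /moeb1 mulrA.
by rewrite /moeb2; field; exact: H.
Qed.

Lemma moeb_sub al be ga x y : be + ga * x != 0 -> be + ga * y != 0 ->
  moeb al be ga x - moeb al be ga y =
  al * be * (be + ga * x)^-1 * (be + ga * y)^-1 * (x - y).
Proof. by move=> hx hy; rewrite /moeb; field; apply/andP. Qed.

Lemma lclose_moeb M m : 0 < m -> exists C, forall d al be ga x al' be' ga' x',
  0 <= d -> lclose M d al al' -> lclose M d be be' -> lclose M d ga ga' -> lclose M d x x' ->
  m <= be + ga * x -> m <= be' + ga' * x' ->
  [/\ lclose C d (moeb al be ga x) (moeb al' be' ga' x'),
      lclose C d (moeb1 al be ga x) (moeb1 al' be' ga' x') &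
      lclose C d (moeb2 al be ga x) (moeb2 al' be' ga' x')].
Proof.
move=> m0.
have [C0 H0] : exists C0, forall d al be ga x al' be' ga' x',
  0 <= d -> lclose M d al al' -> lclose M d be be' -> lclose M d ga ga' -> lclose M d x x' ->
  m <= be + ga * x -> m <= be' + ga' * x' ->
  lclose C0 d (moeb al be ga x) (moeb al' be' ga' x').
  eexists => d al be ga x al' be' ga' x' d0 a b g h u v.
  apply: lclose_mul; first by apply: lclose_mul; [exact: a|exact: h].
  apply: (lclose_inv d0 m0 u v); apply: lclose_add; [exact: b|apply: lclose_mul; [exact: g|exact: h]].
have [C1 H1] : exists C0, forall d al be ga x al' be' ga' x',
  0 <= d -> lclose M d al al' -> lclose M d be be' -> lclose M d ga ga' -> lclose M d x x' ->
  m <= be + ga * x -> m <= be' + ga' * x' ->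
  lclose C0 d (moeb1 al be ga x) (moeb1 al' be' ga' x').
  eexists => d al be ga x al' be' ga' x' d0 a b g h u v.
  have I := lclose_inv d0 m0 u v (lclose_add b (lclose_mul g h)).
  apply: lclose_mul; [apply: lclose_mul; [apply: lclose_mul; [exact: a|exact: b]|exact: I]|exact: I].
have [C2 H2] : exists C0, forall d al be ga x al' be' ga' x',
  0 <= d -> lclose M d al al' -> lclose M d be be' -> lclose M d ga ga' -> lclose M d x x' ->
  m <= be + ga * x -> m <= be' + ga' * x' ->
  lclose C0 d (moeb2 al be ga x) (moeb2 al' be' ga' x').
  eexists => d al be ga x al' be' ga' x' d0 a b g h u v.
  have I := lclose_inv d0 m0 u v (lclose_add b (lclose_mul g h)).
  apply: lclose_opp.
  exact: (lclose_mul (lclose_mul (lclose_mul (lclose_mul (lclose_mul (lclose_mul (lclose_cst 2 d0) a) b) g) I) I) I).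
exists (C0 + C1 + C2) => d al be ga x al' be' ga' x' d0 a b g h u v.
have h0 := H0 _ _ _ _ _ _ _ _ _ d0 a b g h u v.
have h1 := H1 _ _ _ _ _ _ _ _ _ d0 a b g h u v.
have h2 := H2 _ _ _ _ _ _ _ _ _ d0 a b g h u v.
have p0 := lclose_ge0 h0; have p1 := lclose_ge0 h1; have p2 := lclose_ge0 h2.
split; [apply: lclose_weak h0|apply: lclose_weak h1|apply: lclose_weak h2] => //; lra.
Qed.

End closeness.

(** * Negative Schwarzian derivative *)

Section square_root.
Variable R : realType.

Lemma diff_on_sqrt (c d : R) : 0 < c ->
  diff_on c d Num.sqrt (fun x => (2 * Num.sqrt x)^-1).
Proof.
move=> c0 x /andP[cx xd] e e0.
have x0 := lt_le_trans c0 cx.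
have p0 : 0 < Num.sqrt x by rewrite sqrtr_gt0.
set p := Num.sqrt x in p0 *; have pE : x = p * p by rewrite -expr2 sqr_sqrtr ?ltW.
have q0 : 0 < 2 * p ^+ 3 * e by rewrite !mulr_gt0// exprn_gt0.
exists (2 * p ^+ 3 * e) => // y /andP[cy yd] yx.
have y0 := lt_le_trans c0 cy.
have r0 : 0 < Num.sqrt y by rewrite sqrtr_gt0.
set r := Num.sqrt y in r0 *; have rE : y = r * r by rewrite -expr2 sqr_sqrtr ?ltW.
have pn : p != 0 by rewrite gt_eqF.
have srp : 0 < r + p by rewrite addr_gt0.
have -> : r - p - (2 * p)^-1 * (y - x) = - ((r - p) ^+ 2 / (2 * p)).
  by rewrite rE pE; field.
have E : `|y - x| = `|r - p| * (r + p).
  have -> : y - x = (r - p) * (r + p) by rewrite rE pE; ring.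
  by rewrite normrM [`|r + p|]gtr0_norm.
rewrite normrN ger0_norm; last by rewrite divr_ge0 ?sqr_ge0// mulr_ge0// ltW.
rewrite ler_pdivrMr ?mulr_gt0// -(real_normK (num_real (r - p))).
have t0 : 0 <= `|r - p| by [].
move: yx; rewrite E; set t := `|r - p| in t0 * => yx.
have A : t * p <= t * (r + p) by apply: ler_wpM2l => //; lra.
have B : t <= 2 * p ^+ 2 * e.
  rewrite -(ler_pM2r p0); apply: le_trans A (le_trans (ltW yx) _).
  by rewrite exprS; lra.
have C : t * t <= t * (2 * p ^+ 2 * e) by exact: ler_wpM2l.
have D : (t * p) * (2 * p * e) <= t * (r + p) * (2 * p * e).
  by apply: ler_wpM2r A; rewrite !mulr_ge0// ltW.
by rewrite expr2; lra.
Qed.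

End square_root.

Section schwarzian_gap.
Variable R : realType.
Variables (K k kap r c l u : R) (f f1 f2 f3 : R -> R).
Hypothesis (k0 : 0 < k) (K1 : 1 <= K) (kap0 : 0 < kap) (r0 : 0 < r) (c0 : 0 < c).
Hypothesis (kapK : 2 * kap * K <= 1) (kapK2 : 8 * kap * K ^+ 2 <= k).
Hypothesis (rK : 2 * K * r <= kap).
Hypothesis (cK : c * K ^+ 2 <= k / 2) (ck : c <= kap / 4) (cr : c * K ^+ 2 <= kap / 4 * r ^+ 2).
Hypothesis (lu : l <= u) (luK : u - l <= K).
Hypothesis (d1 : diff_on l u f f1) (d2 : diff_on l u f1 f2) (d3 : diff_on l u f2 f3).
Hypothesis (b1 : forall x, l <= x <= u -> k <= f1 x <= K).
Hypothesis (b3 : forall x, l <= x <= u -> `|f3 x| <= K).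
Hypothesis (S : forall x, l <= x <= u -> f3 x / f1 x - 3 / 2 * (f2 x / f1 x) ^+ 2 <= 0).
Hypothesis (pos : forall x, l <= x <= u -> 0 < x - f x).
Hypothesis (gl : k <= l - f l) (gu : k <= u - f u).

(** Negative Schwarzian derivative means that v = (Df)^(-1/2) is convex. *)
Let v x := (Num.sqrt (f1 x))^-1.
Let v1 x := - (1 / 2) * (f2 x * (v x * v x * v x)).
Let v2 x := - (1 / 2) * (f3 x * (v x * v x * v x) +
  f2 x * ((v1 x * v x + v x * v1 x) * v x + v x * v x * v1 x)).

Let f1_gt0 x : l <= x <= u -> 0 < f1 x.
Proof. by move=> /b1/andP[A _]; exact: lt_le_trans A. Qed.

Let v_gt0 x : l <= x <= u -> 0 < v x.
Proof. by move=> xlu; rewrite invr_gt0 sqrtr_gt0 f1_gt0. Qed.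

Let vv x : l <= x <= u -> v x * v x * f1 x = 1.
Proof.
move=> xlu; have p := f1_gt0 xlu; rewrite /v.
have s0 : Num.sqrt (f1 x) != 0 by rewrite gt_eqF// sqrtr_gt0.
by rewrite -{3}(sqr_sqrtr (ltW p)); field.
Qed.

Let dv : diff_on l u v v1.
Proof.
have dq : diff_on l u (fun x => Num.sqrt (f1 x)) (fun x => (2 * Num.sqrt (f1 x))^-1 * f2 x).
  by apply: (diff_on_comp d2 (diff_on_sqrt (d := K) k0)); exact: b1.
apply: (diff_on_ext (diff_on_inv dq _)) => // x xlu.
  by rewrite gt_eqF// sqrtr_gt0 f1_gt0.
have s0 : Num.sqrt (f1 x) != 0 by rewrite gt_eqF// sqrtr_gt0 f1_gt0.
by rewrite /v1 /v; field.
Qed.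

Let dv1 : diff_on l u v1 v2.
Proof.
exact (diff_on_scale (- (1 / 2)) (diff_on_mul d3 (diff_on_mul (diff_on_mul dv dv) dv))).
Qed.

Let v2_ge0 x : l <= x <= u -> 0 <= v2 x.
Proof.
move=> xlu; have p := f1_gt0 xlu; have q := v_gt0 xlu.
have -> : v2 x = - (1 / 2) * (v x * v x * v x * (f3 x - 3 / 2 * f2 x ^+ 2 * (v x * v x))).
  by rewrite /v2 /v1; ring.
have fn : f1 x != 0 by rewrite gt_eqF.
have E : v x * v x = (f1 x)^-1 by rewrite -[LHS]mulr1 -(mulfV fn) mulrA vv// mul1r.
have -> : f3 x - 3 / 2 * f2 x ^+ 2 * (v x * v x) =
   f1 x * (f3 x / f1 x - 3 / 2 * (f2 x / f1 x) ^+ 2).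
  by rewrite E; field.
have Sx := S xlu; move: Sx; move: (f3 x / f1 x - _) => w w0.
have : 0 <= v x * v x * v x * (f1 x * - w).
  apply: mulr_ge0; first by apply/ltW; rewrite !mulr_gt0.
  by apply: mulr_ge0; [exact: ltW|lra].
lra.
Qed.

Let tangent m x : l <= m <= u -> l <= x <= u -> v m + v1 m * (x - m) <= v x.
Proof.
move=> mlu xlu; have := taylor_ge (k := 0) dv dv1 v2_ge0 mlu xlu.
rewrite !mul0r; lra.
Qed.

Let f1_le1 x : l <= x <= u -> 1 <= v x -> f1 x <= 1.
Proof.
move=> xlu v_1; rewrite -(vv xlu); apply: ler_peMl; first exact/ltW/f1_gt0.
by rewrite -[leLHS]mulr1; apply: ler_pM.
Qed.

Let f1_ge1 x : l <= x <= u -> v x <= 1 -> 1 <= f1 x.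
Proof.
move=> xlu v_1; rewrite -(vv xlu); apply: ler_piMl; first exact/ltW/f1_gt0.
by rewrite -[leRHS]mulr1; apply: ler_pM => //; exact/ltW/v_gt0.
Qed.

Let dg : diff_on l u (fun x => x - f x) (fun x => 1 - f1 x).
Proof. by apply: diff_on_subr; [exact: diff_on_id|exact: d1]. Qed.

Let dg1 : diff_on l u (fun x => 1 - f1 x) (fun x => 0 - f2 x).
Proof. by apply: diff_on_subr; [exact: diff_on_cst|exact: d2]. Qed.

(** A convex function has no interior maximum. *)
Let quasi m y w : l <= m <= u -> l <= y <= u -> y <= w -> w <= m ->
  v w <= v m \/ v w <= v y.
Proof.
move=> mlu ylu yw wm; have wlu : l <= w <= u by move: mlu ylu; lra.
have T1 := tangent wlu ylu; have T2 := tangent wlu mlu.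
case: (ler_or_gt 0 (v1 w)) => s0.
  by left; have q : 0 <= v1 w * (m - w) by [apply: mulr_ge0; lra]; lra.
by right; have q : 0 <= - v1 w * (w - y) by [apply: mulr_ge0; lra]; lra.
Qed.

(** Were the second derivative of the gap small at its minimum m, the tangent
   line of v would keep Df close to 1 on the left of m, and the gap could not
   grow from less than k / 2 at m to k at l. *)
Let curvature m : l <= m <= u -> m - f m < k / 2 -> v m = 1 ->
  v1 m = - (1 / 2) * f2 m -> l < m -> kap <= - f2 m.
Proof.
move=> mlu gm vm v1m lm; rewrite leNgt; apply/negP => A.
have [z /andP[lz zm] E] := diff_on_MVT dg (lexx l) lm (proj2 (andP mlu)).
have zlu : l <= z <= u by move: (mlu); lra.
have T := tangent mlu zlu; rewrite vm v1m in T.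
have B : kap * (m - z) <= kap * K by apply: ler_wpM2l; [exact: ltW|move: luK mlu; lra].
have B1 : - f2 m * (m - z) <= kap * (m - z) by apply: ler_wpM2r; lra.
have th : 1 - kap * K / 2 <= v z by lra.
have th0 : 0 < kap * K by rewrite mulr_gt0//; exact: lt_le_trans K1.
have kK := kapK; rewrite -mulrA in kK.
have kK2 : 8 * kap * K ^+ 2 = 2 * (4 * (kap * K) * K) by ring.
have k2 := kapK2; rewrite {}kK2 in k2.
clear T B B1 A; move: (kap * K) th th0 kK k2 => t th th0 kK k2.
have f1z : f1 z <= 1 + 4 * t.
  have q := f1_gt0 zlu.
  have w : (1 - t / 2) * (1 - t / 2) <= v z * v z by apply: ler_pM => //; lra.
  have w1 : (1 - t / 2) * (1 - t / 2) * f1 z <= 1.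
    by rewrite -[leRHS](vv zlu); apply: ler_wpM2r => //; exact: ltW.
  have w2 : 1 <= (1 - t / 2) * (1 - t / 2) * (1 + 4 * t).
    have : 0 <= t * (3 - 15 / 4 * t) by apply: mulr_ge0; lra.
    have : 0 <= t * t * t by apply: mulr_ge0; [apply: mulr_ge0|]; exact: ltW.
    lra.
  have w3 : 0 < (1 - t / 2) * (1 - t / 2) by apply: mulr_gt0; lra.
  by rewrite -(ler_pM2l w3); apply: le_trans w1 w2.
have D : - (4 * t) * (m - l) <= (1 - f1 z) * (m - l) by apply: ler_wpM2r; lra.
have D2 : 4 * t * (m - l) <= 4 * t * K by apply: ler_wpM2l; [lra|move: luK mlu; lra].
by move: gl; lra.
Qed.

(** The second derivative of the gap stays above kap / 2 within distance r of m. *)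
Let near m z : l <= m <= u -> f1 m = 1 -> kap <= - f2 m -> l <= z <= u ->
  `|z - m| <= r -> kap / 4 * (z - m) ^+ 2 <= z - f z.
Proof.
move=> mlu fm kapm zlu zm; have g0 := pos mlu.
have a0 : l <= Num.max l (m - r) by rewrite le_max lexx.
have a1 : Num.min u (m + r) <= u by rewrite ge_min lexx.
have := taylor_ge (k := kap / 2) (diff_on_sub a0 a1 dg) (diff_on_sub a0 a1 dg1) _
  (x := m) (y := z).
rewrite fm subrr mul0r subr0 => T.
suff : kap / 2 / 2 * (z - m) ^+ 2 <= z - f z - (m - f m) by lra.
move: zm; rewrite ler_norml => zm.
apply: T; last 2 first.
- by rewrite ge_max le_min; move: mlu (r0); lra.
- by rewrite ge_max le_min; move: zlu; lra.
move=> w; rewrite ge_max le_min => /andP[/andP[lw mw] /andP[wu wm]].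
have wlu : l <= w <= u by rewrite lw.
have /ler_normlP[_ L] := diff_on_lip d3 b3 wlu mlu.
have : K * `|w - m| <= K * r.
  by apply: ler_wpM2l; [exact: le_trans K1|rewrite ler_norml; lra].
by move: rK; lra.
Qed.

(** Let m be the point where the gap is least. Within distance r of m Taylor's
    formula applies. To the right, the tangent line of v at m gives v >= 1, that
    is Df <= 1, and the gap increases. To the left, by convexity of v, either v
    <= 1 up to m and the gap is monotone in between, or v >= 1 back to l and the
    gap exceeds its value at l. *)
Lemma schwarzian_gap_at : exists2 x0, l <= x0 <= u &
  forall x, l <= x <= u -> c * (x - x0) ^+ 2 <= x - f x.
Proof.
have [m + mmin] := EVT_min lu (diff_on_within dg); rewrite in_itv/= => mlu.
have {}mmin x : l <= x <= u -> m - f m <= x - f x by move=> xlu; apply: mmin; rewrite in_itv.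
exists m => // x xlu.
have sq : (x - m) ^+ 2 <= K ^+ 2.
  rewrite -[leLHS]real_normK ?num_real// lerXn2r ?nnegrE//; move: (K1) (luK) mlu xlu; first lra.
  by rewrite ler_norml; lra.
have far h : c * K ^+ 2 <= h -> h <= x - f x -> c * (x - m) ^+ 2 <= x - f x.
  move=> A B; apply: le_trans B; apply: le_trans A.
  by apply: ler_wpM2l => //; exact: ltW.
case: (ler_or_gt (k / 2) (m - f m)) => gm.
  by apply: far cK _; apply: le_trans gm (mmin _ xlu).
have ml : l < m < u.
  move: (k0) => ?; apply/andP; split; rewrite lt_neqAle.
    by case/andP: mlu => -> _; rewrite andbT; apply/eqP => E; move: gl gm; rewrite E; lra.
  by case/andP: mlu => _ ->; rewrite andbT; apply/eqP => E; move: gu gm; rewrite -E; lra.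
have fm : f1 m = 1.
  by apply/eqP; rewrite eq_sym -subr_eq0; apply/eqP; exact: diff_on_argmin dg ml mmin.
have vm : v m = 1 by rewrite /v fm sqrtr1 invr1.
have v1m : v1 m = - (1 / 2) * f2 m by rewrite /v1 vm !mulr1.
have kapm := curvature mlu gm vm v1m (proj1 (andP ml)).
have nearm := near mlu fm kapm.
case: (ler_or_gt `|x - m| r) => xm.
  by apply: le_trans (nearm _ xlu xm); apply: ler_wpM2r => //; exact: sqr_ge0.
have edge z : l <= z <= u -> `|z - m| = r -> z - f z <= x - f x ->
    c * (x - m) ^+ 2 <= x - f x.
  move=> zlu zm zx; apply: (far _ cr); apply: le_trans zx.
  by have := nearm z zlu; rewrite -[(z - m) ^+ 2]real_normK ?num_real// zm; apply.
clear nearm sq mmin gm.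
have r1 : 0 <= r by exact: ltW.
have r2 : 0 < - f2 m by exact: lt_le_trans kapm.
case: (ler_or_gt m x) => mx.
  rewrite ger0_norm ?subr_ge0// in xm.
  apply: (edge (m + r)); [by move: mlu xlu; lra|by rewrite addrC addKr ger0_norm|].
  apply: (diff_on_incr (diff_on_sub (proj1 (andP mlu)) (lexx u) dg)); last by case/andP: xlu.
  - move=> w /andP[mw wu]; rewrite subr_ge0; have wlu : l <= w <= u by move: mlu; lra.
    apply: f1_le1 => //; have := tangent mlu wlu; rewrite vm v1m => T.
    have : 0 <= - f2 m * (w - m) by apply: mulr_ge0; lra.
    lra.
  - lra.
  - lra.
rewrite ltr0_norm ?subr_lt0// in xm.
case: (ler_or_gt (v x) 1) => v_1.
  apply: (edge (m - r)); [by move: mlu xlu; lra|by rewrite addrC addKr normrN ger0_norm|].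
  have H := diff_on_opp (diff_on_sub (proj1 (andP xlu)) (proj2 (andP mlu)) dg).
  have := diff_on_incr H (x := x) (y := m - r) _ (lexx _) ltac:(lra) ltac:(lra).
  rewrite lerN2; apply => w /andP[xw wm].
  have wlu : l <= w <= u by move: mlu xlu; lra.
  rewrite oppr_ge0 subr_le0; apply: f1_ge1 => //.
  have [] := quasi mlu xlu (ltW xw) (ltW wm); first by rewrite vm.
  by move=> /le_trans; apply.
apply: (far k); first by move: cK (k0); lra.
apply: le_trans gl _.
apply: (diff_on_incr (diff_on_sub (lexx l) (proj2 (andP xlu)) dg)) => //; last by case/andP: xlu.
move=> w /andP[lw wx]; rewrite subr_ge0; have wlu : l <= w <= u by move: mlu xlu; lra.
apply: f1_le1 => //; rewrite leNgt; apply/negP => A.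
have [] := quasi mlu wlu (ltW wx) (ltW mx); rewrite ?vm leNgt ?v_1//.
by rewrite (lt_trans A v_1).
Qed.

End schwarzian_gap.

Section schwarzian_constant.
Variable R : realType.

(** The quadratic lower bound for the gap that makes the corridor a passage;
    this is the only place where the Schwarzian derivative enters. *)
Lemma schwarzian_gap (K : R) : 1 < K -> exists2 c, 0 < c &
  forall l u f f1 f2 f3, l <= u -> u - l <= K ->
  diff_on l u f f1 -> diff_on l u f1 f2 -> diff_on l u f2 f3 ->
  (forall x, l <= x <= u -> K^-1 <= f1 x <= K) ->
  (forall x, l <= x <= u -> `|f3 x| <= K) ->
  (forall x, l <= x <= u -> f3 x / f1 x - 3 / 2 * (f2 x / f1 x) ^+ 2 <= 0) ->
  (forall x, l <= x <= u -> 0 < x - f x) ->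
  K^-1 <= l - f l -> K^-1 <= u - f u ->
  exists2 x0, l <= x0 <= u & forall x, l <= x <= u -> c * (x - x0) ^+ 2 <= x - f x.
Proof.
move=> K1; have K0 : 0 < K by lra.
set k := K^-1; have kK : k * K = 1 by rewrite mulVf// gt_eqF.
have k0 : 0 < k by rewrite invr_gt0.
have k1 : k <= 1 by rewrite invf_le1// ltW.
clearbody k.
have [kap kapE] : exists kap, kap = k ^+ 3 / 8 by eexists.
have [r rE] : exists r, r = kap * k / 2 by eexists.
have [c cE0] : exists c, c = kap * r ^+ 2 * k ^+ 2 / 4 by eexists.
have kap0 : 0 < kap by rewrite kapE divr_gt0// exprn_gt0.
have r0 : 0 < r by rewrite rE divr_gt0// mulr_gt0.
have kk : k ^+ 2 <= 1 by rewrite expr_le1// ltW.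
have kap1 : kap <= 1 by rewrite kapE; have : k ^+ 3 <= 1 by [rewrite expr_le1// ltW]; lra.
have r1 : r <= 1.
  have : kap * k <= 1 by rewrite mulr_ile1// ltW.
  by rewrite rE; lra.
have rr : r ^+ 2 <= 1 by rewrite expr_le1// ltW.
have rk : r ^+ 2 * k ^+ 2 <= 1 by rewrite mulr_ile1// sqr_ge0.
have cE : c * K ^+ 2 = kap / 4 * r ^+ 2.
  have -> : c * K ^+ 2 = kap * r ^+ 2 * (k * K) ^+ 2 / 4 by rewrite cE0; ring.
  by rewrite kK; ring.
have kk2 : k ^+ 3 <= k by rewrite -[leRHS]mulr1 exprS; apply: ler_wpM2l => //; exact: ltW.
have c0 : 0 < c by rewrite cE0 divr_gt0// !mulr_gt0// exprn_gt0.
exists c => // l u f f1 f2 f3 lu luK d1 d2 d3 b1 b3 S pos gl gu.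
apply: (schwarzian_gap_at (K := K) (k := k) (kap := kap) (r := r) (f1 := f1) (f2 := f2)
  (f3 := f3)) => //.
- exact: ltW.
- have -> : 2 * kap * K = k ^+ 2 / 4 * (k * K) by rewrite kapE; field.
  by rewrite kK; lra.
- have -> : 8 * kap * K ^+ 2 = k * (k * K) ^+ 2 by rewrite kapE; field.
  by rewrite kK expr1n mulr1.
- have -> : 2 * K * r = kap * (k * K) by rewrite rE; field.
  by rewrite kK mulr1.
- rewrite cE; have : kap / 4 * r ^+ 2 <= kap / 4 by apply: ler_piMr => //; rewrite divr_ge0// ltW.
  by rewrite kapE; lra.
- rewrite cE0; have : kap * (r ^+ 2 * k ^+ 2) <= kap by apply: ler_piMr => //; exact: ltW.
  by rewrite mulrA; lra.
- by rewrite cE.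
Qed.

End schwarzian_constant.

(** * Normalizing coordinates *)

Section conjugation.
Variable R : realType.
Implicit Types (M N d s x y : R).

Lemma lclose_refl M d x : 0 <= d -> `|x| <= M -> lclose M d x x.
Proof. by move=> d0 xM; split=> //; rewrite subrr normr0 mulr_ge0//; apply: le_trans xM. Qed.

(** The Moebius map that sends -1, 0, s to -1, 0, 1, and its inverse. *)
Definition mo s := @moeb R (1 + s) (2 * s) (s - 1).
Definition mo1 s := @moeb1 R (1 + s) (2 * s) (s - 1).
Definition mo2 s := @moeb2 R (1 + s) (2 * s) (s - 1).
Definition mi s := @moeb R (2 * s) (1 + s) (1 - s).
Definition mi1 s := @moeb1 R (2 * s) (1 + s) (1 - s).
Definition mi2 s := @moeb2 R (2 * s) (1 + s) (1 - s).

Lemma mobN1 s x : mob (-1) s x = mo s x.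
Proof.
rewrite /mob /mo /moeb -[LHS]mulrNN -invrN.
by congr (_ / _); ring.
Qed.

Lemma mobVN1 s x : mobV (-1) s x = mi s x.
Proof.
rewrite /mobV /mi /moeb -[LHS]mulrNN -invrN.
by congr (_ / _); ring.
Qed.

Lemma mo_den k s x : 0 < k -> k <= 1 -> k <= s -> -1 <= x <= s -> k <= 2 * s + (s - 1) * x.
Proof.
move=> k0 k1 ks /andP[x1 xs]; have [s1|s1] := leP 1 s.
  have : 0 <= (s - 1) * (x + 1) by apply: mulr_ge0; lra.
  lra.
have : 0 <= (1 - s) * (s - x) by apply: mulr_ge0; lra.
have : 0 <= s * s by apply: mulr_ge0; lra.
lra.
Qed.

Lemma mi_den k s y : 0 < k -> k <= 1 -> k <= s -> -1 <= y <= 1 -> k <= 1 + s + (1 - s) * y.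
Proof.
move=> k0 k1 ks /andP[x1 xs]; have [s1|s1] := leP 1 s.
  have : 0 <= (s - 1) * (1 - y) by apply: mulr_ge0; lra.
  lra.
have : 0 <= (1 - s) * (y + 1) by apply: mulr_ge0; lra.
lra.
Qed.

Lemma mo_den0 s x : 0 < s -> -1 <= x <= s -> 0 < 2 * s + (s - 1) * x.
Proof.
move=> s0 xs; have m0 : 0 < Num.min s 1 by rewrite lt_min s0 ltr01.
by apply: lt_le_trans m0 (mo_den _ _ _ xs); rewrite ?ge_min ?lexx ?orbT// lt_min s0 ltr01.
Qed.

Lemma mi_den0 s y : 0 < s -> -1 <= y <= 1 -> 0 < 1 + s + (1 - s) * y.
Proof.
move=> s0 xs; have m0 : 0 < Num.min s 1 by rewrite lt_min s0 ltr01.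
by apply: lt_le_trans m0 (mi_den _ _ _ xs); rewrite ?ge_min ?lexx ?orbT// lt_min s0 ltr01.
Qed.

Lemma moE s : 0 < s -> [/\ mo s (-1) = -1, mo s 0 = 0 & mo s s = 1].
Proof. by move=> s0; rewrite -!mobN1; apply: mobE => //; exact: ltrN10. Qed.

Lemma miE s : 0 < s -> [/\ mi s (-1) = -1, mi s 0 = 0 & mi s 1 = s].
Proof. by move=> s0; rewrite -!mobVN1; apply: mobVE => //; exact: ltrN10. Qed.

Lemma moK s x : 0 < s -> -1 <= x <= s -> mi s (mo s x) = x.
Proof. by move=> s0 xs; rewrite -mobVN1 -mobN1; apply: mobK => //; exact: ltrN10. Qed.

Lemma miK s y : 0 < s -> -1 <= y <= 1 -> mo s (mi s y) = y.
Proof.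
move=> s0 ys; have /gt_eqF/negbT D0 := mi_den0 s0 ys.
have s1 : s != 0 by rewrite gt_eqF.
have sp : 1 + s != 0 by rewrite gt_eqF// ltr_pwDl// ltW.
rewrite /mo /mi /moeb.
have -> : 2 * s + (s - 1) * (2 * s * y / (1 + s + (1 - s) * y)) =
   2 * s * (1 + s) / (1 + s + (1 - s) * y) by field.
by field; rewrite D0 sp s1.
Qed.

Lemma mo_lt s x y : 0 < s -> -1 <= x -> x < y -> y <= s -> mo s x < mo s y.
Proof.
move=> s0 x1 xy ys.
have dx : 0 < 2 * s + (s - 1) * x by apply: mo_den0 => //; lra.
have dy : 0 < 2 * s + (s - 1) * y by apply: mo_den0 => //; lra.
rewrite -subr_gt0 moeb_sub ?gt_eqF//; apply: mulr_gt0; last by rewrite subr_gt0.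
by rewrite !mulr_gt0// ?invr_gt0//; lra.
Qed.

Lemma mi_lt s x y : 0 < s -> -1 <= x -> x < y -> y <= 1 -> mi s x < mi s y.
Proof.
move=> s0 x1 xy ys.
have dx : 0 < 1 + s + (1 - s) * x by apply: mi_den0 => //; lra.
have dy : 0 < 1 + s + (1 - s) * y by apply: mi_den0 => //; lra.
rewrite -subr_gt0 moeb_sub ?gt_eqF//; apply: mulr_gt0; last by rewrite subr_gt0.
by rewrite !mulr_gt0// ?invr_gt0//; lra.
Qed.

Lemma mo_le s x y : 0 < s -> -1 <= x -> x <= y -> y <= s -> mo s x <= mo s y.
Proof.
by move=> s0 x1; rewrite le_eqVlt => /predU1P[->//|xy] ys; apply/ltW/mo_lt.
Qed.

Lemma mi_le s x y : 0 < s -> -1 <= x -> x <= y -> y <= 1 -> mi s x <= mi s y.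
Proof.
by move=> s0 x1; rewrite le_eqVlt => /predU1P[->//|xy] ys; apply/ltW/mi_lt.
Qed.

Lemma mo_bd s x : 0 < s -> -1 <= x <= s -> -1 <= mo s x <= 1.
Proof.
move=> s0 /andP[x1 xs]; have [a _ b] := moE s0.
by apply/andP; split; [rewrite -[leLHS]a|rewrite -[leRHS]b]; apply: mo_le.
Qed.

Lemma mi_bd s y : 0 < s -> -1 <= y <= 1 -> -1 <= mi s y <= s.
Proof.
move=> s0 /andP[x1 xs]; have [a _ b] := miE s0.
by apply/andP; split; [rewrite -[leLHS]a|rewrite -[leRHS]b]; apply: mi_le.
Qed.

Lemma mo_neg s x : 0 < s -> -1 <= x <= 0 -> -1 <= mo s x <= 0.
Proof.
move=> s0 /andP[x1 x0]; have [a b _] := moE s0.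
by apply/andP; split; [rewrite -[leLHS]a|rewrite -[leRHS]b]; apply: mo_le => //; lra.
Qed.

Lemma mo_pos s x : 0 < s -> 0 <= x <= s -> 0 <= mo s x <= 1.
Proof.
move=> s0 /andP[x0 xs]; have [_ a b] := moE s0.
by apply/andP; split; [rewrite -[leLHS]a|rewrite -[leRHS]b]; apply: mo_le => //; lra.
Qed.

Lemma mi_neg s y : 0 < s -> -1 <= y <= 0 -> -1 <= mi s y <= 0.
Proof.
move=> s0 /andP[x1 x0]; have [a b _] := miE s0.
by apply/andP; split; [rewrite -[leLHS]a|rewrite -[leRHS]b]; apply: mi_le => //; lra.
Qed.

Lemma mi_pos s y : 0 < s -> 0 <= y <= 1 -> 0 <= mi s y <= s.
Proof.
move=> s0 /andP[x0 xs]; have [_ a b] := miE s0.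
by apply/andP; split; [rewrite -[leLHS]a|rewrite -[leRHS]b]; apply: mi_le => //; lra.
Qed.

Lemma lclose_mi M k : 0 < k -> k <= 1 -> exists C, forall d s s' y y',
  0 <= d -> k <= s -> k <= s' -> lclose M d s s' -> -1 <= y <= 1 -> -1 <= y' <= 1 ->
  lclose M d y y' ->
  [/\ lclose C d (mi s y) (mi s' y'), lclose C d (mi1 s y) (mi1 s' y') &
      lclose C d (mi2 s y) (mi2 s' y')].
Proof.
move=> k0 k1; have [C HC] := lclose_moeb (2 * (2 * M) + 1 + M) k0.
exists C => d s s' y y' d0 ks ks' ss yb yb' yy; have M0 := lclose_ge0 ss.
have one : lclose 1 d (1 : R) 1 by apply: lclose_refl; rewrite ?normr1.
have two : lclose 2 d (2 : R) 2 by apply: lclose_refl; rewrite // ger0_norm.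
apply: HC => //; try exact: mi_den.
- apply: lclose_weak (lclose_mul two ss) => //; lra.
- apply: lclose_weak (lclose_add one ss) => //; lra.
- apply: lclose_weak (lclose_add one (lclose_opp ss)) => //; lra.
- by apply: lclose_weak yy => //; lra.
Qed.

Lemma lclose_mo M k : 0 < k -> k <= 1 -> exists C, forall d s s' x x',
  0 <= d -> k <= s -> k <= s' -> lclose M d s s' -> -1 <= x <= s -> -1 <= x' <= s' ->
  lclose M d x x' ->
  [/\ lclose C d (mo s x) (mo s' x'), lclose C d (mo1 s x) (mo1 s' x') &
      lclose C d (mo2 s x) (mo2 s' x')].
Proof.
move=> k0 k1; have [C HC] := lclose_moeb (2 * (2 * M) + 1 + M) k0.
exists C => d s s' y y' d0 ks ks' ss yb yb' yy; have M0 := lclose_ge0 ss.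
have one : lclose 1 d (1 : R) 1 by apply: lclose_refl; rewrite ?normr1.
have two : lclose 2 d (2 : R) 2 by apply: lclose_refl; rewrite // ger0_norm.
apply: HC => //; try exact: mo_den.
- apply: lclose_weak (lclose_add one ss) => //; lra.
- apply: lclose_weak (lclose_mul two ss) => //; lra.
- apply: lclose_weak (lclose_add ss (lclose_opp one)) => //; lra.
- by apply: lclose_weak yy => //; lra.
Qed.

(** Conjugation of a branch by the normalizing map, on 2-jets. *)
Definition cj s f y := mo s (f (mi s y)).
Definition cj1 s f f1 y := ch1 (mo1 s (f (mi s y))) (ch1 (f1 (mi s y)) (mi1 s y)).
Definition cj2 s f f1 f2 y := ch2 (mo1 s (f (mi s y))) (mo2 s (f (mi s y)))
  (ch1 (f1 (mi s y)) (mi1 s y))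
  (ch2 (f1 (mi s y)) (f2 (mi s y)) (mi1 s y) (mi2 s y)).

Lemma diff_cj s a b l u f f1 f2 : 0 < s -> -1 <= a -> b <= 1 ->
  (forall y, a <= y <= b -> l <= mi s y <= u) ->
  (forall x, l <= x <= u -> -1 <= f x <= s) ->
  diff_on l u f f1 -> diff_on l u f1 f2 ->
  diff_on a b (cj s f) (cj1 s f f1) /\ diff_on a b (cj1 s f f1) (cj2 s f f1 f2).
Proof.
move=> s0 a1 b1 Hm Hf F1 F2.
have Di y : a <= y <= b -> 1 + s + (1 - s) * y != 0.
  by move=> yab; rewrite gt_eqF// mi_den0//; lra.
have Do x : -1 <= x <= s -> 2 * s + (s - 1) * x != 0.
  by move=> xs; rewrite gt_eqF// mo_den0.
have I1 := diff_moeb (2 * s) Di; have I2 := diff_moeb1 (2 * s) Di.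
have O1 := diff_moeb (1 + s) Do; have O2 := diff_moeb1 (1 + s) Do.
have G1 := diff_ch1 I1 F1 Hm; have G2 := diff_ch2 I1 I2 F1 F2 Hm.
have Hg y : a <= y <= b -> -1 <= (f \o mi s) y <= s by move=> /Hm/Hf.
split; [exact (diff_ch1 G1 O1 Hg)|exact (diff_ch2 G1 G2 O1 O2 Hg)].
Qed.

Lemma lclose_cj M k : 0 < k -> k <= 1 -> exists C, forall d s s' y y' f f1 f2 h h1 h2,
  0 <= d -> k <= s -> k <= s' -> lclose M d s s' -> -1 <= y <= 1 -> -1 <= y' <= 1 ->
  lclose M d y y' -> -1 <= f (mi s y) <= s -> -1 <= h (mi s' y') <= s' ->
  lclose M d (f (mi s y)) (h (mi s' y')) -> lclose M d (f1 (mi s y)) (h1 (mi s' y')) ->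
  lclose M d (f2 (mi s y)) (h2 (mi s' y')) ->
  [/\ lclose C d (cj s f y) (cj s' h y'), lclose C d (cj1 s f f1 y) (cj1 s' h h1 y') &
      lclose C d (cj2 s f f1 f2 y) (cj2 s' h h1 h2 y')].
Proof.
move=> k0 k1; have [Ci Hi] := lclose_mi M k0 k1; have [Co Ho] := lclose_mo M k0 k1.
have [G GE] : exists G, G = 2 * (M * Ci) by eexists.
have [P PE] : exists P, P = 2 * (G * Ci) + G by eexists.
have [T TE] : exists T, T = 2 * (Co * P) by eexists.
exists (Co + (2 * (T * P) + T)) => d s s' y y' f f1 f2 h h1 h2 d0 ks ks' ss yb yb' yy fb hb c0 c1 c2.
have [i0 i1 i2] := Hi _ _ _ _ _ d0 ks ks' ss yb yb' yy.
have [q0 q1 q2] := Ho _ _ _ _ _ d0 ks ks' ss fb hb c0.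
have g1 := lclose_ch1 c1 i1; have g2 := lclose_ch2 c1 c2 i1 i2.
have M0 := lclose_ge0 c1; have Ci0 := lclose_ge0 i1; have Co0 := lclose_ge0 q1.
rewrite -GE in g1 g2; rewrite -PE in g2.
have G0 : 0 <= G by rewrite GE mulr_ge0// mulr_ge0.
have GC : 0 <= 2 * (G * Ci) by rewrite mulr_ge0// mulr_ge0.
have GP : G <= P by rewrite PE lerDr.
have P0 := le_trans G0 GP.
have g1' := lclose_weak GP d0 g1.
have r1 := lclose_ch1 q1 g1'; have r2 := lclose_ch2 q1 q2 g1' g2.
rewrite -TE in r1 r2.
have T0 : 0 <= T by rewrite TE mulr_ge0// mulr_ge0.
have TP : 0 <= 2 * (T * P) by rewrite mulr_ge0// mulr_ge0.
by split; [apply: lclose_weak q0|apply: lclose_weak r1|apply: lclose_weak r2] => //; lra.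
Qed.

End conjugation.

(** * Two-jets *)

Section jets.
Variable R : realType.
Implicit Types (a b M N d : R).

(** The second derivative is Lipschitz, which is what allows second derivatives
    to be compared at different points. *)
Record jet a b M (f f1 f2 : R -> R) : Prop := Jet {
  jt_d1 : diff_on a b f f1;
  jt_d2 : diff_on a b f1 f2;
  jt_b0 : forall x, a <= x <= b -> `|f x| <= M;
  jt_b1 : forall x, a <= x <= b -> `|f1 x| <= M;
  jt_b2 : forall x, a <= x <= b -> `|f2 x| <= M;
  jt_lip : forall x y, a <= x <= b -> a <= y <= b -> `|f2 x - f2 y| <= M * `|x - y| }.

Lemma jet_weak a b M N f f1 f2 : M <= N -> jet a b M f f1 f2 -> jet a b N f f1 f2.
Proof.
move=> MN [d1 d2 b0 b1 b2 L]; split=> // x.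
- by move=> xab; apply: le_trans MN; exact: b0.
- by move=> xab; apply: le_trans MN; exact: b1.
- by move=> xab; apply: le_trans MN; exact: b2.
- by move=> y xab yab; apply: le_trans (L _ _ xab yab) _; exact: ler_wpM2r.
Qed.

Lemma jet_lclose a b M N d f f1 f2 x y : jet a b M f f1 f2 -> 0 <= d -> lclose N d x y ->
  a <= x <= b -> a <= y <= b ->
  [/\ lclose (M + M * N) d (f x) (f y), lclose (M + M * N) d (f1 x) (f1 y) &
      lclose (M + M * N) d (f2 x) (f2 y)].
Proof.
move=> J d0 c xab yab; have N0 := lclose_ge0 c; case: c => _ _ c.
have M0 : 0 <= M by apply: le_trans (jt_b0 J xab).
have MN : 0 <= M * N by rewrite mulr_ge0.
have W : M <= M + M * N by rewrite lerDl.
have L : M * `|x - y| <= (M + M * N) * d.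
  apply: (@le_trans _ _ (M * (N * d))); first exact: ler_wpM2l.
  by rewrite mulrDl mulrA lerDr mulr_ge0.
have b0 z : a <= z <= b -> `|f z| <= M by exact: (jt_b0 J).
have b1 z : a <= z <= b -> `|f1 z| <= M by exact: (jt_b1 J).
have b2 z : a <= z <= b -> `|f2 z| <= M by exact: (jt_b2 J).
split; split; try by apply: le_trans W; first [exact: b0|exact: b1|exact: b2].
- by apply: le_trans (diff_on_lip (jt_d1 J) b1 xab yab) L.
- by apply: le_trans (diff_on_lip (jt_d2 J) b2 xab yab) L.
- by apply: le_trans (jt_lip J xab yab) L.
Qed.

Lemma close_jet_lclose a b M N d f f1 f2 h h1 h2 x y :
  jet a b M f f1 f2 -> jet a b M h h1 h2 -> close_on a b d f f1 f2 h h1 h2 ->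
  0 <= d -> lclose N d x y -> a <= x <= b -> a <= y <= b ->
  [/\ lclose (M + M * N + 1) d (f x) (h y), lclose (M + M * N + 1) d (f1 x) (h1 y) &
      lclose (M + M * N + 1) d (f2 x) (h2 y)].
Proof.
move=> J J' C d0 c xab yab; have [c0 c1 c2] := jet_lclose J d0 c xab yab.
have [A0 A1 A2] := C _ yab.
have P := lclose_ge0 c0; have N0 := lclose_ge0 c.
have M0 : 0 <= M by apply: le_trans (jt_b0 J xab).
have W : M <= M + M * N + 1.
  by have : 0 <= M * N by [exact: mulr_ge0]; lra.
have key (u v w : R) : lclose (M + M * N) d u v -> `|w - v| <= d -> `|w| <= M ->
    lclose (M + M * N + 1) d u w.
  move=> [p1 p2 p3] p4 p5; split; [lra|exact: le_trans W|].
  have -> : u - w = (u - v) - (w - v) by ring.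
  apply: le_trans (ler_normB _ _) _; lra.
split; [apply: key c0 A0 _|apply: key c1 A1 _|apply: key c2 A2 _].
- exact: (jt_b0 J').
- exact: (jt_b1 J').
- exact: (jt_b2 J').
Qed.

Lemma lclose_jet a b M f f1 f2 : diff_on a b f f1 -> diff_on a b f1 f2 ->
  (forall d x y, 0 <= d -> a <= x <= b -> a <= y <= b -> `|x - y| <= d ->
    [/\ lclose M d (f x) (f y), lclose M d (f1 x) (f1 y) & lclose M d (f2 x) (f2 y)]) ->
  jet a b M f f1 f2.
Proof.
move=> d1 d2 H.
have B x : a <= x <= b -> [/\ lclose M 0 (f x) (f x), lclose M 0 (f1 x) (f1 x) & lclose M 0 (f2 x) (f2 x)].
  by move=> xab; apply: H; rewrite ?subrr ?normr0.
split=> //.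
- by move=> x /B[[]].
- by move=> x /B[_ []].
- by move=> x /B[_ _ []].
- by move=> x y xab yab; have [_ _ []] := H `|x - y| x y (normr_ge0 _) xab yab (lexx _).
Qed.

Lemma jet_cj K : 1 < K -> exists2 M, 1 <= M & forall s f f1 f2 l u a b,
  K^-1 <= s <= K -> -1 <= a -> b <= 1 ->
  (forall y, a <= y <= b -> l <= mi s y <= u) ->
  (forall x, l <= x <= u -> -1 <= f x <= s) ->
  jet l u K f f1 f2 -> jet a b M (cj s f) (cj1 s f f1) (cj2 s f f1 f2).
Proof.
move=> K1; have K0 : 0 < K by lra.
have k0 : 0 < K^-1 by rewrite invr_gt0.
have k1 : K^-1 <= 1 by rewrite invf_le1// ltW.
have [Ci Hi] := lclose_mi K k0 k1.
have [C HC] := lclose_cj (K + (K + K * Ci)) k0 k1.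
exists (C + 1) => [|s f f1 f2 l u a b ks a1 b1 Hm Hf J].
  have one : lclose K 0 (1 : R) 1 by apply: lclose_refl; rewrite ?normr1// ltW.
  have z : lclose K 0 (0 : R) 0 by apply: lclose_refl; rewrite ?normr0// ltW.
  have m0 : -1 <= (0 : R) <= 1 by lra.
  have [p0 _ _] := Hi 0 1 1 0 0 (lexx 0) k1 k1 one m0 m0 z.
  have Ci0 := lclose_ge0 p0.
  have W : K <= K + (K + K * Ci).
    by have : 0 <= K * Ci by [apply: mulr_ge0; lra]; lra.
  have mi0 : mi 1 0 = 0 :> R by have [_ ->] := miE (@ltr01 R).
  have wz := lclose_weak W (lexx 0) z.
  have [] := HC 0 1 1 0 0 (fun=> 0) (fun=> 0) (fun=> 0) (fun=> 0) (fun=> 0) (fun=> 0)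
    (lexx 0) k1 k1 (lclose_weak W (lexx 0) one) m0 m0 wz m0 m0 wz wz wz.
  by move=> /lclose_ge0 + _ _; lra.
have s0 : 0 < s by lra.
have [d1 d2] := diff_cj s0 a1 b1 Hm Hf (jt_d1 J) (jt_d2 J).
apply: (@jet_weak a b C); first by lra.
apply: lclose_jet => // d x y d0 xab yab xy.
have xb : -1 <= x <= 1 by lra. have yb : -1 <= y <= 1 by lra.
have xy1 : lclose 1 d x y.
  by split; [rewrite ler_norml|rewrite ler_norml|rewrite mul1r].
have xyK : lclose K d x y by apply: lclose_weak xy1 => //; exact: ltW.
have ss : lclose K d s s by apply: lclose_refl => //; rewrite ger0_norm; lra.
have ks' : K^-1 <= s by lra.
have [i0 _ _] := Hi _ _ _ _ _ d0 ks' ks' ss xb yb xyK.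
have Ci0 := lclose_ge0 i0.
have KC : 0 <= K * Ci by apply: mulr_ge0; lra.
have W : K <= K + (K + K * Ci) by lra.
have W2 : K + K * Ci <= K + (K + K * Ci) by lra.
have [f0 g1 g2] := jet_lclose J d0 i0 (Hm _ xab) (Hm _ yab).
by apply: HC => //; [exact: lclose_weak ss|exact: lclose_weak xyK|exact/Hf/Hm|exact/Hf/Hm|
  exact: lclose_weak f0|exact: lclose_weak g1|exact: lclose_weak g2].
Qed.

Lemma C3_jet K l u f : Cr_on 3 `[l, u] f -> (Cr_norm 3 `[l, u] f <= K%:E)%E -> 0 <= K ->
  let D k := nderiv_in `[l, u] k f in
  [/\ jet l u K f (D 1) (D 2), diff_on l u (D 2) (D 3) &
      forall x, l <= x <= u -> `|D 3 x| <= K].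
Proof.
move=> H N K0 D; move/Cr_normP : N => /(_ K0) N.
have B k x : (k <= 3)%N -> l <= x <= u -> `|D k x| <= K.
  by move=> k3 xlu; apply: N => //=; rewrite in_itv.
have d k : (k < 3)%N -> diff_on l u (D k) (D k.+1) by exact: Cr_on_diff.
split; [|exact: d|by move=> x; exact: B].
split; [exact: (d 0)|exact: d|by move=> x; exact: (B 0)|by move=> x; exact: B|
  by move=> x; exact: B|].
by move=> x y xlu ylu; apply: diff_on_lip (d 2 isT) _ xlu ylu => z; exact: B.
Qed.

End jets.

(** * Controlled pairs in normalizing coordinates *)

Section model.
Variable R : realType.

(** A pair in its normalizing coordinate, with branches F on [0, 1] and X on
    [-1, 0]; the corridor is [t, 1] with t = F^a 1, and its passage takes the
    unbounded number a of steps. *)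
Record model (c M : R) (a : nat) (F F1 F2 X X1 X2 : R -> R) : Prop := Model {
  md_F : jet 0 1 M F F1 F2;
  md_X : jet (-1) 0 M X X1 X2;
  md_F0 : F 0 = -1;
  md_X0 : X 0 = 1;
  md_FX : F 1 = X (-1);
  md_Fi : forall x y, 0 <= x -> x < y -> y <= 1 -> F x < F y;
  md_Xi : forall x y, -1 <= x -> x < y -> y <= 0 -> X x < X y;
  md_a : (0 < a)%N;
  md_orb : forall j, (j <= a)%N -> 0 <= iter j F 1 <= 1;
  md_t : c <= iter a F 1;
  md_Ft : iter a.+1 F 1 <= - c;
  md_F1 : F 1 <= 1 - c;
  md_D : forall x, iter a F 1 <= x <= 1 -> c <= F1 x;
  md_gap : exists x0, forall x, iter a F 1 <= x <= 1 -> c * (x - x0) ^+ 2 <= x - F x }.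

(** A fixed point would be a barrier that the orbit of s could not cross. *)
Lemma orbit_decr (f : R -> R) (s : R) (a : nat) :
  (forall x y, 0 <= x -> x < y -> y <= s -> f x < f y) ->
  (forall j, (j <= a)%N -> 0 <= iter j f s <= s) -> iter a.+1 f s < 0 ->
  (forall j, (j <= a)%N -> iter j.+1 f s < iter j f s) /\
  (forall x, iter a f s <= x <= s -> f x < x).
Proof.
move=> incr orb out.
have dec : forall j, (j <= a)%N -> iter (a - j).+1 f s < iter (a - j) f s.
  elim=> [_|j IH ja].
    by rewrite subn0; apply: lt_le_trans out _; case/andP: (orb a (leqnn a)).
  have E : (a - j = (a - j.+1).+1)%N by rewrite -subSn.
  have := IH (ltnW ja); rewrite {}E; set i := (a - j.+1)%N => D.
  have ia : (i < a)%N by rewrite /i; lia.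
  have /andP[A1 A2] := orb i (ltnW ia); have /andP[B1 B2] := orb i.+1 ia.
  rewrite ltNge; apply/negP; rewrite le_eqVlt => /predU1P[E|L].
    by move: D; rewrite [iter i.+2 _ _]iterS -E -[f _]iterS -E ltxx.
  by have := incr _ _ A1 L B2; rewrite -!iterS ltNge (ltW D).
have {}dec j : (j <= a)%N -> iter j.+1 f s < iter j f s.
  by move=> ja; have := dec (a - j)%N; rewrite subKn// => ->//; rewrite leq_subr.
split=> // x /andP[ax xs].
have [j [ja jx xj]] : exists j, [/\ (j <= a)%N, iter j f s <= x & (0 < j)%N -> x < iter j.-1 f s].
  pose P j := iter j f s <= x.
  have exP : exists j, P j by exists a.
  have [j Pj min] := ex_minnP exP.
  exists j; split=> //; first exact: min.
  case: (j) min => // i min _; rewrite ltNge; apply/negP => /min; by rewrite ltnn.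
have fx : forall y, 0 <= y <= s -> x <= y -> f x <= f y.
  move=> y /andP[y0 ys]; rewrite le_eqVlt => /predU1P[->//|xy].
  by apply/ltW/incr => //; apply: le_trans ax; case/andP: (orb a (leqnn a)).
case: j ja jx xj => [|j] ja jx xj.
  have <- : iter 0 f s = x by apply: le_anti; rewrite jx.
  exact: (dec 0).
have := fx _ (orb j (ltnW ja)) (ltW (xj isT)).
rewrite -iterS => L; move: jx; rewrite le_eqVlt => /predU1P[E|jx].
  by rewrite -E; exact: (dec j.+1).
exact: le_lt_trans jx.
Qed.

Lemma mo_bounds (K : R) : 1 < K -> exists lam Lam, [/\ 0 < lam, 0 < Lam, lam <= 1 &
  forall s, K^-1 <= s <= K ->
  [/\ forall x y, -1 <= x -> x <= y -> y <= s ->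
        lam * (y - x) <= mo s y - mo s x <= Lam * (y - x),
      forall x, -1 <= x <= s -> lam <= mo1 s x &
      forall x, -1 <= x <= 1 -> lam <= mi1 s x]].
Proof.
move=> K1; have K0 : 0 < K by lra.
set k := K^-1; have kK : k * K = 1 by rewrite mulVf// gt_eqF.
have k0 : 0 < k by rewrite invr_gt0.
have k1 : k <= 1 by rewrite invf_le1// ltW.
clearbody k.
pose D := 2 * K + K ^+ 2.
have KK : K <= K ^+ 2 by rewrite expr2; apply: ler_peMl; lra.
have D1 : 1 <= D by rewrite /D; lra.
have D0 : 0 < D by lra.
have [lam lamE] : exists lam, lam = 2 * k * D^-1 * D^-1 by eexists.
have iD : D^-1 <= 1 by rewrite invf_le1.
have iD0 : 0 < D^-1 by rewrite invr_gt0.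
exists lam, (2 * K * (1 + K) * k^-1 * k^-1).
have ik0 : 0 < k^-1 by rewrite invr_gt0.
have lam0 : 0 < lam by rewrite lamE; do 2 apply: mulr_gt0 => //; lra.
split=> //.
- by do 2 apply: mulr_gt0 => //; apply: mulr_gt0; lra.
- have D2 : D^-1 * D^-1 <= 2^-1.
    have : D^-1 <= 2^-1 by rewrite lef_pV2 ?posrE//; rewrite /D; lra.
    move=> A; have : D^-1 * D^-1 <= 2^-1 * 1 by apply: ler_pM => //; exact: ltW.
    by rewrite mulr1.
  rewrite lamE -mulrA; have : 2 * k * (D^-1 * D^-1) <= 2 * 1 * 2^-1.
    apply: ler_pM => //; [lra|apply: mulr_ge0; exact: ltW|lra].
  lra.
move=> s /andP[ks sK].
have s0 : 0 < s by lra.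
have num : 2 * k <= 2 * s * (1 + s).
  have : 0 <= s * s by rewrite mulr_ge0// ltW.
  lra.
have num2 : 2 * s * (1 + s) <= 2 * K * (1 + K) by apply: ler_pM; lra.
have odD x : -1 <= x <= s -> 2 * s + (s - 1) * x <= D.
  move=> xs; rewrite /D; have : (s - 1) * x <= K * K.
    apply: le_trans (ler_norm _) _; rewrite normrM; apply: ler_pM => //.
      by rewrite ler_norml; lra.
    by rewrite ler_norml; lra.
  by rewrite expr2; lra.
have idD x : -1 <= x <= 1 -> 1 + s + (1 - s) * x <= D.
  move=> xs; rewrite /D; have : (1 - s) * x <= K * 1.
    apply: le_trans (ler_norm _) _; rewrite normrM; apply: ler_pM => //.
      by rewrite ler_norml; lra.
    by rewrite ler_norml; lra.
  by lra.
have odk x : -1 <= x <= s -> k <= 2 * s + (s - 1) * x by exact: mo_den.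
have idk x : -1 <= x <= 1 -> k <= 1 + s + (1 - s) * x by exact: mi_den.
have inv_lo u : 0 < u -> u <= D -> D^-1 <= u^-1 by move=> u0 uD; rewrite lef_pV2.
have inv_hi u : k <= u -> u^-1 <= k^-1.
  by move=> ku; rewrite lef_pV2// posrE; lra.
have lo n u v : 2 * k <= n -> 0 < u -> 0 < v -> u <= D -> v <= D -> lam <= n * u^-1 * v^-1.
  move=> nk u0 v0 uD vD; rewrite lamE; have i1 := inv_lo _ u0 uD; have i2 := inv_lo _ v0 vD.
  apply: ler_pM => //; try exact: ltW.
    by apply: mulr_ge0; [lra|exact: ltW].
  by apply: ler_pM => //; [lra|exact: ltW].
split.
- move=> x y x1 xy ys.
  have xs : -1 <= x <= s by lra. have ysr : -1 <= y <= s by lra.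
  have xk := odk _ xs; have yk := odk _ ysr; have xD := odD _ xs; have yD := odD _ ysr.
  have x0 : 0 < 2 * s + (s - 1) * x by lra. have y0 : 0 < 2 * s + (s - 1) * y by lra.
  rewrite moeb_sub ?gt_eqF//.
  apply/andP; split; apply: ler_wpM2r; try (rewrite subr_ge0//).
    by apply: lo => //; lra.
  apply: ler_pM; [|by rewrite invr_ge0 ltW| |exact: inv_hi].
    by apply: mulr_ge0; [apply: mulr_ge0; lra|rewrite invr_ge0 ltW].
  apply: ler_pM; [apply: mulr_ge0; lra|by rewrite invr_ge0 ltW|lra|exact: inv_hi].
- move=> x xs; have xk := odk _ xs; have xD := odD _ xs; rewrite /mo1 /moeb1.
  by apply: lo => //; lra.
- move=> x xs; have xk := idk _ xs; have xD := idD _ xs; rewrite /mi1 /moeb1.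
  by apply: lo => //; lra.
Qed.

End model.

Section controlled_model.
Variable R : realType.

Lemma mob_conjE (z : cpair R) f : eta_ z 0 = -1 -> mob_conj z f = cj (xi_ z 0) f.
Proof. by move=> e; apply/funext => y; rewrite /mob_conj /= e mobVN1 mobN1. Qed.

Lemma normalized_maps (K : R) z : 1 < K -> critical_commuting_pair 3 z ->
  normalized z -> controlled K z ->
  [/\ eta_ z 0 = -1 /\ 0 < xi_ z 0, eta_ z (xi_ z 0) = xi_ z (-1),
      forall x y, 0 <= x -> x < y -> y <= xi_ z 0 -> eta_ z x < eta_ z y,
      forall x y, -1 <= x -> x < y -> y <= 0 -> xi_ z x < xi_ z y &
      (forall x, 0 <= x <= xi_ z 0 -> -1 <= eta_ z x <= xi_ z 0) /\
      (forall x, -1 <= x <= 0 -> -1 <= xi_ z x <= xi_ z 0)].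
Proof.
move=> K1 [[_ sz [_ [ieta _ _]] [_ [ixi _ _]]] [comm _] _ _ _] nz [_ [a _ [_ gs _ _ _]]].
have k0 : 0 < K^-1 by rewrite invr_gt0; lra.
have e1 : eta_ z 0 = -1 by exact: nz.
rewrite /dom_eta in ieta; rewrite /dom_xi e1 in ixi.
have ei x y : 0 <= x -> x < y -> y <= xi_ z 0 -> eta_ z x < eta_ z y.
  by move=> x0 xy ys; apply: ieta => //=; rewrite in_itv/=; lra.
have xii x y : -1 <= x -> x < y -> y <= 0 -> xi_ z x < xi_ z y.
  by move=> x0 xy ys; apply: ixi => //=; rewrite in_itv/=; lra.
rewrite e1 in comm.
have ebd x : 0 <= x <= xi_ z 0 -> -1 <= eta_ z x <= eta_ z (xi_ z 0).
  move=> /andP[x0 xs]; apply/andP; split.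
    by rewrite -e1; move: x0; rewrite le_eqVlt => /predU1P[<-//|x0]; exact/ltW/ei.
  by move: xs; rewrite le_eqVlt => /predU1P[->//|xs]; exact/ltW/ei.
have xbd x : -1 <= x <= 0 -> eta_ z (xi_ z 0) <= xi_ z x <= xi_ z 0.
  move=> /andP[x0 xs]; apply/andP; split.
    by rewrite comm; move: x0; rewrite le_eqVlt => /predU1P[<-//|x0]; exact/ltW/xii.
  by move: xs; rewrite le_eqVlt => /predU1P[->//|xs]; exact/ltW/xii.
have es1 : -1 <= eta_ z (xi_ z 0).
  by have := ebd (xi_ z 0); rewrite lexx (ltW sz) => /(_ isT)/andP[].
split=> //; split=> x; [move=> /ebd; lra|move=> /xbd; lra].
Qed.

Section in_coordinates.
Variables (K lam Lam cS c M s : R) (a : nat).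
Variables (eta eta1 eta2 eta3 xi xi1 xi2 : R -> R).
Hypothesis (k0 : 0 < K^-1) (lam0 : 0 < lam) (Lam0 : 0 < Lam) (cS0 : 0 < cS).
Hypothesis (l3 : c <= lam * K^-1) (l2 : c <= lam * (K^-1 * lam)).
Hypothesis (l4 : c <= lam * (cS / Lam ^+ 2)).
Hypothesis HL1 : forall x y, -1 <= x -> x <= y -> y <= s ->
  lam * (y - x) <= mo s y - mo s x <= Lam * (y - x).
Hypothesis HL2 : forall x, -1 <= x <= s -> lam <= mo1 s x.
Hypothesis HL3 : forall x, -1 <= x <= 1 -> lam <= mi1 s x.
Hypothesis JF : jet 0 1 M (cj s eta) (cj1 s eta eta1) (cj2 s eta eta1 eta2).
Hypothesis JX : jet (-1) 0 M (cj s xi) (cj1 s xi xi1) (cj2 s xi xi1 xi2).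
Hypothesis (s0 : 0 < s) (e0 : eta 0 = -1) (x0 : xi 0 = s) (comm : eta s = xi (-1)).
Hypothesis ei : forall x y, 0 <= x -> x < y -> y <= s -> eta x < eta y.
Hypothesis xii : forall x y, -1 <= x -> x < y -> y <= 0 -> xi x < xi y.
Hypothesis ebd : forall x, 0 <= x <= s -> -1 <= eta x <= s.
Hypothesis xbd : forall x, -1 <= x <= 0 -> -1 <= xi x <= s.
Hypothesis a0 : (0 < a)%N.
Hypothesis orb : forall j, (j <= a)%N -> 0 <= iter j eta s <= s.
Hypothesis gs : K^-1 <= s - eta s.
Hypothesis ta : K^-1 <= iter a eta s.
Hypothesis fta : iter a.+1 eta s <= - K^-1.
Hypothesis De : forall x, iter a eta s <= x <= s -> K^-1 <= eta1 x.
Hypothesis gap : exists2 w, iter a eta s <= w <= s &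
  forall x, iter a eta s <= x <= s -> cS * (x - w) ^+ 2 <= x - eta x.

Let t := iter a eta s.

Let t_in : 0 < t /\ -1 <= t <= s.
Proof. by have := orb (leqnn a); move: (ta) (k0); rewrite -/t; lra. Qed.

Let cjE x : -1 <= x <= s -> cj s eta (mo s x) = mo s (eta x).
Proof. by move=> xs; rewrite /cj moK. Qed.

Let itE j : (j <= a.+1)%N -> iter j (cj s eta) 1 = mo s (iter j eta s).
Proof.
elim: j => [|j IH] ja; first by have [_ _ ->] := moE s0.
by rewrite !iterS IH ?(ltnW ja)// cjE//; have := orb ja; lra.
Qed.

Let low x y : -1 <= x -> x + K^-1 <= y -> y <= s -> c <= mo s y - mo s x.
Proof.
move=> x1 xy ys; have xy' : x <= y by move: (k0); lra.
have /andP[H _] := HL1 x1 xy' ys; apply: le_trans l3 (le_trans _ H).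
by apply: ler_wpM2l; [exact: ltW|lra].
Qed.

Let corr x : iter a (cj s eta) 1 <= x <= 1 ->
  [/\ t <= mi s x <= s, -1 <= mi s x <= s, 0 <= mi s x <= s, -1 <= x <= 1 & x = mo s (mi s x)].
Proof.
have [tp tb] := t_in; rewrite itE ?leqnSn// -/t => /andP[tx x1].
have t1 := mo_bd s0 tb; have x11 : -1 <= x <= 1 by lra.
have [_ _ is_] := miE s0.
have A : t <= mi s x <= s.
  rewrite -[in X in X <= _ <= _](moK s0 tb) -[in X in _ <= _ <= X]is_.
  by apply/andP; split; apply: mi_le => //; lra.
by split=> //; [lra|lra|rewrite miK].
Qed.

Let gap_cj : exists w, forall x, iter a (cj s eta) 1 <= x <= 1 ->
  c * (x - w) ^+ 2 <= x - cj s eta x.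
Proof.
have [w wts H0] := gap; have [tp tb] := t_in; rewrite -/t in wts H0.
have ws : -1 <= w <= s by lra.
exists (mo s w) => x xt; have [A1 A2 A3 A5 A4] := corr xt.
have H := H0 _ A1; have E := ebd A3.
have P : eta (mi s x) <= mi s x.
  by rewrite -subr_ge0; apply: le_trans H; rewrite mulr_ge0 ?sqr_ge0// ltW.
have /andP[L _] := HL1 (proj1 (andP E)) P (proj2 (andP A2)).
have -> : x - cj s eta x = mo s (mi s x) - mo s (eta (mi s x)) by rewrite -A4.
apply: le_trans L; rewrite [X in X - mo s w]A4.
have D : `|mo s (mi s x) - mo s w| <= Lam * `|mi s x - w|.
  have pos (y y' : R) : y <= y' -> 0 <= lam * (y' - y).
    by move=> yy; apply: mulr_ge0; [exact: ltW|rewrite subr_ge0].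
  have [B|B] := leP w (mi s x).
    have /andP[B1 B2] := HL1 (proj1 (andP ws)) B (proj2 (andP A2)).
    by have q := pos _ _ B; rewrite !ger0_norm; lra.
  have /andP[B1 B2] := HL1 (proj1 (andP A2)) (ltW B) (proj2 (andP ws)).
  by have q := pos _ _ (ltW B); rewrite distrC (distrC (mi s x)) !ger0_norm; lra.
have D2 : (mo s (mi s x) - mo s w) ^+ 2 <= Lam ^+ 2 * (mi s x - w) ^+ 2.
  rewrite -(real_normK (num_real (mo s _ - _))) -(real_normK (num_real (mi s x - w))).
  by rewrite -exprMn lerXn2r// nnegrE mulr_ge0// ltW.
apply: (@le_trans _ _ (lam * (cS * (mi s x - w) ^+ 2))); last first.
  by apply: ler_wpM2l => //; exact: ltW.
apply: (@le_trans _ _ (lam * (cS / Lam ^+ 2) * (Lam ^+ 2 * (mi s x - w) ^+ 2))).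
  apply: (@le_trans _ _ (lam * (cS / Lam ^+ 2) * (mo s (mi s x) - mo s w) ^+ 2)).
    by apply: ler_wpM2r => //; exact: sqr_ge0.
  apply: ler_wpM2l => //; apply: mulr_ge0; first exact: ltW.
  by rewrite divr_ge0 ?sqr_ge0// ltW.
have Ln : Lam != 0 by rewrite gt_eqF.
have -> // : lam * (cS / Lam ^+ 2) * (Lam ^+ 2 * (mi s x - w) ^+ 2) =
  lam * (cS * (mi s x - w) ^+ 2) by field.
Qed.

Lemma model_cj : model c M a (cj s eta) (cj1 s eta eta1) (cj2 s eta eta1 eta2)
  (cj s xi) (cj1 s xi xi1) (cj2 s xi xi1 xi2).
Proof.
have [mN m0 m1] := moE s0; have [iN i0 i1] := miE s0; have [tp tb] := t_in.
have es := ebd (x := s) ltac:(by rewrite lexx ltW).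
split=> //.
- by rewrite /cj i0 e0.
- by rewrite /cj i0 x0.
- by rewrite /cj i1 iN comm.
- move=> x y x0' xy y1.
  have xb : 0 <= x <= 1 by lra. have yb : 0 <= y <= 1 by lra.
  have /andP[X1 X2] := mi_pos s0 xb; have /andP[Y1 Y2] := mi_pos s0 yb.
  have xy' : mi s x < mi s y by apply: mi_lt => //; lra.
  apply: mo_lt => //; [|exact: ei|].
  + by have /andP[] := ebd (mi_pos s0 xb).
  + by have /andP[] := ebd (mi_pos s0 yb).
- move=> x y x0' xy y1.
  have xb : -1 <= x <= 0 by lra. have yb : -1 <= y <= 0 by lra.
  have /andP[X1 X2] := mi_neg s0 xb; have /andP[Y1 Y2] := mi_neg s0 yb.
  have xy' : mi s x < mi s y by apply: mi_lt => //; lra.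
  apply: mo_lt => //; [|exact: xii|].
  + by have /andP[] := xbd (mi_neg s0 xb).
  + by have /andP[] := xbd (mi_neg s0 yb).
- by move=> j ja; rewrite itE 1?ltnW//; apply: mo_pos => //; exact: orb.
- rewrite itE ?leqnSn// -[leRHS]subr0 -m0.
  by apply: low; move: (ta); rewrite -/t; lra.
- have := ebd (x := t) ltac:(lra); rewrite itE// -[eta t]/(iter a.+1 eta s) => /andP[A B].
  by have := low (x := iter a.+1 eta s) (y := 0) A ltac:(move: (fta); lra) (ltW s0);
    rewrite m0; lra.
- have -> : cj s eta 1 = mo s (eta s) by rewrite -{1}m1 cjE// lexx; lra.
  by have := low (x := eta s) (y := s) ltac:(lra) ltac:(move: (gs); lra) (lexx s);
    rewrite m1; lra.
- move=> x xt; have [A1 A2 A3 A5 A4] := corr xt.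
  apply: le_trans l2 _; rewrite /cj1 /ch1.
  have p0 : 0 <= K^-1 * lam by rewrite mulr_ge0// ltW.
  apply: ler_pM => //; [exact: ltW|exact/HL2/ebd|].
  by apply: ler_pM => //; [exact: ltW|exact: ltW|exact: De|exact: HL3].
Qed.

End in_coordinates.

(** The bounds of the control are transported by Moebius maps that are uniformly
    bi-Lipschitz, because s = xi 0 is between K^-1 and K. *)
Lemma controlled_model (K : R) : 1 < K -> exists c M, [/\ 0 < c, c <= 1, 1 <= M &
  forall z, critical_commuting_pair 3 z -> normalized z -> controlled K z ->
  negative_schwarzian z -> exists a F1 F2 X1 X2, period z = Some a /\
  model c M a (mob_conj z (eta_ z)) F1 F2 (mob_conj z (xi_ z)) X1 X2].
Proof.
move=> K1; have K0 : 0 < K by lra.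
have k0 : 0 < K^-1 by rewrite invr_gt0.
have [M M1 HM] := jet_cj K1.
have [lam [Lam [lam0 Lam0 lam1 HL]]] := mo_bounds K1.
have [cS cS0 HS] := schwarzian_gap K1.
pose c4 := lam * (cS / Lam ^+ 2).
pose c2 := lam * (K^-1 * lam).
have c40 : 0 < c4 by rewrite mulr_gt0// divr_gt0// exprn_gt0.
have c20 : 0 < c2 by rewrite !mulr_gt0.
have c30 : 0 < lam * K^-1 by rewrite mulr_gt0.
exists (Num.min 1 (Num.min c4 (Num.min c2 (lam * K^-1)))), M.
set c := Num.min _ _.
have [l1 l4 l2 l3] : [/\ c <= 1, c <= c4, c <= c2 & c <= lam * K^-1].
  by rewrite /c; split; rewrite ?ge_min ?lexx ?orbT.
split=> // [|z]; first by rewrite /c lt_min ltr01 lt_min c40 lt_min c20.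
clearbody c.
move=> Cz nz cz Sz; have [[e1 sz] comm1 ei xii [ebd xbd]] := normalized_maps K1 Cz nz cz.
have [Seta _] := Sz; have [side [a pa [ks gs [ga ta fta] [Nx Ne] De]]] := cz.
have [[_ _ [Ceta _] [Cxi _]] _ _ _ _] := Cz.
rewrite /dom_eta in Ceta De Seta; rewrite /dom_xi e1 in Cxi.
have [Je d3 b3] := C3_jet Ceta Ne (ltW K0).
have [Jx _ _] := C3_jet Cxi Nx (ltW K0).
move: (period_is_period pa); rewrite /is_period side => -[orb out].
have {}orb j : (j <= a)%N -> 0 <= iter j (eta_ z) (xi_ z 0) <= xi_ z 0.
  by move=> /orb; rewrite /dom_eta /= in_itv.
have [_ pos] := orbit_decr ei orb out.
have a0 : (0 < a)%N.
  by rewrite lt0n; apply/eqP => E; move: ga k0; rewrite E /= subrr leNgt => /negP.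
have [HL1 HL2 HL3] := HL _ ks.
exists a, (cj1 (xi_ z 0) (eta_ z) (nderiv_in `[0, xi_ z 0] 1 (eta_ z))),
  (cj2 (xi_ z 0) (eta_ z) (nderiv_in `[0, xi_ z 0] 1 (eta_ z)) (nderiv_in `[0, xi_ z 0] 2 (eta_ z))),
  (cj1 (xi_ z 0) (xi_ z) (nderiv_in `[-1, 0] 1 (xi_ z))),
  (cj2 (xi_ z 0) (xi_ z) (nderiv_in `[-1, 0] 1 (xi_ z)) (nderiv_in `[-1, 0] 2 (xi_ z))).
split=> //; rewrite (mob_conjE (eta_ z) e1) (mob_conjE (xi_ z) e1).
have JF := HM _ _ _ _ _ _ 0 1 ks (lerN10 R) (lexx 1) (fun y => mi_pos sz (y := y)) ebd Je.
have JX := HM _ _ _ _ _ _ (-1) 0 ks (lexx (-1)) ler01 (fun y => mi_neg sz (y := y)) xbd Jx.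
have ks1 := proj2 (andP ks).
clear HM HL Cz Sz cz Ceta Cxi Nx Ne out side pa nz.
have orba := orb _ (leqnn a).
have xa : 0 <= iter a (eta_ z) (xi_ z 0) by case/andP: orba.
apply: (model_cj (K := K) (lam := lam) (Lam := Lam) (cS := cS)) => //.
have sub x : iter a (eta_ z) (xi_ z 0) <= x <= xi_ z 0 -> 0 <= x <= xi_ z 0.
  by move=> /andP[x1 ->]; rewrite (le_trans xa).
have dom x : 0 <= x <= xi_ z 0 -> [set` `[0, xi_ z 0]] x by move=> xb; rewrite /= in_itv.
apply: HS (proj2 (andP orba)) _ _ _ (diff_on_sub xa (lexx _) d3) _ _ _ _ _ gs.
- by apply: le_trans ks1; rewrite lerBlDr lerDl.
- exact (diff_on_sub xa (lexx _) (jt_d1 Je)).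
- exact (diff_on_sub xa (lexx _) (jt_d2 Je)).
- move=> x xlu; rewrite De//=; have := jt_b1 Je (sub _ xlu).
  by rewrite ler_norml => /andP[].
- by move=> x /sub; exact: b3.
- move=> x xlu; apply/ltW/(Seta x (dom _ (sub _ xlu))).
  by rewrite gt_eqF//; case/andP: xlu => + _; apply: lt_le_trans; apply: lt_le_trans ta.
- by move=> x /pos; rewrite subr_gt0.
- by have := fta; rewrite iterS; lra.
Qed.

End controlled_model.

(** * The corridor of a model *)

Section corridor.
Variable R : realType.

Section one_model.
Variables (c M : R) (a : nat) (F F1 F2 X X1 X2 : R -> R).
Hypothesis P : model c M a F F1 F2 X X1 X2.
Hypothesis (c0 : 0 < c) (c1 : c <= 1) (M1 : 1 <= M).
Ltac hyps := move: (c0) (c1) (M1) => ? ? ?.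

Let t := iter a F 1.

(** The constants of the corridor after an extension by cor_e beyond its end;
    the extension is needed because the corridors of two models need not end at
    the same point. *)
Definition cor_c : R := c ^+ 2 / (6 * M).
Definition cor_e : R := c / (2 * M).

Let M60 : 0 < 6 * M. Proof. by hyps; lra. Qed.

Lemma cor_c_gt0 : 0 < cor_c.
Proof. by rewrite /cor_c divr_gt0// exprn_gt0. Qed.

Lemma cor_e_gt0 : 0 < cor_e.
Proof. by rewrite /cor_e divr_gt0//; hyps; lra. Qed.

Lemma cor_eM : M * cor_e = c / 2.
Proof. by rewrite /cor_e; field; rewrite gt_eqF//; hyps; lra. Qed.

Lemma cor_e_le : cor_e <= c / 2.
Proof. by rewrite -cor_eM; apply: ler_peMl => //; exact/ltW/cor_e_gt0. Qed.

Lemma cor_c_le : cor_c <= c / 2 /\ cor_c <= cor_e.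
Proof.
have A : cor_c <= cor_e.
  have -> : cor_c = c / 3 * cor_e by rewrite /cor_c /cor_e; field; rewrite gt_eqF//; hyps; lra.
  by apply: ler_piMl; [exact/ltW/cor_e_gt0|hyps; lra].
by split=> //; apply: le_trans A cor_e_le.
Qed.

Lemma cor_c_le2 : cor_c * (4 / c + 2) <= c.
Proof.
have -> : cor_c * (4 / c + 2) = (4 * c + 2 * c * c) / (6 * M).
  by rewrite /cor_c; field; rewrite !gt_eqF//; hyps; lra.
rewrite ler_pdivrMr//; hyps.
have : c * c <= c * 1 by apply: ler_wpM2l => //; exact: ltW.
have : c * 1 <= c * M by apply: ler_wpM2l => //; exact: ltW.
lra.
Qed.

Lemma md_FiW x y : 0 <= x -> x <= y -> y <= 1 -> F x <= F y.
Proof.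
by move=> x0; rewrite le_eqVlt => /predU1P[->//|xy] y1; apply/ltW/(md_Fi P).
Qed.

Lemma md_pos x : t <= x <= 1 -> F x < x.
Proof.
have out : iter a.+1 F 1 < 0 by have := md_Ft P; hyps; lra.
by have [_ H] := orbit_decr (md_Fi P) (md_orb P) out; exact: H.
Qed.

Lemma md_dec j : (j <= a)%N -> iter j.+1 F 1 < iter j F 1.
Proof.
have out : iter a.+1 F 1 < 0 by have := md_Ft P; hyps; lra.
by have [H _] := orbit_decr (md_Fi P) (md_orb P) out; exact: H.
Qed.

Lemma md_decW i j : (i <= j)%N -> (j <= a.+1)%N -> iter j F 1 <= iter i F 1.
Proof.
move=> ij; rewrite -(subnKC ij); elim: (j - i)%N => [|n IH] ja; first by rewrite addn0.
rewrite addnS in ja *; apply: le_trans (IH (ltnW ja)); apply/ltW/md_dec.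
by rewrite -ltnS.
Qed.

Lemma md_t1 : t <= 1. Proof. by have := md_orb P (leqnn a) => /andP[]. Qed.

Lemma md_Fbd x : 0 <= x <= 1 -> -1 <= F x <= 1 - c.
Proof.
move=> /andP[x0 x1]; rewrite -(md_F0 P); apply/andP; split; first exact: md_FiW.
by apply: le_trans (md_F1 P); exact: md_FiW.
Qed.

Lemma md_Xbd p : -1 <= p <= 0 -> F 1 <= X p <= 1.
Proof.
move=> /andP[p1 p0]; rewrite (md_FX P); apply/andP; split.
  by move: p1; rewrite le_eqVlt => /predU1P[<-//|H]; apply/ltW/(md_Xi P).
rewrite -(md_X0 P).
by move: p0; rewrite le_eqVlt => /predU1P[->//|H]; apply/ltW/(md_Xi P).
Qed.

Lemma md_F1_lo x : t - cor_e <= x <= 1 -> c / 2 <= F1 x.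
Proof.
move=> /andP[tx x1]; have t1 := md_t1; have tt := md_t P; rewrite -/t in tt.
have e1 := cor_e_le; have e0 := cor_e_gt0.
have [xt|xt] := leP t x.
  by have := md_D P (x := x); rewrite -/t xt x1 => /(_ isT); hyps; lra.
have := md_D P (x := t); rewrite -/t lexx t1 => /(_ isT) D.
have x01 : 0 <= x <= 1 by hyps; lra. have t01 : 0 <= t <= 1 by hyps; lra.
have := diff_on_lip (jt_d2 (md_F P)) (jt_b2 (md_F P)) x01 t01.
have : M * `|x - t| <= M * cor_e.
  by apply: ler_wpM2l; [hyps; lra|rewrite ler_norml; lra].
by rewrite cor_eM => ? /ler_normlP[? ?]; lra.
Qed.

Lemma md_gap_low x : t - cor_e <= x <= t -> c <= x - F x.
Proof.
move=> /andP[tx xt]; have t1 := md_t1; have tt := md_t P; rewrite -/t in tt.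
have e1 := cor_e_le; have := md_Ft P; rewrite -/t iterS -/t => f.
have : F x <= F t by apply: md_FiW; hyps; lra.
by hyps; lra.
Qed.

Lemma md_gap_quad : exists x0, forall x, t - cor_e <= x <= 1 ->
  cor_c * (x - x0) ^+ 2 <= x - F x.
Proof.
have [x0 H] := md_gap P; rewrite -/t in H; exists x0 => x /andP[tx x1].
have t1 := md_t1; have [cc _] := cor_c_le.
have [xt|xt] := leP t x.
  apply: le_trans (H x _); last by rewrite xt.
  by apply: ler_wpM2r; [exact: sqr_ge0|hyps; lra].
apply: le_trans (md_gap_low _); last by rewrite tx ltW.
have T := H t; rewrite lexx t1 in T; have {}T := T isT.
have Fb := md_Fbd (x := t); have tt := md_t P; rewrite -/t in tt.
have {}Fb := Fb ltac:(hyps; lra).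
have q : (t - x0) ^+ 2 <= 2 / c by rewrite ler_pdivlMr// mulrC; hyps; lra.
have e2 : (x - t) ^+ 2 <= 1.
  rewrite -(real_normK (num_real (x - t))) expr_le1// ler_norml; have := cor_e_le; hyps; lra.
apply: le_trans cor_c_le2; apply: ler_wpM2l; first exact/ltW/cor_c_gt0.
have := sqr_ge0 ((x - t) - (t - x0)).
have -> : 4 / c = 2 * (2 / c) by field; rewrite gt_eqF.
lra.
Qed.

(** The left end is only required to lie between the extended end of the
    corridor and the last point but one of the orbit of 1. This freedom makes it
    possible to choose one corridor for two models. *)
Lemma model_passage l : t - cor_e <= l <= iter a.-1 F 1 ->
  passage cor_c (2 * M) l 1 F F1 F2.
Proof.
move=> /andP[tl lq]; have t1 := md_t1; have tt := md_t P; rewrite -/t in tt.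
have e1 := cor_e_le; have e0 := cor_e_gt0; have [cc ce] := cor_c_le.
have a0 := md_a P.
have q1 : 0 <= iter a.-1 F 1 <= 1 by apply: (md_orb P); exact: leq_pred.
have l0 : 0 <= l by hyps; lra.
have in01 x : l <= x <= 1 -> 0 <= x <= 1 by lra.
have pos x : l <= x <= 1 -> 0 < x - F x.
  move=> xl; have [xt|xt] := leP t x.
    by rewrite subr_gt0; apply: md_pos; rewrite xt; case/andP: xl.
  by have := md_gap_low (x := x) ltac:(lra); hyps; lra.
split=> //.
- lra.
- by hyps; lra.
- by move=> x xl; have := md_Fbd (in01 _ xl); hyps; lra.
- exact (diff_on_sub l0 (lexx 1) (jt_d1 (md_F P))).
- exact (diff_on_sub l0 (lexx 1) (jt_d2 (md_F P))).
- move=> x xl; have := md_F1_lo (x := x) ltac:(lra).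
  have := jt_b1 (md_F P) (in01 _ xl); rewrite ler_norml; hyps; lra.
- by move=> x xl; have := jt_b2 (md_F P) (in01 _ xl); hyps; lra.
- move=> x y xl yl; have := jt_lip (md_F P) (in01 _ xl) (in01 _ yl).
  have : 0 <= M * `|x - y| by apply: mulr_ge0 => //; hyps; lra.
  lra.
- by have [x0 H] := md_gap_quad; exists x0 => x xl; apply: H; lra.
- have [lt_|tl'] := leP l t.
    by have := md_gap_low (x := l) ltac:(lra); hyps; lra.
  have Fl : F l <= t.
    have -> : t = F (iter a.-1 F 1) by rewrite /t -iterS prednK.
    by apply: md_FiW; lra.
  have [H|H] := leP (t + cor_e) l; first by lra.
  have := md_Ft P; rewrite -/t iterS -/t => f.
  have := diff_on_lip (jt_d1 (md_F P)) (jt_b1 (md_F P)) (x := l) (y := t) ltac:(lra) ltac:(lra).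
  have : M * `|l - t| <= M * cor_e.
    by apply: ler_wpM2l; [hyps; lra|rewrite ler_norml; lra].
  by rewrite cor_eM => ? /ler_normlP[? ?]; hyps; lra.
- by have := md_F1 P; hyps; lra.
Qed.

Lemma md_orbit x j : F 1 <= x <= 1 -> (j <= a)%N ->
  iter j.+1 F 1 <= iter j F x <= iter j F 1.
Proof.
move=> xb; elim: j => [//|j IH] ja; have /andP[A B] := IH (ltnW ja).
have := md_orb P ja; have := md_orb P (ltnW ja) => /andP[? ?] /andP[? ?].
change (F (iter j.+1 F 1) <= F (iter j F x) <= F (iter j F 1)).
by apply/andP; split; apply: md_FiW => //; lra.
Qed.

Lemma md_orbit_in x j : F 1 <= x <= 1 -> (j < a)%N -> t <= iter j F x <= 1.
Proof.
move=> xb ja; have /andP[A B] := md_orbit xb (ltnW ja).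
have := md_decW ja (leqnSn a); have := md_orb P (ltnW ja); rewrite -/t; lra.
Qed.

Lemma md_orbit_dec x i j : F 1 <= x <= 1 -> (i <= j)%N -> (j <= a)%N ->
  iter j F x <= iter i F x.
Proof.
move=> xb ij; rewrite -(subnKC ij); elim: (j - i)%N => [|n IH] ja; first by rewrite addn0.
rewrite addnS in ja *; apply: le_trans (IH (ltnW ja)).
by rewrite iterS; apply/ltW/md_pos/md_orbit_in.
Qed.

Lemma md_orbit_last x : F 1 <= x <= 1 -> t <= iter a.-1 F x <= iter a.-1 F 1.
Proof.
move=> xb; have a0 := md_a P.
by have := md_orbit (j := a.-1) xb (leq_pred _); rewrite prednK.
Qed.

Lemma md_end x : F 1 <= x <= 1 -> -1 <= iter a F x <= t.
Proof.
move=> xb; have /andP[A B] := md_orbit xb (leqnn a); rewrite -/t B andbT.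
by apply: le_trans A; rewrite iterS; have /andP[] := md_Fbd (md_orb P (leqnn a)).
Qed.

Lemma md_it1 x : F 1 <= x <= 1 -> 0 < it1 F F1 a x <=
  2 * M * (it1_const cor_c (2 * M) * (2 * M)).
Proof.
move=> xb; have [cc ce] := cor_c_le; have e0 := cor_e_gt0; have a0 := md_a P.
have Pt : passage cor_c (2 * M) t 1 F F1 F2.
  by apply: model_passage; have /andP[] := md_orbit_last (x := 1) ltac:(by rewrite lexx; have := md_F1 P; hyps; lra); lra.
have k1 : cor_c <= 1 by hyps; lra. have m1 : 1 <= 2 * M by hyps; lra.
have O j : (j < a)%N -> t <= iter j F x <= 1 by exact: md_orbit_in.
rewrite (it1_gt0 Pt cor_c_gt0 O (leqnn a)) /=.
by apply: (it1_le Pt cor_c_gt0 k1 m1 O) => //; case/andP: xb.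
Qed.

Lemma diff_iter j : (j <= a)%N -> diff_on (F 1) 1 (iter j F) (it1 F F1 j) /\
  diff_on (F 1) 1 (it1 F F1 j) (it2 F F1 F2 j).
Proof.
elim: j => [|j IH] ja; first by split; [exact: diff_on_id|exact: diff_on_cst].
have [A B] := IH (ltnW ja).
have H x : F 1 <= x <= 1 -> 0 <= iter j F x <= 1.
  by move=> xb; have := md_orbit_in xb ja; have := md_t P; rewrite -/t; hyps; lra.
split; first exact (diff_on_comp A (jt_d1 (md_F P)) H).
apply: (diff_on_ext (diff_on_mul (diff_on_comp A (jt_d2 (md_F P)) H) B)) => // x xb.
by rewrite /= expr2 mulrA.
Qed.

End one_model.
End corridor.

Section two_models.
Variable R : realType.

(** Since the images under the last step are close, the lower of the two points
    reached before that step cannot lie far below the corridor of F. *)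
Lemma low_orbit (c M d e : R) (a : nat) F F1 F2 X X1 X2 G G1 G2 Y Y1 Y2 (x y : R) :
  model c M a F F1 F2 X X1 X2 -> model c M a G G1 G2 Y Y1 Y2 ->
  0 < c -> c <= 1 -> 1 <= M -> d + e < c / 2 * cor_e c M ->
  (forall z, 0 <= z <= 1 -> `|G z - F z| <= d) ->
  F 1 <= x <= 1 -> G 1 <= y <= 1 -> `|iter a G y - iter a F x| <= e ->
  iter a F 1 - cor_e c M <= Num.min (iter a.-1 F x) (iter a.-1 G y) <= iter a.-1 F 1.
Proof.
move=> P Q c0 c1 M1 de cls xb yb H; have a0 := md_a P.
have e0 := cor_e_gt0 c0 c1 M1; have e1 := cor_e_le c0 c1 M1.
have /andP[A1 A2] := md_orbit_last P xb; have /andP[B1 B2] := md_orbit_last Q yb.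
apply/andP; split; last by rewrite ge_min A2.
rewrite le_min; apply/andP; split; first by lra.
rewrite leNgt; apply/negP => L.
have tQ := md_t Q; have tP := md_t P; have t1 := md_t1 P.
set y1 := iter a.-1 G y in B1 B2 L; set x1 := iter a.-1 F x in A1 A2.
have q1 : iter a.-1 F 1 <= 1 by have /andP[] := md_orb P (leq_pred a).
have {}H : `|G y1 - F x1| <= e.
  by rewrite /x1 /y1 -!iterS prednK.
have y01 : 0 <= y1 <= 1 by lra.
have S1 : F y1 <= F (iter a F 1 - cor_e c M) by apply: (md_FiW P); lra.
have S2 : F (iter a F 1) <= F x1 by apply: (md_FiW P); lra.
have sub0 : 0 <= iter a F 1 - cor_e c M by lra.
have [z /andP[z1 z2] E] := diff_on_MVT (jt_d1 (md_F P)) sub0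
  (y := iter a F 1) ltac:(lra) t1.
have := md_F1_lo P c0 c1 M1 (x := z) ltac:(lra) => Dz.
have : c / 2 * (iter a F 1 - (iter a F 1 - cor_e c M)) <=
       F1 z * (iter a F 1 - (iter a F 1 - cor_e c M)).
  by apply: ler_wpM2r; lra.
rewrite -E; have := cls _ y01; move: H => /ler_normlP[h1 h2] /ler_normlP[h3 h4].
lra.
Qed.

(** The common corridor of the two maps starts at the lower of the two points
    reached before the last step. *)
Lemma model_jets (c M : R) : 0 < c -> c <= 1 -> 1 <= M -> exists C e0, [/\ 1 <= C, 0 < e0 &
  forall a F F1 F2 X X1 X2 G G1 G2 Y Y1 Y2 d x y,
  model c M a F F1 F2 X X1 X2 -> model c M a G G1 G2 Y Y1 Y2 -> 0 < d -> d <= e0 ->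
  close_on 0 1 d F F1 F2 G G1 G2 ->
  F 1 <= x <= 1 -> G 1 <= y <= 1 -> `|y - x| <= d -> `|iter a G y - iter a F x| <= d ->
  `|it1 G G1 a y - it1 F F1 a x| <= C * d /\
  `|it2 G G1 G2 a y - it2 F F1 F2 a x| <= C * d].
Proof.
move=> c0 c1 M1; have k0 := cor_c_gt0 c0 c1 M1; have [kc _] := cor_c_le c0 c1 M1.
have k1 : cor_c c M <= 1 by lra. have m1 : 1 <= 2 * M by lra.
have [C [d0 [C1 d00 H]]] := passage_jets k0 k1 m1.
have p0 := pass_gap_gt0 k0 k1 m1; have e0 := cor_e_gt0 c0 c1 M1.
have w0 : 0 < c / 8 * cor_e c M by apply: mulr_gt0; lra.
exists C, (Num.min d0 (Num.min (pass_gap (cor_c c M) (2 * M)) (c / 8 * cor_e c M))).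
split=> //; first by rewrite !lt_min d00 p0.
move=> a F F1 F2 X X1 X2 G G1 G2 Y Y1 Y2 d x y P Q dp.
rewrite !le_min => /and3P[dd dg de] cls xb yb xy axy; have a0 := md_a P.
have cls0 z : 0 <= z <= 1 -> `|G z - F z| <= d by move=> /cls[].
have cls1 z : 0 <= z <= 1 -> `|F z - G z| <= d by rewrite distrC; exact: cls0.
have small : d + d < c / 2 * cor_e c M by lra.
have L1 := low_orbit P Q c0 c1 M1 small cls0 xb yb axy.
have axy' : `|iter a F x - iter a G y| <= d by rewrite distrC.
have L2 := low_orbit Q P c0 c1 M1 small cls1 yb xb axy'.
rewrite minC in L2.
have PF := model_passage P c0 c1 M1 L1; have PG := model_passage Q c0 c1 M1 L2.
set l := Num.min _ _ in L1 L2 PF PG.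
have lx : l <= iter a.-1 F x by rewrite ge_min lexx.
have ly : l <= iter a.-1 G y by rewrite ge_min lexx orbT.
have lmin : iter a.-1 F x <= l \/ iter a.-1 G y <= l.
  by rewrite /l; case: (leP (iter a.-1 F x) (iter a.-1 G y)) => ?; [left|right].
clearbody l.
have in_x j : (j < a)%N -> l <= iter j F x <= 1.
  move=> ja; have ja1 : (j <= a.-1)%N by rewrite -ltnS prednK.
  rewrite (le_trans lx)/=; last by exact: (md_orbit_dec P c0 c1 M1 xb ja1 (leq_pred a)).
  by case/andP: (md_orbit_in P c0 c1 M1 xb ja).
have in_y j : (j < a)%N -> l <= iter j G y <= 1.
  move=> ja; have ja1 : (j <= a.-1)%N by rewrite -ltnS prednK.
  rewrite (le_trans ly)/=; last by exact: (md_orbit_dec Q c0 c1 M1 yb ja1 (leq_pred a)).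
  by case/andP: (md_orbit_in Q c0 c1 M1 yb ja).
have dx : iter a F x <= iter a.-1 F x by exact: (md_orbit_dec P c0 c1 M1 xb (leq_pred a) (leqnn a)).
have dy : iter a G y <= iter a.-1 G y by exact: (md_orbit_dec Q c0 c1 M1 yb (leq_pred a) (leqnn a)).
have l0 : 0 <= l.
  by have := md_t P; have := cor_e_le c0 c1 M1; lra.
apply: (H l 1) => //.
- by move=> z zl; apply: cls; lra.
move: axy => /ler_normlP[h1 h2].
split=> //; [by case/andP: xb|by case/andP: yb| | |by rewrite ler_norml; lra].
- by case: lmin; lra.
- by case: lmin; lra.
Qed.

End two_models.

(** * Propagation of closeness *)

Section bootstrap.
Variable R : realType.

(** At the infimum m of the points where the conclusion fails, the bound on the
    derivative is available to the left of m and gives |f m| < 2 * B; by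
    continuity the conclusion then holds beyond m. *)
Lemma bootstrap (q r B kap : R) (f f1 : R -> R) x : diff_on q r f f1 -> `|f q| <= B -> 0 < B ->
  kap * (r - q) < B -> 0 <= kap ->
  (forall y, q <= y <= r -> `|f y| <= 2 * B -> `|f1 y| <= kap) ->
  q <= x <= r -> `|f x| <= 2 * B.
Proof.
move=> H fq B0 kB kap0 Hk xqr; rewrite leNgt; apply/negP => fx.
pose E : set R := [set y | q <= y <= r /\ 2 * B < `|f y|].
have Ex : E x by [].
have lbE : lbound E q by move=> y [/andP[]].
have infE : has_inf E by split; [exists x|exists q].
pose m := inf E.
have mx : m <= x by apply: ge_inf => //; exists q.
have qm : q <= m by apply: lb_le_inf => //; exists x.
have mqr : q <= m <= r by lra.
have below y : q <= y -> y < m -> `|f y| <= 2 * B.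
  move=> qy ym; rewrite leNgt; apply/negP => fy.
  by have : m <= y; [apply: ge_inf; [exists q|split=> //; lra]|lra].
have fm : `|f m| < 2 * B.
  move: qm; rewrite le_eqVlt => /predU1P[<-|qm]; first lra.
  have [z /andP[qz zm] D] := diff_on_MVT H (lexx q) qm (proj2 (andP mqr)).
  have fz : `|f1 z| <= kap by apply: Hk; [lra|apply: below => //; exact: ltW].
  have : `|f m - f q| <= kap * (r - q).
    rewrite D normrM; apply: ler_pM => //; rewrite ger0_norm; lra.
  by have := ler_normD (f m - f q) (f q); rewrite subrK; lra.
have e0 : 0 < 2 * B - `|f m| by lra.
have [d d0 Hd] := diff_on_cont H mqr e0.
have [y [yqr fy] ym] : exists2 y, E y & y < m + d by apply: inf_adherent.
have my : m <= y by apply: ge_inf; [exists q|split].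
have := Hd y yqr; rewrite ger0_norm ?subr_ge0// => /(_ ltac:(lra)).
by have := ler_normD (f y - f m) (f m); rewrite subrK; lra.
Qed.

Lemma propagate_right (a b p C d e B : R) n (f f1 : R -> R) : diff_on a b f f1 -> b - a <= 1 ->
  a <= p <= b -> 0 < d -> d <= B -> `|f p| <= B -> 0 <= C -> 2 * C < n%:R ->
  2 ^+ n * B <= e ->
  (forall y, a <= y <= b -> `|f y| <= e -> `|f1 y| <= C * Num.max d `|f y|) ->
  forall x, p <= x <= b -> `|f x| <= 2 ^+ n * B.
Proof.
move=> H ba pab d0 dB fp C0 Cn Be Hf.
have B0 : 0 < B by lra.
have n0 : 0 < n%:R :> R by lra.
have pow_mono j : (j <= n)%N -> 2 ^+ j * B <= 2 ^+ n * B.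
  by move=> jn; apply: ler_wpM2r; [exact: ltW|apply: ler_weXn2l => //; lra].
suff key j x : (j <= n)%N -> p <= x <= b -> x <= p + j%:R / n%:R -> `|f x| <= 2 ^+ j * B.
  by move=> x xp; apply: key => //; rewrite divff ?gt_eqF//; lra.
elim: j x => [|j IH] x jn xp.
  rewrite mul0r addr0 expr0 mul1r => xp'.
  by have -> : x = p by lra.
move=> xj; have [xq|qx] := leP x (p + j%:R / n%:R).
  apply: le_trans (IH x (ltnW jn) xp xq) _.
  by apply: ler_wpM2r; [exact: ltW|apply: ler_weXn2l => //; lra].
set q := p + j%:R / n%:R in qx.
have pq : p <= q by rewrite /q lerDl divr_ge0// ltW.
have qlen : x - q <= n%:R^-1.
  by move: xj; rewrite -(natr1 j) mulrDl mul1r /q; lra.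
have fq : `|f q| <= 2 ^+ j * B by apply: IH; [exact: ltnW|lra|exact: lexx].
clearbody q.
have Bj : 0 < 2 ^+ j * B by rewrite mulr_gt0// exprn_gt0.
have dBj : d <= 2 ^+ j * B.
  by apply: le_trans dB _; apply: ler_peMl; [exact: ltW|apply: exprn_ege1; lra].
have E : 2 ^+ j.+1 * B = 2 * (2 ^+ j * B) by rewrite exprS mulrA.
rewrite E.
have e2 : 2 * (2 ^+ j * B) <= e by rewrite -E; apply: le_trans (pow_mono _ jn) Be.
have aq : a <= q by lra. have xb : x <= b by lra.
apply: (bootstrap (q := q) (r := x) (kap := C * (2 * (2 ^+ j * B)))
  (diff_on_sub aq xb H) fq Bj); last by rewrite (ltW qx) lexx.
- have : C * (2 * (2 ^+ j * B)) * (x - q) <= C * (2 * (2 ^+ j * B)) * n%:R^-1.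
    by apply: ler_wpM2l => //; apply: mulr_ge0 => //; apply: mulr_ge0 => //; exact: ltW.
  move=> /le_lt_trans; apply.
  rewrite ltr_pdivrMr//.
  have -> : C * (2 * (2 ^+ j * B)) = 2 ^+ j * B * (2 * C) by ring.
  by rewrite ltr_pM2l.
- by apply: mulr_ge0 => //; apply: mulr_ge0 => //; exact: ltW.
move=> y yq fy; apply: le_trans (Hf y ltac:(lra) (le_trans fy e2)) _.
by apply: ler_wpM2l => //; rewrite ge_max fy andbT; lra.
Qed.

Lemma diff_on_flip (a b : R) (f f1 : R -> R) : diff_on a b f f1 ->
  diff_on (- b) (- a) (fun x => f (- x)) (fun x => - f1 (- x)).
Proof.
move=> H x xab e e0; have [d d0 Hd] := H (- x) ltac:(lra) e e0.
exists d => // y yab yd.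
have E : `|- y - - x| = `|y - x| by rewrite -opprD normrN.
have := Hd (- y) ltac:(lra); rewrite E => /(_ yd).
by have -> : f1 (- x) * (- y - - x) = - f1 (- x) * (y - x) by ring.
Qed.

(** Gronwall's inequality when the differential inequality is only known while f
    is small: the bound doubles on each of n successive intervals. *)
Lemma propagate (a b p C d e B : R) n (f f1 : R -> R) : diff_on a b f f1 -> b - a <= 1 ->
  a <= p <= b -> 0 < d -> d <= B -> `|f p| <= B -> 0 <= C -> 2 * C < n%:R ->
  2 ^+ n * B <= e ->
  (forall y, a <= y <= b -> `|f y| <= e -> `|f1 y| <= C * Num.max d `|f y|) ->
  forall x, a <= x <= b -> `|f x| <= 2 ^+ n * B.
Proof.
move=> H ba pab d0 dB fp C0 Cn Be Hf x xab.
have [px|xp] := leP p x.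
  by apply: (propagate_right H ba pab d0 dB fp C0 Cn Be Hf); lra.
have := propagate_right (diff_on_flip H) (p := - p) (d := d) (e := e) (B := B) (C := C)
  (n := n) ltac:(lra) ltac:(lra) d0 dB _ C0 Cn Be.
rewrite opprK => /(_ fp) K; have := K _ (- x); rewrite opprK; apply; last by lra.
by move=> y yab fy; rewrite normrN; apply: Hf => //; lra.
Qed.

End bootstrap.

(** * Closeness of the return maps *)

Section rigidity.
Variable R : realType.

(** A Lipschitz constant of the return map p |-> F^a (X p). *)
Definition ret_lip (c M : R) := 2 * M * (it1_const (cor_c c M) (2 * M) * (2 * M)) * M.

Section one_model.
Variables (c M : R) (a : nat) (F F1 F2 X X1 X2 : R -> R).
Hypothesis P : model c M a F F1 F2 X X1 X2.
Hypothesis (c0 : 0 < c) (c1 : c <= 1) (M1 : 1 <= M).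

Let L := ret_lip c M.
Let L' := 2 * M * (it1_const (cor_c c M) (2 * M) * (2 * M)).

Let L'0 : 0 <= L'.
Proof.
have k1 : cor_c c M <= 1 by have [A _] := cor_c_le c0 c1 M1; move: (c1); lra.
have := it1_const_ge0 (cor_c_gt0 c0 c1 M1) k1 (M := 2 * M) ltac:(move: (M1); lra).
by move=> A; rewrite /L' mulr_ge0//; [|apply: mulr_ge0 => //]; move: (M1); lra.
Qed.

Lemma ret_lip_ge0 : 0 <= L.
Proof. by rewrite /L /ret_lip mulr_ge0//; move: (M1); lra. Qed.

Lemma iter_lip x y : F 1 <= x <= 1 -> F 1 <= y <= 1 ->
  `|iter a F x - iter a F y| <= L' * `|x - y|.
Proof.
move=> xb yb; have [D _] := diff_iter P c0 c1 M1 (leqnn a).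
apply: diff_on_lip D _ xb yb => z /(md_it1 P c0 c1 M1)/andP[A B].
by rewrite gtr0_norm.
Qed.

Lemma diff_return : diff_on (-1) 0 (fun p => iter a F (X p))
  (fun p => it1 F F1 a (X p) * X1 p).
Proof.
have [D _] := diff_iter P c0 c1 M1 (leqnn a).
by apply: (diff_on_comp (jt_d1 (md_X P)) D) => p; exact: (md_Xbd P).
Qed.

Lemma return_d1 p : -1 <= p <= 0 -> `|it1 F F1 a (X p)| <= L'.
Proof. by move=> /(md_Xbd P)/(md_it1 P c0 c1 M1)/andP[A B]; rewrite gtr0_norm. Qed.

Lemma return_lip p q : -1 <= p <= 0 -> -1 <= q <= 0 ->
  `|iter a F (X p) - iter a F (X q)| <= L * `|p - q|.
Proof.
move=> pb qb; apply: diff_on_lip diff_return _ pb qb => r rb.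
by rewrite normrM /L /ret_lip; apply: ler_pM => //; [exact: return_d1|exact: (jt_b1 (md_X P))].
Qed.

Let psi := circle_lift F X.
Let phi x := psi x - 2.

Lemma phi_F x : 0 <= x <= 1 -> phi x = F x.
Proof. by move=> xb; rewrite /phi /psi (lift_F (md_FX P))// addrK. Qed.

Lemma iter_phi x j : F 1 <= x <= 1 -> (j <= a)%N -> iter j phi x = iter j F x.
Proof.
move=> xb; elim: j => [//|j IH] ja; rewrite !iterS IH ?(ltnW ja)//; apply: phi_F.
by have := md_orbit_in P c0 c1 M1 xb ja; have := md_t P; move: (c0); lra.
Qed.

Lemma chi_return p : -1 <= p <= 0 -> iter a phi (psi p) = iter a F (X p).
Proof.
move=> pb; rewrite /psi (lift_X (md_F0 P) (md_X0 P))//.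
exact: iter_phi (md_Xbd P pb) (leqnn a).
Qed.

(** Left of -1 the lifted return map is F after F^a on a neighbourhood of 1, so
    it has a Lipschitz constant of the same order there. *)
Lemma chi_left x d : 0 < d -> 2 * d <= c -> L * (2 * d) <= c -> -1 <= x <= 0 ->
  iter a F (X x) - 4 * L * d <= iter a phi (psi (x - 2 * d)).
Proof.
move=> d0 dc dL xb; have L0 := ret_lip_ge0.
have [xd|xd] := leP (-1) (x - 2 * d).
  rewrite chi_return; last by lra.
  have := return_lip (p := x) (q := x - 2 * d) xb ltac:(lra).
  have -> : x - (x - 2 * d) = 2 * d by ring.
  rewrite [`|2 * d|]ger0_norm; last by lra.
  have : 0 <= L * d by apply: mulr_ge0 => //; exact: ltW.
  by move=> ? /ler_normlP[? ?]; lra.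
have [u uE] : exists u, u = -1 - (x - 2 * d) by eexists.
have u0 : 0 < u <= 2 * d by lra.
have E : psi (x - 2 * d) = phi (1 - u).
  have -> : 1 - u = x - 2 * d + 2 by rewrite uE; ring.
  by rewrite /phi /psi lift_period addrK.
have ub : F 1 <= 1 - u <= 1 by have := md_F1 P; lra.
have u1 : F 1 <= (1 : R) <= (1 : R) by have := md_F1 P; move: (c0); lra.
rewrite E -iterSr iterS iter_phi//.
have A := iter_lip ub u1.
have A0 : L' * `|1 - u - 1| <= L' * (2 * d).
  by apply: ler_wpM2l => //; rewrite ler_norml; lra.
have LL : L' <= L by rewrite /L /ret_lip -/L'; apply: ler_peMr.
have A1 : L' * (2 * d) <= L * (2 * d) by apply: ler_wpM2r LL; lra.
have tc := md_t P; have t1 := md_t1 P.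
have /ler_normlP[A2 A3] := A.
have yb : 0 <= iter a F (1 - u) <= 1.
  by have := md_end P ub; lra.
rewrite phi_F//.
have B := diff_on_lip (jt_d1 (md_F P)) (jt_b1 (md_F P)) yb (y := iter a F 1) ltac:(move: (c0); lra).
have B1 : M * `|iter a F (1 - u) - iter a F 1| <= M * (L' * (2 * d)).
  by apply: ler_wpM2l; [move: (M1); lra|lra].
have B2 : M * (L' * (2 * d)) = L * (2 * d) by rewrite /L /ret_lip -/L'; ring.
have C := return_lip xb (q := -1) ltac:(lra).
have C1 : L * `|x - -1| <= L * (2 * d).
  by apply: ler_wpM2l => //; rewrite ler_norml; lra.
have C2 : iter a F (X (-1)) = F (iter a F 1) by rewrite -(md_FX P) -iterSr.
rewrite C2 in C; move: B C => /ler_normlP[? ?] /ler_normlP[? ?]; lra.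
Qed.

End one_model.

Section two_models.
Variables (c M : R) (a : nat) (F F1 F2 X X1 X2 G G1 G2 Y Y1 Y2 : R -> R) (rho d : R).
Hypothesis P : model c M a F F1 F2 X X1 X2.
Hypothesis Q : model c M a G G1 G2 Y Y1 Y2.
Hypothesis (c0 : 0 < c) (c1 : c <= 1) (M1 : 1 <= M).
Hypothesis (SP : word_signs (circle_lift F X) rho) (SQ : word_signs (circle_lift G Y) rho).
Hypothesis (rho0 : 0 <= rho) (irr : irrational rho).
Hypothesis (d0 : 0 < d) (dc : 2 * d <= c) (dL : ret_lip c M * (2 * d) <= c).
Hypothesis close : forall x, 0 <= x <= 1 -> `|G x - F x| <= d.

Lemma not_above : exists2 p, -1 <= p <= 0 &
  iter a G (Y p) - iter a F (X p) <= (1 + 4 * ret_lip c M) * d.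
Proof.
apply: contrapT => H.
have {}H p : -1 <= p <= 0 -> iter a F (X p) + (1 + 4 * ret_lip c M) * d <= iter a G (Y p).
  move=> pb; rewrite leNgt; apply/negP => A; apply: H; exists p => //; lra.
have perP := lift_period F X; have perQ := lift_period G Y.
have homP := lift_homo (md_Xi P) (md_Fi P) (md_F0 P) (md_X0 P) (md_FX P).
have homQ := lift_homo (md_Xi Q) (md_Fi Q) (md_F0 Q) (md_X0 Q) (md_FX Q).
have z01 : 0 <= (0 : R) <= 1 by rewrite lexx ler01.
have zN : -1 <= (0 : R) <= 0 by rewrite lexx lerN10.
have dk : d < c by move: (dc) (d0); lra.
have chi0 : iter a (fun x => circle_lift F X x - 2) (circle_lift F X 0) = iter a F 1.
  by rewrite (chi_return P c0 c1 M1 zN) (md_X0 P).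
apply: (no_domination perP homP perQ homQ SP SQ rho0 irr (md_a P) (kappa := c) _ _ d0 dk).
- by rewrite (phi_F P z01) (md_F0 P).
- by rewrite chi0; apply: lt_le_trans (md_t P).
- rewrite chi0 => x /andP[x0 xt]; have t1 := md_t1 P.
  have xb : 0 <= x <= 1 by lra.
  rewrite (phi_F P xb) (phi_F Q xb).
  have := close xb => /ler_normlP[? ?]; split; last by lra.
  apply: le_trans (md_Ft P); rewrite iterS; apply: (md_FiW P) => //; exact: ltW.
- move=> x /andP[x1 x0]; have xb : -1 <= x <= 0 by rewrite x1 ltW.
  rewrite (chi_return P c0 c1 M1 xb).
  have := chi_left Q c0 c1 M1 d0 dc dL xb; have := H x xb; lra.
Qed.

End two_models.

(** By not_above, applied in both directions, and the intermediate value theorem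
    the two return maps are close at some point. There model_jets bounds the
    derivative of their difference by the difference itself and d, and propagate
    spreads closeness to the whole interval. *)
Lemma model_close (c M : R) : 0 < c -> c <= 1 -> 1 <= M -> exists C e0, [/\ 1 <= C, 0 < e0 &
  forall a F F1 F2 X X1 X2 G G1 G2 Y Y1 Y2 rho d,
  model c M a F F1 F2 X X1 X2 -> model c M a G G1 G2 Y Y1 Y2 ->
  word_signs (circle_lift F X) rho -> word_signs (circle_lift G Y) rho -> 0 <= rho -> irrational rho ->
  0 < d -> d <= e0 -> close_on 0 1 d F F1 F2 G G1 G2 ->
  close_on (-1) 0 d X X1 X2 Y Y1 Y2 ->
  forall p, -1 <= p <= 0 -> `|iter a G (Y p) - iter a F (X p)| <= C * d].
Proof.
move=> c0 c1 M1; have [C [e0 [C1 e00 HJ]]] := model_jets c0 c1 M1.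
have L0 := ret_lip_ge0 c0 c1 M1; set L := ret_lip c M in L0.
pose L' := 2 * M * (it1_const (cor_c c M) (2 * M) * (2 * M)).
have LL : L = L' * M by [].
have Lp : 0 <= L'.
  by move: L0; rewrite LL pmulr_lge0//; lra.
pose B := 1 + 4 * L.
have B1 : 1 <= B by rewrite /B; lra.
pose K := L' + C * M.
have K0 : 0 <= K by rewrite /K addr_ge0// mulr_ge0; lra.
have [n Hn] : exists n : nat, 2 * K < n%:R.
  by exists (Num.bound (2 * K)); apply: archi_boundP; apply: mulr_ge0.
have n1 : 1 <= 2 ^+ n :> R by apply: exprn_ege1; lra.
pose e1 := Num.min (c / (2 * B)) (e0 / (2 ^+ n * B)).
have e10 : 0 < e1 by rewrite lt_min !divr_gt0// ?mulr_gt0//; lra.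
exists (2 ^+ n * B), e1; split=> //.
  by apply: le_trans n1 _; apply: ler_peMr => //; lra.
move=> a F F1 F2 X X1 X2 G G1 G2 Y Y1 Y2 rho d P Q SP SQ rho0 irr d0.
rewrite le_min => /andP[dc de] cF cX.
have cB : 2 * B * d <= c by rewrite mulrC -ler_pdivlMr//; lra.
have dn : 2 ^+ n * (B * d) <= e0.
  by rewrite mulrA mulrC -ler_pdivlMr// mulr_gt0//; lra.
have Ld : 0 <= L * d by apply: mulr_ge0 => //; exact: ltW.
have dc2 : 2 * d <= c by move: cB; rewrite /B; lra.
have dL : L * (2 * d) <= c by move: cB; rewrite /B; lra.
have dL' : ret_lip c M * (2 * d) <= c by [].
have cl1 x : 0 <= x <= 1 -> `|G x - F x| <= d by move=> /cF[].
have cl2 x : 0 <= x <= 1 -> `|F x - G x| <= d by rewrite distrC; exact: cl1.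
have [p1 p1b D1] := not_above P Q c0 c1 M1 SP SQ rho0 irr d0 dc2 dL' cl1.
have [p2 p2b D2] := not_above Q P c0 c1 M1 SQ SP rho0 irr d0 dc2 dL' cl2.
pose De p := iter a G (Y p) - iter a F (X p).
have {}D1 : De p1 <= B * d by exact: D1.
have {}D2 : - De p2 <= B * d by rewrite opprB; exact: D2.
have dD := diff_on_subr (diff_return Q c0 c1 M1) (diff_return P c0 c1 M1).
have [p pb Dp] : exists2 p, -1 <= p <= 0 & `|De p| <= B * d.
  have [A1|A1] := leP (- (B * d)) (De p1).
    by exists p1 => //; rewrite ler_norml A1.
  have [A2|A2] := leP (De p2) (B * d).
    by exists p2 => //; rewrite ler_norml A2 andbT lerNl.
  have Bd : 0 < B * d by rewrite mulr_gt0//; lra.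
  have [p12|p12] := leP p1 p2.
    have dd := diff_on_within (diff_on_sub (proj1 (andP p1b)) (proj2 (andP p2b)) dD).
    have [p] := IVT p12 dd (v := 0) ltac:(rewrite ge_min le_max -/(De p1) -/(De p2); apply/andP; split; apply/orP; [left|right]; lra).
    rewrite in_itv/= => pb E; exists p; first lra.
    by rewrite /De E normr0; exact: ltW.
  have dd := diff_on_within (diff_on_sub (proj1 (andP p2b)) (proj2 (andP p1b)) dD).
  have [p] := IVT (ltW p12) dd (v := 0) ltac:(rewrite ge_min le_max -/(De p1) -/(De p2); apply/andP; split; apply/orP; [right|left]; lra).
  rewrite in_itv/= => pb E; exists p; first lra.
  by rewrite /De E normr0; exact: ltW.
have dB : d <= B * d by apply: ler_peMl => //; exact: ltW.
move=> x xb; rewrite -mulrA.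
have ba : 0 - (-1) <= 1 :> R by lra.
apply: (propagate dD ba pb d0 dB Dp K0 Hn dn) => //.
move=> y yb; set w := _ - _ => wy.
pose dd := Num.max d `|w|.
have ddd : d <= dd by rewrite le_max lexx.
have dd0 : 0 < dd by exact: lt_le_trans ddd.
have de0 : d <= e0.
  have Bd0 := le_trans (ltW d0) dB.
  by apply: le_trans dn; apply: le_trans dB _; exact: ler_peMl.
have dde : dd <= e0 by rewrite ge_max de0.
have cdd : close_on 0 1 dd F F1 F2 G G1 G2.
  by move=> z /cF[q0 q1 q2]; split; [exact: le_trans q0 ddd|exact: le_trans q1 ddd|exact: le_trans q2 ddd].
have [X0 X1' _] := cX y yb.
have YX : `|Y y - X y| <= dd by apply: le_trans X0 ddd.
have wdd : `|w| <= dd by rewrite le_max lexx orbT.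
have [J _] := HJ _ _ _ _ _ _ _ _ _ _ _ _ _ _ _ _ P Q dd0 dde cdd (md_Xbd P yb) (md_Xbd Q yb) YX wdd.
have -> : it1 G G1 a (Y y) * Y1 y - it1 F F1 a (X y) * X1 y =
  it1 G G1 a (Y y) * (Y1 y - X1 y) + (it1 G G1 a (Y y) - it1 F F1 a (X y)) * X1 y by ring.
apply: le_trans (ler_normD _ _) _; rewrite !normrM mulrDl; apply: lerD.
  apply: ler_pM => //; first exact: (return_d1 Q c0 c1 M1).
  exact: le_trans ddd.
rewrite -[C * M * _]mulrA [M * _]mulrC mulrA.
by apply: ler_pM => //; exact: (jt_b1 (md_X P)).
Qed.

End rigidity.

(** * Two-jets of the renormalizations *)

Section return_maps.
Variable R : realType.

Lemma md_branch (c M : R) a F F1 F2 X X1 X2 x : model c M a F F1 F2 X X1 X2 ->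
  0 < c -> 0 <= x <= iter a F 1 -> -1 <= F x <= iter a F 1.
Proof.
move=> P c0 /andP[x0 xt]; have /andP[t0 t1] := md_orb P (leqnn a).
have xb : 0 <= x <= 1 by rewrite x0 (le_trans xt).
have /andP[-> _] := md_Fbd P xb; rewrite (le_trans (md_FiW P x0 xt t1))// -iterS.
by apply: le_trans (md_Ft P) _; apply: le_trans t0; rewrite oppr_le0 ltW.
Qed.

Definition ret1 (F F1 X X1 : R -> R) a p := ch1 (it1 F F1 a (X p)) (X1 p).
Definition ret2 (F F1 F2 X X1 X2 : R -> R) a p :=
  ch2 (it1 F F1 a (X p)) (it2 F F1 F2 a (X p)) (X1 p) (X2 p).

Lemma diff_ret (c M : R) a F F1 F2 X X1 X2 : model c M a F F1 F2 X X1 X2 ->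
  0 < c -> c <= 1 -> 1 <= M ->
  diff_on (-1) 0 (fun p => iter a F (X p)) (ret1 F F1 X X1 a) /\
  diff_on (-1) 0 (ret1 F F1 X X1 a) (ret2 F F1 F2 X X1 X2 a).
Proof.
move=> P c0 c1 M1; have [D1 D2] := diff_iter P c0 c1 M1 (leqnn a).
have H p : -1 <= p <= 0 -> F 1 <= X p <= 1 by exact: (md_Xbd P).
have J := md_X P; split; first exact (diff_ch1 (jt_d1 J) D1 H).
exact (diff_ch2 (jt_d1 J) (jt_d2 J) D1 D2 H).
Qed.

Lemma md_it2 (c M : R) a F F1 F2 X X1 X2 x : model c M a F F1 F2 X X1 X2 ->
  0 < c -> c <= 1 -> 1 <= M -> F 1 <= x <= 1 ->
  `|it2 F F1 F2 a x| <= 2 * M * (it1_const (cor_c c M) (2 * M) * (2 * M)) *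
    (2 * M / cor_c c M * it1_const (cor_c c M) (2 * M) * 2).
Proof.
move=> P c0 c1 M1 xb; have k0 := cor_c_gt0 c0 c1 M1.
have [kc _] := cor_c_le c0 c1 M1; have e0 := cor_e_gt0 c0 c1 M1.
have k1 : cor_c c M <= 1 by lra. have m1 : 1 <= 2 * M by lra.
have u1 : F 1 <= (1 : R) <= (1 : R) by have := md_F1 P; lra.
have Pt : passage (cor_c c M) (2 * M) (iter a F 1) 1 F F1 F2.
  by apply: (model_passage P c0 c1 M1); have /andP[] := md_orbit_last P u1; lra.
have O j : (j < a)%N -> iter a F 1 <= iter j F x <= 1 by exact: (md_orbit_in P c0 c1 M1).
have F0 j : (j < a)%N -> F1 (iter j F x) != 0.
  by move=> /O/(ps_f1 Pt)/andP[A _]; rewrite gt_eqF//; apply: lt_le_trans A.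
rewrite it2E// normrM; have /andP[A B] := md_it1 P c0 c1 M1 xb.
have xF : F 1 <= x by case/andP: xb.
apply: ler_pM => //; first by rewrite gtr0_norm.
have I := itn_le Pt k0 k1 m1 O xF (leqnn a); apply: le_trans I _.
have I0 := it1_const_ge0 k0 k1 m1.
apply: ler_wpM2l.
  by apply: mulr_ge0 => //; apply: divr_ge0; [lra|exact: ltW].
by have := md_end P xb; lra.
Qed.

(** By model_close the passages start and end at close points, which is what
    model_jets requires. Taking two different points p and q yields at the same
    time the Lipschitz dependence on the point, uniformly in a. *)
Lemma return_lclose (c M N : R) : 0 < c -> c <= 1 -> 1 <= M -> 0 <= N ->
  exists C e0, 0 < e0 /\
  forall a F F1 F2 X X1 X2 G G1 G2 Y Y1 Y2 rho d,
  model c M a F F1 F2 X X1 X2 -> model c M a G G1 G2 Y Y1 Y2 ->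
  word_signs (circle_lift F X) rho -> word_signs (circle_lift G Y) rho ->
  0 <= rho -> irrational rho ->
  0 < d -> d <= e0 -> close_on 0 1 d F F1 F2 G G1 G2 ->
  close_on (-1) 0 d X X1 X2 Y Y1 Y2 ->
  forall p q, -1 <= p <= 0 -> -1 <= q <= 0 -> lclose N d p q ->
  [/\ lclose C d (iter a F (X p)) (iter a G (Y q)),
      lclose C d (ret1 F F1 X X1 a p) (ret1 G G1 Y Y1 a q) &
      lclose C d (ret2 F F1 F2 X X1 X2 a p) (ret2 G G1 G2 Y Y1 Y2 a q)].
Proof.
move=> c0 c1 M1 N0; have [C0 [e0 [C01 e00 H0]]] := model_close c0 c1 M1.
have [C1 [e1 [C11 e10 H1]]] := model_jets c0 c1 M1.
have L0 := ret_lip_ge0 c0 c1 M1; set L := ret_lip c M in L0.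
have [A1 A1E] : exists A, A = 2 * M * (it1_const (cor_c c M) (2 * M) * (2 * M)) by eexists.
have [A2 A2E] : exists A, A = A1 * (2 * M / cor_c c M * it1_const (cor_c c M) (2 * M) * 2) by eexists.
have MN : 0 <= M * N by apply: mulr_ge0 => //; lra.
have LN : 0 <= L * N by exact: mulr_ge0.
have [E [E1 EM EL]] : exists E, [/\ 1 <= E, 1 + M * N <= E & C0 + L * N <= E].
  by exists (1 + M * N + (C0 + L * N)); split; lra.
have [T [T1 TA1 TA2 TE TC]] : exists T, [/\ 1 <= T, A1 <= T, A2 <= T, E <= T & C1 * E <= T].
  exists (1 + `|A1| + `|A2| + E + `|C1 * E|).
  have := normr_ge0 A1; have := normr_ge0 A2; have := normr_ge0 (C1 * E).
  by have := ler_norm A1; have := ler_norm A2; have := ler_norm (C1 * E); split; lra.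
have [V VE] : exists V, V = M + M * N + 1 by eexists.
have V0 : 0 <= V by rewrite VE; lra.
have T0 : 0 <= T by lra.
have TV : 0 <= 2 * (T * V) by apply: mulr_ge0 => //; apply: mulr_ge0.
have TVV : 0 <= 2 * (2 * (T * V) * V) by apply: mulr_ge0 => //; apply: mulr_ge0.
have [W [W0 W1 W2]] : exists W, [/\ T <= W, 2 * (T * V) <= W &
    2 * (2 * (T * V) * V) + 2 * (T * V) <= W].
  by exists (T + 2 * (T * V) + (2 * (2 * (T * V) * V) + 2 * (T * V))); split; lra.
exists W, (Num.min e0 (e1 / E)).
split; first by rewrite lt_min e00 divr_gt0//; lra.
move=> a F F1 F2 X X1 X2 G G1 G2 Y Y1 Y2 rho d P Q SP SQ rho0 irr d0.
rewrite le_min => /andP[de0 de1] cF cX p q pb qb pq.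
have d0' := ltW d0.
have Ed : 0 < E * d by rewrite mulr_gt0//; lra.
have Ede : E * d <= e1 by rewrite mulrC -ler_pdivlMr//; lra.
have dE : d <= E * d by apply: ler_peMl.
have [_ _ pq'] := pq.
have xb := md_Xbd P pb; have yb := md_Xbd Q qb.
have JX := md_X P; have JY := md_X Q.
have [x0 x1 x2] := close_jet_lclose JX JY cX d0' pq pb qb.
rewrite -VE in x0 x1 x2.
have M0 : 0 <= M by exact: le_trans ler01 M1.
have Mpq : M * `|p - q| <= M * N * d by rewrite -mulrA; apply: ler_wpM2l.
have Lpq : L * `|p - q| <= L * N * d by rewrite -mulrA; apply: ler_wpM2l.
have EMd : (1 + M * N) * d <= E * d by exact: ler_wpM2r.
have ELd : (C0 + L * N) * d <= E * d by exact: ler_wpM2r.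
have xy : `|Y q - X p| <= E * d.
  have -> : Y q - X p = (Y q - X q) - (X p - X q) by ring.
  apply: le_trans (ler_normB _ _) (le_trans _ EMd); have [B _ _] := cX _ qb.
  rewrite mulrDl mul1r; apply: lerD => //; apply: le_trans Mpq.
  exact: (diff_on_lip (jt_d1 JX) (jt_b1 JX) pb qb).
have axy : `|iter a G (Y q) - iter a F (X p)| <= E * d.
  have -> : iter a G (Y q) - iter a F (X p) =
    (iter a G (Y q) - iter a F (X q)) - (iter a F (X p) - iter a F (X q)) by ring.
  apply: le_trans (ler_normB _ _) (le_trans _ ELd); rewrite mulrDl; apply: lerD.
    exact: (H0 _ _ _ _ _ _ _ _ _ _ _ _ _ _ _ P Q SP SQ rho0 irr d0 de0 cF cX q qb).
  by apply: le_trans Lpq; exact: (return_lip P c0 c1 M1 pb qb).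
have cF' : close_on 0 1 (E * d) F F1 F2 G G1 G2.
  by move=> z /cF[q0 q1 q2]; split; [exact: le_trans q0 dE|exact: le_trans q1 dE|exact: le_trans q2 dE].
have [J1 J2] := H1 _ _ _ _ _ _ _ _ _ _ _ _ _ _ _ _ P Q Ed Ede cF' xb yb xy axy.
have bF x : F 1 <= x <= 1 -> `|it1 F F1 a x| <= A1.
  by rewrite A1E => /(md_it1 P c0 c1 M1)/andP[? ?]; rewrite gtr0_norm.
have bG x : G 1 <= x <= 1 -> `|it1 G G1 a x| <= A1.
  by rewrite A1E => /(md_it1 Q c0 c1 M1)/andP[? ?]; rewrite gtr0_norm.
have bF2 x : F 1 <= x <= 1 -> `|it2 F F1 F2 a x| <= A2.
  by rewrite A2E A1E; exact: (md_it2 P c0 c1 M1).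
have bG2 x : G 1 <= x <= 1 -> `|it2 G G1 G2 a x| <= A2.
  by rewrite A2E A1E; exact: (md_it2 Q c0 c1 M1).
have up (u : R) : -1 <= u <= 1 -> `|u| <= T by rewrite -ler_norml => /le_trans; apply.
have endF := md_end P xb; have endG := md_end Q yb.
have tF := md_t1 P; have tG := md_t1 Q.
have k0 : lclose T d (iter a F (X p)) (iter a G (Y q)).
  split; [apply: up|apply: up|].
  - by case/andP: endF => -> /le_trans ->.
  - by case/andP: endG => -> /le_trans ->.
  - by rewrite distrC; apply: le_trans axy _; exact: ler_wpM2r.
have C1Ed : C1 * (E * d) <= T * d by rewrite mulrA; exact: ler_wpM2r.
have k1 : lclose T d (it1 F F1 a (X p)) (it1 G G1 a (Y q)).
  split; [exact: le_trans (bF _ xb) TA1|exact: le_trans (bG _ yb) TA1|].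
  by rewrite distrC; exact: le_trans J1 C1Ed.
have k2 : lclose T d (it2 F F1 F2 a (X p)) (it2 G G1 G2 a (Y q)).
  split; [exact: le_trans (bF2 _ xb) TA2|exact: le_trans (bG2 _ yb) TA2|].
  by rewrite distrC; exact: le_trans J2 C1Ed.
have r1 := lclose_ch1 k1 x1; have r2 := lclose_ch2 k1 k2 x1 x2.
by split; [exact: lclose_weak k0|exact: lclose_weak r1|exact: lclose_weak r2].
Qed.

(** In the normalizing coordinates of the renormalizations, whose dependence on
    the pair is Lipschitz because the right end points s and t are close and
    bounded below. *)
Lemma renorm_lclose (c M : R) : 0 < c -> c <= 1 -> 1 <= M ->
  exists C e0, 0 < e0 /\
  forall a F F1 F2 X X1 X2 G G1 G2 Y Y1 Y2 rho d,
  model c M a F F1 F2 X X1 X2 -> model c M a G G1 G2 Y Y1 Y2 ->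
  word_signs (circle_lift F X) rho -> word_signs (circle_lift G Y) rho ->
  0 <= rho -> irrational rho ->
  0 < d -> d <= e0 -> close_on 0 1 d F F1 F2 G G1 G2 ->
  close_on (-1) 0 d X X1 X2 Y Y1 Y2 ->
  let s := iter a F 1 in let t := iter a G 1 in
  [/\ lclose C d s t,
   forall y, 0 <= y <= 1 ->
   [/\ lclose C d (cj s F y) (cj t G y), lclose C d (cj1 s F F1 y) (cj1 t G G1 y) &
       lclose C d (cj2 s F F1 F2 y) (cj2 t G G1 G2 y)] &
   forall y, -1 <= y <= 0 ->
   let U p := iter a F (X p) in let W p := iter a G (Y p) in
   let U1 := ret1 F F1 X X1 a in let W1 := ret1 G G1 Y Y1 a in
   let U2 := ret2 F F1 F2 X X1 X2 a in let W2 := ret2 G G1 G2 Y Y1 Y2 a in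
   [/\ lclose C d (cj s U y) (cj t W y), lclose C d (cj1 s U U1 y) (cj1 t W W1 y) &
       lclose C d (cj2 s U U1 U2 y) (cj2 t W W1 W2 y)]].
Proof.
move=> c0 c1 M1.
have [C0 [e0 [e00 H0]]] := return_lclose c0 c1 M1 ler01.
have [Ci Hi] := lclose_mi (1 + `|C0|) c0 c1.
have [C1 [e1 [e10 H1]]] := return_lclose c0 c1 M1 (normr_ge0 Ci).
have [V VE] : exists V, V = (1 + `|C0| + `|C1|) + (M + M * `|Ci| + 1) by eexists.
have M0 : 0 <= M by lra.
have MC : 0 <= M * `|Ci| by apply: mulr_ge0.
have V0 : 0 <= V by rewrite VE !addr_ge0.
have VC0 : `|C0| <= V by rewrite VE; have := normr_ge0 C1; lra.
have VC1 : `|C1| <= V by rewrite VE; have := normr_ge0 C0; lra.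
have V1 : 1 <= V by rewrite VE; have := normr_ge0 C0; have := normr_ge0 C1; lra.
have VM : M + M * `|Ci| + 1 <= V by rewrite VE; have := normr_ge0 C0; have := normr_ge0 C1; lra.
have [Cj Hj] := lclose_cj V c0 c1.
exists (V + `|Cj|), (Num.min e0 e1); split; first by rewrite lt_min e00.
move=> a F F1 F2 X X1 X2 G G1 G2 Y Y1 Y2 rho d P Q SP SQ rho0 irr d0.
rewrite le_min => /andP[de0 de1] cF cX s t.
have d0' := ltW d0; have Cj0 := normr_ge0 Cj.
have W (D u v : R) : lclose D d u v -> `|D| <= V -> lclose V d u v.
  by move=> h DV; apply: lclose_weak h => //; apply: le_trans (ler_norm _) DV.
have z0 : -1 <= (0 : R) <= (0 : R) by lra.
have zz : lclose 1 d (0 : R) 0 by apply: lclose_refl; rewrite ?normr0.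
have [st _ _] := H0 _ _ _ _ _ _ _ _ _ _ _ _ _ _ _ P Q SP SQ rho0 irr d0 de0 cF cX 0 0 z0 z0 zz.
rewrite (md_X0 P) (md_X0 Q) -/s -/t in st.
have sc : c <= s by exact: (md_t P). have tc : c <= t by exact: (md_t Q).
have s1 : s <= 1 by exact: (md_t1 P). have t1 : t <= 1 by exact: (md_t1 Q).
have s0 : 0 < s by lra. have t0 : 0 < t by lra.
have stV := W _ _ _ st VC0.
have st1 : lclose (1 + `|C0|) d s t by apply: lclose_weak st => //; have := ler_norm C0; lra.
have yy y : -1 <= y <= 1 -> lclose 1 d y y by move=> yb; apply: lclose_refl => //; rewrite ler_norml.
have mic y : -1 <= y <= 1 -> lclose `|Ci| d (mi s y) (mi t y).
  move=> yb; have c1y : lclose (1 + `|C0|) d y y.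
    by apply: lclose_weak (yy y yb) => //; rewrite lerDl.
  by have [h _ _] := Hi _ _ _ _ _ d0' sc tc st1 yb yb c1y; apply: lclose_weak h => //; exact: ler_norm.
have fin (D u v : R) : D <= `|Cj| -> lclose D d u v -> lclose (V + `|Cj|) d u v.
  by move=> DV h; apply: lclose_weak h => //; lra.
split; first by apply: lclose_weak stV => //; lra.
- move=> y yb; have yb' : -1 <= y <= 1 by lra.
  have su := mi_pos s0 yb.
  have tu := mi_pos t0 yb.
  have su1 : 0 <= mi s y <= 1 by lra. have tu1 : 0 <= mi t y <= 1 by lra.
  have [j0 j1 j2] := close_jet_lclose (md_F P) (md_F Q) cF d0' (mic y yb') su1 tu1.
  have VM' : `|M + M * `|Ci| + 1| <= V by rewrite ger0_norm//; lra.
  have Fs := md_branch P c0 su.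
  have Gt := md_branch Q c0 tu.
  have yV : lclose V d y y by apply: lclose_weak (yy y yb').
  have [h0 h1 h2] := Hj _ _ _ _ _ F F1 F2 G G1 G2 d0' sc tc stV yb' yb' yV Fs Gt
    (W _ _ _ j0 VM') (W _ _ _ j1 VM') (W _ _ _ j2 VM').
  by split; [apply: fin h0|apply: fin h1|apply: fin h2]; exact: ler_norm.
- move=> y yb U W' U1 W1 U2 W2; have yb' : -1 <= y <= 1 by lra.
  have su := mi_neg s0 yb.
  have tu := mi_neg t0 yb.
  have [j0 j1 j2] := H1 _ _ _ _ _ _ _ _ _ _ _ _ _ _ _ P Q SP SQ rho0 irr d0 de1 cF cX _ _ su tu (mic y yb').
  have Fs : -1 <= U (mi s y) <= s by exact: (md_end P (md_Xbd P su)).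
  have Gt : -1 <= W' (mi t y) <= t by exact: (md_end Q (md_Xbd Q tu)).
  have yV : lclose V d y y by apply: lclose_weak (yy y yb').
  have [h0 h1 h2] := Hj _ _ _ _ _ U U1 U2 W' W1 W2 d0' sc tc stV yb' yb' yV Fs Gt
    (W _ _ _ j0 VC1) (W _ _ _ j1 VC1) (W _ _ _ j2 VC1).
  by split; [apply: fin h0|apply: fin h1|apply: fin h2]; exact: ler_norm.
Qed.

End return_maps.

(** * Renormalized pairs *)

Section renormalized_pairs.
Variable R : realType.

(** The normalizing map of the renormalization is the composition of the
    normalizing map of the pair with a map of the same family. *)
Lemma mo_comp (s r x : R) : 0 < s -> 0 < r -> r <= s -> -1 <= x <= r ->
  mo (mo s r) (mo s x) = mo r x.
Proof.
move=> s0 r0 rs xb.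
have D0 : 0 < 2 * s + (s - 1) * r by apply: mo_den0 => //; lra.
have E0 : 0 < 2 * s + (s - 1) * x by apply: mo_den0 => //; lra.
have H0 : 0 < 2 * r + (r - 1) * x by exact: mo_den0.
have [Dn En Hn sn] : [/\ 2 * s + (s - 1) * r != 0, 2 * s + (s - 1) * x != 0,
   2 * r + (r - 1) * x != 0 & s != 0] by split; rewrite gt_eqF.
have pn : 1 + s != 0 by rewrite gt_eqF//; lra.
rewrite {1}/mo /moeb.
have -> : 1 + mo s r = 2 * s * (1 + r) / (2 * s + (s - 1) * r).
  by rewrite /mo /moeb; field.
have -> : 2 * mo s r + (mo s r - 1) * mo s x = 2 * (1 + s) * s * (2 * r + (r - 1) * x) /
    ((2 * s + (s - 1) * r) * (2 * s + (s - 1) * x)).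
  by rewrite /mo /moeb; field; rewrite En Dn.
by rewrite /mo /moeb; field; rewrite Dn En Hn sn pn.
Qed.

Lemma mi_comp (s t y : R) : 0 < s -> 0 < t -> t <= 1 -> -1 <= y <= 1 ->
  mi (mi s t) y = mi s (mi t y).
Proof.
move=> s0 t0 t1 yb; have [sN s_0 s_1] := miE s0.
have tb : -1 <= t <= 1 by lra.
have r0 : 0 < mi s t by rewrite -[ltLHS]s_0; apply: mi_lt => //; lra.
have rs : mi s t <= s by rewrite -[leRHS]s_1; apply: mi_le => //; lra.
have /andP[w1 wt] := mi_bd t0 yb.
have wb : -1 <= mi t y <= 1 by lra.
have ub : -1 <= mi s (mi t y) <= mi s t.
  by rewrite -[in X in X <= _ <= _]sN; apply/andP; split; apply: mi_le => //; lra.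
rewrite -[in LHS](miK t0 yb) -[X in mo t X](miK s0 wb) -[in X in mo X _](miK s0 tb).
by rewrite mo_comp// moK.
Qed.

(** The rescaling is trivial as eta (0) = -1. *)
Lemma renormE (z : cpair R) a : eta_ z 0 = -1 -> eta_side z -> period z = Some a ->
  renorm z = CPair (eta_ z) (iter a (eta_ z) \o xi_ z).
Proof.
move=> e1 side pa; rewrite /renorm /prerenorm pa side /= e1 opprK /rescale /=.
by congr CPair; apply/funext => x; rewrite mul1r divr1.
Qed.

Section one_pair.
Variables (K c M : R) (z : cpair R) (a : nat) (F1 F2 X1 X2 : R -> R).
Let F := mob_conj z (eta_ z).
Let X := mob_conj z (xi_ z).
Hypothesis (K1 : 1 < K) (Cz : critical_commuting_pair 3 z) (nz : normalized z).
Hypothesis (cz : controlled K z) (iz : infinitely_renormalizable z).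
Hypothesis (pa : period z = Some a) (P : model c M a F F1 F2 X X1 X2).
Hypothesis (c0 : 0 < c) (c1 : c <= 1) (M1 : 1 <= M).

Let s := xi_ z 0.
Let t := iter a F 1.
Let s0 : 0 < s. Proof. by have [[]] := normalized_maps K1 Cz nz cz. Qed.
Let e1 : eta_ z 0 = -1. Proof. exact: nz. Qed.
Let FE : F = cj s (eta_ z). Proof. exact: mob_conjE. Qed.
Let XE : X = cj s (xi_ z). Proof. exact: mob_conjE. Qed.

Let miF x : 0 <= x <= 1 -> mi s (F x) = eta_ z (mi s x).
Proof.
move=> /(mi_pos s0) xb; have [_ _ _ _ [H _]] := normalized_maps K1 Cz nz cz.
by rewrite FE /cj moK//; exact: H.
Qed.

Let miX x : -1 <= x <= 0 -> mi s (X x) = xi_ z (mi s x).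
Proof.
move=> /(mi_neg s0) xb; have [_ _ _ _ [_ H]] := normalized_maps K1 Cz nz cz.
by rewrite XE /cj moK//; exact: H.
Qed.

Let mi_iter j x : F 1 <= x <= 1 -> (j <= a)%N ->
  mi s (iter j F x) = iter j (eta_ z) (mi s x).
Proof.
move=> xb; elim: j => [//|j IH] ja; rewrite !iterS -IH ?(ltnW ja)// miF//.
by have := md_orbit_in P c0 c1 M1 xb ja; have := md_t P; move: (c0); lra.
Qed.

Lemma model_tracks : tracks (mo s) z (fun x => circle_lift F X x - 2) (circle_lift F X).
Proof.
have [_ _ _ _ [He Hx]] := normalized_maps K1 Cz nz cz.
have homo := lift_homo (md_Xi P) (md_Fi P) (md_F0 P) (md_X0 P) (md_FX P).
split; [by rewrite e1 ltrN10|exact: s0|by have [] := moE s0| | | | |exact: homo|].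
- by rewrite e1 => x y x1 xy ys; exact: mo_lt.
- rewrite e1 => x xb; split; first exact: He.
  rewrite (phi_F P (mo_pos s0 xb)) FE /cj moK//.
  by move: xb; rewrite -/s; lra.
- rewrite e1 => x xb; split; first exact: Hx.
  rewrite (lift_X (md_F0 P) (md_X0 P) (mo_neg s0 xb)) XE /cj moK//.
  by have := s0; lra.
- by move=> x y xy; rewrite ltrD2r; exact: homo.
- by move=> x; rewrite -[in LHS](subrK 2 (circle_lift F X x)) lift_period addrK.
Qed.

Lemma model_signs : word_signs (circle_lift F X) (rotation_number z).
Proof.
move=> m n mn; have := sign_tracks (leqnn _) mn model_tracks iz.
by have [-> _] := cz.
Qed.

Lemma renorm_model : let z' := renorm z in
  [/\ eta_ z' 0 = -1, xi_ z' 0 = mi s t,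
   forall y, 0 <= y <= 1 -> mob_conj z' (eta_ z') y = cj t F y &
   forall y, -1 <= y <= 0 -> mob_conj z' (xi_ z') y = cj t (fun p => iter a F (X p)) y].
Proof.
have [side _] := cz; cbv zeta; rewrite (renormE e1 side pa).
have u1 : F 1 <= (1 : R) <= (1 : R) by have := md_F1 P; move: (c0); lra.
have tc : c <= t by exact: (md_t P). have t1 : t <= 1 by exact: (md_t1 P).
have t0 : 0 < t by move: (c0); lra.
have tb : -1 <= t <= 1 by lra.
have [sN s_0 s_1] := miE s0.
have sig : iter a (eta_ z) s = mi s t by rewrite /t mi_iter// s_1.
have sigma : xi_ (CPair (eta_ z) (iter a (eta_ z) \o xi_ z)) 0 = mi s t by rewrite -sig.
have r0 : 0 < mi s t by rewrite -[ltLHS]s_0; apply: mi_lt => //; lra.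
have rs : mi s t <= s by rewrite -[leRHS]s_1; apply: mi_le => //; lra.
have mo_t x : -1 <= x <= t -> mo (mi s t) (mi s x) = mo t x.
  move=> xb; rewrite -[in RHS](miK s0 tb) -[in RHS](miK s0 (y := x)); last by lra.
  rewrite mo_comp//.
  by rewrite -[in X in X <= _ <= _]sN; apply/andP; split; apply: mi_le => //; lra.
split=> //.
- move=> y yb; rewrite mob_conjE// sigma /cj.
  have wb := mi_pos t0 yb.
  have wb1 : 0 <= mi t y <= 1 by lra.
  rewrite mi_comp//; last by lra.
  rewrite -miF// mo_t//.
  have /andP[-> _] := md_Fbd P wb1; have := md_Ft P; rewrite iterS -/t => ft.
  have : F (mi t y) <= F t by apply: (md_FiW P); lra.
  by move: (c0) => /=; lra.
- move=> y yb; rewrite mob_conjE// sigma /cj /=.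
  have wb := mi_neg t0 yb.
  rewrite mi_comp//; last by lra.
  by rewrite -miX// -mi_iter ?(md_Xbd P)// mo_t// (md_end P (md_Xbd P wb)).
Qed.

End one_pair.
End renormalized_pairs.

(** * The Lipschitz estimate *)

Section main.
Variable R : realType.

(** The period is read off the rotation number, so it is the same for both
    pairs. *)
Lemma model_period (c M rho : R) a F F1 F2 X X1 X2 :
  model c M a F F1 F2 X X1 X2 -> 0 < c -> c <= 1 -> 1 <= M ->
  word_signs (circle_lift F X) rho -> irrational rho ->
  a%:R * rho < 1 /\ 1 < a.+1%:R * rho.
Proof.
move=> P c0 c1 M1 S irr.
have z0 : -1 <= (0 : R) <= 0 by rewrite lerN10 lexx.
have E : iter a (fun x => circle_lift F X x - 2) (circle_lift F X 0) = iter a F 1.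
  by rewrite (chi_return P c0 c1 M1 z0) (md_X0 P).
have N k : (0 < k)%N -> 1 - k%:R * rho != 0.
  move=> k0; apply/eqP => /eqP; rewrite subr_eq0 => /eqP e; apply: irr.
  exists k%:R^-1 => //.
  have k1 : k%:R != 0 :> R by rewrite pnatr_eq0 -lt0n.
  by rewrite fmorphV rmorph_nat; apply: (mulfI k1); rewrite -e divff.
have tc := md_t P; have t1 := md_t1 P.
have [_ A] := S a 1 ltac:(by rewrite addn1); have [B _] := S a.+1 1 isT.
have := N _ (md_a P); have := N a.+1 isT.
split.
- rewrite -subr_gt0 lt_neqAle eq_sym; apply/andP; split; first exact: N (md_a P).
  rewrite leNgt; apply/negP => /A; rewrite /= E; lra.
- rewrite -subr_lt0 lt_neqAle; apply/andP; split; first exact: N.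
  rewrite leNgt; apply/negP => /B.
  rewrite iterS /= E => h; have := phi_F P (x := iter a F 1) ltac:(lra).
  by have := md_Ft P; rewrite iterS => h1 h2; move: h; rewrite h2; lra.
Qed.

Lemma model_period_inj (c M rho : R) a b F F1 F2 X X1 X2 G G1 G2 Y Y1 Y2 :
  model c M a F F1 F2 X X1 X2 -> model c M b G G1 G2 Y Y1 Y2 ->
  0 < c -> c <= 1 -> 1 <= M ->
  word_signs (circle_lift F X) rho -> word_signs (circle_lift G Y) rho ->
  0 <= rho -> irrational rho -> a = b.
Proof.
move=> P Q c0 c1 M1 SP SQ rho0 irr.
have [A1 A2] := model_period P c0 c1 M1 SP irr.
have [B1 B2] := model_period Q c0 c1 M1 SQ irr.
have key (m n : nat) : m%:R * rho < 1 -> 1 < n.+1%:R * rho -> (m <= n)%N.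
  move=> h1 h2; rewrite leqNgt; apply/negP => nm.
  have : n.+1%:R * rho <= m%:R * rho by apply: ler_wpM2r => //; rewrite ler_nat.
  by rewrite leNgt (lt_trans h1 h2).
by apply/eqP; rewrite eqn_leq (key _ _ A1 B2) (key _ _ B1 A2).
Qed.

Lemma dist_CrP (z0 z1 : cpair R) (F F1 F2 X X1 X2 G G1 G2 Y Y1 Y2 : R -> R) d :
  0 <= d ->
  diff_on 0 1 F F1 -> diff_on 0 1 F1 F2 -> diff_on 0 1 G G1 -> diff_on 0 1 G1 G2 ->
  diff_on (-1) 0 X X1 -> diff_on (-1) 0 X1 X2 ->
  diff_on (-1) 0 Y Y1 -> diff_on (-1) 0 Y1 Y2 ->
  (forall x, 0 <= x <= 1 -> mob_conj z0 (eta_ z0) x = F x) ->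
  (forall x, 0 <= x <= 1 -> mob_conj z1 (eta_ z1) x = G x) ->
  (forall x, -1 <= x <= 0 -> mob_conj z0 (xi_ z0) x = X x) ->
  (forall x, -1 <= x <= 0 -> mob_conj z1 (xi_ z1) x = Y x) ->
  eta_ z0 0 = -1 -> eta_ z1 0 = -1 ->
  (dist_Cr 2 z0 z1 <= d%:E)%E <->
  [/\ `|xi_ z0 0 - xi_ z1 0| <= d, close_on 0 1 d G G1 G2 F F1 F2 &
      close_on (-1) 0 d Y Y1 Y2 X X1 X2].
Proof.
move=> d0 HF HF1 HG HG1 HX HX1 HY HY1 EF EG EX EY e0 e1.
have DF := diff_on_subr HF HG; have DF1 := diff_on_subr HF1 HG1.
have DX := diff_on_subr HX HY; have DX1 := diff_on_subr HX1 HY1.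
have {}DF : diff_on 0 1 (fun x => mob_conj z0 (eta_ z0) x - mob_conj z1 (eta_ z1) x)
    (fun x => F1 x - G1 x).
  by apply: (diff_on_ext DF) => // x xb; rewrite EF// EG.
have {}DX : diff_on (-1) 0 (fun x => mob_conj z0 (xi_ z0) x - mob_conj z1 (xi_ z1) x)
    (fun x => X1 x - Y1 x).
  by apply: (diff_on_ext DX) => // x xb; rewrite EX// EY.
have NF := C2_normP d0 ltr01 DF DF1; have NX := C2_normP d0 (ltrN10 R) DX DX1.
have E : `|xi_ z0 0 / eta_ z0 0 - xi_ z1 0 / eta_ z1 0| = `|xi_ z0 0 - xi_ z1 0|.
  by rewrite e0 e1 invrN1 !mulrN1 -opprD normrN.
rewrite /dist_Cr E !ge_max lee_fin; split.
  move=> /and3P[A /NX B /NF C]; split=> // x xb.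
    by have := C x xb; rewrite EF// EG.
  by have := B x xb; rewrite EX// EY.
move=> [A C B]; apply/and3P; split=> //.
  by apply/NX => x xb; have := B x xb; rewrite EX// EY.
by apply/NF => x xb; have := C x xb; rewrite EF// EG.
Qed.

End main.

Theorem lemma4p1 (R : realType) (K : R) (hK : 1 < K) :
  exists eps0 L : R, [/\ 0 < eps0 < 1, 1 < L &
    forall z0 z1 : cpair R,
      critical_commuting_pair 3 z0 -> critical_commuting_pair 3 z1 ->
      normalized z0 -> normalized z1 ->
      infinitely_renormalizable z0 -> infinitely_renormalizable z1 ->
      controlled K z0 -> controlled K z1 ->
      negative_schwarzian z0 -> negative_schwarzian z1 ->
      rotation_number z0 = rotation_number z1 ->
      0 <= rotation_number z0 <= 1 ->
      irrational (rotation_number z0) ->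
      (dist_Cr 2 z0 z1 < eps0%:E)%E ->
      (dist_Cr 2 (renorm z0) (renorm z1) <= L%:E * dist_Cr 2 z0 z1)%E].
Proof.
have K1 := hK; have K0 : 0 < K by lra.
have k0 : 0 < K^-1 by rewrite invr_gt0.
have k1 : K^-1 <= 1 by rewrite invf_le1// ltW.
have [c [M [c0 c1 M1 HM]]] := controlled_model K1.
have [C [e0 [e00 HC]]] := renorm_lclose c0 c1 M1.
have [Ci Hi] := lclose_mi (K + `|C| + 1) k0 k1.
pose L := `|C| + `|Ci| + 2.
pose eps := Num.min e0 (1 / 2).
have C0 := normr_ge0 C; have Ci0 := normr_ge0 Ci.
have L1 : 1 < L by rewrite /L; lra.
have CL' : C <= L by rewrite /L; have := ler_norm C; lra.
have CiL : Ci <= L by rewrite /L; have := ler_norm Ci; lra.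
have KC : C <= K + `|C| + 1 by have := ler_norm C; lra.
have KC1 : 1 <= K + `|C| + 1 by lra.
have pos_le (x : R) : K^-1 <= x <= K -> `|x| <= K + `|C| + 1.
  by move=> xK; rewrite ger0_norm; lra.
have in_unit (x : R) : c <= x -> x <= 1 -> -1 <= x <= 1 by lra.
have L0 : 0 < L by lra.
have eps0 : 0 < eps by rewrite lt_min e00 divr_gt0.
have epse : eps <= e0 by rewrite ge_min lexx.
have eps1 : eps < 1 by rewrite gt_min; apply/orP; right; lra.
exists eps, L; rewrite eps0 eps1; split=> // z0 z1 C0' C1' n0 n1 i0 i1 K0' K1' S0 S1 rE.
move=> /andP[rho0 _] irr dlt.
have [a [F1 [F2 [X1 [X2 [pa P]]]]]] := HM z0 C0' n0 K0' S0.
have [b [G1 [G2 [Y1 [Y2 [pb Q]]]]]] := HM z1 C1' n1 K1' S1.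
have SP := model_signs K1 C0' n0 K0' i0 P; have SQ := model_signs K1 C1' n1 K1' i1 Q.
rewrite -rE in SQ.
have ab := model_period_inj P Q c0 c1 M1 SP SQ rho0 irr; rewrite -ab in pb Q.
have [pe0 px0 E0 X0] := renorm_model K1 C0' n0 K0' pa P c0 c1 M1.
have [pe1 px1 E1 X1'] := renorm_model K1 C1' n1 K1' pb Q c0 c1 M1.
have [s0 s1] : K^-1 <= xi_ z0 0 <= K /\ K^-1 <= xi_ z1 0 <= K.
  by case: K0' => _ [? _ []]; case: K1' => _ [? _ []].
have JF := md_F P; have JX := md_X P; have JG := md_F Q; have JY := md_X Q.
have D := dist_CrP _ (jt_d1 JF) (jt_d2 JF) (jt_d1 JG) (jt_d2 JG)
  (jt_d1 JX) (jt_d2 JX) (jt_d1 JY) (jt_d2 JY) (fun x _ => erefl) (fun x _ => erefl)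
  (fun x _ => erefl) (fun x _ => erefl) n0 n1.
set t0 := iter a _ 1 in px0 E0 X0; set t1 := iter a _ 1 in px1 E1 X1'.
have cj_diff F Fa Fb X Xa Xb : model c M a F Fa Fb X Xa Xb ->
    (diff_on 0 1 (cj (iter a F 1) F) (cj1 (iter a F 1) F Fa) /\
     diff_on 0 1 (cj1 (iter a F 1) F Fa) (cj2 (iter a F 1) F Fa Fb)) /\
    (let U p := iter a F (X p) in
     let U1 := ret1 F Fa X Xa a in let U2 := ret2 F Fa Fb X Xa Xb a in
     diff_on (-1) 0 (cj (iter a F 1) U) (cj1 (iter a F 1) U U1) /\
     diff_on (-1) 0 (cj1 (iter a F 1) U U1) (cj2 (iter a F 1) U U1 U2)).
  move=> W; have tc := md_t W; have t1' := md_t1 W; set t := iter a F 1 in tc t1' *.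
  have tp : 0 < t by lra.
  split; last first.
    have [V1 V2] := diff_ret W c0 c1 M1.
    apply: (diff_cj (l := -1) (u := 0) tp (lexx _) ler01 _ _ V1 V2).
      by move=> y; exact: mi_neg.
    by move=> p pb'; exact: (md_end W (md_Xbd W pb')).
  apply: (diff_cj (l := 0) (u := t) tp (lerN10 R) (lexx 1)).
  - by move=> y; exact: mi_pos.
  - by move=> x; exact: (md_branch W c0).
  - exact (diff_on_sub (lexx 0) t1' (jt_d1 (md_F W))).
  - exact (diff_on_sub (lexx 0) t1' (jt_d2 (md_F W))).
have [[A1 A2] [A3 A4]] := cj_diff _ _ _ _ _ _ P.
have [[B1 B2] [B3 B4]] := cj_diff _ _ _ _ _ _ Q.
have D' := dist_CrP _ A1 A2 B1 B2 A3 A4 B3 B4 E0 E1 X0 X1' pe0 pe1.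
have key d : 0 < d -> d <= e0 -> (dist_Cr 2 z0 z1 <= d%:E)%E ->
    (dist_Cr 2 (renorm z0) (renorm z1) <= (L * d)%:E)%E.
  move=> d0 de /(D _ (ltW d0))[Ds DF DX].
  have [st RF RX] := HC _ _ _ _ _ _ _ _ _ _ _ _ _ _ _ P Q SP SQ rho0 irr d0 de
    (close_on_sym DF) (close_on_sym DX).
  have d0' := ltW d0.
  have Ld : 0 <= L * d by apply: mulr_ge0 => //; exact: ltW.
  have CL : C * d <= L * d.
    exact: ler_wpM2r.
  have out (u v : R) : lclose C d u v -> `|u - v| <= L * d.
    by case=> _ _ h; apply: le_trans h CL.
  apply/(D' _ Ld); split.
  - rewrite px0 px1.
    have ss : lclose (K + `|C| + 1) d (xi_ z0 0) (xi_ z1 0).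
      split; [exact: pos_le s0|exact: pos_le s1|].
      by apply: le_trans Ds _; exact: ler_peMl.
    have tt := lclose_weak KC d0' st.
    have tb0 := in_unit _ (md_t P) (md_t1 P).
    have tb1 := in_unit _ (md_t Q) (md_t1 Q).
    have [[_ _ h] _ _] := Hi _ _ _ _ _ d0' (proj1 (andP s0)) (proj1 (andP s1)) ss tb0 tb1 tt.
    by apply: le_trans h _; exact: ler_wpM2r.
  - by move=> y /RF[/out h0 /out h1 /out h2].
  - by move=> y /RX[/out h0 /out h1 /out h2].
(* key requires d > 0; if the distance vanishes, let d tend to 0 *)
have dge : (0 <= dist_Cr 2 z0 z1)%E by rewrite /dist_Cr le_max lee_fin normr_ge0.
move: dlt dge key; case: (dist_Cr 2 z0 z1) => [d|//|//]; rewrite lte_fin lee_fin => dlt.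
rewrite le_eqVlt => /predU1P[<-|d0] key; last first.
  by rewrite -EFinM; apply: key => //; apply: ltW; apply: lt_le_trans dlt _.
rewrite mule0; apply/lee_addgt0Pr => e e_gt0; rewrite add0e.
have m0 : 0 < Num.min e0 (e / L) by rewrite lt_min e00 divr_gt0.
apply: le_trans (key _ m0 _ _) _.
- by rewrite ge_min lexx.
- by rewrite lee_fin ltW.
- rewrite lee_fin mulrC -ler_pdivlMr//; by rewrite ge_min lexx orbT.
Qed.
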